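(* Let $\Omega\subset\mathbb{R}^N$, $N\ge 2$, be a bounded domain with Lipschitz boundary $\partial\Omega$. Let $p,q\in C^{0,1}(\overline\Omega)$ satisfy $1<p(x)\le q(x)<N$ and $\frac{q(x)}{p(x)}<1+\frac1N$ for all $x\in\overline\Omega$. Let $a,b\in C^{0,1}(\overline\Omega)$ with $a,b\ge 0$ and $a(x)+b(x)\ge d>0$ for a.a. $x\in\Omega$, and let $1\le\delta\le e$, $\eta\ge0$, $\delta+\eta>1$. If $\delta=1$, assume in addition that there is a constant $C>0$ with $b(x)\le C a(x)$ for a.a. $x\in\Omega$. Let $\mathcal{A}\colon\Omega\times\mathbb{R}\times\mathbb{R}^N\to\mathbb{R}^N$ and $\mathcal{B}\colon\Omega\times\mathbb{R}\times\mathbb{R}^N\to\mathbb{R}$ be Carathéodory functions for which there are positive constants $\alpha_1,\alpha_2,\alpha_3,\beta$ such that, for a.a. $x\in\Omega$ and all $(t,\xi)\in\mathbb{R}\times\mathbb{R}^N$, (i) $|\mathcal{A}(x,t,\xi)|\le \alpha_1\Big[a(x)^{\frac{N-1}{N-p(x)}}|t|^{\frac{p^*(x)}{p'(x)}}+\big(b(x)\log(\delta+\eta|t|)\big)^{\frac{N-1}{N-q(x)}}|t|^{\frac{q^*(x)}{q'(x)}}+a(x)|\xi|^{p(x)-1}+b(x)|\xi|^{q(x)-1}\log(\delta+\eta|\xi|)+1\Big]$; (ii) $\mathcal{A}(x,t,\xi)\cdot\xi\ge \alpha_2\big[a(x)|\xi|^{p(x)}+b(x)|\xi|^{q(x)}\log(\delta+\eta|\xi|)\big]-\alpha_3\Big[a(x)^{\frac{p^*(x)}{p(x)}}|t|^{p^*(x)}+\big(b(x)\log(\delta+\eta|t|)\big)^{\frac{q^*(x)}{q(x)}}|t|^{q^*(x)}+1\Big]$;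 (iii) $|\mathcal{B}(x,t,\xi)|\le\beta\Big[a(x)^{\frac{p^*(x)}{p(x)}}|t|^{p^*(x)-1}+\big(b(x)\log(\delta+\eta|t|)\big)^{\frac{q^*(x)}{q(x)}}|t|^{q^*(x)-1}+a(x)^{\frac{N+1}{N}}|\xi|^{\frac{p(x)}{(p^* )'(x)}}+\big(b(x)\log(\delta+\eta|t|)\big)^{\frac1{q(x)}}\big(b(x)\log(\delta+\eta|\xi|)\big)^{\frac1{(q^* )'(x)}}|\xi|^{\frac{q(x)}{(q^* )'(x)}}+1\Big]$. Then every weak solution $u\in W^{1,\mathcal{S}}_0(\Omega)$ of $$-\operatorname{div}\mathcal{A}(x,u,\nabla u)=\mathcal{B}(x,u,\nabla u)\ \text{ in }\Omega,\qquad u=0\ \text{ on }\partial\Omega,$$ belongs to $L^\infty(\Omega)$.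
   Context: For an exponent $\kappa$ with $1<\kappa(x)<N$, $\kappa^*(x):=\frac{N\kappa(x)}{N-\kappa(x)}$; for $\kappa>1$, $\kappa'(x):=\frac{\kappa(x)}{\kappa(x)-1}$ (so $(p^* )'$ and $(q^* )'$ are the conjugate exponents of $p^*$ and $q^*$). $\mathcal{S}(x,t):=a(x)t^{p(x)}+b(x)t^{q(x)}\log(\delta+\eta t)$ for $x\in\Omega$, $t\ge0$. $L^{\mathcal{S}}(\Omega)$ is the set of measurable $u\colon\Omega\to\mathbb{R}$ with $\int_\Omega\mathcal{S}(x,\lambda|u|)\,dx<\infty$ for some $\lambda>0$. $W^{1,\mathcal{S}}(\Omega)$ is the set of weakly differentiable $u\in L^{\mathcal{S}}(\Omega)$ with $|\nabla u|\in L^{\mathcal{S}}(\Omega)$, normed by $\|u\|_{1,\mathcal{S}}:=\inf\{\lambda>0:\int_\Omega[\mathcal{S}(x,|u|/\lambda)+\mathcal{S}(x,|\nabla u|/\lambda)]\,dx\le1\}$, and $W^{1,\mathcal{S}}_0(\Omega)$ is the closure of $C_0^\infty(\Omega)$ in $W^{1,\mathcal{S}}(\Omega)$. A weak solution is a function $u\in W^{1,\mathcal{S}}_0(\Omega)$ with $\int_\Omega\mathcal{A}(x,u,\nabla u)\cdot\nabla\varphi\,dx=\int_\Omega\mathcal{B}(x,u,\nabla u)\varphi\,dx$ for all $\varphi\in W_0^{1,\mathcal{S}}(\Omega)$. *)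

(* Defs.v *)
From HB Require Import structures.
From mathcomp Require Import all_boot all_order all_algebra.
From mathcomp Require Import all_classical all_reals all_analysis.

Set Implicit Arguments.
Unset Strict Implicit.
Unset Printing Implicit Defensive.

Import Order.TTheory GRing.Theory Num.Theory.
Import numFieldNormedType.Exports.

Local Open Scope classical_set_scope.
Local Open Scope ring_scope.

(** Lebesgue measure on R^N: on Borel sets of [n.-tuple R] it is the iterated
    product of the one-dimensional Lebesgue measure; it is then transported to
    ['rV[R]_N] and completed, so "measurable" below means Lebesgue
    measurable. *)

Section tuple_measure.
Context {R : realType}.
Notation mR := (measurableTypeR R).

Definition tcons (n : nat) (z : mR * n.-tuple mR) : n.+1.-tuple mR :=
  [tuple of z.1 :: z.2].

Definition tuncons (n : nat) (t : n.+1.-tuple mR) : mR * n.-tuple mR :=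
  (thead t, [tuple of behead t]).

Lemma measurable_tcons n : measurable_fun setT (@tcons n).
Proof. exact: measurable_cons. Qed.

Lemma measurable_tuncons n : measurable_fun setT (@tuncons n).
Proof.
apply: (@measurable_fun_pair _ _ _ _ _ _ (fun t => thead t)).
  exact: measurable_tnth.
exact: measurable_behead.
Qed.

Lemma tconsK n : cancel (@tcons n) (@tuncons n).
Proof.
move=> [x t]; rewrite /tcons /tuncons /=; congr pair; exact/val_inj.
Qed.

Lemma tunconsK n : cancel (@tuncons n) (@tcons n).
Proof. by move=> t; rewrite [RHS]tuple_eta. Qed.

Section cons_measure.
Variables (n : nat) (m : {sigma_finite_measure set (n.-tuple mR) -> \bar R}).

Definition cons_measure : set (n.+1.-tuple mR) -> \bar R :=
  pushforward ((@lebesgue_measure R) \x m)%E (@tcons n).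

Let cons_measure0 : cons_measure set0 = 0%E.
Proof. by rewrite /cons_measure /pushforward preimage_set0 measure0. Qed.

Let cons_measure_ge0 A : (0 <= cons_measure A)%E.
Proof. exact: (measure_ge0 ((@lebesgue_measure R) \x m)%E). Qed.

Let cons_measure_sigma_additive : semi_sigma_additive cons_measure.
Proof.
move=> F mF tF mUF; rewrite /cons_measure /pushforward preimage_bigcup.
have mpre A : measurable A -> measurable (@tcons n @^-1` A).
  by move=> mA; rewrite -[X in measurable X]setTI; exact: measurable_tcons.
apply: measure_semi_sigma_additive.
- by move=> k; exact: mpre.
- apply/trivIsetP => /= i j _ _ ij; rewrite -preimage_setI.
  by move/trivIsetP : tF => /(_ _ _ _ _ ij) ->//; rewrite preimage_set0.
- by rewrite -preimage_bigcup; exact: mpre.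
Qed.

HB.instance Definition _ := isMeasure.Build _ _ _ cons_measure
  cons_measure0 cons_measure_ge0 cons_measure_sigma_additive.

Let cons_measure_sigma_finite : sigma_finite setT cons_measure.
Proof.
have /sigma_finiteP[F [TF ndF Foo]] := sigma_finiteT (@lebesgue_measure R).
have /sigma_finiteP[G [TG ndG Goo]] := sigma_finiteT m.
exists (fun k => @tuncons n @^-1` (F k `*` G k)).
  apply/esym; rewrite -preimage_bigcup -subTset => t _.
  have [i _ Fi] : (\bigcup_k F k) (tuncons t).1 by rewrite -TF.
  have [j _ Gj] : (\bigcup_k G k) (tuncons t).2 by rewrite -TG.
  exists (maxn i j) => //; split.
  - by move: Fi; exact/subsetPset/ndF/leq_maxl.
  - by move: Gj; exact/subsetPset/ndG/leq_maxr.
move=> k; have [mF Fk] := Foo k; have [mG Gk] := Goo k; split.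
  rewrite -[X in measurable X]setTI; apply: measurable_tuncons => //.
  exact: measurableX.
rewrite /cons_measure /pushforward (_ : _ @^-1` _ = F k `*` G k).
  by rewrite product_measure1E// lte_mul_pinfty// ge0_fin_numE.
by apply/funext => z; rewrite /preimage /mkset tconsK.
Qed.

HB.instance Definition _ := Measure_isSigmaFinite.Build _ _ _ cons_measure
  cons_measure_sigma_finite.

End cons_measure.

Fixpoint tuple_lebesgue (n : nat) :
    {sigma_finite_measure set (n.-tuple mR) -> \bar R} :=
  match n with
  | 0 => \d_[tuple]
  | k.+1 => cons_measure (tuple_lebesgue k)
  end.

End tuple_measure.

Section lebesgue_rV.
Variables (R : realType) (N : nat).

Definition rV_of_tuple (t : N.-tuple (measurableTypeR R)) : 'rV[R]_N :=
  \row_i tnth t i.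

Definition lebesgue_outer (A : set 'rV[R]_N) : \bar R :=
  ((@tuple_lebesgue R N)^*)%mu (rV_of_tuple @^-1` A).

Let lebesgue_outer0 : lebesgue_outer set0 = 0%E.
Proof. by rewrite /lebesgue_outer preimage_set0 outer_measure0. Qed.

Let lebesgue_outer_ge0 A : (0 <= lebesgue_outer A)%E.
Proof. exact: outer_measure_ge0. Qed.

Let le_lebesgue_outer : {homo lebesgue_outer : A B / A `<=` B >-> (A <= B)%E}.
Proof. by move=> A B AB; apply: le_outer_measure => t; exact: AB. Qed.

Let lebesgue_outer_sigma_subadditive : sigma_subadditive lebesgue_outer.
Proof.
move=> F; rewrite /lebesgue_outer preimage_bigcup.
exact: outer_measure_sigma_subadditive.
Qed.

HB.instance Definition _ := isOuterMeasure.Build R 'rV[R]_N lebesgue_outer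
  lebesgue_outer0 lebesgue_outer_ge0 le_lebesgue_outer
  lebesgue_outer_sigma_subadditive.

Definition leb : set (caratheodory_type lebesgue_outer) -> \bar R :=
  lebesgue_outer.

HB.instance Definition _ := isMeasure.Build _ _ _ leb
  (caratheodory_measure0 _) (@caratheodory_measure_ge0 _ _ _)
  (@caratheodory_measure_sigma_additive _ _ _).

Lemma leb_measurable (A : set (caratheodory_type lebesgue_outer)) :
  measurable (rV_of_tuple @^-1` A) -> measurable A.
Proof.
move=> mA; suff: lebesgue_outer.-caratheodory A by [].
move=> X; have := @caratheodory_measurable_mu_ext _ _ _ (tuple_lebesgue N) _ mA.
exact.
Qed.

Lemma lebE (A : set (caratheodory_type lebesgue_outer)) :
  measurable (rV_of_tuple @^-1` A) ->
  leb A = tuple_lebesgue N (rV_of_tuple @^-1` A).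
Proof. by move=> mA; rewrite /leb /lebesgue_outer measurable_mu_extE. Qed.

Let leb_sigma_finite : sigma_finite setT leb.
Proof.
have [F TF Foo] := sigma_finiteT (@tuple_lebesgue R N).
pose h (v : 'rV[R]_N) : N.-tuple (measurableTypeR R) := [tuple v ord0 i | i < N].
have rhE k : rV_of_tuple @^-1` (h @^-1` F k) = F k.
  apply/funext => t; rewrite /preimage /mkset; congr (F k _).
  by apply: eq_from_tnth => i; rewrite tnth_mktuple mxE.
exists (fun k => h @^-1` F k); first by rewrite -preimage_bigcup -TF.
move=> k; have [mF Fk] := Foo k; split; first by apply: leb_measurable; rewrite rhE.
by rewrite lebE rhE.
Qed.

HB.instance Definition _ := Measure_isSigmaFinite.Build _ _ _ leb
  leb_sigma_finite.

End lebesgue_rV.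
Arguments leb {R N}.

Section euclidean.
Variables (R : realType) (N : nat).
Implicit Types (u v : 'rV[R]_N).

Definition dotp u v : R := \sum_i u ord0 i * v ord0 i.

(** The norm [`| v |] of ['rV[R]_N] is the max norm: it is used for the topology
    only, and all pointwise estimates are in terms of [enorm]. *)
Definition enorm v : R := Num.sqrt (dotp v v).

Definition partial (i : 'I_N) (f : 'rV[R]_N -> R) : 'rV[R]_N -> R :=
  'D_(delta_mx ord0 i) f.

Definition grad (f : 'rV[R]_N -> R) (x : 'rV[R]_N) : 'rV[R]_N :=
  \row_i partial i f x.

Definition iter_partial (s : seq 'I_N) (f : 'rV[R]_N -> R) : 'rV[R]_N -> R :=
  foldr partial f s.

Definition smooth (f : 'rV[R]_N -> R) : Prop := forall s : seq 'I_N,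
  continuous (iter_partial s f) /\
  (forall i x, derivable (iter_partial s f) x (delta_mx ord0 i)).

(** Elements of C_0^oo(Omega), extended by zero to R^N. *)
Definition test_function (Omega : set 'rV[R]_N) (phi : 'rV[R]_N -> R) : Prop :=
  [/\ smooth phi, compact (closure [set x | phi x != 0]) &
      closure [set x | phi x != 0] `<=` Omega].

(** Near each boundary point, in some orthonormal coordinates
    [y = (x - x0) *m Q], Omega is the part lying strictly above the graph of a
    Lipschitz function of the N - 1 coordinates other than [y_k]. *)
Definition lipschitz_boundary (Omega : set 'rV[R]_N) : Prop :=
  forall x0, (closure Omega `\` interior Omega) x0 ->
  exists (r : R) (Q : 'M[R]_N) (k : 'I_N) (gamma : 'rV[R]_N.-1 -> R),
    [/\ 0 < r, Q *m Q^T = 1%:M, [lipschitz gamma y | y in setT] &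
      forall x, ball x0 r x ->
        let y := (x - x0) *m Q in
        Omega x <-> gamma (col' k y) < y ord0 k].

Definition bounded_lipschitz_domain (Omega : set 'rV[R]_N) : Prop :=
  [/\ open Omega, connected Omega, Omega !=set0, bounded_set Omega &
      lipschitz_boundary Omega].

Definition loc_integrable (Omega : set 'rV[R]_N) (f : 'rV[R]_N -> R) : Prop :=
  @measurable_fun _ _ (caratheodory_type (@lebesgue_outer R N))
    (measurableTypeR R) Omega f /\
  forall K, compact K -> K `<=` Omega ->
    (\int[leb]_(x in K) `|f x|%:E < +oo)%E.

Definition weak_gradient (Omega : set 'rV[R]_N) (u : 'rV[R]_N -> R)
    (g : 'rV[R]_N -> 'rV[R]_N) : Prop :=
  [/\ loc_integrable Omega u,
      forall i, loc_integrable Omega (fun x => g x ord0 i) &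
      forall i phi, test_function Omega phi ->
        (\int[leb]_(x in Omega) (u x * partial i phi x)%:E =
         - \int[leb]_(x in Omega) (g x ord0 i * phi x)%:E)%E].

(** [u \_ Omega] is u extended by zero outside Omega. *)
Definition Linfty (Omega : set 'rV[R]_N) (u : 'rV[R]_N -> R) : Prop :=
  (u \_ Omega) \in Lfun (leb : {measure set _ -> \bar R}) +oo%E.

Definition caratheodory_fun (Omega : set 'rV[R]_N)
    (f : 'rV[R]_N -> R -> 'rV[R]_N -> R) : Prop :=
  (forall t xi, @measurable_fun _ _ (caratheodory_type (@lebesgue_outer R N))
    (measurableTypeR R) Omega (fun x => f x t xi)) /\
  {ae leb, forall x, Omega x ->
    continuous (fun z : R * 'rV[R]_N => f x z.1 z.2)}.

End euclidean.

Section exponents.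
Variable R : realType.

Definition conj_exp (k : R) : R := k / (k - 1).

Definition sobolev_exp (N : nat) (k : R) : R := N%:R * k / (N%:R - k).

End exponents.

Section musielak_orlicz.
Variables (R : realType) (N : nat) (Omega : set 'rV[R]_N).
Variable S : 'rV[R]_N -> R -> R.

Definition in_LS (u : 'rV[R]_N -> R) : Prop :=
  @measurable_fun _ _ (caratheodory_type (@lebesgue_outer R N))
    (measurableTypeR R) Omega u /\
  exists2 l : R, 0 < l & (\int[leb]_(x in Omega) (S x (l * `|u x|))%:E < +oo)%E.

(** [in_W1S u g]: u belongs to W^{1,S}(Omega) and g is its weak gradient. *)
Definition in_W1S (u : 'rV[R]_N -> R) (g : 'rV[R]_N -> 'rV[R]_N) : Prop :=
  [/\ in_LS u, weak_gradient Omega u g & in_LS (fun x => enorm (g x))].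

(** The Luxemburg norm of a pair (u, grad u); it is +oo if no l qualifies. *)
Definition norm_W1S (u : 'rV[R]_N -> R) (g : 'rV[R]_N -> 'rV[R]_N) : \bar R :=
  ereal_inf [set l%:E | l in [set l : R | 0 < l /\
    (\int[leb]_(x in Omega)
       (S x (`|u x| / l) + S x (enorm (g x) / l))%:E <= 1)%E]].

Definition in_W1S0 (u : 'rV[R]_N -> R) (g : 'rV[R]_N -> 'rV[R]_N) : Prop :=
  in_W1S u g /\
  forall eps : R, 0 < eps -> exists2 phi, test_function Omega phi &
    (norm_W1S (fun x => u x - phi x)%R (fun x => g x - grad phi x)%R < eps%:E)%E.

(** A weak gradient g of u is unique almost everywhere on Omega, so the
    existential over g and the universal over the weak gradient h of phi only
    name grad u and grad phi. *)
Definition weak_solution (A : 'rV[R]_N -> R -> 'rV[R]_N -> 'rV[R]_N)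
    (B : 'rV[R]_N -> R -> 'rV[R]_N -> R) (u : 'rV[R]_N -> R) : Prop :=
  exists2 g, in_W1S0 u g &
    forall phi h, in_W1S0 phi h ->
      (\int[leb]_(x in Omega) (dotp (A x (u x) (g x)) (h x))%:E =
       \int[leb]_(x in Omega) (B x (u x) (g x) * phi x)%:E)%E.

End musielak_orlicz.

Section log_double_phase.
Variables (R : realType) (N : nat).

Definition log_double_phase (a b p q : 'rV[R]_N -> R) (delta eta : R)
    (x : 'rV[R]_N) (t : R) : R :=
  a x * t `^ p x + b x * t `^ q x * ln (delta + eta * t).

End log_double_phase.

(* Main.v *)
Require Import Defs.
From mathcomp Require Import all_boot all_order all_algebra.
From mathcomp Require Import all_classical all_reals all_analysis.
From mathcomp Require Import measurable_realfun ring lra.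
Set Implicit Arguments.
Unset Strict Implicit.
Unset Printing Implicit Defensive.
Import Order.TTheory GRing.Theory Num.Theory.
Import numFieldNormedType.Exports.
Local Open Scope classical_set_scope.
Local Open Scope ring_scope.

(* Let G be the critical phase a^(p*/p) t^p* + (b log(delta + eta t))^(q*/q) t^q* of the growth
   conditions and S the double phase.  Gagliardo's inequality is applied to the truncations
   (|u| - k)^+ /\ M composed with a phase to the power sigma = (N - 1)/(N - r), whose
   N/(N - 1)-th power is a summand of G.  The slope of this composition is absorbed by S of the
   gradient and a small multiple of G; the terms coming from the dependence of the exponents and
   coefficients on x are subcritical because q/p < 1 + 1/N.  This yields
   X <= (A (X + int_{|u|>k} S(|u|) + S(|grad u|)))^(N/(N-1)) for X = int G((|u| - k)^+ /\ M).
   For large k the superlinear exponent keeps X small while M is doubled, so int G(|u|) is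
   finite.  Testing the equation with smooth soft thresholds of u, which are W_0^{1,S} functions,
   gives int_{|u|>=k} S(|grad u|) <= C int_{|u|>k'} G(|u|) for 1 <= k' < k.  With the previous
   inequality this is a De Giorgi recursion Z_{n+1} <= (C D^n Z_n)^(N/(N-1)) for
   Z_n = int G((|u| - k_n)^+), k_n = k_0 (2 - 2^-n), so that |u| <= 2 k_0 almost everywhere. *)

(** * Gagliardo's inequality for iterated integrals *)

Section hoelder_powers.
Local Open Scope ereal_scope.

(** No single Lebesgue exponent fits, so the Sobolev step starts from Gagliardo's inequality for p =
    1, applied to a power of the phase itself; the price is the x-dependence of this power, whose
    slopes must all be controlled by the critical phase. Nothing is absorbed there by smallness: [X]
    returns on the right with a large factor, and only the exponent N / (N - 1) > 1 makes the
    inequality useful, first as a range of values that a doubling cannot jump over, then as the gain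
    of the De Giorgi recursion. The space W_0^{1,S} is given as a closure of test functions, which
    shapes both halves. Inequalities are proved for C^1 functions and passed to the limit under a
    truncation that keeps the phases bounded; and the equation is tested with smooth thresholds
    because these send test functions to test functions. A smooth threshold is not constant below
    its level, whence the two levels k' < k and an error that disappears with the smoothing
    parameter. Finiteness of the integral of G(|u|) has to precede the energy estimate, where it
    makes the bounds on both sides integrable. *)

Lemma young_poweR (R : realType) (p : R) (x y : \bar R) : (0 < p < 1)%R ->
  0 <= x -> 0 <= y ->
  x `^ p * y `^ (1 - p) <= p%:E * x + (1 - p)%:E * y.
Proof.
move=> /andP[p0 p1] x0 y0; have q0 : (0 < 1 - p)%R by rewrite subr_gt0.
have [->|x0'] := eqVneq x 0.
  by rewrite poweR0r ?gt_eqF// mul0e mule0 add0e mule_ge0// lee_fin ltW.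
have [->|y0'] := eqVneq y 0.
  by rewrite poweR0r ?gt_eqF// mule0 mule0 adde0 mule_ge0// lee_fin ltW.
have {}x0 : 0 < x by rewrite lt0e x0'.
have {}y0 : 0 < y by rewrite lt0e y0'.
move: x y x0 y0 {x0' y0'} => [x| |] [y| |] //; rewrite ?lte_fin => x0 y0; last 3 first.
- by rewrite [X in _ <= _ + X]gt0_muley ?lte_fin// addey ?leey// -EFinM.
- by rewrite [X in _ <= X + _]gt0_muley ?lte_fin// addye ?leey// -EFinM.
- by rewrite [X in _ <= X + _]gt0_muley ?lte_fin// addye ?leey// gt0_muley ?lte_fin.
rewrite !poweR_EFin -!EFinM -EFinD lee_fin.
have := @conjugate_powR R (x `^ p)%R (y `^ (1 - p))%R (p^-1)%R ((1 - p)^-1)%R (powR_ge0 _ _)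
  (powR_ge0 _ _).
rewrite !invr_gt0 !invrK -!powRrM !mulfV ?gt_eqF// (powRr1 (ltW x0)) (powRr1 (ltW y0)).
by rewrite (mulrC x) (mulrC y) => -> //; rewrite addrC subrK.
Qed.

(** Both integrals are normalised to 1 and Young's inequality is integrated; an integral equal to 0
    or [+oo] is settled first. Extended values are allowed because line integrals may be infinite
    before any integrability is known. *)
Lemma ge0_hoelder d (T : measurableType d) (R : realType)
    (mu : {measure set T -> \bar R}) (p : R) (A B : T -> \bar R) :
  (0 < p < 1)%R -> measurable_fun [set: T] A -> measurable_fun [set: T] B ->
  (forall x, 0 <= A x) -> (forall x, 0 <= B x) ->
  \int[mu]_x (A x `^ p * B x `^ (1 - p)) <=
  (\int[mu]_x A x) `^ p * (\int[mu]_x B x) `^ (1 - p).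
Proof.
move=> p01 mA mB A0 B0; have /andP[p0 p1] := p01.
have q0 : (0 < 1 - p)%R by rewrite subr_gt0.
have mP (f : T -> \bar R) r : measurable_fun [set: T] f ->
    measurable_fun [set: T] (fun x => f x `^ r).
  by move=> mf; exact: (measurableT_comp (measurable_poweR r)).
have mAB : measurable_fun [set: T] (fun x => A x `^ p * B x `^ (1 - p)).
  by apply: emeasurable_funM; exact: mP.
(* A vanishing integral makes its function zero almost everywhere; both degenerate cases reduce to
   this one by symmetry. *)
have zero (f g : T -> \bar R) r s : (0 < r)%R -> measurable_fun [set: T] f ->
    measurable_fun [set: T] g -> (forall x, 0 <= f x) -> (forall x, 0 <= g x) ->
    \int[mu]_x f x = 0 -> \int[mu]_x (f x `^ r * g x `^ s) = 0.
  move=> r0 mf mg f0 g0 If.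
  have mfg : measurable_fun [set: T] (fun x => f x `^ r * g x `^ s).
    by apply: emeasurable_funM; exact: mP.
  rewrite (@ae_eq_integral _ _ _ mu setT (cst 0))//; first exact: integral0.
  have /(ae_eq_integral_abs mu measurableT mf) : \int[mu]_x `|f x| = 0.
    by under eq_integral do rewrite gee0_abs//.
  by apply: filterS => x /(_ I) fx _; rewrite fx poweR0r ?gt_eqF// mul0e.
have [IA0|IA0] := eqVneq (\int[mu]_x A x) 0.
  by rewrite zero// mule_ge0// poweR_ge0.
have [IB0|IB0] := eqVneq (\int[mu]_x B x) 0.
  rewrite (_ : integral _ _ _ = 0) ?mule_ge0 ?poweR_ge0//.
  under eq_integral do rewrite muleC.
  exact: zero.
have {}IA0 : 0 < \int[mu]_x A x by rewrite lt0e IA0 integral_ge0.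
have {}IB0 : 0 < \int[mu]_x B x by rewrite lt0e IB0 integral_ge0.
have [IAy|IAy] := eqVneq (\int[mu]_x A x) +oo.
  by rewrite IAy poweRyr ?gt_eqF// gt0_mulye ?leey// poweR_gt0.
have [IBy|IBy] := eqVneq (\int[mu]_x B x) +oo.
  by rewrite IBy poweRyr ?gt_eqF// gt0_muley ?leey// poweR_gt0.
have fA : \int[mu]_x A x \is a fin_num by rewrite ge0_fin_numE ?ltey// ltW.
have fB : \int[mu]_x B x \is a fin_num by rewrite ge0_fin_numE ?ltey// ltW.
pose a := fine (\int[mu]_x A x); pose b := fine (\int[mu]_x B x).
have aE : \int[mu]_x A x = a%:E by rewrite fineK.
have bE : \int[mu]_x B x = b%:E by rewrite fineK.
have a0 : (0 < a)%R by rewrite -lte_fin -aE.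
have b0 : (0 < b)%R by rewrite -lte_fin -bE.
rewrite aE bE !poweR_EFin -EFinM.
set c := (_ * _)%R; have c0 : (0 < c)%R by rewrite mulr_gt0 ?powR_gt0.
apply: (@le_trans _ _ (\int[mu]_x (c%:E *
    (p%:E * (a^-1%:E * A x) + (1 - p)%:E * (b^-1%:E * B x))))).
  apply: ge0_le_integral => //.
  - by move=> x _; rewrite mule_ge0// poweR_ge0.
  - apply: emeasurable_funM => //; apply: emeasurable_funD.
    + by apply: emeasurable_funM => //; exact: emeasurable_funM.
    + by apply: emeasurable_funM => //; exact: emeasurable_funM.
  move=> x _.
  have -> : A x `^ p * B x `^ (1 - p) =
      c%:E * ((a^-1%:E * A x) `^ p * (b^-1%:E * B x) `^ (1 - p)).
    have [a0' b0'] : (0 <= a^-1)%R /\ (0 <= b^-1)%R by rewrite !invr_ge0 !ltW.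
    rewrite (poweRM p _ (A0 x)) ?lee_fin// (poweRM (1 - p) _ (B0 x)) ?lee_fin//.
    have cE : (c * (a^-1 `^ p * b^-1 `^ (1 - p)) = 1)%R.
      rewrite /c mulrACA -!powRM// ?(ltW a0) ?(ltW b0)//.
      by rewrite !mulfV ?gt_eqF// !powR1 mulr1.
    have gen (r s t : R) (y z : \bar R) : (r * (s * t) = 1)%R ->
        y * z = r%:E * (s%:E * y * (t%:E * z)).
      move=> h; rewrite -[LHS]mul1e -h !EFinM -!muleA.
      by congr (_ * (_ * _)); rewrite muleCA.
    exact: gen.
  rewrite lee_pmul2l ?lte_fin//; apply: young_poweR => //.
  - by rewrite mule_ge0// lee_fin invr_ge0 ltW.
  - by rewrite mule_ge0// lee_fin invr_ge0 ltW.
have mulA : measurable_fun [set: T] (fun x => a^-1%:E * A x) by exact: emeasurable_funM.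
have mulB : measurable_fun [set: T] (fun x => b^-1%:E * B x) by exact: emeasurable_funM.
have gA x : 0 <= a^-1%:E * A x by rewrite mule_ge0// lee_fin invr_ge0 ltW.
have gB x : 0 <= b^-1%:E * B x by rewrite mule_ge0// lee_fin invr_ge0 ltW.
have gpA x : 0 <= p%:E * (a^-1%:E * A x) by rewrite mule_ge0// lee_fin ltW.
have gpB x : 0 <= (1 - p)%:E * (b^-1%:E * B x) by rewrite mule_ge0// lee_fin ltW.
rewrite ge0_integralZl//; [|by apply: emeasurable_funD; exact: emeasurable_funM
  |by move=> x _; rewrite adde_ge0|by rewrite lee_fin ltW].
rewrite ge0_integralD//; [|exact: emeasurable_funM|exact: emeasurable_funM].
have [a0' b0'] : (0 <= a^-1)%R /\ (0 <= b^-1)%R by rewrite !invr_ge0 !ltW.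
rewrite !ge0_integralZl// ?lee_fin ?(ltW p0) ?(ltW q0)//.
have inve (r : R) : (0 < r)%R -> r^-1%:E * r%:E = 1.
  by move=> r0; rewrite -EFinM mulVf// gt_eqF.
by rewrite aE bE !inve// !mule1 -EFinD addrC subrK mule1.
Qed.

Lemma emeasurable_prod d (T : measurableType d) (R : realType) (I : Type)
    (s : seq I) (F : I -> T -> \bar R) :
  (forall i, measurable_fun [set: T] (F i)) ->
  measurable_fun [set: T] (fun x => \prod_(i <- s) F i x).
Proof.
move=> mF; elim: s => [|i s IH].
  by under eq_fun do rewrite big_nil; exact: measurable_cst.
by under eq_fun do rewrite big_cons; exact: emeasurable_funM.
Qed.

(** Induction on the number of factors: the last one is split off with weight p = 1 / (m + 2), and
    the power 1 - p = (m + 1) / (m + 2) turns the exponents 1 / (m + 1) of the induction hypothesis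
    into 1 / (m + 2). *)
Lemma ge0_hoelder_prod d (T : measurableType d) (R : realType)
    (mu : {measure set T -> \bar R}) m (F : nat -> T -> \bar R) :
  (forall i, measurable_fun [set: T] (F i)) -> (forall i x, 0 <= F i x) ->
  \int[mu]_x (\prod_(i < m.+1) (F i x) `^ m.+1%:R^-1) <=
  \prod_(i < m.+1) (\int[mu]_x F i x) `^ m.+1%:R^-1.
Proof.
move=> mF F0; elim: m => [|m IH].
  rewrite big_ord_recl big_ord0 mule1 invr1 poweRe1 ?integral_ge0//.
  apply: ge0_le_integral => //.
  - by move=> x _; rewrite prode_ge0// => i _; rewrite poweR_ge0.
  - under eq_fun do rewrite big_ord_recl big_ord0 mule1 poweRe1//.
    exact: mF.
  - by move=> x _; rewrite big_ord_recl big_ord0 mule1 poweRe1.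
pose p : R := (m.+2%:R^-1)%R.
have qE : (1 - p = m.+1%:R / m.+2%:R)%R.
  apply: (mulIf (_ : m.+2%:R != 0)%R) => //.
  by rewrite mulrBl mulVf// divfK// mul1r -natr1 addrK.
have p01 : (0 < p < 1)%R.
  by rewrite /p invr_gt0 ltr0n/= invf_lt1 ?ltr1n// ltr0n.
have prodE (G : nat -> \bar R) : (forall i, 0 <= G i) ->
    \prod_(i < m.+1) G i `^ p = (\prod_(i < m.+1) G i `^ m.+1%:R^-1) `^ (1 - p).
  move=> G0.
  have pM k (H : nat -> \bar R) r : (forall i, 0 <= H i) ->
      (\prod_(i < k) H i) `^ r = \prod_(i < k) H i `^ r.
    move=> H0; elim: k => [|k IHk]; first by rewrite !big_ord0 poweR1r.
    by rewrite !big_ord_recr/= poweRM ?IHk// prode_ge0.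
  rewrite (pM _ (fun i => G i `^ m.+1%:R^-1)); last by move=> i; exact: poweR_ge0.
  apply: eq_bigr => i _; rewrite -poweRrM qE mulrA mulVf ?mul1r//.
under eq_integral => x _ do rewrite big_ord_recr/= (prodE (F ^~ x))// muleC.
rewrite big_ord_recr/= (prodE (fun i => \int[mu]_x F i x)); last first.
  by move=> i; apply: integral_ge0.
rewrite muleC.
apply: (le_trans (@ge0_hoelder _ _ _ mu p _ _ p01 _ _ _ _)) => //.
- apply: emeasurable_prod => i _.
  exact: (measurableT_comp (measurable_poweR _)).
- by move=> x; rewrite prode_ge0// => i _; rewrite poweR_ge0.
rewrite lee_pmul ?poweR_ge0//.
apply: gt0_ler_poweR => //.
- by rewrite subr_ge0 ltW//; case/andP: p01.
- rewrite in_itv/= leey andbT integral_ge0// => x _.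
  by rewrite prode_ge0// => i _; rewrite poweR_ge0.
- rewrite in_itv/= leey andbT.
  by rewrite prode_ge0// => i _; rewrite poweR_ge0.
Qed.

End hoelder_powers.

(** * Tonelli along coordinate lines and the slicing argument *)

Section tuple_tonelli.
Context {R : realType}.
Notation mR := (measurableTypeR R).
Notation leb1 := (@lebesgue_measure R).
Local Open Scope ereal_scope.

(** The direction is a natural number so that it drops from i + 1 to i when the first coordinate is
    split off. A line integral stays a function on the whole space, constant in the i-th coordinate,
    so that no coordinate has to be removed. *)
Definition tset n (t : n.-tuple mR) (i : nat) (s : mR) : n.-tuple mR :=
  [tuple (if val j == i then s else tnth t j) | j < n].

Definition lineint n (i : nat) (h : n.-tuple mR -> \bar R) (t : n.-tuple mR) :=
  \int[leb1]_s h (tset t i s).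

Lemma tset_cons0 n x (t : n.-tuple mR) s : tset (tcons (x, t)) 0 s = tcons (s, t).
Proof.
apply: eq_from_tnth => j; rewrite tnth_mktuple.
by case: (unliftP ord0 j) => [k|] ->; rewrite ?tnthS ?tnth0.
Qed.

Lemma tset_consS n x (t : n.-tuple mR) i s :
  tset (tcons (x, t)) i.+1 s = tcons (x, tset t i s).
Proof.
apply: eq_from_tnth => j; rewrite tnth_mktuple.
by case: (unliftP ord0 j) => [k|] ->; rewrite ?tnthS ?tnth0//= tnth_mktuple.
Qed.

Lemma measurable_tset n i :
  measurable_fun [set: n.-tuple mR * mR] (fun z => tset z.1 i z.2).
Proof.
apply/measurable_fun_tnthP => j.
rewrite (_ : _ \o _ = fun z => if val j == i then z.2 else tnth z.1 j); last first.
  by apply/funext => z /=; rewrite tnth_mktuple.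
case: (val j == i); first exact: measurable_snd.
by apply: (measurableT_comp (measurable_tnth j)); exact: measurable_fst.
Qed.

Lemma measurable_tset2 n i (t : n.-tuple mR) : measurable_fun [set: mR] (tset t i).
Proof. exact: (measurable_fun_pair2 _ (measurable_tset i)). Qed.

Lemma measurable_tcons2 n (x : mR) :
  measurable_fun [set: n.-tuple mR] (fun t => tcons (x, t)).
Proof. exact: (measurable_fun_pair2 _ (@measurable_tcons R n)). Qed.

Lemma measurable_tcons1 n (t : n.-tuple mR) :
  measurable_fun [set: mR] (fun x => tcons (x, t)).
Proof. exact: (measurable_fun_pair1 _ (@measurable_tcons R n)). Qed.

Section int_cons.
Variables (n : nat) (f : n.+1.-tuple mR -> \bar R).
Hypotheses (mf : measurable_fun setT f) (f0 : forall t, 0 <= f t).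

Let mfc : measurable_fun [set: mR * n.-tuple mR] (f \o @tcons R n).
Proof. by apply: measurableT_comp => //; exact: measurable_tcons. Qed.

Let f0c z : 0 <= (f \o @tcons R n) z. Proof. exact: f0. Qed.

Lemma integral_tuple_cons :
  \int[tuple_lebesgue n.+1]_t f t =
  \int[leb1]_x \int[tuple_lebesgue n]_t f (tcons (x, t)).
Proof.
transitivity (\int[(leb1 \x tuple_lebesgue n)]_z (f \o @tcons R n) z).
  have := @ge0_integral_pushforward _ _ _ _ R _ (@measurable_tcons R n)
    (leb1 \x tuple_lebesgue n)%E setT f measurableT mf.
  by rewrite preimage_setT => <- //.
by rewrite (fubini_tonelli1 _ mfc f0c).
Qed.

Lemma integral_tuple_cons_swap :
  \int[tuple_lebesgue n.+1]_t f t =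
  \int[tuple_lebesgue n]_t \int[leb1]_x f (tcons (x, t)).
Proof.
by rewrite integral_tuple_cons (fubini_tonelli (f \o @tcons R n) mfc f0c).
Qed.

Lemma measurable_integral_cons :
  measurable_fun setT (fun t : n.-tuple mR => \int[leb1]_x f (tcons (x, t))).
Proof. exact: (measurable_fun_fubini_tonelli_G (f \o @tcons R n) mfc f0c). Qed.

End int_cons.

Lemma lineint_ge0 n i (h : n.-tuple mR -> \bar R) t :
  (forall t, 0 <= h t) -> 0 <= lineint i h t.
Proof. by move=> h0; exact: integral_ge0. Qed.

Lemma measurable_lineint n i (h : n.-tuple mR -> \bar R) :
  measurable_fun setT h -> (forall t, 0 <= h t) ->
  measurable_fun setT (lineint i h).
Proof.
move=> mh h0.
apply: (@measurable_fun_fubini_tonelli_F _ _ _ _ _ leb1 (fun z => h (tset z.1 i z.2))) => //.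
exact: (measurableT_comp mh (measurable_tset i)).
Qed.

Lemma lineint_cons0 n (h : n.+1.-tuple mR -> \bar R) x t :
  lineint 0 h (tcons (x, t)) = \int[leb1]_s h (tcons (s, t)).
Proof. by apply: eq_integral => s _; rewrite tset_cons0. Qed.

Lemma lineint_consS n i (h : n.+1.-tuple mR -> \bar R) x t :
  lineint i.+1 h (tcons (x, t)) = lineint i (fun t => h (tcons (x, t))) t.
Proof. by apply: eq_integral => s _; rewrite tset_consS. Qed.

Lemma integral_lineint_swap n i (h : n.+1.-tuple mR -> \bar R) t :
  measurable_fun setT h -> (forall t, 0 <= h t) ->
  \int[leb1]_x lineint i (fun t => h (tcons (x, t))) t =
  lineint i (fun t => \int[leb1]_x h (tcons (x, t))) t.
Proof.
move=> mh h0; rewrite /lineint.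
rewrite (fubini_tonelli (fun z : mR * mR => h (tcons (z.1, tset t i z.2))))//.
apply: (measurableT_comp mh); apply: (measurableT_comp (@measurable_tcons R n)).
apply: measurable_fun_pair; first exact: measurable_fst.
by apply: (measurableT_comp (measurable_tset2 i t)); exact: measurable_snd.
Qed.

(* Line integrals determine the integral: this replaces Fubini in an arbitrary
   coordinate. *)
Lemma eq_lineint_integral n i (f g : n.-tuple mR -> \bar R) : (i < n)%N ->
  measurable_fun setT f -> measurable_fun setT g ->
  (forall t, 0 <= f t) -> (forall t, 0 <= g t) ->
  (forall t, lineint i f t = lineint i g t) ->
  \int[tuple_lebesgue n]_t f t = \int[tuple_lebesgue n]_t g t.
Proof.
elim: n i f g => // n IH [|i] f g ltin mf mg f0 g0 fg.
  rewrite !integral_tuple_cons_swap//; apply: eq_integral => t _.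
  by have := fg (tcons (0%R : mR, t)); rewrite !lineint_cons0.
rewrite !integral_tuple_cons//; apply: eq_integral => x _; apply: (IH i) => //.
- exact: (measurableT_comp mf (measurable_tcons2 x)).
- exact: (measurableT_comp mg (measurable_tcons2 x)).
by move=> t; rewrite -!lineint_consS.
Qed.

(* One Hoelder inequality in the first variable turns a product of line
   integrals on R^(n+1) into a product of line integrals on R^n. *)
Lemma integral_prod_lineint_cons m n (F h : n.+1.-tuple mR -> \bar R)
    (t : n.-tuple mR) :
  measurable_fun setT h -> (forall t, 0 <= h t) ->
  measurable_fun setT F -> (forall t, 0 <= F t) ->
  \int[leb1]_x (F (tcons (x, t)) `^ m.+2%:R^-1 *
    \prod_(i < m.+1) lineint i.+1 h (tcons (x, t)) `^ m.+2%:R^-1) <=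
  (\int[leb1]_x F (tcons (x, t))) `^ m.+2%:R^-1 *
    \prod_(i < m.+1) lineint i (fun t => \int[leb1]_x h (tcons (x, t))) t `^ m.+2%:R^-1.
Proof.
move=> mh h0 mF F0.
pose G (i : nat) x := if i is j.+1 then lineint j.+1 h (tcons (x, t)) else F (tcons (x, t)).
have mG i : measurable_fun [set: mR] (G i).
  case: i => [|i].
    exact: (measurableT_comp mF (measurable_tcons1 t)).
  exact: (measurableT_comp (measurable_lineint i.+1 mh h0) (measurable_tcons1 t)).
have G0 i x : 0 <= G i x by case: i => [|i]; [exact: F0|exact: lineint_ge0].
have := ge0_hoelder_prod leb1 m.+1 mG G0.
under eq_integral do rewrite big_ord_recl/=.
rewrite big_ord_recl/= => /le_trans; apply.
rewrite lee_pmul// ?poweR_ge0//; first by rewrite prode_ge0// => i _; exact: poweR_ge0.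
rewrite le_eqVlt; apply/orP; left; apply/eqP; apply: eq_bigr => i _; congr (_ `^ _).
under eq_integral do rewrite lineint_consS.
by rewrite integral_lineint_swap.
Qed.

Lemma lee_prode m (F G : 'I_m -> \bar R) :
  (forall i, 0 <= F i <= G i) -> \prod_i F i <= \prod_i G i.
Proof.
move=> FG; suff /andP[] : 0 <= \prod_i F i <= \prod_i G i by [].
elim/big_ind2: _ => [|x1 x2 y1 y2 /andP[x0 x12] /andP[y0 y12]|i _]; last exact: FG.
  by rewrite lexx lee01.
by rewrite mule_ge0//= lee_pmul.
Qed.

Lemma prode_cst_powR m (c : \bar R) (r : R) : (0 < r)%R -> 0 <= c ->
  \prod_(i < m) c `^ r = c `^ (m%:R * r).
Proof.
move=> r0 c0; elim: m => [|m IH]; first by rewrite big_ord0 mul0r poweRe0.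
rewrite big_ord_recr/= IH -natr1 mulrDl mul1r poweRD//.
by rewrite add_neq0_poweRD_def// gt_eqF// ltr_wpDl ?mulr_ge0// ltW.
Qed.

(* The weight [K] absorbs the line integral in the first variable in the induction on
   the dimension. *)
Lemma gagliardo_aux m (K h : m.+1.-tuple mR -> \bar R) :
  measurable_fun setT h -> (forall t, 0 <= h t) ->
  measurable_fun setT K -> (forall t, 0 <= K t) ->
  \int[tuple_lebesgue m.+1]_t (K t `^ m.+1%:R^-1 *
    \prod_(i < m.+1) lineint i h t `^ m.+1%:R^-1) <=
  (\int[tuple_lebesgue m.+1]_t K t) `^ m.+1%:R^-1 *
    \prod_(i < m.+1) (\int[tuple_lebesgue m.+1]_t h t) `^ m.+1%:R^-1.
Proof.
have mpow d (T : measurableType d) (f : T -> \bar R) r :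
    measurable_fun [set: T] f -> measurable_fun [set: T] (fun x => f x `^ r).
  exact: (measurableT_comp (measurable_poweR r)).
elim: m K h => [|m IH] K h mh h0 mK K0.
  rewrite big_ord1 invr1 !poweRe1 ?integral_ge0//.
  (* In dimension one the remaining measure is the Dirac mass at the empty tuple, so the line
     integral is the whole integral. *)
  have hE (t : 1.-tuple mR) : lineint 0 h t = \int[tuple_lebesgue 1]_t h t.
    rewrite integral_tuple_cons_swap//= integral_dirac//; last first.
      exact: measurable_integral_cons.
    by rewrite diracT mul1e -(@tunconsK R _ t) lineint_cons0 tuple0.
  under eq_integral do rewrite big_ord1/= !poweRe1 ?lineint_ge0// hE.
  by rewrite ge0_integralZr// integral_ge0.
set th : R := (m.+2%:R^-1)%R.
pose J t := \int[leb1]_x h (tcons (x, t)).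
pose K' t := \int[leb1]_x K (tcons (x, t)).
have mJ : measurable_fun setT J by exact: measurable_integral_cons.
have mK' : measurable_fun setT K' by exact: measurable_integral_cons.
have J0 t : 0 <= J t by exact: integral_ge0.
have K'0 t : 0 <= K' t by exact: integral_ge0.
(* Integrand of the induction hypothesis for the sections [J] and [K']. The line integral in the
   first direction does not depend on the first variable and comes out as [J]; Hoelder with weights
   [th] and [1 - th] then separates [J] from [B]. *)
pose B t := K' t `^ m.+1%:R^-1 * \prod_(i < m.+1) lineint i J t `^ m.+1%:R^-1.
have B0 t : 0 <= B t.
  by rewrite mule_ge0 ?poweR_ge0// prode_ge0// => i _; rewrite poweR_ge0.
have mB : measurable_fun setT B.
  apply: emeasurable_funM; first exact: mpow.
  by apply: emeasurable_prod => i; apply: mpow; exact: measurable_lineint.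
have thE : (1 - th = m.+1%:R / m.+2%:R)%R.
  apply: (mulIf (_ : m.+2%:R != 0)%R) => //.
  by rewrite mulrBl mulVf// divfK// mul1r -natr1 addrK.
have th01 : (0 < th < 1)%R.
  by rewrite /th invr_gt0 ltr0n/= invf_lt1 ?ltr1n// ltr0n.
have rootE : (m.+1%:R^-1 * (1 - th) = th)%R by rewrite thE mulrA mulVf ?mul1r.
have pM k (H : nat -> \bar R) r : (forall i, 0 <= H i) ->
    (\prod_(i < k) H i) `^ r = \prod_(i < k) H i `^ r.
  move=> H0; elim: k => [|k IHk]; first by rewrite !big_ord0 poweR1r.
  by rewrite !big_ord_recr/= poweRM ?IHk// prode_ge0.
have powE (c : \bar R) (H : nat -> \bar R) : 0 <= c -> (forall i, 0 <= H i) ->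
    (c `^ m.+1%:R^-1 * \prod_(i < m.+1) H i `^ m.+1%:R^-1) `^ (1 - th) =
    c `^ th * \prod_(i < m.+1) H i `^ th.
  move=> c0 H0; rewrite poweRM ?poweR_ge0//; last first.
    by rewrite prode_ge0// => i _; rewrite poweR_ge0.
  rewrite (pM _ (fun i => H i `^ m.+1%:R^-1)); last by move=> i; exact: poweR_ge0.
  rewrite -poweRrM rootE; congr (_ * _); apply: eq_bigr => i _.
  by rewrite -poweRrM rootE.
rewrite integral_tuple_cons_swap; last 2 first.
- apply: emeasurable_funM; first exact: mpow.
  by apply: emeasurable_prod => i; apply: mpow; exact: measurable_lineint.
- move=> t; rewrite mule_ge0 ?poweR_ge0// prode_ge0// => i _.
  by rewrite poweR_ge0.
apply: (@le_trans _ _ (\int[tuple_lebesgue m.+1]_t (J t `^ th * B t `^ (1 - th)))).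
  apply: ge0_le_integral => //.
  - move=> t _; apply: integral_ge0 => x _.
    by rewrite mule_ge0 ?poweR_ge0// prode_ge0// => i _; rewrite poweR_ge0.
  - apply: (measurable_integral_cons (f := fun t => K t `^ th *
      \prod_(i < m.+2) lineint i h t `^ th)).
      apply: emeasurable_funM; first exact: mpow.
      by apply: emeasurable_prod => i; apply: mpow; exact: measurable_lineint.
    move=> t; rewrite mule_ge0 ?poweR_ge0// prode_ge0// => i _.
    by rewrite poweR_ge0.
  - by apply: emeasurable_funM; exact: mpow.
  move=> t _; rewrite /B (powE _ (fun i => lineint i J t))// => [|i]; last exact: lineint_ge0.
  have := @integral_prod_lineint_cons m _ K h t mh h0 mK K0.
  rewrite -/th => H.
  rewrite (_ : integral _ _ _ = J t `^ th * \int[leb1]_x (K (tcons (x, t)) `^ th *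
      \prod_(i < m.+1) lineint i.+1 h (tcons (x, t)) `^ th)).
    by rewrite lee_wpmul2l// poweR_ge0.
  rewrite -ge0_integralZl//; last 3 first.
  - apply: emeasurable_funM.
      by apply: mpow; exact: (measurableT_comp mK (measurable_tcons1 t)).
    apply: emeasurable_prod => i; apply: mpow.
    exact: (measurableT_comp (measurable_lineint i.+1 mh h0) (measurable_tcons1 t)).
  - move=> x _; rewrite mule_ge0 ?poweR_ge0// prode_ge0// => i _.
    by rewrite poweR_ge0.
  - by rewrite poweR_ge0.
  by apply: eq_integral => x _; rewrite big_ord_recl/= lineint_cons0 muleCA.
apply: (le_trans (@ge0_hoelder _ _ _ (tuple_lebesgue m.+1) th _ _ th01 mJ mB J0 B0)).
rewrite big_ord_recl/= muleCA -/th.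
have -> : \int[tuple_lebesgue m.+2]_t h t = \int[tuple_lebesgue m.+1]_t J t.
  by rewrite integral_tuple_cons_swap.
have -> : \int[tuple_lebesgue m.+2]_t K t = \int[tuple_lebesgue m.+1]_t K' t.
  by rewrite integral_tuple_cons_swap.
rewrite lee_wpmul2l ?poweR_ge0//.
rewrite -(powE _ (fun=> \int[tuple_lebesgue m.+1]_t J t)) ?integral_ge0//.
apply: gt0_ler_poweR.
- by rewrite subr_ge0 ltW//; case/andP: th01.
- by rewrite in_itv/= leey andbT integral_ge0.
- rewrite in_itv/= leey andbT mule_ge0 ?poweR_ge0// prode_ge0// => i _.
  by rewrite poweR_ge0.
exact: IH.
Qed.

(** The power n / (n - 1) of [w] is a product of n factors [w] to 1 / (n - 1), each bounded by the
    line integral in its own direction. The line integral in the first direction then serves as the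
    weight of [gagliardo_aux] and supplies the remaining factor of the bound. *)
Lemma gagliardo m (w h : m.+2.-tuple mR -> \bar R) :
  measurable_fun setT w -> (forall t, 0 <= w t) ->
  measurable_fun setT h -> (forall t, 0 <= h t) ->
  (forall i t, (i < m.+2)%N -> w t <= lineint i h t) ->
  \int[tuple_lebesgue m.+2]_t w t `^ (m.+2%:R / m.+1%:R) <=
  (\int[tuple_lebesgue m.+2]_t h t) `^ (m.+2%:R / m.+1%:R).
Proof.
have mpow d (T : measurableType d) (f : T -> \bar R) r :
    measurable_fun [set: T] f -> measurable_fun [set: T] (fun x => f x `^ r).
  exact: (measurableT_comp (measurable_poweR r)).
move=> mw w0 mh h0 wh.
pose J t := \int[leb1]_x h (tcons (x, t)).
have mJ : measurable_fun setT J by exact: measurable_integral_cons.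
have J0 t : 0 <= J t by exact: integral_ge0.
pose th : R := (m.+1%:R^-1)%R.
have th0 : (0 < th)%R by rewrite /th invr_gt0.
have mprod : measurable_fun setT (fun t => \prod_(i < m.+2) lineint i h t `^ th).
  by apply: emeasurable_prod => i; apply: mpow; exact: measurable_lineint.
have prod0 t : 0 <= \prod_(i < m.+2) lineint i h t `^ th.
  by rewrite prode_ge0// => i _; rewrite poweR_ge0.
apply: (@le_trans _ _ (\int[tuple_lebesgue m.+2]_t
    \prod_(i < m.+2) lineint i h t `^ th)).
  apply: ge0_le_integral => //.
  - by move=> t _; exact: poweR_ge0.
  - exact: mpow.
  move=> t _; rewrite -(prode_cst_powR _ th0)//.
  apply: lee_prode => i; rewrite poweR_ge0/=.
  apply: gt0_ler_poweR; [exact: ltW| | |exact: wh].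
  - by rewrite in_itv/= leey andbT.
  - by rewrite in_itv/= leey andbT lineint_ge0.
rewrite integral_tuple_cons_swap// -(prode_cst_powR _ th0) ?integral_ge0//.
have -> : \int[tuple_lebesgue m.+2]_t h t = \int[tuple_lebesgue m.+1]_t J t.
  by rewrite integral_tuple_cons_swap.
rewrite big_ord_recl.
apply: le_trans (@gagliardo_aux m J J mJ J0 mJ J0).
apply: ge0_le_integral => //.
- by move=> t _; exact: integral_ge0.
- exact: (measurable_integral_cons mprod).
- apply: emeasurable_funM; first exact: mpow.
  by apply: emeasurable_prod => i; apply: mpow; exact: measurable_lineint.
move=> t _.
have mL i : measurable_fun setT (fun x => lineint i.+1 h (tcons (x, t))).
  exact: (measurableT_comp (measurable_lineint i.+1 mh h0) (measurable_tcons1 t)).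
rewrite (_ : integral _ _ _ = J t `^ th *
    \int[leb1]_x (\prod_(i < m.+1) lineint i.+1 h (tcons (x, t)) `^ th)).
  rewrite lee_wpmul2l ?poweR_ge0//.
  have := ge0_hoelder_prod leb1 m mL (fun i x => lineint_ge0 i.+1 (tcons (x, t)) h0).
  move=> /le_trans; apply; rewrite le_eqVlt; apply/orP; left; apply/eqP.
  apply: eq_bigr => i _; congr (_ `^ _).
  under eq_integral do rewrite lineint_consS.
  by rewrite integral_lineint_swap.
rewrite -ge0_integralZl//; last 3 first.
- by apply: emeasurable_prod => i; exact: mpow.
- by move=> x _; rewrite prode_ge0// => i _; rewrite poweR_ge0.
- by rewrite poweR_ge0.
by apply: eq_integral => x _; rewrite big_ord_recl/= lineint_cons0.
Qed.

End tuple_tonelli.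

(** * Borel sets, boxes and transfer of integrals between row vectors and tuples *)

Section leb_basics.
Context {R : realType} {N : nat}.
Notation mR := (measurableTypeR R).
Notation cT := (caratheodory_type (@lebesgue_outer R N)).

(** An open set is a countable union of boxes with rational centres and radii 1 / (m + 1), and boxes
    are measurable because the coordinates are. A radius below e / 2 keeps a box that contains x
    inside the ball of radius e around x. *)
Lemma measurable_preimage_open_rV (U : set 'rV[R]_N) :
  open U -> measurable (@rV_of_tuple R N @^-1` U).
Proof.
move=> oU.
pose box (z : 'rV[rat]_N * nat) :=
  [set x : 'rV[R]_N | forall i, `|ratr (z.1 ord0 i) - x ord0 i| < z.2.+1%:R^-1].
pose F z := if `[< box z `<=` U >] then box z else set0.
have -> : U = \bigcup_z F z.
  apply/seteqP; split=> [x Ux|x [z _]]; last by rewrite /F; case: asboolP => // zU /zU.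
  have /nbhs_ballP[e /= e0 xeU] : nbhs x U by exact: open_nbhs_nbhs.
  have [m] : exists m : nat, m.+1%:R^-1 < e / 2.
    exists (Num.trunc ((e / 2)^-1)).
    by rewrite invf_plt ?posrE ?divr_gt0//; exact: truncnS_gt.
  move=> me.
  have rx i : exists q : rat, `|ratr q - x ord0 i| < m.+1%:R^-1.
    have : x ord0 i - m.+1%:R^-1 < x ord0 i + m.+1%:R^-1.
      by rewrite ltrBlDr -addrA ltrDl addr_gt0// invr_gt0.
    move=> /rat_in_itvoo[q]; rewrite in_itv/= => /andP[q1 q2]; exists q.
    by rewrite ltr_distlC ltrBlDr; apply/andP; split; rewrite // -ltrBlDr.
  pose z := (\row_i projT1 (cid (rx i)), m) : 'rV[rat]_N * nat.
  have bz : box z x by move=> i; rewrite mxE; exact: projT2 (cid (rx i)).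
  exists z => //; rewrite /F asboolT// => y By; apply: xeU.
  split=> // j i; rewrite ord1 /ball/=.
  rewrite (le_lt_trans (ler_distD (ratr (z.1 ord0 i)) _ _))// (splitr e) distrC.
  by apply: ltrD; [exact: lt_trans (bz i) me|exact: lt_trans (By i) me].
rewrite preimage_bigcup; apply: countable_bigcupT_measurable => [|z].
  exact: countableP.
rewrite /F; case: asboolP => _; last by rewrite preimage_set0.
have -> : @rV_of_tuple R N @^-1` box z = \bigcap_(i in [set: 'I_N])
    ((@tnth _ mR ^~ i) @^-1` ball (ratr (z.1 ord0 i) : mR) z.2.+1%:R^-1).
  apply/seteqP; split=> t /= H i; first by move=> _; have := H i; rewrite mxE.
  by have := H i I; rewrite /rV_of_tuple mxE.
apply: fin_bigcap_measurable => [|i _]; first exact: finite_finset.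
rewrite -[X in measurable X]setTI; apply: measurable_tnth => //.
exact: measurable_ball.
Qed.

Lemma measurable_open_rV (U : set cT) : open (U : set 'rV[R]_N) -> measurable U.
Proof. by move=> oU; apply: leb_measurable; exact: measurable_preimage_open_rV. Qed.

Lemma measurable_closed_rV (U : set cT) : closed (U : set 'rV[R]_N) -> measurable U.
Proof.
move=> cU; rewrite -[U]setCK; apply: measurableC; apply: measurable_open_rV.
exact: closed_openC.
Qed.

Lemma continuous_measurable_tuple (f : 'rV[R]_N -> R) : continuous f ->
  measurable_fun [set: N.-tuple mR] (f \o @rV_of_tuple R N).
Proof.
move=> cf; apply: (measurability _ (RGenOpens.measurableE R)).
move=> _ [_ [a [b ->] <-]].
rewrite setTI comp_preimage; apply: measurable_preimage_open_rV.
by move/continuousP : cf; apply; exact: interval_open.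
Qed.

Lemma continuous_open_measurable (D : set cT) (f : 'rV[R]_N -> R) :
  open (D : set 'rV[R]_N) -> {in (D : set 'rV[R]_N), continuous f} ->
  measurable_fun D (f : cT -> mR).
Proof.
move=> oD cf; apply: (measurability _ (RGenOpens.measurableE R)).
move=> _ [_ [a [b ->] <-]]; apply: measurable_open_rV.
rewrite openE => x [Dx fx]; apply: filterI; first exact: open_nbhs_nbhs.
apply: (cf x); first exact/mem_set.
by apply: open_nbhs_nbhs; split => //; exact: interval_open.
Qed.

Lemma continuous_leb_measurable (D : set cT) (f : 'rV[R]_N -> R) :
  measurable D -> continuous f -> measurable_fun D (f : cT -> mR).
Proof.
move=> mD cf; apply: (@measurable_funS _ _ _ _ setT) => //.
by apply: continuous_open_measurable => [|x _]; [exact: openT|exact: cf].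
Qed.

Let tuple_of_rV (v : cT) : N.-tuple mR := [tuple (v : 'rV[R]_N) ord0 i | i < N].

Let rV_of_tupleK : cancel (@rV_of_tuple R N) tuple_of_rV.
Proof. by move=> t; apply: eq_from_tnth => i; rewrite tnth_mktuple mxE. Qed.

Let tuple_of_rVK : cancel tuple_of_rV (@rV_of_tuple R N).
Proof. by move=> v; apply/rowP => i; rewrite mxE tnth_mktuple. Qed.

Let measurable_tuple_of_rV : measurable_fun [set: cT] tuple_of_rV.
Proof.
move=> _ B mB; rewrite setTI; apply: leb_measurable.
rewrite -comp_preimage (_ : _ \o _ = id)//.
by apply/funext => t /=; rewrite rV_of_tupleK.
Qed.

(** Measurability is asked on tuples, where the measure lives on Borel sets, whereas [leb] is
    completed. Continuous functions satisfy it, and integrals are sliced for these only. *)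
Lemma integral_leb_tuple (f : 'rV[R]_N -> \bar R) :
  measurable_fun [set: N.-tuple mR] (f \o @rV_of_tuple R N) ->
  (forall x, 0 <= f x)%E ->
  (\int[leb]_x f x = \int[tuple_lebesgue N]_t f (rV_of_tuple t))%E.
Proof.
move=> mf f0.
have := @ge0_integral_pushforward _ _ _ _ R _ measurable_tuple_of_rV
  (leb : {measure set cT -> \bar R}) setT (f \o @rV_of_tuple R N) measurableT mf.
rewrite preimage_setT => H.
transitivity (\int[leb]_(x in [set: cT]) ((f \o @rV_of_tuple R N) \o tuple_of_rV) x)%E.
  by apply: eq_integral => x _ /=; rewrite tuple_of_rVK.
rewrite -H; last by move=> t _; exact: f0.
apply: eq_measure_integral => A mA _.
have AE : @rV_of_tuple R N @^-1` (tuple_of_rV @^-1` A) = A.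
  by apply/funext => t; rewrite /preimage /mkset rV_of_tupleK.
rewrite -[RHS](congr1 _ AE); apply: lebE.
by rewrite AE.
Qed.

(** Centres are indexed by [nat] so that the induction can shift them. Boxes inside and outside a
    set give the positive measure of open sets and the finite measure of bounded ones. *)
Lemma tuple_lebesgue_box n (c : nat -> R) (M : R) : 0 < M ->
  let B := [set t : n.-tuple mR | forall i, `|tnth t i - c i| < M] in
  measurable B /\ (0 < tuple_lebesgue n B < +oo)%E.
Proof.
move=> M0; elim: n c => [|n IH] c B.
  rewrite (_ : B = setT); last by apply/seteqP; split=> // t _ [].
  by rewrite /= diracT ltry lte01.
have [mB /andP[B0 Boo]] := IH (fun i => c i.+1).
have BE : @tcons R n @^-1` B = ball (c 0%N : mR) M `*`
    [set t : n.-tuple mR | forall i, `|tnth t i - c i.+1| < M].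
  apply/seteqP; split=> [[x t] /= H|[x t] /= [xM tM] i]; first split=> /=.
  - by have := H ord0; rewrite tnth0 /ball/= distrC.
  - by move=> i; have := H (lift ord0 i); rewrite tnthS.
  - case: (unliftP ord0 i) => [j|] ->; rewrite ?tnthS ?tnth0/=.
      by have := tM j.
    by move: xM; rewrite /ball/= distrC.
split; last first.
  rewrite /= /cons_measure /pushforward BE product_measure1E//; last exact: measurable_ball.
  have bE : lebesgue_measure (ball (c 0%N : mR) M) = (M *+ 2)%:E.
    exact: lebesgue_measure_ball (ltW M0).
  apply/andP; split; last by apply: lte_mul_pinfty => //; rewrite [X in X \is a fin_num]bE.
  apply: mule_gt0 => //.
  by rewrite [X in (0 < X)%E]bE lte_fin mulrn_wgt0.
have -> : B = @tuncons R n @^-1` (@tcons R n @^-1` B).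
  by apply/funext => t; rewrite /preimage /mkset tunconsK.
rewrite -[X in measurable X]setTI BE; apply: measurable_tuncons => //.
by apply: measurableX => //; exact: measurable_ball.
Qed.

Let rV_box (c : 'rV[R]_N) (M : R) := [set x : 'rV[R]_N | forall i, `|x ord0 i - c ord0 i| < M].

Let leb_box c M : 0 < M -> (0 < leb (rV_box c M) < +oo)%E.
Proof.
move=> M0; pose c' k := if insub k is Some i then c ord0 i else 0.
have [mB Boo] := tuple_lebesgue_box N c' M0.
have BE : @rV_of_tuple R N @^-1` rV_box c M =
    [set t : N.-tuple mR | forall i, `|tnth t i - c' i| < M].
  by apply/seteqP; split=> t /= H i; have := H i; rewrite /c' valK !mxE.
have B'E : lebesgue_outer (rV_box c M) = tuple_lebesgue N (@rV_of_tuple R N @^-1` rV_box c M).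
  by apply: lebE; rewrite BE.
by rewrite [X in (0 < X < _)%E]B'E BE.
Qed.

Let coord_le (x : 'rV[R]_N) i : `|x ord0 i| <= `|x|.
Proof.
have -> : `|x| = \big[Order.max/0]_ij `|x ij.1 ij.2| by exact: mx_normrE.
exact: (le_bigmax _ (fun ij : 'I_1 * 'I_N => `|x ij.1 ij.2|) (ord0, i)).
Qed.

Lemma leb_bounded_lty (A : set 'rV[R]_N) : bounded_set A -> (leb A < +oo)%E.
Proof.
move=> [M [Mr AM]]; have M0 : 0 < `|M| + 2 by rewrite ltr_wpDl.
have /andP[_ Boo] := leb_box 0 M0.
apply: le_lt_trans (le_outer_measure (@lebesgue_outer R N) A _ _) Boo.
move=> x Ax i; have := AM (`|M| + 1) _ x Ax; rewrite (le_lt_trans (ler_norm M)) ?ltrDl// => /(_ isT) xM.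
by rewrite mxE subr0 (le_lt_trans (coord_le x i))// (le_lt_trans xM)// ltrD2l ltr1n.
Qed.

Lemma leb_open_gt0 (U : set 'rV[R]_N) x : open U -> U x -> (0 < leb U)%E.
Proof.
move=> oU Ux; have /nbhs_ballP[r /= r0 rU] : nbhs x U by exact: open_nbhs_nbhs.
have /andP[B0 _] := leb_box x r0.
apply: lt_le_trans B0 (le_outer_measure (@lebesgue_outer R N) _ _ _).
move=> y yB; apply: rU; split=> // i j; rewrite /ball/= (ord1 i) distrC; exact: yB.
Qed.

End leb_basics.

(** * Slopes and the Sobolev inequality *)

Section slope.
Context {R : realType}.
Implicit Types (f g h : R -> R) (x y a b c e K : R).

(** A bound for the upper limit of the difference quotients at one point, in place of the modulus of
    the derivative there. *)
Definition slope_le f x K :=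
  forall e, 0 < e -> \forall y \near x, `|f y - f x| <= (K + e) * `|y - x|.

Lemma is_derive_near f x l : is_derive x 1 f l ->
  forall e, 0 < e -> \forall y \near x, `|f y - f x - l * (y - x)| <= e * `|y - x|.
Proof.
move=> [df fl] e e0.
have : h^-1 *: ((f \o shift x) (h *: 1) - f x) @[h --> 0^'] --> l.
  by rewrite -fl; exact: df.
move/cvgrPdist_le => /(_ e e0).
move=> /nbhs_ballP[d /= d0 xd].
apply/nbhs_ballP; exists d => //= y; rewrite /ball/= => xy.
have [->|yx] := eqVneq y x; first by rewrite !subrr mulr0 subr0 normr0 mulr0.
have := xd (y - x); rewrite /ball/= sub0r normrN distrC => /(_ xy).
rewrite subr_eq0 => /(_ yx) /=; rewrite /GRing.scale/= mulr1 subrK => H.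
have yx0 : y - x != 0 by rewrite subr_eq0.
have -> : f y - f x - l * (y - x) = - ((l - (y - x)^-1 * (f y - f x)) * (y - x)).
  by rewrite mulrBl mulrAC mulVf// mul1r opprB.
by rewrite normrN normrM (distrC x) ler_wpM2r.
Qed.

(** Let s be the supremum of the points of [a, b] where [g] is at least [g a]. The condition on the
    left of s gives [g a <= g s], the condition on the right pushes s up to b. *)
Lemma locally_increasing_le g a b : a <= b ->
  (forall x, x \in `[a, b] -> \forall y \near x, (x <= y -> g x <= g y) /\
    (y <= x -> g y <= g x)) -> g a <= g b.
Proof.
move=> ab H.
pose E := [set x | x \in `[a, b] /\ g a <= g x].
have Ea : E a by split; rewrite // in_itv/= lexx.
have supE : has_sup E.
  by split; [exists a|exists b => x []; rewrite in_itv/= => /andP[]].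
set s := sup E.
have as_ : a <= s by exact: (sup_upper_bound supE).
have sb : s <= b.
  by apply: ge_sup; [exists a|move=> x []; rewrite in_itv/= => /andP[]].
have sab : s \in `[a, b] by rewrite in_itv/= as_.
have /nbhs_ballP[d /= d0 sd] := H _ sab.
have gas : g a <= g s.
  have [x Ex sx] := sup_adherent d0 supE.
  have xs : x <= s by exact: (sup_upper_bound supE).
  have sdx : ball s d x by rewrite /ball/= ger0_norm ?subr_ge0// ltrBlDr -ltrBlDl.
  have [_ /(_ xs)] := sd x sdx.
  by apply: le_trans; case: Ex.
have [<-//|sb'] := eqVneq s b.
have {}sb' : s < b by rewrite lt_neqAle sb'.
pose y := Num.min b (s + d / 2).
have sy : s < y by rewrite /y lt_min sb' ltrDl divr_gt0.
have yb : y <= b by rewrite /y ge_min lexx.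
have [/(_ (ltW sy)) gsy _] : (s <= y -> g s <= g y) /\ (y <= s -> g y <= g s).
  apply: sd; rewrite /ball/= distrC ger0_norm ?subr_ge0 ?(ltW sy)//.
  rewrite ltrBlDl (@le_lt_trans _ _ (s + d / 2))//; first by rewrite /y ge_min lexx orbT.
  by rewrite ltrD2l ltr_pdivrMr// ltr_pMr// ltr1n.
have : y <= s.
  apply: (sup_upper_bound supE); split; last exact: le_trans gsy.
  by rewrite in_itv/= yb andbT (le_trans as_)// ltW.
by rewrite leNgt sy.
Qed.

(** A primitive of [h], tilted by e x, minus either sign of [f] is locally increasing, hence
    increasing; then e tends to 0. This acts as the fundamental theorem for a function known only
    through its slopes. *)
Lemma slope_le_integral f h a b : a <= b -> continuous h -> (forall x, 0 <= h x) ->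
  (forall x, slope_le f x (h x)) ->
  (`|f b - f a|%:E <= \int[lebesgue_measure]_x (h x)%:E)%E.
Proof.
move=> ab ch h0 slf.
(* Starting the primitive on the left of a makes it differentiable at a too. *)
pose c := a - 1; have ca : c < a by rewrite /c gtrBl.
pose F x : R := \int[lebesgue_measure]_(t in `[c, x]) h t.
have ih x y : lebesgue_measure.-integrable `[x, y] (EFin \o h).
  apply: continuous_compact_integrable; first exact: segment_compact.
  exact: continuous_subspaceT.
have dF x : c < x -> is_derive x 1 F (h x).
  move=> cx; have xx1 : x < x + 1 by rewrite ltrDl.
  have [d1 d2] := @continuous_FTC1_closed R h c x (x + 1) xx1 (ih _ _) cx (ch x).
  by split; [exact: d1|rewrite -derive1E].
have key sg : `|sg| = 1 -> forall e, 0 < e ->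
    sg * (f b - f a) <= F b - F a + e * (b - a).
  move=> sg1 e e0; pose g x := F x + e * x - sg * f x.
  suff : g a <= g b by rewrite /g mulrBr mulrBr; lra.
  apply: locally_increasing_le => // x.
  rewrite in_itv/= => /andP[ax xb].
  have e20 : 0 < e / 2 by rewrite divr_gt0.
  have := is_derive_near (dF _ (lt_le_trans ca ax)) e20.
  have := slf x _ e20.
  apply: filterS2 => y fyx Fyx.
  have sfyx : `|sg * (f y - f x)| <= (h x + e / 2) * `|y - x| by rewrite normrM sg1 mul1r.
  move: Fyx sfyx; rewrite !ler_norml mulrBr; split => xy; rewrite /g.
  - have yx0 : `|y - x| = y - x by rewrite ger0_norm// subr_ge0.
    move: Fyx sfyx; rewrite yx0; nra.
  - have yx0 : `|y - x| = x - y by rewrite distrC ger0_norm// subr_ge0.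
    move: Fyx sfyx; rewrite yx0; nra.
have {}key sg : `|sg| = 1 -> sg * (f b - f a) <= F b - F a.
  move=> sg1; apply/ler_addgt0Pr => e e0.
  have ba0 : 0 < b - a + 1 by rewrite ltr_wpDl ?subr_ge0.
  have := key sg sg1 (e / (b - a + 1)) (divr_gt0 e0 ba0).
  move=> /le_trans; apply; rewrite lerD2l mulrAC ler_pdivrMr// ler_wpM2l ?ltW//.
  by rewrite ltrDl.
have : `|f b - f a| <= F b - F a.
  rewrite ler_norml lerNl; apply/andP; split.
    by rewrite -mulN1r; apply: key; rewrite normrN1.
  by rewrite -[X in X <= _]mul1r; apply: key; rewrite normr1.
have Fa0 : 0 <= F a by apply: Rintegral_ge0.
move=> H; have {H Fa0} : `|f b - f a| <= F b by lra.
rewrite -lee_fin => /le_trans; apply.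
rewrite /F /Rintegral fineK; last by have /integrable_fin_num := ih c b; apply.
apply: ge0_subset_integral => //.
  apply/measurable_EFinP; apply: continuous_measurable_fun.
  exact: ch.
by move=> x _; rewrite lee_fin.
Qed.

End slope.

Lemma gagliardo_gt1 (R : realType) n (w h : n.-tuple (measurableTypeR R) -> \bar R) :
  (1 < n)%N -> measurable_fun setT w -> (forall t, 0 <= w t)%E ->
  measurable_fun setT h -> (forall t, 0 <= h t)%E ->
  (forall i t, (i < n)%N -> w t <= lineint i h t)%E ->
  (\int[tuple_lebesgue n]_t w t `^ (n%:R / (n%:R - 1)) <=
  (\int[tuple_lebesgue n]_t h t) `^ (n%:R / (n%:R - 1)))%E.
Proof.
case: n w h => [|[|m]] w h // _ mw w0 mh h0 wh.
have -> : m.+2%:R - 1 = m.+1%:R :> R by rewrite -(natrB _ (isT : (1 <= m.+2)%N)) subn1.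
exact: gagliardo.
Qed.

Section sobolev.
Context {R : realType} {N : nat}.
Notation mR := (measurableTypeR R).
Notation cT := (caratheodory_type (@lebesgue_outer R N)).
Notation leb1 := (@lebesgue_measure R).
Implicit Types (f g h w phi psi : 'rV[R]_N -> R) (x : 'rV[R]_N) (i : 'I_N).

Definition dslope_le w x i (K : R) := forall e, 0 < e ->
  \forall s \near (0 : R), `|w (x + s *: delta_mx ord0 i) - w x| <= (K + e) * `|s|.

Lemma rV_tset (t : N.-tuple mR) i (s r : R) :
  rV_of_tuple (tset t i s) = rV_of_tuple (tset t i r) + (s - r) *: delta_mx ord0 i.
Proof.
apply/rowP => j; rewrite !mxE !tnth_mktuple eqxx/=.
have [->|ji] := eqVneq j i; first by rewrite eqxx mulr1 addrC subrK.
by rewrite -(inj_eq val_inj)/= in ji; rewrite (negbTE ji) mulr0 addr0.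
Qed.

Lemma tset_id (t : N.-tuple mR) i : tset t i (tnth t i) = t.
Proof.
apply: eq_from_tnth => j; rewrite tnth_mktuple.
by case: eqP => // /val_inj ->.
Qed.

Lemma continuous_tset (t : N.-tuple mR) i f : continuous f ->
  continuous (fun s : R => f (rV_of_tuple (tset t i s))).
Proof.
move=> cf s; apply: (@continuous_comp _ _ _ (fun s : R => rV_of_tuple (tset t i s))); last exact: cf.
have -> : (fun s : R => @rV_of_tuple R N (tset t i s)) =
    (fun s : R => rV_of_tuple (tset t i 0) + s *: delta_mx ord0 i).
  by apply/funext => r; rewrite (rV_tset _ _ r 0) subr0.
apply: continuousD; first exact: cst_continuous.
exact: scalel_continuous.
Qed.

Lemma integral_lebT_open (Omega : set 'rV[R]_N) (f : 'rV[R]_N -> \bar R) :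
  (forall x, ~ Omega x -> f x = 0%E) ->
  (\int[leb]_x f x = \int[leb]_(x in Omega) f x)%E.
Proof.
move=> f0; rewrite [RHS]integral_mkcond; apply: eq_integral => x _.
by rewrite /patch; case: ifPn => // /negP; rewrite inE => /f0.
Qed.

Section domain.
Variable Omega : set 'rV[R]_N.
Hypotheses (oOmega : open Omega) (bOmega : bounded_set Omega).

Lemma bounded_domain_coord : exists M : R, forall x i, M < `|x ord0 i| -> ~ Omega x.
Proof.
have [M [_ HM]] := bOmega; exists (M + 1) => x i Mx Ox.
have := HM (M + 1) _ _ Ox; rewrite ltrDl => /(_ ltr01) xM.
suff : `|x ord0 i| <= M + 1 by rewrite leNgt Mx.
apply: le_trans xM.
have -> : `|x| = \big[Order.max/0]_ij `|x ij.1 ij.2| by exact: mx_normrE.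
exact: (le_bigmax _ (fun ij : 'I_1 * 'I_N => `|x ij.1 ij.2|) (ord0, i)).
Qed.

Lemma measurable_domain : measurable (Omega : set cT).
Proof. exact: measurable_open_rV. Qed.

Lemma leb_domain_lty : (leb Omega < +oo)%E.
Proof. exact: leb_bounded_lty. Qed.

Lemma compact_closure_domain : compact (closure Omega).
Proof.
apply: bounded_closed_compact; last exact: closed_closure.
have [M [Mr HM]] := bOmega; exists (M + 1); split; first by rewrite realD.
move=> y My x /=.
have cB : closed [set z : 'rV[R]_N | `|z| <= M + 1].
  rewrite (_ : mkset _ = Num.norm @^-1` [set r | r <= M + 1])//.
  by apply: closed_comp; [move=> ? _; exact: norm_continuous|exact: closed_le].
have sub : Omega `<=` [set z : 'rV[R]_N | `|z| <= M + 1].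
  by move=> z Oz; apply: HM => //; rewrite ltrDl.
by move=> /(closureS sub); rewrite -(closure_id _).1// => xM; exact: le_trans xM (ltW My).
Qed.

Lemma continuous_bounded_domain f : {within closure Omega, continuous f} ->
  exists2 C : R, 0 < C & forall x, closure Omega x -> `|f x| <= C.
Proof.
move=> cf.
have /compact_bounded[M [_ HM]] := continuous_compact cf compact_closure_domain.
exists (Num.max 1 (M + 1)); first by rewrite lt_max ltr01.
move=> x Ox; apply: (HM (Num.max 1 (M + 1))); last by exists x.
by rewrite lt_max [X in _ || X]ltrDl ltr01 orbT.
Qed.

Lemma integrable_bounded_domain f (C : R) :
  measurable_fun (Omega : set cT) (f : cT -> mR) ->
  (forall x, Omega x -> `|f x| <= C) ->
  (leb : {measure set cT -> \bar R}).-integrable Omega (EFin \o f).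
Proof.
move=> mf fC; apply: measurable_bounded_integrable => //.
- exact: measurable_domain.
- exact: leb_domain_lty.
exists C; split; first exact: num_real.
by move=> y Cy x /fC fxC; exact: le_trans fxC (ltW Cy).
Qed.

Lemma integrable_continuous_domain f : continuous f ->
  (leb : {measure set cT -> \bar R}).-integrable Omega (EFin \o f).
Proof.
move=> cf; have [C C0 fC] : exists2 C : R, 0 < C & forall x, closure Omega x -> `|f x| <= C.
  by apply: continuous_bounded_domain; exact: continuous_subspaceT.
apply: (@integrable_bounded_domain f C).
  by apply: continuous_leb_measurable => //; exact: measurable_domain.
by move=> x Ox; apply: fC; exact: subset_closure.
Qed.

(* Gagliardo-Nirenberg-Sobolev for p = 1; slopes replace the gradient because the
   composition with a variable-exponent phase need not be differentiable. *)
Lemma sobolev_slope w h : (1 < N)%N ->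
  continuous w -> (forall x, 0 <= w x) -> continuous h -> (forall x, 0 <= h x) ->
  (forall x, ~ Omega x -> w x = 0) -> (forall x, ~ Omega x -> h x = 0) ->
  (forall x i, dslope_le w x i (h x)) ->
  (\int[leb]_(x in Omega) (w x `^ (N%:R / (N%:R - 1)))%:E <=
   (\int[leb]_(x in Omega) (h x)%:E) `^ (N%:R / (N%:R - 1)))%E.
Proof.
move=> N1 cw w0 ch h0 wO hO slw.
have [M OM] := bounded_domain_coord.
have r0 : N%:R / (N%:R - 1) != 0 :> R.
  rewrite mulf_neq0// ?invr_eq0 ?subr_eq0 ?pnatr_eq0 -?lt0n ?(ltnW N1)//.
  by rewrite (eqr_nat _ _ 1) gtn_eqF.
set r := (_ / _) in r0 *.
rewrite -(@integral_lebT_open Omega (fun x => (w x `^ r)%:E)); last first.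
  by move=> x /wO ->; rewrite powR0.
rewrite -(@integral_lebT_open Omega (fun x => (h x)%:E)); last by move=> x /hO ->.
pose W := EFin \o w \o @rV_of_tuple R N; pose H := EFin \o h \o @rV_of_tuple R N.
have mW : measurable_fun [set: N.-tuple mR] W.
  by apply/measurable_EFinP; exact: continuous_measurable_tuple.
have mH : measurable_fun [set: N.-tuple mR] H.
  by apply/measurable_EFinP; exact: continuous_measurable_tuple.
rewrite integral_leb_tuple; last 2 first.
- apply: (@measurableT_comp _ _ _ _ _ _ (fun y => (y `^ r)%E) _ W) => //.
  exact: measurable_poweR.
- by move=> x; rewrite lee_fin powR_ge0.
rewrite integral_leb_tuple; [|exact: mH|by move=> x; rewrite lee_fin].
have WH (i : nat) t : (i < N)%N -> (W t <= lineint i H t)%E.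
  move=> iN; pose j := Ordinal iN.
  pose F (s : R) := w (rV_of_tuple (tset t j s)).
  pose G (s : R) := h (rV_of_tuple (tset t j s)).
  pose b : R := tnth t j.
  (* A point of the line on the left of b and outside Omega, where [w] vanishes; the increment of
     [w] from there is its full value. *)
  pose a : R := Num.min b (- `|M| - 1).
  have ab : a <= b by rewrite /a ge_min lexx.
  have Fa : F a = 0.
    apply/wO/(OM _ j); rewrite mxE tnth_mktuple eqxx.
    rewrite (le_lt_trans (ler_norm M))//.
    have aM : a <= - `|M| - 1 by rewrite /a ge_min lexx orbT.
    have Mn := normr_ge0 M; have a0 : a <= 0 by lra.
    by rewrite (ler0_norm a0) ltrNr (le_lt_trans aM)// ltrBlDr ltrDl.
  have := @slope_le_integral R F G a b ab (@continuous_tset t j h ch) (fun s => h0 _).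
  rewrite Fa subr0 ger0_norm; last exact: w0.
  rewrite /F /b tset_id; apply.
  move=> s e e0; have := slw (rV_of_tuple (tset t j s)) j e e0.
  move=> /nbhs_ballP[d /= d0 H0d]; apply/nbhs_ballP; exists d => //= y sy.
  rewrite (rV_tset t j y s); apply: H0d.
  by move: sy; rewrite /ball/= sub0r normrN distrC.
have W0 t : (0 <= W t)%E by rewrite lee_fin.
have H0 t : (0 <= H t)%E by rewrite lee_fin.
have := @gagliardo_gt1 R N W H N1 mW W0 mH H0 WH.
by rewrite -/r /W /H.
Qed.

(** Vanishing near each outside point makes the derivatives vanish outside as well and is stable
    under products, which is what integration by parts and the Sobolev inequality use. *)
Definition C1_0 phi := [/\ continuous phi,
  forall x i, derivable phi x (delta_mx ord0 i),
  forall i, continuous (partial i phi) &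
  forall x, ~ Omega x -> \forall y \near x, phi y = 0].

Lemma C1_0_out phi x : C1_0 phi -> ~ Omega x -> phi x = 0 /\ forall i, partial i phi x = 0.
Proof.
move=> [_ _ _ H] /H phi0; split; first exact: nbhs_singleton phi0.
move=> i; rewrite /partial.
by rewrite (@near_eq_derive _ _ _ phi (cst 0)) ?derive_cst//.
Qed.

Lemma test_function_C1_0 phi : test_function Omega phi -> C1_0 phi.
Proof.
move=> [sphi _ sO]; split.
- by have [] := sphi [::].
- by have [_ +] := sphi [::].
- by move=> i; have [] := sphi [:: i].
move=> x Ox.
have Sx : ~ closure [set x | phi x != 0] x by move=> /sO.
have : open (~` closure [set x | phi x != 0]).
  by apply: closed_openC; exact: closed_closure.
rewrite openE => /(_ x Sx); apply: filterS => y Sy; apply: contrapT => /eqP py.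
by apply: Sy; exact: subset_closure.
Qed.

Lemma C1_0_M phi psi : C1_0 phi -> C1_0 psi -> C1_0 (fun x => phi x * psi x).
Proof.
move=> [cphi dphi cdphi phi0] [cpsi dpsi cdpsi psi0].
have dE i : partial i (fun x => phi x * psi x) =
    (fun x => phi x * partial i psi x + psi x * partial i phi x).
  by apply/funext => x; rewrite /partial deriveM.
split.
- by move=> x; apply: continuousM; [exact: cphi|exact: cpsi].
- by move=> x i; exact: derivableM.
- move=> i; rewrite dE => x.
  have c1 : {for x, continuous (fun x => phi x * partial i psi x)}.
    by apply: continuousM; [exact: cphi|exact: cdpsi].
  have c2 : {for x, continuous (fun x => psi x * partial i phi x)}.
    by apply: continuousM; [exact: cpsi|exact: cdphi].
  exact: (cvgD c1 c2).
move=> x /phi0; apply: filterS => y ->; exact: mul0r.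
Qed.

Lemma is_derive_tset phi (t : N.-tuple mR) i (s : R) :
  (forall x i, derivable phi x (delta_mx ord0 i)) ->
  is_derive s 1 (fun s : R => phi (rV_of_tuple (tset t i s)))
    (partial i phi (rV_of_tuple (tset t i s))).
Proof.
move=> dphi; have := dphi (rV_of_tuple (tset t i s)) i.
rewrite /partial /derivable /derive => d.
have E : (fun h : R => h^-1 *: (((fun s : R => phi (rV_of_tuple (tset t i s))) \o shift s)
      (h *: 1) - phi (rV_of_tuple (tset t i s)))) =
    (fun h : R => h^-1 *: ((phi \o shift (rV_of_tuple (tset t i s)))
      (h *: delta_mx ord0 i) - phi (rV_of_tuple (tset t i s)))).
  apply/funext => h /=; congr (_ *: (phi _ - _)).
  by rewrite (rV_tset t i (h *: 1 + s) s) addrK addrC /GRing.scale/= mulr1.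
split; first by rewrite /derivable E.
by rewrite /derive E.
Qed.

(** The fundamental theorem on an interval beyond which both functions vanish, phrased with positive
    and negative parts because [eq_lineint_integral] compares nonnegative functions. *)
Lemma integral_line_derive (F G : R -> R) (M : R) :
  (forall s : R, is_derive s 1 F (G s)) -> continuous G ->
  (forall s : R, M < `|s| -> F s = 0 /\ G s = 0) ->
  (\int[leb1]_s (Num.max (G s) 0)%:E = \int[leb1]_s (Num.max (- G s) 0)%:E)%E.
Proof.
move=> dF cG FG0.
pose K : R := `|M| + 1.
pose I := `[- K, K]%classic.
have K0 : 0 < K by rewrite ltr_wpDl.
have MK : M < K by rewrite (le_lt_trans (ler_norm M))// ltrDl.
have GE (f : R -> R) : (forall s, G s = 0 -> f s = 0) ->
    (\int[leb1]_s (f s)%:E = \int[leb1]_(s in I) (f s)%:E)%E.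
  move=> f0; rewrite [RHS]integral_mkcond; apply: eq_integral => s _.
  rewrite /patch; case: ifPn => //; rewrite notin_setE /I/= in_itv/= => /negP sK.
  rewrite f0//; apply: (FG0 s _).2; apply: (lt_le_trans MK).
  by rewrite leNgt ltr_norml; apply/negP => /andP[s1 s2]; apply: (negP sK); rewrite (ltW s1) (ltW s2).
have iG : leb1.-integrable `[- K, K] (EFin \o G).
  by apply: continuous_compact_integrable; [exact: segment_compact|exact: continuous_subspaceT].
have : (\int[leb1]_(s in I) (G s)%:E = 0)%E.
  rewrite (@continuous_FTC2 R G F (- K) K).
  - have [|F1 _] := FG0 K; first by rewrite gtr0_norm.
    have [|F2 _] := FG0 (- K); first by rewrite normrN gtr0_norm.
    by rewrite F1 F2 sube0.
  - by rewrite (lt_trans _ K0)// oppr_lt0.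
  - exact: continuous_subspaceT.
  - have cF : continuous F.
      move=> s; apply: differentiable_continuous; apply/derivable1_diffP.
      by have [] := dF s.
    split.
    + by move=> s _; have [] := dF s.
    + by apply: cvg_at_right_filter; exact: cF.
    + by apply: cvg_at_left_filter; exact: cF.
  - by move=> s _; rewrite derive1E; have [] := dF s.
rewrite integralE (GE (fun s => Num.max (G s) 0)); last by move=> s ->; rewrite maxxx.
rewrite (GE (fun s => Num.max (- G s) 0)); last by move=> s ->; rewrite oppr0 maxxx.
have -> : (\int[leb1]_(s in I) (EFin \o G)^\+ s =
    \int[leb1]_(s in I) (Num.max (G s) 0)%:E)%E.
  by apply: eq_integral => s _; rewrite funeposE ?/P EFin_max.
have -> : (\int[leb1]_(s in I) (EFin \o G)^\- s =
    \int[leb1]_(s in I) (Num.max (- G s) 0)%:E)%E.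
  by apply: eq_integral => s _; rewrite funenegE ?/Q EFin_max.
have fin : (\int[leb1]_(s in I) (Num.max (- G s) 0)%:E)%E \is a fin_num.
  have : leb1.-integrable I (EFin \o (fun s => Num.max (- G s) 0)); last first.
    by move=> iI; apply: (integrable_fin_num _ iI); exact: measurable_itv.
  apply: continuous_compact_integrable; first exact: segment_compact.
  apply: continuous_subspaceT.
  have cmG : continuous (fun s : R => Num.max (- G s) 0).
    have c1 : continuous (fun s : R => - G s).
      by move=> s; apply: continuousN; exact: cG.
    have c2 : continuous (cst (0 : R) : R -> R) by move=> s; exact: cst_continuous.
    move=> s; exact: (continuous_max (c1 s) (c2 s)).
  exact: cmG.
by move=> E0; rewrite -[LHS](subeK _ fin) E0 add0e.
Qed.

Lemma integral_partial0 f i : C1_0 f -> (\int[leb]_(x in Omega) (partial i f x)%:E = 0)%E.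
Proof.
move=> Cf; have [cf df cdf _] := Cf.
have f0 x := @C1_0_out f x Cf.
have [M OM] := bounded_domain_coord.
rewrite integralE.
pose P x := (Num.max (partial i f x) 0)%:E; pose Q x := (Num.max (- partial i f x) 0)%:E.
have cP : continuous (fun x => Num.max (partial i f x) 0).
  by move=> x; apply: continuous_max; [exact: cdf|exact: cst_continuous].
have cQ : continuous (fun x => Num.max (- partial i f x) 0).
  by move=> x; apply: (@continuous_max _ _ (fun x => - partial i f x)); [apply: (@continuousN _ _ _ (partial i f)); exact: cdf|exact: cst_continuous].
have P0 x : (0 <= P x)%E by rewrite lee_fin le_max lexx orbT.
have Q0 x : (0 <= Q x)%E by rewrite lee_fin le_max lexx orbT.
have -> : (\int[leb]_(x in Omega) (fun x => (partial i f x)%:E)^\+ x = \int[leb]_(x in Omega) P x)%E.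
  by apply: eq_integral => s _; rewrite funeposE ?/P EFin_max.
have -> : (\int[leb]_(x in Omega) (fun x => (partial i f x)%:E)^\- x = \int[leb]_(x in Omega) Q x)%E.
  by apply: eq_integral => s _; rewrite funenegE ?/Q EFin_max.
have PQ : (\int[leb]_(x in Omega) P x = \int[leb]_(x in Omega) Q x)%E.
  rewrite -(@integral_lebT_open Omega P); last first.
    by move=> x /f0[_ /(_ i)]; rewrite /P => ->; rewrite maxxx.
  rewrite -(@integral_lebT_open Omega Q); last first.
    by move=> x /f0[_ /(_ i)]; rewrite /Q => ->; rewrite oppr0 maxxx.
  have mP : measurable_fun [set: N.-tuple mR] (P \o @rV_of_tuple R N).
    by apply/measurable_EFinP; exact: continuous_measurable_tuple cP.
  have mQ : measurable_fun [set: N.-tuple mR] (Q \o @rV_of_tuple R N).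
    by apply/measurable_EFinP; exact: continuous_measurable_tuple cQ.
  rewrite (integral_leb_tuple mP P0) (integral_leb_tuple mQ Q0).
  apply: (@eq_lineint_integral R N i) => //= t.
  apply: (@integral_line_derive (fun s : R => f (rV_of_tuple (tset t i s)))
    (fun s : R => partial i f (rV_of_tuple (tset t i s))) M).
  - by move=> s; exact: is_derive_tset.
  - by apply: continuous_tset; exact: cdf.
  move=> s Ms; have [|-> ->//] := f0 (rV_of_tuple (tset t i s)).
  by apply: (OM _ i); rewrite mxE tnth_mktuple eqxx.
rewrite PQ subee//.
exact: (integrable_fin_num measurable_domain (integrable_continuous_domain cQ)).
Qed.

Lemma integration_by_parts_rV phi psi i : C1_0 phi -> C1_0 psi ->
  (\int[leb]_(x in Omega) (phi x * partial i psi x)%:E =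
   - \int[leb]_(x in Omega) (partial i phi x * psi x)%:E)%E.
Proof.
move=> Cphi Cpsi.
have [cphi dphi cdphi phi0] := Cphi; have [cpsi dpsi cdpsi psi0] := Cpsi.
have := integral_partial0 i (C1_0_M Cphi Cpsi).
have -> : partial i (fun x => phi x * psi x) =
    (fun x => phi x * partial i psi x + partial i phi x * psi x).
  by apply/funext => x; rewrite /partial deriveM// /GRing.scale/= (mulrC (psi x)).
have i1 : (leb : {measure set cT -> \bar R}).-integrable Omega
    (EFin \o (fun x => phi x * partial i psi x)).
  by apply: integrable_continuous_domain => x; apply: continuousM; [exact: cphi|exact: cdpsi].
have i2 : (leb : {measure set cT -> \bar R}).-integrable Omega
    (EFin \o (fun x => partial i phi x * psi x)).
  by apply: integrable_continuous_domain => x; apply: continuousM; [exact: cdphi|exact: cpsi].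
under eq_integral do rewrite EFinD.
rewrite integralD//; last exact: measurable_domain.
have I2 : (\int[leb]_(x in Omega) (partial i phi x * psi x)%:E)%E \is a fin_num.
  exact: (integrable_fin_num measurable_domain i2).
by move=> I12; rewrite -[LHS](addeK _ I2) I12 sub0e.
Qed.

End domain.
End sobolev.

(** * Pointwise inequalities for the logarithmic phases *)

Section ell.
Context {R : realType}.
Implicit Types (t s x y : R).

Definition ell (delta eta t : R) : R := ln (delta + eta * t).

Section ell_theory.
Variables (delta eta : R).
Hypotheses (hdelta : 1 <= delta) (heta : 0 <= eta) (hde : 1 < delta + eta).
Local Notation l := (ell delta eta).

Lemma ell_arg_ge1 t : 0 <= t -> 1 <= delta + eta * t.
Proof. by move=> t0; rewrite (le_trans hdelta)// lerDl mulr_ge0. Qed.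

Lemma ell_ge0 t : 0 <= t -> 0 <= l t.
Proof. by move=> t0; rewrite ln_ge0// ell_arg_ge1. Qed.

Lemma ell_homo s t : 0 <= s -> s <= t -> l s <= l t.
Proof.
move=> s0 st; have t0 := le_trans s0 st.
rewrite ler_ln ?posrE; last 2 first.
- by rewrite (lt_le_trans ltr01)// ell_arg_ge1.
- by rewrite (lt_le_trans ltr01)// ell_arg_ge1.
by rewrite lerD2l ler_wpM2l.
Qed.

Lemma ell_gt0 t : 0 < t -> 0 < l t.
Proof.
move=> t0; rewrite ln_gt0//.
have [d1|d1] := eqVneq delta 1; last first.
  by rewrite ltr_wpDr ?mulr_ge0 ?(ltW t0)// lt_neqAle eq_sym d1.
have eta0 : 0 < eta by have := hde; rewrite d1 ltrDl.
by rewrite d1 ltrDl mulr_gt0.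
Qed.

(** Since [delta >= 1], the argument [delta + 2 * eta * t] is at most the square of
    [delta + eta * t]. *)
Lemma ell_double t : 0 <= t -> l (2 * t) <= 2 * l t.
Proof.
move=> t0; rewrite /ell [leRHS]mulr_natl -lnXn; last by rewrite (lt_le_trans ltr01)// ell_arg_ge1.
have et0 : 0 <= eta * t by rewrite mulr_ge0.
rewrite ler_ln ?posrE; last 2 first.
- by rewrite (lt_le_trans ltr01)// ell_arg_ge1// mulr_ge0.
- by rewrite exprn_gt0// (lt_le_trans ltr01)// ell_arg_ge1.
have -> : eta * (2 * t) = 2 * (eta * t) by ring.
have d1 := hdelta; have et0' := et0; rewrite expr2; nra.
Qed.

Lemma ln_le_powR k t : 0 < k -> 0 < t -> ln t <= k^-1 * t `^ k.
Proof.
move=> k0 t0; rewrite mulrC ler_pdivlMr// mulrC -ln_powR.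
by apply/ltW/ln_sublinear; rewrite powR_gt0.
Qed.

Lemma ell_le_powR k : 0 < k -> exists2 C, 0 < C & forall t, 1 <= t -> l t <= C * t `^ k.
Proof.
move=> k0; exists (ln (delta + eta) + k^-1).
  by rewrite addr_gt0 ?ln_gt0 ?invr_gt0.
move=> t t1; have t0 := lt_le_trans ltr01 t1.
have de0 : 0 < delta + eta := lt_trans ltr01 hde.
have : l t <= ln ((delta + eta) * t).
  rewrite ler_ln ?posrE ?mulr_gt0//.
    by rewrite mulrDl lerD2r ler_peMr// (le_trans ler01).
  by rewrite (lt_le_trans ltr01)// ell_arg_ge1// ltW.
move=> /le_trans; apply; rewrite lnM ?posrE// mulrDl lerD//.
  have tk : 1 <= t `^ k by rewrite -(powRr0 t) ler_powR// (ltW k0).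
  by rewrite ler_peMr ?ln_ge0 ?(ltW hde).
exact: ln_le_powR.
Qed.

Lemma is_derive_ell t : 0 <= t -> is_derive t 1 l (eta / (delta + eta * t)).
Proof.
move=> t0; have d0 : 0 < delta + eta * t by rewrite (lt_le_trans ltr01)// ell_arg_ge1.
have h1 : is_derive t 1 (fun t : R => delta + eta * t) eta.
  by apply: is_derive_eq; rewrite /GRing.scale/=; ring.
have := @is_derive1_comp R (@ln R) (fun t : R => delta + eta * t) t _ _ (is_derive1_ln d0) h1.
by rewrite mulrC.
Qed.

(** This makes the logarithm count for at most one extra power of t in the logarithmic derivative of
    a phase. *)
Lemma ell_derive_le t : 0 < t -> t * (eta / (delta + eta * t)) <= l t.
Proof.
move=> t0; have et0 : 0 <= eta * t by rewrite mulr_ge0// ltW.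
have d1 := ell_arg_ge1 (ltW t0).
have d0 := lt_le_trans ltr01 d1.
(* [ln y >= 1 - 1/y] *)
have : 1 - (delta + eta * t)^-1 <= l t.
  have := @le_ln1Dx R ((delta + eta * t)^-1 - 1).
  rewrite ltrBrDl subrr invr_gt0 d0 addrC subrK lnV ?posrE// => /(_ isT).
  by rewrite /ell; lra.
apply: le_trans.
have -> : t * (eta / (delta + eta * t)) = 1 - delta / (delta + eta * t).
  by field; rewrite gt_eqF.
by rewrite lerD2l lerN2 ler_peMl// invr_ge0 ltW.
Qed.

End ell_theory.

Lemma ler_of_eq x y : x = y -> x <= y.
Proof. by move=> ->. Qed.

(** Comparing y with s^(1/th) x settles it without convexity: below, the product is at most s x;
    above, it is at most s^(1 - 1/th) y. The free exponent [m] absorbs 1/th - 1 because s <= 1, so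
    that the constant stays uniform when [th] varies with the point. *)
Lemma powR_young (x y th m s : R) : 0 <= x -> 0 <= y -> 0 < s <= 1 -> 0 < th <= 1 ->
  th^-1 - 1 <= m -> x `^ (1 - th) * y `^ th <= s * x + s `^ (- m) * y.
Proof.
move=> x0 y0 /andP[s0 s1] /andP[th0 th1] thm.
have thn : th != 0 by rewrite gt_eqF.
have [->|xn0] := eqVneq x 0.
  have [th1n|th1n] := eqVneq th 1.
    rewrite th1n subrr powRr0 mul1r powRr1// mulr0 add0r ler_peMl//.
    have m0 : 0 <= m by rewrite (le_trans _ thm)// th1n invr1 subrr.
    by rewrite -(powRr0 s) ger_powR ?s0// oppr_le0.
  by rewrite powR0 ?subr_eq0 1?eq_sym// mul0r mulr0 add0r mulr_ge0// powR_ge0.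
have xp : 0 < x by rewrite lt0r xn0.
have [ysx|sxy] := leP y (s `^ th^-1 * x).
  rewrite (@le_trans _ _ (s * x))//; last by rewrite lerDl mulr_ge0// powR_ge0.
  apply: (@le_trans _ _ (x `^ (1 - th) * (s `^ th^-1 * x) `^ th)).
    by rewrite ler_wpM2l ?powR_ge0// ge0_ler_powR ?nnegrE ?mulr_ge0 ?powR_ge0// ltW.
  rewrite powRM ?powR_ge0// -powRrM mulVf// (powRr1 (ltW s0)) mulrCA -powRD.
    by rewrite subrK powRr1.
  by rewrite subrK oner_eq0.
rewrite (@le_trans _ _ (s `^ (- m) * y))//; last by rewrite lerDr mulr_ge0// ltW.
have sp : 0 < s `^ th^-1 by rewrite powR_gt0.
have yp : 0 < y by rewrite (le_lt_trans _ sxy)// mulr_ge0// ltW.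
apply: (@le_trans _ _ ((s `^ th^-1)^-1 `^ (1 - th) * y `^ (1 - th) * y `^ th)).
  rewrite ler_wpM2r ?powR_ge0// -powRM ?invr_ge0 ?powR_ge0//.
  rewrite ge0_ler_powR ?nnegrE ?subr_ge0 ?mulr_ge0 ?invr_ge0 ?powR_ge0//.
  by rewrite mulrC ler_pdivlMr// mulrC ltW.
rewrite -mulrA -powRD; last by rewrite subrK oner_eq0.
rewrite subrK powRr1// ler_wpM2r//.
rewrite -powR_inv1 ?powR_ge0// -!powRrM.
rewrite ger_powR ?s0//.
by rewrite mulN1r mulrN lerN2 mulrBr mulr1 mulVf.
Qed.

(** Beyond the threshold [K] the gain x^g exceeds 1/eps; below it, x^al is at most K^amax. The
    constant depends on the exponents only through the gap and the upper bound, as exponents varying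
    with the point require. *)
Lemma powR_interp (g amax eps : R) : 0 < g -> 0 < eps ->
  exists2 C, 0 < C & forall x al be, 0 <= x -> 0 <= al <= amax -> al + g <= be ->
    x `^ al <= eps * x `^ be + C.
Proof.
move=> g0 e0; pose K := Num.max 1 (eps^-1 `^ g^-1).
have K1 : 1 <= K by rewrite /K le_max lexx.
have K0 := lt_le_trans ltr01 K1.
exists (K `^ amax); first by rewrite powR_gt0.
move=> x al be x0 /andP[al0 alm] ab.
have [xK|Kx] := leP x K.
  rewrite (@le_trans _ _ (K `^ amax))//; last by rewrite lerDr mulr_ge0 ?powR_ge0// ltW.
  rewrite (@le_trans _ _ (K `^ al))//; first by rewrite ge0_ler_powR ?nnegrE// ltW.
  by rewrite ler_powR.
rewrite (@le_trans _ _ (eps * x `^ be))//; last by rewrite lerDl ltW// powR_gt0.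
have xp := lt_trans K0 Kx.
rewrite -ler_pdivrMl//.
have : eps^-1 <= x `^ g.
  rewrite (@le_trans _ _ ((eps^-1 `^ g^-1) `^ g))//.
    by rewrite -powRrM mulVf ?gt_eqF// powRr1// invr_ge0 ltW.
  rewrite ge0_ler_powR ?nnegrE ?powR_ge0 ?(ltW g0) ?(ltW xp)//.
  by rewrite (le_trans _ (ltW Kx))// /K le_max lexx orbT.
move=> eg; rewrite (@le_trans _ _ (x `^ g * x `^ al))//.
  by rewrite ler_wpM2r ?powR_ge0.
rewrite -powRD; last by apply/implyP => _; rewrite gt_eqF.
by rewrite ler_powR 1?addrC// (le_trans K1)// ltW.
Qed.

End ell.

Section phase.
Context {R : realType}.
Implicit Types (n c r t s x y delta eta : R).

Definition phase c r delta eta t : R := c * t `^ r * ell delta eta t.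
Definition sigma_exp n r : R := (n - 1) / (n - r).
(** With r* = n r / (n - r) this is the quotient r* / r, and [sigma_exp] is its multiple by (n - 1)
    / n, which Gagliardo's exponent n / (n - 1) brings back to [tau_exp]. *)
Definition tau_exp n r : R := n / (n - r).
Definition phase_star n c r delta eta t : R := phase c r delta eta t `^ tau_exp n r.

Lemma phase_ge0 c r delta eta t : 1 <= delta -> 0 <= eta -> 0 <= c -> 0 <= t ->
  0 <= phase c r delta eta t.
Proof. by move=> *; rewrite !mulr_ge0 ?powR_ge0 ?ell_ge0. Qed.

Section exponents.
Variables (n r1 r2 r : R).
Hypotheses (n2 : 2 <= n) (r11 : 1 < r1) (r2n : r2 < n) (hr : r1 <= r <= r2).

Let nr0 : 0 < n - r. Proof. by have /andP[] := hr; have := r2n; lra. Qed.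
Let n0 : 0 < n. Proof. by have := n2; lra. Qed.
Let n1 : 0 < n - 1. Proof. by have := n2; lra. Qed.
Let nr1 : 0 < n - r1. Proof. by have /andP[] := hr; have := r2n; lra. Qed.
Let nr2 : 0 < n - r2. Proof. by have := r2n; lra. Qed.
Let rn1 : 1 < r. Proof. by have /andP[] := hr; have := r11; lra. Qed.
Let rr2 : r <= r2. Proof. by have /andP[] := hr. Qed.
Let rr1 : r1 <= r. Proof. by have /andP[] := hr. Qed.

Lemma sigma_exp_ge : sigma_exp n r1 <= sigma_exp n r.
Proof. by rewrite /sigma_exp ler_pM2l// lef_pV2 ?posrE//; have := rr1; lra. Qed.

Lemma sigma_exp_le : sigma_exp n r <= sigma_exp n r2.
Proof. by rewrite /sigma_exp ler_pM2l// lef_pV2 ?posrE//; have := rr2; lra. Qed.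

Lemma sigma_exp_gt1 : 1 < sigma_exp n r.
Proof. by rewrite /sigma_exp ltr_pdivlMr// mul1r; have := rn1; lra. Qed.

Lemma tau_exp_le : tau_exp n r <= tau_exp n r2.
Proof. by rewrite /tau_exp ler_pM2l// lef_pV2 ?posrE//; have := rr2; lra. Qed.

Lemma tau_exp_gt1 : 1 < tau_exp n r.
Proof. by rewrite /tau_exp ltr_pdivlMr// mul1r; have := rn1; lra. Qed.

(** The room of 1 / n below the critical power is what makes the power sigma subcritical, even with
    a logarithm of the phase as an extra factor. *)
Lemma tau_sigma : sigma_exp n r + n^-1 <= tau_exp n r.
Proof.
have -> : tau_exp n r = sigma_exp n r + (n - r)^-1.
  by rewrite /tau_exp /sigma_exp; field; rewrite gt_eqF.
by rewrite lerD2l lef_pV2 ?posrE//; have := rn1; lra.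
Qed.

(** Together with the next two identities this gives the weights of three Young inequalities: 1 / n
    against a logarithm, 1 / r against the gradient, (n + 1 - r) / n against the other phase. *)
Lemma sigma_tau : sigma_exp n r = tau_exp n r * (1 - n^-1).
Proof. by rewrite /tau_exp /sigma_exp; field; rewrite !gt_eqF. Qed.

Lemma sigma_tau_r : sigma_exp n r = tau_exp n r * (1 - r^-1) + r^-1.
Proof.
have r0 : 0 < r by have := rn1; lra.
by rewrite /tau_exp /sigma_exp; field; rewrite !gt_eqF.
Qed.

Lemma sigma_tau_B : sigma_exp n r - 1 = tau_exp n r * (1 - (n + 1 - r) / n).
Proof. by rewrite /tau_exp /sigma_exp; field; rewrite !gt_eqF. Qed.

End exponents.

Section pointwise.
Variables (n r1 r2 A0 d : R).
Hypotheses (n2 : 2 <= n) (r11 : 1 < r1) (r2n : r2 < n) (A00 : 0 <= A0) (d0 : 0 < d).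
Variables (delta eta : R).
Hypotheses (hdelta : 1 <= delta) (heta : 0 <= eta) (hde : 1 < delta + eta).
Notation l := (ell delta eta).
Notation H c r t := (phase c r delta eta t).
Notation sg := (sigma_exp n).
Notation ta := (tau_exp n).

(** For c >= 0 and t > 0 this is the phase to the power sigma divided by t, the size of its
    derivative in t. The form without a quotient is continuous down to t = 0, since r sigma > 1. *)
Definition slope_t n c r delta eta t : R :=
  (c * ell delta eta t) `^ sigma_exp n r * t `^ (r * sigma_exp n r - 1).

Lemma slope_tE c r t : 0 <= c -> 0 < t ->
  slope_t n c r delta eta t = H c r t `^ sg r / t.
Proof.
move=> c0 t0; have t0' := ltW t0; have l0 := ell_ge0 hdelta heta t0'.
rewrite /slope_t /phase mulrAC (@powRM _ (c * l t)) ?powR_ge0 ?mulr_ge0// -mulrA.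
congr (_ * _); rewrite powRB ?powRr1// -?powRrM//.
by apply/implyP => _; rewrite gt_eqF.
Qed.

(** By [sigma_tau_r] the slope is the critical phase to the power 1 - 1/r times (c l(t))^(1/r), and
    Young with weight 1/r turns the product of the last factor with y into a phase. The power [- n]
    of s is uniform because r - 1 <= n. *)
Lemma slope_t_young s c r t y : 0 < s <= 1 -> r1 <= r <= r2 -> 0 <= c -> 0 < t -> 0 <= y ->
  slope_t n c r delta eta t * y <=
  s * phase_star n c r delta eta t + s `^ (- n) * (H c r y + H c r t).
Proof.
have n2' := n2; have r11' := r11; have r2n' := r2n.
move=> s01 hr c0 t0 y0; have /andP[s0 s1] := s01; have t0' := ltW t0.
have r0 : 0 < r by case/andP: hr; lra.
have lt0 := ell_ge0 hdelta heta t0'; have ly0 := ell_ge0 hdelta heta y0.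
have Ht0 : 0 <= H c r t by exact: phase_ge0.
have Hy0 : 0 <= H c r y by exact: phase_ge0.
(* The logarithm stands at t, while the phase of y has it at y. If t <= y, monotonicity compensates;
   otherwise y is replaced by t, which accounts for the phase of t in the bound. *)
pose z := if t <= y then H c r y else H c r t.
have z0 : 0 <= z by rewrite /z; case: ifP.
have zle : z <= H c r y + H c r t by rewrite /z; case: ifP => _; [rewrite lerDl|rewrite lerDr].
have zlow : (c * l t) `^ r^-1 * y <= z `^ r^-1.
  rewrite /z; case: (leP t y) => ty.
    have {1}-> : y = (y `^ r) `^ r^-1 by rewrite -powRrM mulfV ?gt_eqF// powRr1.
    rewrite -powRM ?mulr_ge0 ?powR_ge0//.
    rewrite ge0_ler_powR ?nnegrE ?invr_ge0 ?mulr_ge0 ?powR_ge0 ?(ltW r0)//.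
    rewrite /phase [leRHS]mulrAC ler_wpM2r ?powR_ge0//.
    by rewrite ler_wpM2l// ell_homo.
  apply: (@le_trans _ _ ((c * l t) `^ r^-1 * t)).
    by rewrite ler_wpM2l ?powR_ge0// ltW.
  have {2}-> : t = (t `^ r) `^ r^-1 by rewrite -powRrM mulfV ?gt_eqF// powRr1.
  by rewrite -powRM ?mulr_ge0 ?powR_ge0// /phase mulrAC.
have main : slope_t n c r delta eta t * y <= phase_star n c r delta eta t `^ (1 - r^-1) * z `^ r^-1.
  apply: le_trans (ler_wpM2l (powR_ge0 _ _) zlow).
  rewrite mulrA ler_wpM2r// slope_tE// /phase_star -powRrM.
  rewrite (sigma_tau_r r11 r2n hr).
  have [->|H0] := eqVneq (H c r t) 0.
    rewrite powR0 ?mul0r ?mulr_ge0 ?powR_ge0//.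
    by rewrite -(sigma_tau_r r11 r2n hr) gt_eqF// (lt_trans ltr01)// (sigma_exp_gt1 r11 r2n hr).
  rewrite powRD; last by rewrite H0 implybT.
  rewrite -mulrA ler_wpM2l ?powR_ge0// ler_pdivrMr// /phase mulrAC (@powRM _ (c * l t)) ?powR_ge0 ?mulr_ge0//.
  by rewrite -powRrM mulfV ?gt_eqF// powRr1.
apply: (le_trans main).
apply: (@le_trans _ _ (s * phase_star n c r delta eta t + s `^ (- n) * z)).
  apply: powR_young; rewrite ?powR_ge0//.
    by rewrite invr_gt0 r0 invf_le1//; case/andP: hr; lra.
  by rewrite invrK; case/andP: hr; lra.
by rewrite lerD2l ler_wpM2l ?powR_ge0.
Qed.

Let K := Num.max 1 (A0 * l 1).
Let K1 : 1 <= K. Proof. by rewrite /K le_max lexx. Qed.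

Lemma phase_small c r t : r1 <= r <= r2 -> 0 <= c <= A0 -> 0 <= t <= 1 ->
  H c r t <= K * t `^ r.
Proof.
move=> hr /andP[c0 cA] /andP[t0 t1]; rewrite /phase mulrAC ler_wpM2r ?powR_ge0//.
apply: (@le_trans _ _ (A0 * l 1)); last by rewrite /K le_max lexx orbT.
by rewrite ler_pM ?ell_ge0 ?ell_homo.
Qed.

Lemma phase_small_lin c r t : r1 <= r <= r2 -> 0 <= c <= A0 -> 0 <= t <= 1 ->
  H c r t <= K * t.
Proof.
have n2' := n2; have r11' := r11; have r2n' := r2n.
move=> hr hc ht; apply: (le_trans (phase_small hr hc ht)).
rewrite ler_wpM2l ?(le_trans ler01)//; case/andP: ht => t0 t1.
have [->|tn] := eqVneq t 0; first by rewrite powR0// gt_eqF//; case/andP: hr; lra.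
by rewrite ge1r_powR ?lt0r ?tn ?t0//; case/andP: hr; lra.
Qed.

Lemma phase_le1_lin c r t : r1 <= r <= r2 -> 0 <= c <= A0 -> 0 <= t ->
  H c r t <= 1 -> H c r t <= K * t.
Proof.
move=> hr hc t0 H1; have [t1|t1] := leP t 1; first by rewrite phase_small_lin// t0.
by rewrite (le_trans H1)// (le_trans K1)// ler_peMr ?(le_trans ler01)// ltW.
Qed.

Lemma phase_ge1_lin c r t : r1 <= r <= r2 -> 0 <= c <= A0 -> 0 <= t ->
  1 <= H c r t -> 1 <= K * t.
Proof.
move=> hr hc t0 H1; have [t1|t1] := leP t 1.
  by rewrite (le_trans H1)// phase_small_lin// t0.
by rewrite (le_trans K1)// ler_peMr ?(le_trans ler01)// ltW.
Qed.

(** The exponent sigma depends on the point, and its slope produces this logarithm. Where the phase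
    is at least 1 the logarithm costs the power [k], half of the room in [tau_sigma]; where it is
    below 1 the spare power sigma - 1 >= [k1] absorbs the logarithm, and what remains is linear in
    t. *)
Lemma phase_log1 eps : 0 < eps -> exists2 C, 0 < C & forall c r t,
  r1 <= r <= r2 -> 0 <= c <= A0 -> 0 < t -> 0 < H c r t ->
  H c r t `^ sg r * `|ln (H c r t)| <= eps * phase_star n c r delta eta t + C * t.
Proof.
have n2' := n2; have r11' := r11; have r2n' := r2n.
move=> e0; pose k := (2 * n)^-1; pose k1 := sg r1 - 1.
have k0 : 0 < k by rewrite invr_gt0 mulr_gt0//; lra.
have r1r2_n r : r1 <= r <= r2 -> r1 <= r1 <= r2.
  by case/andP => a b; rewrite lexx (le_trans a b).
have [C C0 HC] := @powR_interp R k (ta r2) (eps * k) k0 (mulr_gt0 e0 k0).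
pose C2 := k^-1 * C * K + k1^-1 * K.
exists (Num.max 1 C2); first by rewrite lt_max ltr01.
move=> c r t hr hc t0 H0.
have k10 : 0 < k1 by rewrite /k1 subr_gt0 (sigma_exp_gt1 r11 r2n (r1r2_n _ hr)).
have K0 : 0 <= K := le_trans ler01 K1.
have C2C : C2 * t <= Num.max 1 C2 * t by rewrite ler_wpM2r ?(ltW t0)// le_max lexx orbT.
have star0 : 0 <= eps * phase_star n c r delta eta t by rewrite mulr_ge0 ?(ltW e0) ?powR_ge0.
have [H1|H1] := leP 1 (H c r t).
  rewrite ger0_norm ?ln_ge0//.
  apply: (@le_trans _ _ (H c r t `^ sg r * (k^-1 * H c r t `^ k))).
    by rewrite ler_wpM2l ?powR_ge0// ln_le_powR.
  rewrite mulrCA -powRD; last by apply/implyP => _; rewrite gt_eqF.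
  apply: (@le_trans _ _ (k^-1 * (eps * k * H c r t `^ ta r + C))).
    have ik : 0 <= k^-1 by rewrite invr_ge0 ltW.
    apply: (ler_wpM2l ik); apply: (HC _ (sg r + k) (ta r)); first exact: ltW.
      have := tau_sigma n2 r11 r2n hr; have := tau_exp_le n2 r2n hr.
      have := sigma_exp_gt1 r11 r2n hr.
      have -> : n^-1 = k + k by rewrite /k; field; rewrite gt_eqF//; lra.
      by lra.
    have := tau_sigma n2 r11 r2n hr.
    have -> : n^-1 = k + k by rewrite /k; field; rewrite gt_eqF//; lra.
    by lra.
  rewrite mulrDr mulrA (mulrC eps) mulrA mulVf ?gt_eqF// mul1r lerD2l.
  apply: le_trans C2C; rewrite /C2 mulrDl.
  apply: (@le_trans _ _ (k^-1 * C * K * t)).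
    have kp : 0 < k^-1 by rewrite invr_gt0.
    rewrite -[X in X <= _]mulr1 -[leRHS]mulrA ler_wpM2l ?(mulr_ge0 (ltW kp) (ltW C0))//.
    by apply: (phase_ge1_lin hr hc _ H1); exact: ltW.
  have k1p : 0 < k1^-1 by rewrite invr_gt0.
  by rewrite lerDl (mulr_ge0 (mulr_ge0 (ltW k1p) K0) (ltW t0)).
rewrite ler0_norm ?ln_le0 ?(ltW H1)// -lnV ?posrE//.
apply: (@le_trans _ _ (H c r t `^ sg r * (k1^-1 * (H c r t)^-1 `^ k1))).
  by rewrite ler_wpM2l ?powR_ge0// ln_le_powR// invr_gt0.
rewrite -(@powR_inv1 _ (H c r t)) ?(ltW H0)// -powRrM mulN1r mulrCA -powRD; last first.
  by apply/implyP => _; rewrite gt_eqF.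
apply: (@le_trans _ _ (k1^-1 * (K * t))); last first.
  apply: (@le_trans _ _ (C2 * t)); last by rewrite (le_trans C2C)// lerDr.
  have kp : 0 < k^-1 by rewrite invr_gt0.
  rewrite /C2 mulrDl mulrA lerDr.
  exact: (mulr_ge0 (mulr_ge0 (mulr_ge0 (ltW kp) (ltW C0)) K0) (ltW t0)).
rewrite ler_wpM2l ?invr_ge0 ?(ltW k10)//.
apply: le_trans (phase_le1_lin hr hc (ltW t0) (ltW H1)).
rewrite ge1r_powR ?H0 ?(ltW H1)//.
by have := sigma_exp_ge n2 r2n hr; rewrite /k1; lra.
Qed.

(** The logarithm comes from the slope of the exponent in t^r. For t >= 1 Young with weight 1 / n
    leaves (ln t)^n, at most n^n t; for t < 1 the logarithm costs t^(1 - r1), and the power r sigma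
    >= r1 of t still leaves a linear term. *)
Lemma phase_log2 eps : 0 < eps -> exists2 C, 0 < C & forall c r t,
  r1 <= r <= r2 -> 0 <= c <= A0 -> 0 < t -> 0 < H c r t ->
  H c r t `^ sg r * `|ln t| <= eps * phase_star n c r delta eta t + C * t.
Proof.
have n2' := n2; have r11' := r11; have r2n' := r2n.
move=> e0; pose s := Num.min eps 1; pose k := r1 - 1.
have s0 : 0 < s by rewrite /s lt_min e0 ltr01.
have k0 : 0 < k by rewrite subr_gt0.
have n0 : 0 < n by lra.
have K0 : 0 <= K := le_trans ler01 K1.
pose C1 := s `^ (- n) * n `^ n; pose C2 := K `^ sg r2 * k^-1.
have C10 : 0 < C1 by rewrite mulr_gt0 ?powR_gt0.
exists (Num.max C1 C2); first by rewrite lt_max C10.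
move=> c r t hr hc t0 H0.
have star0 : 0 <= phase_star n c r delta eta t by rewrite powR_ge0.
have [t1|t1] := leP 1 t.
  rewrite ger0_norm ?ln_ge0//.
  have ln0 : 0 <= ln t := ln_ge0 t1.
  have -> : ln t = (ln t `^ n) `^ n^-1 by rewrite -powRrM mulfV ?gt_eqF// powRr1.
  rewrite (sigma_tau n2 r2n hr) powRrM.
  apply: (@le_trans _ _ (s * phase_star n c r delta eta t + s `^ (- n) * (ln t `^ n))).
    apply: powR_young; rewrite ?powR_ge0//.
    - by rewrite s0 /s ge_min lexx orbT.
    - by rewrite invr_gt0 n0 invf_le1//; lra.
    - by rewrite invrK; lra.
  rewrite lerD// ?ler_wpM2r// ?ge_min ?lexx//.
  apply: (@le_trans _ _ (C1 * t)); last by rewrite ler_wpM2r ?(ltW t0)// le_max lexx.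
  rewrite -mulrA ler_wpM2l ?powR_ge0//.
  apply: (@le_trans _ _ ((n * t `^ n^-1) `^ n)).
    rewrite ge0_ler_powR ?nnegrE ?mulr_ge0 ?powR_ge0 ?(ltW n0)//.
    have n0' : 0 < n^-1 by rewrite invr_gt0.
    by have := ln_le_powR n0' t0; rewrite invrK.
  rewrite powRM ?powR_ge0 ?(ltW n0)// -powRrM mulVf ?gt_eqF// powRr1//.
  exact: ltW.
have t01 : 0 <= t <= 1 by rewrite !ltW.
rewrite ler0_norm ?ln_le0 ?(ltW t1)// -lnV ?posrE//.
apply: (@le_trans _ _ (C2 * t)); last first.
  rewrite (@le_trans _ _ (Num.max C1 C2 * t))//; last by rewrite lerDr mulr_ge0// ltW.
  by rewrite ler_wpM2r ?(ltW t0)// le_max lexx orbT.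
have sg1 := sigma_exp_gt1 r11 r2n hr.
have sg0 : 0 <= sg r by rewrite (le_trans ler01)// ltW.
apply: (@le_trans _ _ ((K * t `^ r) `^ sg r * (k^-1 * t^-1 `^ k))).
  rewrite ler_pM ?powR_ge0 ?ln_le_powR ?invr_gt0//.
    by rewrite ln_ge0// invf_ge1// ltW.
  apply: ge0_ler_powR => //; rewrite ?nnegrE ?(ltW H0)//.
    by rewrite mulr_ge0// powR_ge0.
  exact: phase_small.
rewrite powRM ?powR_ge0// -(@powR_inv1 _ t) ?(ltW t0)// -!powRrM mulN1r mulrACA.
rewrite -powRD; last by apply/implyP => _; rewrite gt_eqF.
apply: ler_pM; rewrite ?mulr_ge0 ?powR_ge0 ?invr_ge0 ?(ltW k0)//.
  rewrite ler_wpM2r ?invr_ge0 ?(ltW k0)// ler_powR//.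
  exact: (sigma_exp_le n2 r2n hr).
rewrite ge1r_powR ?t0 ?(ltW t1)// /k; case/andP: hr => hr1 hr2; nra.
Qed.

End pointwise.

(** For c > 0 and t >= 0 this is the phase to the power sigma divided by c, the size of its
    derivative in the coefficient; as sigma > 1, the form without a quotient also covers c = 0. *)
Definition slope_x n c r delta eta t : R :=
  c `^ (sigma_exp n r - 1) * (t `^ r * ell delta eta t) `^ sigma_exp n r.

(* The coefficient slope [slope_x] is the only term which needs the other
   phase: it is critical exactly when q / p = 1 + 1 / n. *)
Lemma slope_x_le n r1 r2 A0 d delta eta delta' eta' g eps :
  2 <= n -> 1 < r1 -> r2 < n -> 0 <= A0 -> 0 < d ->
  1 <= delta -> 0 <= eta -> 1 < delta + eta -> 1 <= delta' -> 0 <= eta' -> 1 < delta' + eta' ->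
  0 < g -> 0 < eps -> exists2 C, 0 < C & forall c c' r r' t,
  r1 <= r <= r2 -> r1 <= r' <= r2 -> 0 <= c <= A0 -> 0 <= c' -> d <= c + c' ->
  r * n / (n + 1 - r) + g <= r' * tau_exp n r' -> 0 <= t ->
  slope_x n c r delta eta t <=
    eps * (phase_star n c r delta eta t + phase_star n c' r' delta' eta' t) + C * t.
Proof.
move=> n2 r11 r2n A00 d0 hdelta heta hde hd' he' hde' g0 e0.
have n0 : 0 < n by lra.
have in0 : 0 < n^-1 by rewrite invr_gt0.
pose l1 := ell delta eta 1; have l10 : 0 < l1 by apply: ell_gt0.
(* [Ca] serves small [t], [Cb] the case [c >= d / 2], the rest the case [c < d / 2]. *)
pose B := Num.max 1 A0; pose L := Num.max 1 l1.
have B1 : 1 <= B by rewrite le_max lexx.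
have L1 : 1 <= L by rewrite le_max lexx.
have B0 := lt_le_trans ltr01 B1; have L0 := lt_le_trans ltr01 L1.
pose Ca := B `^ sigma_exp n r2 * L `^ sigma_exp n r2.
have Ca0 : 0 < Ca by rewrite mulr_gt0 ?powR_gt0.
have ed0 : 0 < eps * (d / 2) by rewrite mulr_gt0// divr_gt0.
have [Cb Cb0 HCb] := @powR_interp R n^-1 (tau_exp n r2) (eps * (d / 2)) in0 ed0.
pose s := Num.min eps 1; have s0 : 0 < s by rewrite /s lt_min e0 ltr01.
(* The logarithm is bounded by a multiple of t^k; after the power n / (n + 1 - r) <= n this uses at
   most half of the gap [g]. *)
pose k := g / (2 * n); have k0 : 0 < k by rewrite divr_gt0 ?mulr_gt0//; lra.
have [D D0 HD] := ell_le_powR hdelta heta hde k0.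
pose D' := Num.max 1 D; have D'1 : 1 <= D' by rewrite le_max lexx.
have D'0 := lt_le_trans ltr01 D'1.
pose E := s `^ (- n) * D' `^ n; have E0 : 0 < E by rewrite mulr_gt0 ?powR_gt0.
pose l1' := ell delta' eta' 1; have l1'0 : 0 < l1' by apply: ell_gt0.
pose m := Num.min 1 (d / 2 * l1').
have m0 : 0 < m by rewrite /m lt_min ltr01 mulr_gt0// divr_gt0.
have m1 : m <= 1 by rewrite /m ge_min lexx.
pose M := m `^ tau_exp n r2; have M0 : 0 < M by rewrite powR_gt0.
have g20 : 0 < g / 2 by rewrite divr_gt0.
have eEM : 0 < eps * M / E by rewrite divr_gt0// mulr_gt0.
have [Cc Cc0 HCc] := @powR_interp R (g / 2) ((r2 + k) * n) _ g20 eEM.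
pose C := Ca + (2 / d) * Cb + E * Cc.
have d20 : 0 < 2 / d by rewrite divr_gt0.
have C0 : 0 < C := addr_gt0 (addr_gt0 Ca0 (mulr_gt0 d20 Cb0)) (mulr_gt0 E0 Cc0).
exists C => // c c' r r' t hr hr' hc c'0 dcc hg t0.
have /andP[c0 cA] := hc.
have sg1 := sigma_exp_gt1 r11 r2n hr.
have sg0 : 0 < sigma_exp n r := lt_trans ltr01 sg1.
have ss0 : 0 <= phase_star n c r delta eta t by exact: powR_ge0.
have ss'0 : 0 <= phase_star n c' r' delta' eta' t by exact: powR_ge0.
have sgle := sigma_exp_le n2 r2n hr.
have lt0 := ell_ge0 hdelta heta t0.
have [t1|t1] := leP t 1.
  apply: (@le_trans _ _ (Ca * t)); last first.
    apply: (@le_trans _ _ (C * t)).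
      rewrite ler_wpM2r// /C -addrA lerDl.
      exact: (addr_ge0 (mulr_ge0 (ltW d20) (ltW Cb0)) (mulr_ge0 (ltW E0) (ltW Cc0))).
    by rewrite lerDr (mulr_ge0 (ltW e0) (addr_ge0 ss0 ss'0)).
  rewrite /slope_x /Ca -mulrA ler_pM ?powR_ge0//.
    apply: (@le_trans _ _ (B `^ (sigma_exp n r - 1))).
      apply: ge0_ler_powR; rewrite ?nnegrE ?subr_ge0 ?(ltW sg1) ?(ltW B0)//.
      by rewrite /B le_max cA orbT.
    by rewrite ler_powR//; clear -sgle; lra.
  apply: (@le_trans _ _ ((t * L) `^ sigma_exp n r)).
    apply: ge0_ler_powR; rewrite ?nnegrE ?(ltW sg0) ?mulr_ge0 ?powR_ge0 ?(ltW L0)//.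
    rewrite ler_pM ?powR_ge0//.
      have [->|tn] := eqVneq t 0; first by rewrite powR0// gt_eqF//; clear -hr r11; case/andP: hr; lra.
      by rewrite ge1r_powR ?lt0r ?tn ?t0//; clear -hr r11; case/andP: hr; lra.
    by rewrite (@le_trans _ _ l1)// ?ell_homo// le_max lexx orbT.
  rewrite powRM ?(ltW L0)// mulrC ler_pM ?powR_ge0 ?ler_powR//.
  have [->|tn] := eqVneq t 0; first by rewrite powR0// gt_eqF.
  by rewrite ge1r_powR ?lt0r ?tn ?t0// ltW.
have tp : 0 < t := lt_trans ltr01 t1.
have Ht0 : 0 <= phase c r delta eta t by exact: phase_ge0.
have CCt : C <= C * t by rewrite ler_peMr// ltW.
(* A coefficient bounded below makes the quotient by c harmless, and only the power sigma of the
   same phase remains, which is subcritical by [tau_sigma]. *)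
have [cd|cd] := leP (d / 2) c.
  have cp : 0 < c by rewrite (lt_le_trans _ cd)// divr_gt0.
  have -> : slope_x n c r delta eta t = phase c r delta eta t `^ sigma_exp n r / c.
    rewrite /slope_x /phase -mulrA (@powRM _ c) ?mulr_ge0 ?powR_ge0//.
    rewrite powRB ?powRr1//; last by apply/implyP => _; rewrite gt_eqF.
    by rewrite mulrAC.
  rewrite ler_pdivrMr//.
  apply: (@le_trans _ _ (eps * (d / 2) * phase_star n c r delta eta t + Cb)).
    rewrite /phase_star; apply: HCb => //.
      have := tau_sigma n2 r11 r2n hr; have := tau_exp_le n2 r2n hr.
      by clear -sg1 in0; lra.
    exact: (tau_sigma n2 r11 r2n hr).
  apply: (@le_trans _ _ ((eps * phase_star n c r delta eta t + 2 / d * Cb) * (d / 2))).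
    by rewrite le_eqVlt; apply/orP; left; apply/eqP; field; rewrite gt_eqF.
  have H1 : 0 <= eps * phase_star n c r delta eta t by rewrite mulr_ge0// ltW.
  have H2 : 0 <= eps * phase_star n c' r' delta' eta' t by rewrite mulr_ge0// ltW.
  have H3 := mulr_gt0 d20 Cb0; have H4 := mulr_gt0 E0 Cc0.
  have d2p : 0 <= d / 2 by rewrite ltW// divr_gt0.
  apply: ler_pM => //; first exact: (addr_ge0 H1 (ltW H3)).
  have H5 : 2 / d * Cb <= C * t.
    by apply: le_trans CCt; rewrite /C; clear -Ca0 H4; lra.
  by rewrite mulrDr; clear -H2 H5; lra.
(* Now the other coefficient is bounded below, so that the other critical phase controls t to the
   power r' tau(r'). *)
have cd' : d / 2 <= c' by clear -cd dcc; lra.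
pose th := (n + 1 - r) / n.
have rn : r < n by clear -hr r2n; case/andP: hr => *; lra.
have r1' : 1 < r by clear -hr r11; case/andP: hr => *; lra.
have th0 : 0 < th by rewrite divr_gt0//; clear -rn; lra.
have th1 : th <= 1 by rewrite ler_pdivrMr//; clear -r1'; lra.
pose y := (t `^ r * ell delta eta t) `^ th^-1.
have y0 : 0 <= y by exact: powR_ge0.
have nr1' : 1 <= n + 1 - r by clear -rn; lra.
have nr1'' : 0 < n + 1 - r := lt_le_trans ltr01 nr1'.
have nle : n / (n + 1 - r) <= n by rewrite ler_pdivrMr ?ler_peMr// ltW.
have nge0 : 0 <= n / (n + 1 - r) by rewrite divr_ge0// ltW.
(* [sigma_tau_B] splits the slope into the critical phase to the power 1 - th, which carries all
   powers of c, and the factor t^r l(t) free of c; Young sends the latter to the power 1 / th, where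
   the gap hypothesis applies. *)
have step1 : slope_x n c r delta eta t <= s * phase_star n c r delta eta t + s `^ (- n) * y.
  have -> : slope_x n c r delta eta t = phase_star n c r delta eta t `^ (1 - th) * y `^ th.
    rewrite /phase_star /y -!powRrM mulVf ?gt_eqF// powRr1 ?mulr_ge0 ?powR_ge0//.
    rewrite -(sigma_tau_B n2 r2n hr) /slope_x /phase -mulrA.
    rewrite (@powRM _ c) ?mulr_ge0 ?powR_ge0// -mulrA; congr (_ * _).
    have [->|tl] := eqVneq (t `^ r * ell delta eta t) 0; first by rewrite mulr0 powR0// gt_eqF.
    rewrite -[X in _ = _ * X]powRr1 ?mulr_ge0 ?powR_ge0// -powRD ?subrK//.
    by rewrite tl implybT.
  apply: powR_young => //.
  - by rewrite s0 /s ge_min lexx orbT.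
  - by rewrite th0.
  - rewrite /th invf_div.
    by rewrite lerBlDr (le_trans nle)// lerDl.
have step2 : y <= D' `^ n * t `^ ((r + k) * (n / (n + 1 - r))).
  rewrite /y /th invf_div.
  apply: (@le_trans _ _ ((D' * t `^ (r + k)) `^ (n / (n + 1 - r)))).
    apply: ge0_ler_powR => //; rewrite ?nnegrE ?mulr_ge0 ?powR_ge0 ?(ltW D'0)//.
    apply: (@le_trans _ _ (t `^ r * (D * t `^ k))).
      by rewrite ler_wpM2l ?powR_ge0// HD// ltW.
    rewrite mulrCA -powRD; last by rewrite (gt_eqF tp) implybT.
    by rewrite ler_wpM2r ?powR_ge0// le_max lexx orbT.
  rewrite powRM ?powR_ge0 ?(ltW D'0)// -powRrM ler_wpM2r ?powR_ge0//.
  by rewrite ler_powR.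
have step3 : t `^ ((r + k) * (n / (n + 1 - r))) <= (eps * M / E) * t `^ (r' * tau_exp n r') + Cc.
  apply: HCc => //; first (apply/andP; split).
  - by rewrite mulr_ge0 ?addr_ge0 ?(ltW k0)//; clear -r1'; lra.
  - rewrite ler_pM ?addr_ge0 ?(ltW k0)//; first by clear -r1'; lra.
    by rewrite lerD2r; case/andP: hr.
  have : k * (n / (n + 1 - r)) <= g / 2.
    apply: (@le_trans _ _ (k * n)); first by rewrite ler_wpM2l// ltW.
    by rewrite /k; apply: ler_of_eq; field; rewrite gt_eqF.
  by move: hg; rewrite mulrDl mulrA; clear; lra.
have step4 : M * t `^ (r' * tau_exp n r') <= phase_star n c' r' delta' eta' t.
  have ta0 : 0 <= tau_exp n r' by rewrite (le_trans ler01)// ltW// (tau_exp_gt1 r11 r2n hr').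
  apply: (@le_trans _ _ ((m * t `^ r') `^ tau_exp n r')).
    rewrite powRM ?powR_ge0 ?(ltW m0)// -powRrM ler_wpM2r ?powR_ge0//.
    by rewrite ger_powR ?m0//; exact: (tau_exp_le n2 r2n hr').
  apply: ge0_ler_powR => //; rewrite ?nnegrE ?mulr_ge0 ?powR_ge0 ?(ltW m0) ?ell_ge0//.
  rewrite /phase mulrAC ler_wpM2r ?powR_ge0//.
  apply: (@le_trans _ _ (d / 2 * l1')); first by rewrite /m ge_min lexx orbT.
  by rewrite ler_pM ?divr_ge0 ?(ltW d0) ?(ltW l1'0)// ell_homo// ltW.
have step5 : s `^ (- n) * y <= eps * phase_star n c' r' delta' eta' t + E * Cc.
  apply: (@le_trans _ _ (E * (eps * M / E * t `^ (r' * tau_exp n r') + Cc))).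
    rewrite /E -mulrA ler_wpM2l ?powR_ge0//; apply: (le_trans step2).
    by rewrite ler_wpM2l ?powR_ge0.
  rewrite mulrDr lerD2r.
  apply: (@le_trans _ _ (eps * (M * t `^ (r' * tau_exp n r')))).
    by apply: ler_of_eq; field; rewrite gt_eqF.
  by rewrite ler_wpM2l// ltW.
have step6 : s * phase_star n c r delta eta t <= eps * phase_star n c r delta eta t.
  by rewrite ler_wpM2r// /s ge_min lexx.
have H3 := mulr_gt0 d20 Cb0; have H4 := mulr_gt0 E0 Cc0.
have : E * Cc <= C * t by apply: le_trans CCt; rewrite /C; clear -Ca0 H3; lra.
rewrite mulrDr; clear -step1 step5 step6; lra.
Qed.

End phase.

(** * Calculus of slopes *)

Section slope_rules.
Context {R : realType}.
Implicit Types (f g : R -> R) (x y a b e K L l : R).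

Lemma slope_le_lip f x L : (\forall y \near x, `|f y - f x| <= L * `|y - x|) ->
  slope_le f x L.
Proof.
move=> H e e0; apply: filterS H => y /le_trans; apply.
by rewrite ler_wpM2r// lerDl ltW.
Qed.

Lemma slope_le_mono f x K L : K <= L -> slope_le f x K -> slope_le f x L.
Proof.
move=> KL H e e0; apply: filterS (H e e0) => y /le_trans; apply.
by rewrite ler_wpM2r// lerD2r.
Qed.

Lemma slope_le_near f g x K : (\forall y \near x, f y = g y) ->
  slope_le f x K -> slope_le g x K.
Proof.
move=> fg H e e0; have fgx := nbhs_singleton fg.
by apply: filterS2 fg (H e e0) => y <-; rewrite fgx.
Qed.

Lemma slope_le_cvg f x K : slope_le f x K -> f y @[y --> x] --> f x.
Proof.
move=> H; apply/cvgrPdist_lt => e e0.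
have := H 1 ltr01; pose M := `|K| + 1 + 1.
have M0 : 0 < M by rewrite /M ltr_wpDl ?addr_ge0.
move=> Hf; near=> y.
rewrite distrC; apply: (@le_lt_trans _ _ (M * `|y - x|)).
  apply: (@le_trans _ _ ((K + 1) * `|y - x|)); first by near: y.
  by rewrite ler_wpM2r// /M -addrA lerD// ?ler_norm// lerDl.
rewrite mulrC -ltr_pdivlMr//; near: y.
apply/nbhs_ballP; exists (e / M) => /=; first by rewrite divr_gt0.
by move=> y; rewrite /ball/= distrC.
Unshelve. all: by end_near. Qed.

Lemma slope_leD f g x K L : slope_le f x K -> slope_le g x L ->
  slope_le (fun y => f y + g y) x (K + L).
Proof.
move=> Hf Hg e e0; have e20 : 0 < e / 2 by rewrite divr_gt0.
apply: filterS2 (Hf _ e20) (Hg _ e20) => y fy gy.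
rewrite (_ : _ - _ = (f y - f x) + (g y - g x)); last by ring.
rewrite (le_trans (ler_normD _ _))// (le_trans (lerD fy gy))// -mulrDl.
by rewrite ler_wpM2r//; lra.
Qed.

Lemma slope_leM f g x K L : 0 <= K -> 0 <= L -> slope_le f x K -> slope_le g x L ->
  slope_le (fun y => f y * g y) x (`|f x| * L + `|g x| * K).
Proof.
move=> K0 L0 Hf Hg e e0.
pose M := `|f x| + `|g x| + K + L + 3.
have [fx0 gx0] : 0 <= `|f x| /\ 0 <= `|g x| by [].
have M0 : 0 < M by rewrite /M; lra.
pose d := Num.min 1 (e / M); have d0 : 0 < d by rewrite lt_min ltr01 divr_gt0.
have d1 : d <= 1 by rewrite ge_min lexx.
have dM : d * M <= e by rewrite -ler_pdivlMr// ge_min lexx orbT.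
have cg : \forall y \near x, `|g y| <= `|g x| + d.
  have /cvgrPdist_lt/(_ d d0) := slope_le_cvg Hg.
  apply: filterS => y yx; rewrite -lerBlDl (le_trans (lerB_dist _ _))// distrC ltW//.
near=> y.
have fy : `|f y - f x| <= (K + d) * `|y - x| by near: y; exact: Hf.
have gy : `|g y - g x| <= (L + d) * `|y - x| by near: y; exact: Hg.
have gyd : `|g y| <= `|g x| + d by near: y.
rewrite (_ : _ - _ = (f y - f x) * g y + f x * (g y - g x)); last by ring.
rewrite (le_trans (ler_normD _ _))// !normrM.
apply: (@le_trans _ _ ((K + d) * `|y - x| * (`|g x| + d) + `|f x| * ((L + d) * `|y - x|))).
  by rewrite lerD ?ler_pM.
rewrite (_ : _ + _ = ((K + d) * (`|g x| + d) + `|f x| * (L + d)) * `|y - x|); last by ring.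
rewrite ler_wpM2r//.
rewrite /M in dM; nra.
Unshelve. all: by end_near. Qed.

Lemma slope_le_comp f g x K l : 0 <= K -> is_derive (f x) 1 g l -> slope_le f x K ->
  slope_le (g \o f) x (`|l| * K).
Proof.
move=> K0 dg Hf e e0.
pose M := `|l| + K + 1; have l0 : 0 <= `|l| by [].
have M0 : 0 < M by rewrite /M; lra.
pose d := Num.min 1 (e / M); have d0 : 0 < d by rewrite lt_min ltr01 divr_gt0.
have d1 : d <= 1 by rewrite ge_min lexx.
have dM : d * M <= e by rewrite -ler_pdivlMr// ge_min lexx orbT.
have /= gf := slope_le_cvg Hf (is_derive_near dg d0).
near=> y.
have fy : `|f y - f x| <= (K + d) * `|y - x| by near: y; exact: Hf.
have gy : `|g (f y) - g (f x) - l * (f y - f x)| <= d * `|f y - f x| by near: y; exact: gf.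
have : `|g (f y) - g (f x)| <= (`|l| + d) * `|f y - f x|.
  rewrite -[X in `|X| <= _](subrK (l * (f y - f x))) (le_trans (ler_normD _ _))//.
  by rewrite normrM mulrDl addrC lerD2l.
move=> /le_trans; apply; apply: (@le_trans _ _ ((`|l| + d) * ((K + d) * `|y - x|))).
  by rewrite ler_wpM2l// addr_ge0// ltW.
rewrite mulrA ler_wpM2r//.
rewrite /M in dM; nra.
Unshelve. all: by end_near. Qed.

(** Where the base vanishes, exponents bounded below by s1 > 1 make the power negligible against the
    distance to the point. This serves the zeros of a phase, which logarithmic differentiation does
    not reach. *)
Lemma slope_le_powR0 (f s : R -> R) x K s1 : 1 < s1 -> f x = 0 -> s x != 0 ->
  (\forall y \near x, 0 <= f y <= K * `|y - x| /\ s1 <= s y) ->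
  slope_le (fun y => f y `^ s y) x 0.
Proof.
move=> s11 fx0 sx0 H e e0; rewrite fx0 powR0// add0r.
pose k := s1 - 1; have k0 : 0 < k by rewrite subr_gt0.
pose M := `|K| + 1; have M0 : 0 < M by rewrite ltr_wpDl.
pose d := Num.min M^-1 ((e / M) `^ k^-1 / M).
have d0 : 0 < d by rewrite lt_min invr_gt0 M0 divr_gt0// powR_gt0// divr_gt0.
near=> y.
have [/andP[fy0 fyK] sy] : 0 <= f y <= K * `|y - x| /\ s1 <= s y by near: y.
have yxd : `|y - x| < d.
  near: y; apply/nbhs_ballP; exists d => //= y; by rewrite /ball/= distrC.
rewrite subr0 ger0_norm ?powR_ge0//.
have [fy00|fy00] := eqVneq (f y) 0.
  by rewrite fy00 powR0 ?mulr_ge0 ?(ltW e0)// gt_eqF// (lt_le_trans _ sy)// (lt_trans ltr01).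
have fyp : 0 < f y by rewrite lt0r fy00.
have fyM : f y <= M * `|y - x|.
  by rewrite (le_trans fyK)// ler_wpM2r// /M (le_trans (ler_norm K))// lerDl.
have fy1 : f y <= 1.
  rewrite (le_trans fyM)// -ler_pdivlMl// mulr1 (le_trans (ltW yxd))//.
  by rewrite ge_min lexx.
apply: (@le_trans _ _ (f y `^ s1)); first by rewrite ger_powR// fyp.
have -> : f y `^ s1 = f y * f y `^ k by rewrite /k mulr_powRB1// (lt_trans ltr01).
apply: (@le_trans _ _ (M * `|y - x| * (e / M))); last first.
  by apply: ler_of_eq; clearbody M; field; rewrite gt_eqF.
apply: ler_pM => //; first exact: powR_ge0.
apply: (@le_trans _ _ (((e / M) `^ k^-1) `^ k)).
  apply: ge0_ler_powR; rewrite ?nnegrE ?powR_ge0 ?(ltW k0)//.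
  rewrite (le_trans fyM)// -ler_pdivlMl// mulrC (le_trans (ltW yxd))//.
  by rewrite ge_min lexx orbT.
rewrite -powRrM mulVf ?gt_eqF// powRr1//.
by apply: divr_ge0; exact: ltW.
Unshelve. all: by end_near. Qed.

(** At a positive base this is continuity of [expR] and [ln]. At base 0 the exponents are eventually
    at least b / 2, and the power b / 2 of a base below 1 dominates. *)
Lemma cvg_powR (T : Type) (F : set_system T) (FF : ProperFilter F) (f s : T -> R) a b :
  0 < b -> (\forall z \near F, 0 <= f z) -> f @ F --> a -> s @ F --> b ->
  (fun z => f z `^ s z) @ F --> a `^ b.
Proof.
move=> b0 f0 fa sb.
have a0 : 0 <= a.
  rewrite leNgt; apply/negP => a0.
  have a20 : 0 < - a by rewrite oppr_gt0.
  have /cvgrPdist_lt/(_ _ a20) af := fa.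
  have [z [/= fz0]] : exists z, 0 <= f z /\ `|a - f z| < - a.
    exact: (filter_ex (filterI f0 af)).
  by rewrite ltr_norml => /andP[+ _]; lra.
have [ap|] := ltP 0 a.
  have fp : \forall z \near F, 0 < f z.
    move/cvgrPdist_lt : fa => /(_ a ap); apply: filterS => z.
    by rewrite ltr_norml => /andP[_]; lra.
  have E : \forall z \near F, expR (s z * ln (f z)) = f z `^ s z.
    by apply: filterS fp => z fz; rewrite /powR gt_eqF.
  rewrite [X in _ --> X](_ : _ = expR (b * ln a)); last by rewrite /powR gt_eqF.
  apply: (cvg_trans (near_eq_cvg E)).
  apply: continuous_cvg; first exact: continuous_expR.
  by apply: cvgM => //; apply: continuous_cvg => //; exact: continuous_ln.
move=> a0'; have a00 : a = 0 by apply/eqP; rewrite eq_le a0' a0.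
rewrite a00 powR0 ?gt_eqF//; rewrite a00 in fa.
apply/cvgrPdist_lt => e e0.
pose d := Num.min 1 ((e / 2) `^ (b / 2)^-1).
have b20 : 0 < b / 2 by rewrite divr_gt0.
have e20 : 0 < e / 2 by rewrite divr_gt0.
have d0 : 0 < d by rewrite lt_min ltr01 powR_gt0.
have /cvgrPdist_lt/(_ _ d0) fd := fa.
have /cvgrPdist_lt/(_ _ b20) sd := sb.
near=> z.
have fz0 : 0 <= f z by near: z.
have : `|0 - f z| < d by near: z.
rewrite sub0r normrN ger0_norm// => fzd.
have : `|b - s z| < b / 2 by near: z.
rewrite ltr_norml => /andP[_ bs].
have sz : b / 2 <= s z by lra.
rewrite sub0r normrN ger0_norm ?powR_ge0//.
have fz1 : f z <= 1 by rewrite (le_trans (ltW fzd))// ge_min lexx.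
apply: (@le_lt_trans _ _ (e / 2)); last by rewrite ltr_pdivrMr// ltr_pMr// ltr1n.
apply: (@le_trans _ _ (f z `^ (b / 2))).
  have [->|fzn] := eqVneq (f z) 0; first by rewrite !powR0// gt_eqF// (lt_le_trans b20).
  by rewrite ger_powR// lt0r fzn fz0.
apply: (@le_trans _ _ (((e / 2) `^ (b / 2)^-1) `^ (b / 2))).
  apply: ge0_ler_powR; rewrite ?nnegrE ?powR_ge0 ?(ltW b20)//.
  by rewrite (le_trans (ltW fzd))// ge_min lexx orbT.
by rewrite -powRrM mulVf ?gt_eqF// powRr1// ltW.
Unshelve. all: by end_near. Qed.

End slope_rules.
Section slope_phase.
Context {R : realType}.
Implicit Types (x y a b e K L l : R).

Lemma slope_le_ln (f : R -> R) x K : 0 <= K -> 0 < f x -> slope_le f x K ->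
  slope_le (fun y => ln (f y)) x (K / f x).
Proof.
move=> K0 fx Hf; have := @slope_le_comp R f (@ln R) x K (f x)^-1 K0 (is_derive1_ln fx) Hf.
by rewrite ger0_norm ?invr_ge0 ?(ltW fx)// mulrC.
Qed.

Lemma is_derive_sigma_exp (n r : R) : r < n ->
  is_derive r 1 (sigma_exp n) ((n - 1) / (n - r) ^+ 2).
Proof.
move=> rn; have nr : n - r != 0 by rewrite subr_eq0 gt_eqF.
have h1 : is_derive r 1 (fun r => n - r) (- 1).
  by apply: is_derive_eq; rewrite /GRing.scale/=; ring.
have h2 := @is_deriveV R (fun r => n - r) r _ 1 nr h1.
have h3 := is_deriveZ (n - 1) h2.
apply: (@is_derive_eq _ _ _ _ _ _ _ _ h3).
by rewrite /GRing.scale/=; field.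
Qed.

(** Logarithmic differentiation: the power is the exponential of sigma(r) (ln c + r ln v + ln l(v)).
    The terms in which a logarithm survives come from the slope of r and are absorbed by
    [phase_log1] and [phase_log2]; hence [C] depends on eps, but [C1] does not. *)
Lemma slope_phase (n r1 r2 A0 delta eta Lc Lr : R) :
  2 <= n -> 1 < r1 -> r1 <= r2 -> r2 < n -> 0 <= A0 ->
  1 <= delta -> 0 <= eta -> 1 < delta + eta -> 0 <= Lc -> 0 <= Lr ->
  exists2 C1, 0 < C1 & forall eps, 0 < eps -> exists2 C, 0 < C &
  forall (c r v : R -> R) x xi, 0 <= xi ->
  (\forall y \near x, [/\ 0 <= c y <= A0, r1 <= r y <= r2 & 0 <= v y]) ->
  slope_le c x Lc -> slope_le r x Lr -> slope_le v x xi ->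
  slope_le (fun y => phase (c y) (r y) delta eta (v y) `^ sigma_exp n (r y)) x
    (C1 * (slope_t n (c x) (r x) delta eta (v x) * xi + slope_x n (c x) (r x) delta eta (v x))
     + eps * phase_star n (c x) (r x) delta eta (v x) + C * v x).
Proof.
move=> n2 r11 r12 r2n A00 hd he hde Lc0 Lr0.
pose s2 := sigma_exp n r2; pose D := (n - 1) / (n - r2) ^+ 2.
have r2r : r1 <= r2 <= r2 by rewrite r12 lexx.
have s20 : 0 < s2 by rewrite (lt_trans ltr01)// (sigma_exp_gt1 r11 r2n r2r).
have nr2 : 0 < n - r2 by rewrite subr_gt0.
have D0 : 0 <= D by rewrite divr_ge0 ?exprn_ge0 ?(ltW nr2)//; clear -n2; lra.
pose C1 := s2 * (n + 1) + s2 * Lc + 1.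
have n0 : 0 < n by clear -n2; lra.
have C10 : 0 < C1.
  by rewrite /C1 ltr_wpDl// addr_ge0// mulr_ge0 ?(ltW s20)// addr_ge0// ltW.
exists C1 => // eps e0.
(* The weights of the two logarithmic terms add up to at most [Q], so that estimating each of them
   with eps / Q gives eps in total; the 1 keeps [Q] positive. *)
pose Q := D * Lr + s2 * Lr + 1.
have Q0 : 0 < Q := ltr_wpDl (addr_ge0 (mulr_ge0 D0 Lr0) (mulr_ge0 (ltW s20) Lr0)) ltr01.
have eQ : 0 < eps / Q by rewrite divr_gt0.
have [Ca Ca0 Ha] := phase_log1 A0 n2 r11 r2n hd he eQ.
have [Cb Cb0 Hb] := phase_log2 A0 n2 r11 r2n hd he eQ.
pose C := Q * (Ca + Cb); have C0 : 0 < C by rewrite mulr_gt0// addr_gt0.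
exists C => // c r v x xi xi0 near_x slc slr slv.
have [hc hr hv] := nbhs_singleton near_x.
have /andP[c0 cA] := hc.
have sx1 := sigma_exp_gt1 r11 r2n hr.
have cc := slope_le_cvg slc; have cr := slope_le_cvg slr; have cv := slope_le_cvg slv.
have rhs0 : 0 <= C1 * (slope_t n (c x) (r x) delta eta (v x) * xi +
    slope_x n (c x) (r x) delta eta (v x)) +
    eps * phase_star n (c x) (r x) delta eta (v x) + C * v x.
  apply: addr_ge0; last exact: mulr_ge0 (ltW C0) hv.
  apply: addr_ge0; last by apply: mulr_ge0; [exact: ltW|exact: powR_ge0].
  by apply: mulr_ge0; [exact: ltW|rewrite addr_ge0 ?mulr_ge0 ?powR_ge0].
(* At a zero of the coefficient or of v the phase grows at most linearly with the factor [K], so its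
   power, of exponent above 1, has slope 0. *)
have [/orP H0|/norP[cn vn]] := boolP ((c x == 0) || (v x == 0)).
  apply: (slope_le_mono rhs0).
  pose V := v x + 2; have V1 : 1 <= V by rewrite /V; clear -hv; lra.
  pose K := (Lc + 1) * (V `^ r2 * ell delta eta V) + Num.max 1 (A0 * ell delta eta 1) * (xi + 1).
  have K00 : 0 <= ell delta eta V by rewrite ell_ge0// (le_trans ler01).
  have r11r : r1 <= r1 <= r2 by rewrite lexx.
  apply: (@slope_le_powR0 _ _ _ _ K (sigma_exp n r1)).
  - by rewrite (sigma_exp_gt1 r11 r2n r11r).
  - by case: H0 => /eqP H0; rewrite /phase H0 ?mul0r// powR0 ?mulr0 ?mul0r// gt_eqF//; clear -hr r11; case/andP: hr => *; lra.
  - by rewrite gt_eqF// (lt_trans ltr01).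
  near=> y.
  have [hcy hry hvy] : [/\ 0 <= c y <= A0, r1 <= r y <= r2 & 0 <= v y] by near: y.
  have sy : sigma_exp n r1 <= sigma_exp n (r y) by exact: sigma_exp_ge hry.
  have /andP[cy0 cyA] := hcy.
  have p0 : 0 <= phase (c y) (r y) delta eta (v y) by exact: phase_ge0.
  split => //; apply/andP; split=> //.
  have m0 : 0 <= `|y - x| by [].
  case: H0 => /eqP H0.
    have cy : `|c y - c x| <= (Lc + 1) * `|y - x| by near: y; exact: slc.
    rewrite H0 subr0 ger0_norm// in cy.
    have vyV : v y <= V.
      have : `|v x - v y| < 1 by near: y; move/cvgrPdist_lt : cv; exact.
      by rewrite ltr_norml /V => /andP[+ _]; clear; lra.
    rewrite /phase -mulrA; apply: (@le_trans _ _ ((Lc + 1) * `|y - x| * (V `^ r2 * ell delta eta V))).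
      rewrite ler_pM ?mulr_ge0 ?powR_ge0 ?ell_ge0//.
      rewrite ler_pM ?powR_ge0 ?ell_ge0 ?ell_homo//.
      apply: (@le_trans _ _ (V `^ r y)).
        have V0 : 0 <= V := le_trans ler01 V1.
        by apply: ge0_ler_powR; rewrite ?nnegrE//; clear -hry r11; case/andP: hry => *; lra.
      by rewrite ler_powR//; case/andP: hry.
    rewrite mulrAC ler_wpM2r// lerDl mulr_ge0 ?addr_ge0// le_max ler01//.
  have vy : `|v y - v x| <= (xi + 1) * `|y - x| by near: y; exact: slv.
  rewrite H0 subr0 ger0_norm// in vy.
  have vy1 : v y <= 1.
    have : `|v x - v y| < 1 by near: y; move/cvgrPdist_lt : cv; exact.
    by rewrite H0 ltr_norml => /andP[+ _]; clear; lra.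
  have vy01 : 0 <= v y <= 1 by rewrite hvy.
  apply: (le_trans (phase_small_lin n2 r11 r2n hd he hry hcy vy01)).
  apply: (@le_trans _ _ (Num.max 1 (A0 * ell delta eta 1) * ((xi + 1) * `|y - x|))).
    by rewrite ler_wpM2l// le_max ler01.
  by rewrite mulrA ler_wpM2r// lerDr !mulr_ge0 ?powR_ge0 ?addr_ge0.
have cp : 0 < c x by rewrite lt0r cn.
have vp : 0 < v x by rewrite lt0r vn.
have lp : 0 < ell delta eta (v x) by exact: ell_gt0.
pose lH y := ln (c y) + r y * ln (v y) + ln (ell delta eta (v y)).
have cny : \forall y \near x, 0 < c y.
  move/cvgrPdist_lt : cc => /(_ _ cp); apply: filterS => y.
  by rewrite ltr_norml => /andP[_]; clear; lra.
have vny : \forall y \near x, 0 < v y.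
  move/cvgrPdist_lt : cv => /(_ _ vp); apply: filterS => y.
  by rewrite ltr_norml => /andP[_]; clear; lra.
have lHE y : 0 < c y -> 0 < v y -> ln (phase (c y) (r y) delta eta (v y)) = lH y.
  move=> cy vy; have ly : 0 < ell delta eta (v y) by exact: ell_gt0.
  by rewrite /phase lnM ?posrE ?mulr_gt0 ?powR_gt0// lnM ?posrE ?powR_gt0// ln_powR.
have Hp y : 0 < c y -> 0 < v y -> 0 < phase (c y) (r y) delta eta (v y).
  by move=> cy vy; rewrite /phase !mulr_gt0 ?powR_gt0// ell_gt0.
apply: (@slope_le_near _ (expR \o (fun y => sigma_exp n (r y) * lH y))).
  apply: filterS2 cny vny => y cy vy /=.
  by rewrite /powR gt_eqF ?Hp// lHE.
have rx0 : 0 <= r x by clear -hr r11; case/andP: hr => *; lra.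
have rxn : r x < n by clear -hr r2n; case/andP: hr => *; lra.
pose KL := Lc / c x + (`|r x| * (xi / v x) + `|ln (v x)| * Lr) + xi / v x.
have ixv : 0 <= xi / v x by rewrite divr_ge0.
have KL0 : 0 <= KL.
  rewrite /KL addr_ge0// addr_ge0 ?divr_ge0// addr_ge0//.
    exact: mulr_ge0.
  exact: mulr_ge0.
have slH : slope_le lH x KL.
  apply: slope_leD; last first.
    have hl := is_derive_ell hd he hv.
    have := slope_le_ln _ _ (slope_le_comp xi0 hl slv).
    move=> /(_ _ lp); set q := (`|_| * xi / _) => Hq.
    apply: (slope_le_mono _ (Hq _)); last by rewrite mulr_ge0.
    rewrite /q ler_pdivrMr// mulrAC ler_pdivlMr// -mulrA.
    have := ell_derive_le hd he vp.
    rewrite ger0_norm ?divr_ge0 ?addr_ge0 ?mulr_ge0//; last by rewrite (le_trans ler01).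
    by move=> h; rewrite mulrCA ler_wpM2l// mulrC.
  apply: slope_leD; first exact: slope_le_ln.
  apply: slope_leM => //; exact: slope_le_ln.
have sls : slope_le (fun y => sigma_exp n (r y)) x (D * Lr).
  apply: slope_le_mono (slope_le_comp Lr0 (is_derive_sigma_exp rxn) slr).
  have nrx : 0 < n - r x by rewrite subr_gt0.
  rewrite ger0_norm ?divr_ge0 ?exprn_ge0 ?(ltW nrx)//; last by clear -n2; lra.
  rewrite ler_wpM2r// /D ler_wpM2l//; first by clear -n2; lra.
  rewrite lef_pV2 ?posrE ?exprn_gt0// lerXn2r ?nnegrE ?(ltW nr2) ?(ltW nrx)//.
  by rewrite lerD2l lerN2; case/andP: hr.
have DLr : 0 <= D * Lr by rewrite mulr_ge0.
have slw := slope_le_comp (addr_ge0 (mulr_ge0 (normr_ge0 _) KL0) (mulr_ge0 (normr_ge0 _) DLr))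
  (is_derive_expR _) (slope_leM DLr KL0 sls slH).
apply: slope_le_mono slw.
rewrite ger0_norm ?expR_ge0//.
have wE : expR (sigma_exp n (r x) * lH x) = phase (c x) (r x) delta eta (v x) `^ sigma_exp n (r x).
  by rewrite /powR gt_eqF ?Hp// lHE.
rewrite wE.
set w := _ `^ _; have w0 : 0 <= w by exact: powR_ge0.
have slope_tE' : slope_t n (c x) (r x) delta eta (v x) = w / v x.
  by rewrite (slope_tE _ hd he).
have slope_xE : slope_x n (c x) (r x) delta eta (v x) = w / c x.
  rewrite /w /slope_x /phase -mulrA (@powRM _ (c x)) ?mulr_ge0 ?powR_ge0 ?(ltW lp)//.
  rewrite powRB ?powRr1//; last by apply/implyP => _.
  by rewrite mulrAC.
rewrite slope_tE' slope_xE.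
have a1 := Ha _ _ _ hr hc vp (Hp _ cp vp); have b1 := Hb _ _ _ hr hc vp (Hp _ cp vp).
rewrite lHE// -/w in a1; rewrite -/w in b1.
set G := phase_star _ _ _ _ _ _ in a1 b1 *; have G0 : 0 <= G by exact: powR_ge0.
have sx2 : sigma_exp n (r x) <= s2 by exact: sigma_exp_le hr.
have sx0 : 0 <= sigma_exp n (r x) by rewrite ltW// (lt_trans ltr01).
rewrite (ger0_norm sx0).
apply: (@le_trans _ _ (w * (s2 * KL + `|lH x| * (D * Lr)))).
  by rewrite ler_wpM2l// lerD2r ler_wpM2r.
pose P1 := w / v x * xi; pose P2 := w / c x; pose P3 := w * `|ln (v x)|; pose P4 := w * `|lH x|.
have P10 : 0 <= P1 by rewrite mulr_ge0 ?divr_ge0.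
have P20 : 0 <= P2 by rewrite divr_ge0.
have P30 : 0 <= P3 by rewrite mulr_ge0.
have P40 : 0 <= P4 by rewrite mulr_ge0.
rewrite /KL (ger0_norm rx0).
have -> : w * (s2 * (Lc / c x + (r x * (xi / v x) + `|ln (v x)| * Lr) + xi / v x) + `|lH x| * (D * Lr)) =
    s2 * Lc * P2 + s2 * (r x + 1) * P1 + s2 * Lr * P3 + D * Lr * P4.
  by rewrite /P1 /P2 /P3 /P4; ring.
rewrite -/P1 -/P2.
have t12 : s2 * Lc * P2 + s2 * (r x + 1) * P1 <= C1 * (P1 + P2).
  have h2 : s2 * Lc * P2 <= C1 * P2.
    rewrite ler_wpM2r// /C1.
    have : 0 <= s2 * (n + 1) by rewrite mulr_ge0 ?(ltW s20)// addr_ge0// ltW.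
    by clear; lra.
  have h1 : s2 * (r x + 1) * P1 <= C1 * P1.
    rewrite ler_wpM2r// /C1.
    have : s2 * (r x + 1) <= s2 * (n + 1) by rewrite ler_wpM2l ?(ltW s20)// lerD2r ltW.
    have : 0 <= s2 * Lc by rewrite mulr_ge0 ?(ltW s20).
    by clear; lra.
  by rewrite mulrDr; clear -h1 h2; lra.
have t34 : s2 * Lr * P3 + D * Lr * P4 <= eps * G + C * v x.
  pose Z := eps / Q * G + (Ca + Cb) * v x.
  have p3Z : P3 <= Z.
    by apply: (le_trans b1); rewrite /Z lerD2l ler_wpM2r// lerDr ltW.
  have p4Z : P4 <= Z.
    by apply: (le_trans a1); rewrite /Z lerD2l ler_wpM2r// lerDl ltW.
  have Z0 := le_trans P30 p3Z.
  have -> : eps * G + C * v x = Q * Z by rewrite /Z /C; clear -Q0; field; rewrite gt_eqF.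
  apply: (@le_trans _ _ (s2 * Lr * Z + D * Lr * Z)).
    by rewrite lerD// ler_wpM2l// mulr_ge0// ltW.
  by rewrite /Q -mulrDl ler_wpM2r//; clear; lra.
by clear -t12 t34; lra.
Unshelve. all: by end_near. Qed.

End slope_phase.

(** * Sobolev inequality for truncations *)

Section variable_exponent.
Context {R : realType}.

Lemma powR_le_bound (x Q s s2 : R) : 0 <= x <= Q -> 1 <= Q -> 0 <= s <= s2 ->
  x `^ s <= Q `^ s2.
Proof.
move=> /andP[x0 xQ] Q1 /andP[s0 ss]; have Q0 := le_trans ler01 Q1.
apply: (@le_trans _ _ (Q `^ s)); last by rewrite ler_powR.
by apply: ge0_ler_powR; rewrite ?nnegrE.
Qed.

Lemma measurable_powRs d (T : measurableType d) (D : set T) (f s : T -> R) :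
  measurable D -> measurable_fun D f -> measurable_fun D s ->
  measurable_fun D (fun x => f x `^ s x).
Proof.
move=> mD mf ms; rewrite /powR; apply: measurable_fun_if => //.
- exact: measurable_fun_eqr.
- apply: measurableT_comp => //.
  by apply: (@measurable_funS _ _ _ _ D) => //; exact: measurable_fun_eqr.
- apply: (@measurable_funS _ _ _ _ D) => //.
  apply: measurableT_comp; first exact: measurable_expR.
  by apply: measurable_funM => //; apply: measurableT_comp mf; exact: measurable_ln.
Qed.

Lemma measurable_funV d (T : measurableType d) (D : set T) (f : T -> R) :
  measurable D -> measurable_fun D f -> (forall x, D x -> 0 < f x) ->
  measurable_fun D (fun x => (f x)^-1).
Proof.
move=> mD mf f0; apply: (eq_measurable_fun (fun x => f x `^ (-1))).
  by move=> x; rewrite inE => /f0/ltW fx; rewrite powR_inv1.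
exact: measurable_powRs.
Qed.

Variables (n r1 r2 A0 delta eta : R).
Hypotheses (n2 : 2 <= n) (r11 : 1 < r1) (r2n : r2 < n) (A00 : 0 <= A0).
Hypotheses (hdelta : 1 <= delta) (heta : 0 <= eta).

Local Notation okc c := (0 <= c <= A0).
Local Notation okr r := (r1 <= r <= r2).

(* The bound for the slopes of [phase ^ sigma_exp] given by [slope_phase]. *)
Definition majorant C1 eps C c r t y : R :=
  C1 * (slope_t n c r delta eta t * y + slope_x n c r delta eta t)
  + eps * phase_star n c r delta eta t + C * t.

Lemma majorant_ge0 C1 eps C c r t y : 0 <= C1 -> 0 <= eps -> 0 <= C -> 0 <= t -> 0 <= y ->
  0 <= majorant C1 eps C c r t y.
Proof.
move=> *; rewrite addr_ge0 ?mulr_ge0//.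
by rewrite addr_ge0 ?mulr_ge0 ?powR_ge0// addr_ge0 ?mulr_ge0 ?powR_ge0.
Qed.

Lemma majorant0 C1 eps C c r y : okr r -> majorant C1 eps C c r 0 y = 0.
Proof.
move=> hr; have s1 := sigma_exp_gt1 r11 r2n hr; have t1 := tau_exp_gt1 r11 r2n hr.
have rx1 : 1 < r by case/andP: hr => /(lt_le_trans r11).
have rx0 : 0 `^ r = 0 :> R by rewrite powR0// gt_eqF// (lt_trans ltr01).
rewrite /majorant /slope_t /slope_x /phase_star /phase rx0 mulr0 !mul0r.
rewrite (@powR0 _ (r * sigma_exp n r - 1)); last by rewrite gt_eqF// subr_gt0; nra.
rewrite (@powR0 _ (sigma_exp n r)); last by rewrite gt_eqF// (lt_trans ltr01).
rewrite (@powR0 _ (tau_exp n r)); last by rewrite gt_eqF// (lt_trans ltr01).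
by rewrite !(mulr0, mul0r, addr0).
Qed.

Section cvg.
Variables (T : Type) (F : set_system T) (FF : ProperFilter F) (c r v : T -> R) (c0 r0 v0 : R).
Hypotheses (near_ok : \forall z \near F, [/\ okc (c z), okr (r z) & 0 <= v z]).
Hypotheses (okr0 : okr r0) (v00 : 0 <= v0).
Hypotheses (cc : c @ F --> c0) (cr : r @ F --> r0) (cv : v @ F --> v0).

Let cl : (fun z => ell delta eta (v z)) @ F --> ell delta eta v0.
Proof.
apply: (@continuous_cvg _ _ _ _ _ _ (fun t => ell delta eta t)) => //.
rewrite /ell; apply: continuous_comp.
  by apply: continuousD; [exact: cst_continuous|apply: continuousM; [exact: cst_continuous|]].
apply: continuous_ln; rewrite (lt_le_trans ltr01)//; exact: ell_arg_ge1.
Qed.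

Let rn : n - r0 != 0.
Proof. by rewrite gt_eqF// subr_gt0; case/andP: okr0 => _ /le_lt_trans; exact. Qed.

Let cs : (fun z => sigma_exp n (r z)) @ F --> sigma_exp n r0.
Proof.
apply: cvgM; first exact: cvg_cst.
by apply: cvgV => //; apply: cvgB => //; exact: cvg_cst.
Qed.

Let ct : (fun z => tau_exp n (r z)) @ F --> tau_exp n r0.
Proof.
apply: cvgM; first exact: cvg_cst.
by apply: cvgV => //; apply: cvgB => //; exact: cvg_cst.
Qed.

Let s1 : 1 < sigma_exp n r0. Proof. exact: (sigma_exp_gt1 r11 r2n okr0). Qed.
Let t1 : 1 < tau_exp n r0. Proof. exact: (tau_exp_gt1 r11 r2n okr0). Qed.
Let r01 : 1 < r0. Proof. by case/andP: okr0 => /(lt_le_trans r11). Qed.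

Let cvr : (fun z => v z `^ r z) @ F --> v0 `^ r0.
Proof.
apply: cvg_powR => //; first exact: lt_trans r01.
by apply: filterS near_ok => z [].
Qed.

Lemma cvg_phase : (fun z => phase (c z) (r z) delta eta (v z)) @ F --> phase c0 r0 delta eta v0.
Proof. by rewrite /phase; apply: cvgM => //; exact: cvgM. Qed.

Lemma cvg_phase_sigma :
  (fun z => phase (c z) (r z) delta eta (v z) `^ sigma_exp n (r z)) @ F -->
  phase c0 r0 delta eta v0 `^ sigma_exp n r0.
Proof.
apply: cvg_powR => //; first exact: lt_trans s1.
  by apply: filterS near_ok => z [/andP[? _] _ ?]; exact: phase_ge0.
exact: cvg_phase.
Qed.

Lemma cvg_phase_star :
  (fun z => phase_star n (c z) (r z) delta eta (v z)) @ F --> phase_star n c0 r0 delta eta v0.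
Proof.
apply: cvg_powR => //; first exact: lt_trans t1.
  by apply: filterS near_ok => z [/andP[? _] _ ?]; exact: phase_ge0.
exact: cvg_phase.
Qed.

Lemma cvg_slope_t :
  (fun z => slope_t n (c z) (r z) delta eta (v z)) @ F --> slope_t n c0 r0 delta eta v0.
Proof.
rewrite /slope_t; apply: cvgM; apply: cvg_powR => //.
- exact: lt_trans s1.
- by apply: filterS near_ok => z [/andP[? _] _ ?]; rewrite mulr_ge0 ?ell_ge0.
- exact: cvgM.
- by rewrite subr_gt0; have h1 := s1; have h2 := r01; nra.
- by apply: filterS near_ok => z [].
- by apply: cvgB; [exact: cvgM|exact: cvg_cst].
Qed.

Lemma cvg_slope_x :
  (fun z => slope_x n (c z) (r z) delta eta (v z)) @ F --> slope_x n c0 r0 delta eta v0.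
Proof.
rewrite /slope_x; apply: cvgM; apply: cvg_powR => //.
- by rewrite subr_gt0.
- by apply: filterS near_ok => z [/andP[]].
- by apply: cvgB => //; exact: cvg_cst.
- exact: lt_trans s1.
- by apply: filterS near_ok => z [_ _ ?]; rewrite mulr_ge0 ?powR_ge0 ?ell_ge0.
- exact: cvgM.
Qed.

Lemma cvg_majorant C1 eps C (y : T -> R) y0 : y @ F --> y0 ->
  (fun z => majorant C1 eps C (c z) (r z) (v z) (y z)) @ F --> majorant C1 eps C c0 r0 v0 y0.
Proof.
move=> cy.
have c1 := cvg_slope_t; have c2 := cvg_slope_x; have c3 := cvg_phase_star.
apply: cvgD; last by apply: cvgM => //; exact: cvg_cst.
apply: cvgD; last by apply: cvgM => //; exact: cvg_cst.
apply: cvgM; first exact: cvg_cst.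
by apply: cvgD => //; exact: cvgM.
Qed.

End cvg.

Section bound.
Variable M : R.
Let V := Num.max M 1.
Let Q := (1 + A0) * (1 + ell delta eta V).

Let V1 : 1 <= V. Proof. by rewrite le_max lexx orbT. Qed.
Let V0 : 0 <= V. Proof. exact: le_trans V1. Qed.
Let l0 : 0 <= ell delta eta V. Proof. exact: ell_ge0. Qed.
Let Q1 : 1 <= Q.
Proof. by have h1 := l0; have h2 := A00; rewrite /Q; nra. Qed.

Let cl_le c t : okc c -> 0 <= t <= M -> 0 <= c * ell delta eta t <= Q.
Proof.
move=> /andP[c0 cA] /andP[t0 tM].
have lt0 : 0 <= ell delta eta t by exact: ell_ge0.
have ltV : ell delta eta t <= ell delta eta V by rewrite ell_homo// le_max tM.
rewrite mulr_ge0//=; apply: ler_pM => //; first by apply: (le_trans cA); rewrite lerDr.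
by apply: (le_trans ltV); rewrite lerDr.
Qed.

(** A truncation at height [M] thus makes all these quantities bounded uniformly in the coefficient
    and the exponent, which supplies the dominating functions for passages to the limit. *)
Lemma phase_bounded : exists2 K, 0 < K & forall c r t, okc c -> okr r -> 0 <= t <= M ->
  [/\ phase c r delta eta t <= K, phase_star n c r delta eta t <= K,
      slope_t n c r delta eta t <= K & slope_x n c r delta eta t <= K].
Proof.
pose s2 := sigma_exp n r2; pose t2 := tau_exp n r2.
pose B := Q * V `^ r2; pose A1 := 1 + A0.
have Q0 : 0 <= Q := le_trans ler01 Q1.
have B0 : 0 <= B by rewrite mulr_ge0 ?powR_ge0.
pose K1 := B `^ t2; pose K2 := Q `^ s2 * V `^ (r2 * s2); pose K3 := A1 `^ s2 * B `^ s2.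
have K10 : 0 <= K1 by exact: powR_ge0.
have K20 : 0 <= K2 by rewrite mulr_ge0 ?powR_ge0.
have K30 : 0 <= K3 by rewrite mulr_ge0 ?powR_ge0.
exists (1 + B + K1 + K2 + K3); first by lra.
move=> c r t hc hr ht.
have s1 := sigma_exp_gt1 r11 r2n hr; have t1 := tau_exp_gt1 r11 r2n hr.
have s12 : sigma_exp n r <= s2 := sigma_exp_le n2 r2n hr.
have t12 : tau_exp n r <= t2 := tau_exp_le n2 r2n hr.
have [c0 cA] := andP hc; have [t0 tM] := andP ht; have [rr1 rr2] := andP hr.
have rr0 : 0 <= r by rewrite (le_trans ler01)// (le_trans (ltW r11)).
have tV : 0 <= t <= V by rewrite t0 le_max tM.
have trV : t `^ r <= V `^ r2 by rewrite powR_le_bound// rr0.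
have Vr1 : 1 <= V `^ r2 by rewrite -[leLHS](powRr0 V) ler_powR// (le_trans rr0).
have B1 : 1 <= B by rewrite -[leLHS]mulr1 /B ler_pM.
have hB : 0 <= phase c r delta eta t <= B.
  rewrite phase_ge0//= /phase mulrAC /B; case/andP: (cl_le hc ht) => ? ?.
  by rewrite ler_pM ?powR_ge0.
have hlB : 0 <= t `^ r * ell delta eta t <= B.
  have lt0 : 0 <= ell delta eta t by exact: ell_ge0.
  rewrite mulr_ge0 ?powR_ge0//= /B mulrC ler_pM ?powR_ge0//.
  have ltV : ell delta eta t <= ell delta eta V by rewrite ell_homo//; case/andP: tV.
  by have h1 := l0; have h2 := A00; rewrite /Q; nra.
have hs : 0 <= sigma_exp n r <= s2 by rewrite s12 (le_trans ler01 (ltW s1)).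
have p1 : phase_star n c r delta eta t <= K1.
  by rewrite powR_le_bound// t12 (le_trans ler01 (ltW t1)).
have p2 : slope_t n c r delta eta t <= K2.
  apply: ler_pM; rewrite ?powR_ge0//; first by rewrite powR_le_bound// cl_le.
  rewrite powR_le_bound//; apply/andP; split; first by have h := r11; nra.
  rewrite (@le_trans _ _ (r * sigma_exp n r))//; first by rewrite gerBl.
  by apply: ler_pM => //; case/andP: hs.
have p3 : slope_x n c r delta eta t <= K3.
  have A11 : 1 <= A1 by rewrite lerDl.
  apply: ler_pM; rewrite ?powR_ge0//; last by rewrite powR_le_bound.
  rewrite powR_le_bound//; first by rewrite c0 (le_trans cA)// lerDr.
  by rewrite subr_ge0 (ltW s1)/= (le_trans _ s12)// gerBl.
have /andP[_ hB'] := hB.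
by split; lra.
Qed.
End bound.

Section measurable.
Context d (T : measurableType d) (D : set T) (mD : measurable D) (c r v : T -> R).
Hypotheses (mc : measurable_fun D c) (mr : measurable_fun D r) (mv : measurable_fun D v).
Hypotheses (hr : forall x, D x -> okr (r x)).

Lemma measurable_ell : measurable_fun D (fun x => ell delta eta (v x)).
Proof.
rewrite /ell; apply: (measurableT_comp (@measurable_ln R)).
by apply: measurable_funD => //; exact: measurable_funM.
Qed.

Lemma measurable_phase : measurable_fun D (fun x => phase (c x) (r x) delta eta (v x)).
Proof.
apply: measurable_funM; last exact: measurable_ell.
by apply: measurable_funM => //; exact: measurable_powRs.
Qed.

Let mnr : measurable_fun D (fun x => (n - r x)^-1).
Proof.
apply: measurable_funV => //; first exact: measurable_funB.
by move=> x /hr /andP[_]; rewrite subr_gt0 => /le_lt_trans; exact.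
Qed.

Let ms : measurable_fun D (fun x => sigma_exp n (r x)).
Proof. exact: measurable_funM. Qed.

Let mt : measurable_fun D (fun x => tau_exp n (r x)).
Proof. exact: measurable_funM. Qed.

Lemma measurable_phase_star :
  measurable_fun D (fun x => phase_star n (c x) (r x) delta eta (v x)).
Proof. by apply: measurable_powRs => //; exact: measurable_phase. Qed.

Lemma measurable_slope_t :
  measurable_fun D (fun x => slope_t n (c x) (r x) delta eta (v x)).
Proof.
apply: measurable_funM; apply: measurable_powRs => //.
  by apply: measurable_funM => //; exact: measurable_ell.
by apply: measurable_funB => //; exact: measurable_funM.
Qed.

Lemma measurable_slope_x :
  measurable_fun D (fun x => slope_x n (c x) (r x) delta eta (v x)).
Proof.
apply: measurable_funM; apply: measurable_powRs => //.
  exact: measurable_funB.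
apply: measurable_funM; last exact: measurable_ell.
exact: measurable_powRs.
Qed.

Lemma measurable_majorant C1 eps C (y : T -> R) : measurable_fun D y ->
  measurable_fun D (fun x => majorant C1 eps C (c x) (r x) (v x) (y x)).
Proof.
move=> my; have h1 := measurable_phase_star; have h2 := measurable_slope_t.
have h3 := measurable_slope_x.
apply: measurable_funD; last exact: measurable_funM.
apply: measurable_funD; last exact: measurable_funM.
apply: measurable_funM => //; apply: measurable_funD => //.
exact: measurable_funM.
Qed.

End measurable.

End variable_exponent.

Section trunc.
Context {R : realType}.
Implicit Types (k M t s : R).

Definition trunc k M t : R := Num.min (Num.max (`|t| - k) 0) M.

Lemma trunc_ge0 k M t : 0 <= M -> 0 <= trunc k M t.
Proof. by move=> M0; rewrite le_min M0 le_max lexx orbT. Qed.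

Lemma trunc_le k M t : trunc k M t <= M.
Proof. by rewrite ge_min lexx orbT. Qed.

Lemma trunc_le_norm k M t : 0 <= k -> trunc k M t <= `|t|.
Proof. by move=> k0; rewrite /trunc ge_min ge_max normr_ge0 gerBl k0. Qed.

Lemma trunc_eq0 k M t : 0 <= M -> `|t| <= k -> trunc k M t = 0.
Proof.
move=> M0 tk; rewrite /trunc max_r ?subr_le0//.
by rewrite min_l.
Qed.

Lemma trunc_lip k M s t : `|trunc k M s - trunc k M t| <= `|s - t|.
Proof.
have := ler_dist_dist s t; rewrite /trunc; move: (`|s|) (`|t|) (`|s - t|) => x y d.
rewrite ler_norml => /andP[h1 h2]; rewrite ler_norml !minEle !maxEle.
case: (leP (x - k) 0) => ?; case: (leP (y - k) 0) => ?;
  repeat (match goal with |- context [_ <= M] => case: (leP _ M) => ? end);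
  by apply/andP; split; lra.
Qed.

Lemma continuous_trunc k M : continuous (trunc k M).
Proof.
move=> t; apply: (@continuous_min _ _ (fun t => Num.max (`|t| - k) 0) (cst M)).
  apply: (@continuous_max _ _ (fun t => `|t| - k) (cst 0)); last exact: cst_continuous.
  by apply: continuousB; [exact: norm_continuous|exact: cst_continuous].
exact: cst_continuous.
Qed.

End trunc.

Section enorm.
Context {R : realType} {N : nat}.
Implicit Types u v : 'rV[R]_N.

Lemma dotp_ge0 v : 0 <= dotp v v.
Proof. by apply: sumr_ge0 => i _; rewrite -expr2 sqr_ge0. Qed.

Lemma enorm_ge0 v : 0 <= enorm v. Proof. exact: sqrtr_ge0. Qed.

Lemma coord_le_enorm v i : `|v ord0 i| <= enorm v.
Proof.
rewrite -sqrtr_sqr /enorm ler_wsqrtr// /dotp (bigD1 i)//= -expr2 lerDl.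
by apply: sumr_ge0 => j _; rewrite -expr2 sqr_ge0.
Qed.

Lemma sqr_enorm v : enorm v ^+ 2 = dotp v v.
Proof. by rewrite sqr_sqrtr ?dotp_ge0. Qed.

Lemma dotp_le_enorm u v : dotp u v <= enorm u * enorm v.
Proof.
have z (w w' : 'rV[R]_N) : enorm w = 0 -> dotp w w' = 0 /\ dotp w' w = 0.
  move=> w0; have wi i : w ord0 i = 0.
    by apply/eqP; rewrite -normr_eq0 eq_le normr_ge0 -w0 coord_le_enorm.
  by split; apply: big1 => i _; rewrite wi ?mul0r ?mulr0.
have [/eqP u0|u0] := boolP (enorm u == 0); first by rewrite (z _ _ u0).1 u0 mul0r.
have [/eqP v0|v0] := boolP (enorm v == 0); first by rewrite (z _ _ v0).2 v0 mulr0.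
set a := enorm u in u0 *; set b := enorm v in v0 *.
have a0 : 0 < a by rewrite lt0r u0 enorm_ge0.
have b0 : 0 < b by rewrite lt0r v0 enorm_ge0.
have : 0 <= \sum_i (b * u ord0 i - a * v ord0 i) ^+ 2 by apply: sumr_ge0 => i _; exact: sqr_ge0.
have -> : \sum_i (b * u ord0 i - a * v ord0 i) ^+ 2 =
    b ^+ 2 * dotp u u - 2 * (a * b) * dotp u v + a ^+ 2 * dotp v v.
  rewrite /dotp !mulr_sumr -sumrB -big_split; apply: eq_bigr => i _ /=; ring.
rewrite -!sqr_enorm -/a -/b => h.
have ab0 : 0 < a * b by rewrite mulr_gt0.
rewrite -(ler_pM2l ab0); lra.
Qed.

Lemma ler_enormD u v : enorm (u + v) <= enorm u + enorm v.
Proof.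
rewrite -(@ler_pXn2r _ 2) ?nnegrE ?addr_ge0 ?enorm_ge0//.
rewrite sqrrD !sqr_enorm.
have -> : dotp (u + v) (u + v) = dotp u u + 2 * dotp u v + dotp v v.
  rewrite /dotp mulr_sumr -!big_split; apply: eq_bigr => i _ /=; rewrite !mxE; ring.
by rewrite lerD2r lerD2l -[leRHS]mulr_natl ler_pM2l// dotp_le_enorm.
Qed.

Lemma enormN u : enorm (- u) = enorm u.
Proof. by congr Num.sqrt; apply: eq_bigr => i _; rewrite !mxE mulrNN. Qed.

Lemma continuous_enorm (T : topologicalType) (f : T -> 'rV[R]_N) (x : T) :
  (forall i, {for x, continuous (fun y => f y ord0 i)}) ->
  {for x, continuous (fun y => enorm (f y))}.
Proof.
move=> cf; apply: (@continuous_comp _ _ _ (fun y => dotp (f y) (f y)) (@Num.sqrt R)); last first.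
  exact: sqrt_continuous.
rewrite /dotp; apply: cvg_big => [|i _]; first exact: add_continuous.
by apply: continuousM; exact: cf.
Qed.

Lemma measurable_enorm d (T : measurableType d) (D : set T) (f : T -> 'rV[R]_N) :
  (forall i, measurable_fun D (fun y => f y ord0 i)) ->
  measurable_fun D (fun y => enorm (f y)).
Proof.
move=> mf; rewrite /enorm; apply: measurableT_comp.
  exact: (continuous_measurable_fun (@sqrt_continuous R)).
by rewrite /dotp; apply: measurable_sum => i; exact: measurable_funM.
Qed.

Lemma measurable_enormB d (T : measurableType d) (D : set T) (f g : T -> 'rV[R]_N) :
  (forall i, measurable_fun D (fun y => f y ord0 i)) ->
  (forall i, measurable_fun D (fun y => g y ord0 i)) ->
  measurable_fun D (fun y => enorm (f y - g y)).
Proof.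
move=> mf mg; apply: measurable_enorm => i.
rewrite (_ : (fun y => _) = (fun y => f y ord0 i - g y ord0 i)).
  exact: measurable_funB.
by apply/funext => y; rewrite !mxE.
Qed.

End enorm.

(** * Gagliardo's inequality for phases of truncated C^1 functions *)

Section sobolev_phase.
Context {R : realType} {N : nat}.
Variable Omega : set 'rV[R]_N.
Hypotheses (oOmega : open Omega) (bOmega : bounded_set Omega) (N1 : (1 < N)%N).
Variables (r1 r2 A0 delta eta L : R) (c r : 'rV[R]_N -> R).
Let n : R := N%:R.
Hypotheses (r11 : 1 < r1) (r12 : r1 <= r2) (r2n : r2 < n) (A00 : 0 <= A0) (L0 : 0 <= L).
Hypotheses (hdelta : 1 <= delta) (heta : 0 <= eta) (hde : 1 < delta + eta).
Hypotheses (hc : forall x, Omega x -> 0 <= c x <= A0) (hr : forall x, Omega x -> r1 <= r x <= r2).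
Hypotheses (lc : forall x y, Omega x -> Omega y -> `|c x - c y| <= L * `|x - y|).
Hypotheses (lr : forall x y, Omega x -> Omega y -> `|r x - r y| <= L * `|x - y|).
Let n2 : 2 <= n. Proof. by rewrite ler_nat. Qed.

Lemma lipschitz_open_continuous (f : 'rV[R]_N -> R) x : Omega x ->
  (forall x y, Omega x -> Omega y -> `|f x - f y| <= L * `|x - y|) ->
  {for x, continuous f}.
Proof.
move=> Ox lf; apply/(@cvgrPdist_lt _ _ _ (nbhs x)) => e e0.
have L10 : 0 < L + 1 by rewrite ltr_wpDl.
near=> y.
apply: (@le_lt_trans _ _ ((L + 1) * `|x - y|)).
  apply: (@le_trans _ _ (L * `|x - y|)); last by rewrite ler_wpM2r// lerDl.
  by apply: lf => //; near: y; exact: open_nbhs_nbhs.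
rewrite mulrC -ltr_pdivlMr//; near: y.
apply/nbhs_ballP; exists (e / (L + 1)) => /=; first by rewrite divr_gt0.
by move=> y; rewrite -ball_normE.
Unshelve. all: by end_near. Qed.

(** [sobolev_slope] is applied to the phase of the truncation to the power sigma, extended by zero.
    Along a coordinate line [slope_phase] asks only for a slope of the truncation, and the norm of
    the gradient is one because truncation is 1-Lipschitz. *)
Lemma sobolev_phase_C1 : exists2 C1, 0 < C1 & forall eps, 0 < eps -> exists2 C, 0 < C &
  forall k M phi, 0 <= k -> 0 <= M -> C1_0 Omega phi ->
  (\int[leb]_(x in Omega)
     (phase_star n (c x) (r x) delta eta (trunc k M (phi x)))%:E <=
   (\int[leb]_(x in Omega)
     (majorant n delta eta C1 eps C (c x) (r x) (trunc k M (phi x)) (enorm (grad phi x)))%:E) `^ (n / (n - 1)))%E.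
Proof.
have [C1 C10 H1] := slope_phase n2 r11 r12 r2n A00 hdelta heta hde L0 L0.
exists C1 => // eps e0; have [C C0 HC] := H1 _ e0; exists C => // k M phi k0 M0 Cphi.
have [cphi dphi cdphi phi0] := Cphi.
pose v x := trunc k M (phi x).
have v0 x : 0 <= v x by exact: trunc_ge0.
have cv : continuous v.
  move=> x; apply: (@continuous_comp _ _ _ phi (trunc k M)); first exact: cphi.
  exact: continuous_trunc.
have v_out x : ~ Omega x -> \forall y \near x, v y = 0.
  by move=> /phi0; apply: filterS => y y0; rewrite /v y0 trunc_eq0// normr0.
pose w0 x := phase (c x) (r x) delta eta (v x) `^ sigma_exp n (r x).
pose h0 x := majorant n delta eta C1 eps C (c x) (r x) (v x) (enorm (grad phi x)).
have w00 x : Omega x -> v x = 0 -> w0 x = 0.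
  move=> Ox vx; have rx := hr Ox; have [rx1 _] := andP rx.
  rewrite /w0 vx /phase powR0 ?mulr0 ?mul0r ?powR0// gt_eqF//.
    by rewrite (lt_trans ltr01)//; exact: (sigma_exp_gt1 r11 r2n rx).
  by rewrite (lt_le_trans _ rx1)// (lt_trans ltr01).
have h00 x : Omega x -> v x = 0 -> h0 x = 0 by move=> Ox vx; rewrite /h0 vx (majorant0 delta eta r11 r2n _ _ _ _ _ (hr Ox)).
(* Coefficients and exponents are controlled inside Omega only. The truncation vanishes near every
   outside point, which makes the extension by zero continuous across the boundary. *)
have patch_cvg (f : 'rV[R]_N -> R) (x : 'rV[R]_N) : (forall x, Omega x -> v x = 0 -> f x = 0) ->
    (forall x, Omega x -> {for x, continuous f}) -> {for x, continuous (f \_ Omega)}.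
  move=> f0 cf; have [Ox|Ox] := pselect (Omega x).
    have E : \forall y \near x, f y = (f \_ Omega) y.
      have := open_nbhs_nbhs (conj oOmega Ox).
      by apply: filterS => y Oy; rewrite patchE mem_set.
    rewrite /prop_for /continuous_at patchE mem_set//.
    exact: cvg_trans (near_eq_cvg E) (cf _ Ox).
  have E : \forall y \near x, 0 = (f \_ Omega) y.
    apply: filterS (v_out _ Ox) => y vy; rewrite patchE.
    by case: ifPn => //; rewrite inE => Oy; rewrite f0.
  rewrite /prop_for /continuous_at patchE memNset//.
  exact: cvg_trans (near_eq_cvg E) (cvg_cst _).
have near_ok x : Omega x -> \forall z \near x,
    [/\ 0 <= c z <= A0, r1 <= r z <= r2 & 0 <= v z].
  move=> Ox; have := open_nbhs_nbhs (conj oOmega Ox).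
  by apply: filterS => y Oy; split; [exact: hc|exact: hr|].
have cc x : Omega x -> {for x, continuous c} by move=> Ox; exact: lipschitz_open_continuous.
have cr x : Omega x -> {for x, continuous r} by move=> Ox; exact: lipschitz_open_continuous.
have cw : continuous (w0 \_ Omega).
  move=> x; apply: patch_cvg w00 _ => {}x Ox.
  exact: (cvg_phase_sigma r11 r2n hdelta heta _ (near_ok _ Ox) (hr Ox) (v0 x)
    (cc _ Ox) (cr _ Ox) (cv x)).
have ch : continuous (h0 \_ Omega).
  move=> x; apply: patch_cvg h00 _ => {}x Ox.
  apply: (cvg_majorant r11 r2n hdelta heta _ (near_ok _ Ox) (hr Ox) (v0 x)
    (cc _ Ox) (cr _ Ox) (cv x)).
  apply: continuous_enorm => i; rewrite (_ : (fun y => _) = partial i phi)//.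
    exact: cdphi.
  by apply/funext => y; rewrite mxE.
have slw x i : dslope_le (w0 \_ Omega) x i ((h0 \_ Omega) x).
  pose line (s : R) : 'rV[R]_N := x + s *: (delta_mx ord0 i : 'rV[R]_N).
  have line0 : line 0 = x by rewrite /line scale0r addr0.
  have cline : line s @[s --> 0] --> x.
    have cl : continuous line.
      move=> s; apply: (@continuousD _ _ _ (fun=> x) (fun s : R => s *: (delta_mx ord0 i : 'rV[R]_N))).
        exact: cst_continuous.
      exact: scalel_continuous.
    by have := cl 0; rewrite /continuous_at line0.
  have [Ox|Ox] := pselect (Omega x); last first.
    move=> e e1; rewrite !patchE memNset//.
    have vl : \forall s \near (0 : R), v (line s) = 0 by exact: cline (v_out _ Ox).
    apply: filterS vl => s vs; rewrite /point/=.
    rewrite subr0 add0r patchE; case: ifPn => [|_].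
      by rewrite inE => Os; rewrite w00// normr0 mulr_ge0// ltW.
    by rewrite normr0 mulr_ge0// ltW.
  have dline s : `|line s - x| <= `|s|.
    rewrite /line addrC addKr normrZ ler_piMr//.
    have -> : `|delta_mx ord0 i : 'rV[R]_N| =
        \big[Order.max/0]_ij `|(delta_mx ord0 i : 'rV[R]_N) ij.1 ij.2| by exact: mx_normrE.
    apply/bigmax_leP; split => // -[a b] _ /=; rewrite mxE.
    by case: (_ && _); rewrite ?normr1 ?normr0.
  have Oline : \forall s \near 0, Omega (line s).
    by apply: cline; exact: open_nbhs_nbhs.
  have sll f : (forall x y, Omega x -> Omega y -> `|f x - f y| <= L * `|x - y|) ->
      slope_le (f \o line) 0 L.
    move=> lf; apply: slope_le_lip; apply: filterS Oline => s Os /=.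
    rewrite line0 subr0 (le_trans (lf _ _ Os Ox))//.
    by rewrite ler_wpM2l.
  have xi0 : 0 <= enorm (grad phi x) by exact: enorm_ge0.
  have slv : slope_le (v \o line) 0 (enorm (grad phi x)).
    have : slope_le (phi \o line) 0 (enorm (grad phi x)).
      apply: (@slope_le_mono _ _ _ (`|partial i phi x| )).
        by have := coord_le_enorm (grad phi x) i; rewrite mxE.
      have dl : is_derive (0 : R) 1 (phi \o line) (partial i phi x).
        have := dphi x i; rewrite /partial /derivable /derive => d.
        have E : (fun h : R => h^-1 *: (((phi \o line) \o shift (0 : R)) (h *: 1) - (phi \o line) 0)) =
          (fun h : R => h^-1 *: ((phi \o shift x) (h *: delta_mx ord0 i) - phi x)).
          apply/funext => h; rewrite /comp line0 /line /shift/= addr0 [h *: 1]mulr1.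
          by rewrite [x + _]addrC.
        by apply: DeriveDef; rewrite /derivable /derive E.
      move=> e e1; apply: filterS (is_derive_near dl e1) => s H.
      rewrite -[X in `|X|](subrK (partial i phi x * (s - 0))) (le_trans (ler_normD _ _))//.
      by rewrite normrM mulrDl addrC lerD2l.
    move=> H e e1; apply: filterS (H e e1) => s; apply: le_trans.
    exact: trunc_lip.
  have okl : \forall s \near 0, [/\ 0 <= (c \o line) s <= A0, r1 <= (r \o line) s <= r2
      & 0 <= (v \o line) s].
    by apply: filterS Oline => s Os /=; split; [exact: hc|exact: hr|].
  have := HC _ _ _ _ _ xi0 okl (sll _ lc) (sll _ lr) slv.
  move=> H e e1; apply: filterS2 Oline (H e e1) => s Os.
  by rewrite /= line0 subr0 !patchE !mem_set.
have wge x : 0 <= (w0 \_ Omega) x by rewrite patchE; case: ifP => // _; exact: powR_ge0.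
have hge x : 0 <= (h0 \_ Omega) x.
  rewrite patchE; case: ifP => // _; apply: majorant_ge0 => //; [exact: ltW|exact: ltW|exact: ltW|].
  exact: enorm_ge0.
have pout f x : ~ Omega x -> (f \_ Omega) x = 0 :> R by move=> Ox; rewrite patchE memNset.
have := sobolev_slope bOmega N1 cw wge ch hge (pout _) (pout _) slw.
have -> : (\int[leb]_(x in Omega) ((w0 \_ Omega) x `^ (N%:R / (N%:R - 1)))%:E =
    \int[leb]_(x in Omega) (phase_star n (c x) (r x) delta eta (v x))%:E)%E.
  apply: eq_integral => x Ox; rewrite patchE Ox /w0 -powRrM; congr (_ `^ _)%:E.
  rewrite inE in Ox; have [_ rx2] := andP (hr Ox).
  have nr : n - r x != 0 by rewrite gt_eqF// subr_gt0 (le_lt_trans rx2).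
  have n1 : n - 1 != 0 by rewrite gt_eqF// subr_gt0; have := n2; lra.
  by rewrite /sigma_exp /tau_exp -/n; field; rewrite n1 nr.
have -> : (\int[leb]_(x in Omega) ((h0 \_ Omega) x)%:E =
    \int[leb]_(x in Omega) (h0 x)%:E)%E.
  by apply: eq_integral => x Ox; rewrite patchE Ox.
by [].
Qed.

End sobolev_phase.

Lemma ae_leb_filter (R : realType) (N : nat) : Filter (almost_everywhere (@leb R N)).
Proof.
exact: (@ae_filter_ringOfSetsType _ (caratheodory_type (@lebesgue_outer R N)) R
  (leb : {measure set _ -> \bar R})).
Qed.
#[export] Existing Instance ae_leb_filter.

Lemma cvge_near_lt (R : realType) (f : nat -> \bar R) (a b : \bar R) :
  f n @[n --> \oo] --> a -> (a < b)%E -> (\forall n \near \oo, f n < b)%E.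
Proof. by move=> fa ab; have := fa [set u | (u < b)%E] (open_ereal_lt' ab). Qed.

Lemma le_integralD d (T : measurableType d) (R : realType) (mu : {measure set T -> \bar R})
    (D : set T) (f g h : T -> R) (K : R) :
  measurable D -> measurable_fun D f -> measurable_fun D g -> measurable_fun D h -> 0 <= K ->
  (forall x, D x -> 0 <= f x) -> (forall x, D x -> 0 <= g x) -> (forall x, D x -> 0 <= h x) ->
  (forall x, D x -> f x <= g x + K * h x) ->
  (\int[mu]_(x in D) (f x)%:E <=
   \int[mu]_(x in D) (g x)%:E + K%:E * \int[mu]_(x in D) (h x)%:E)%E.
Proof.
move=> mD mf mg mh K0 f0 g0 h0 fgh.
have mf' : measurable_fun D (fun x => (f x)%:E) by exact/measurable_EFinP.
have mg' : measurable_fun D (fun x => (g x)%:E) by exact/measurable_EFinP.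
have mh' : measurable_fun D (fun x => (h x)%:E) by exact/measurable_EFinP.
have mKh : measurable_fun D (fun x => K%:E * (h x)%:E)%E.
  by apply/measurable_EFinP; exact: measurable_funM.
rewrite -ge0_integralZl// -ge0_integralD//; last first.
  by move=> x Dx; rewrite -EFinM lee_fin mulr_ge0 ?h0.
by apply: ge0_le_integral => //; exact: emeasurable_funD.
Qed.

Lemma real_dominated_convergence d (T : measurableType d) (R : realType)
    (mu : {measure set T -> \bar R}) (D : set T) (f_ : nat -> T -> R) (f g : T -> R) :
  measurable D -> (forall n, measurable_fun D (f_ n)) -> measurable_fun D f ->
  {ae mu, forall x, D x -> f_ n x @[n --> \oo] --> f x} ->
  mu.-integrable D (EFin \o g) -> (forall n x, D x -> `|f_ n x| <= g x) ->
  mu.-integrable D (EFin \o f) /\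
  (\int[mu]_(x in D) (f_ n x)%:E @[n --> \oo] --> \int[mu]_(x in D) (f x)%:E)%E.
Proof.
move=> mD mf_ mf f_f ig fg.
have [] := @dominated_convergence _ T R mu D mD (fun n => EFin \o f_ n) (EFin \o f) (EFin \o g).
- by move=> n; exact/measurable_EFinP.
- exact/measurable_EFinP.
- by apply: filterS f_f => x H /H ?; apply: cvg_EFin => //; exact: nearW.
- exact: ig.
- by apply/nearW => x n Dx /=; rewrite lee_fin fg.
by move=> ? _ ?.
Qed.

(** * Passage to the limit in the truncated inequality *)

Section sobolev_phase_limit.
Context {R : realType} {N : nat}.
Notation cT := (caratheodory_type (@lebesgue_outer R N)).
Notation mR := (measurableTypeR R).
Notation mu := (leb : {measure set cT -> \bar R}).
Variable Omega : set 'rV[R]_N.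
Hypotheses (oOmega : open Omega) (bOmega : bounded_set Omega) (N1 : (1 < N)%N).

(** Almost everywhere convergence of the functions feeds dominated convergence under the truncation;
    L^1 convergence of the gradients suffices because the majorant is affine in the gradient. *)
Definition W11_limit (phi_ : nat -> 'rV[R]_N -> R) (u : 'rV[R]_N -> R) (g : 'rV[R]_N -> 'rV[R]_N) :=
  [/\ measurable_fun (Omega : set cT) (u : cT -> mR),
      forall i, measurable_fun (Omega : set cT) ((fun x => g x ord0 i) : cT -> mR),
      (\int[leb]_(x in Omega) (enorm (g x))%:E < +oo)%E,
      {ae mu, forall x, Omega x -> phi_ n x @[n --> \oo] --> u x} &
      (\int[leb]_(x in Omega) (enorm (g x - grad (phi_ n) x))%:E @[n --> \oo] --> 0)%E].

Variables (r1 r2 A0 delta eta L : R) (c r : 'rV[R]_N -> R).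
Let n : R := N%:R.
Hypotheses (r11 : 1 < r1) (r12 : r1 <= r2) (r2n : r2 < n) (A00 : 0 <= A0) (L0 : 0 <= L).
Hypotheses (hdelta : 1 <= delta) (heta : 0 <= eta) (hde : 1 < delta + eta).
Hypotheses (hc : forall x, Omega x -> 0 <= c x <= A0) (hr : forall x, Omega x -> r1 <= r x <= r2).
Hypotheses (lc : forall x y, Omega x -> Omega y -> `|c x - c y| <= L * `|x - y|).
Hypotheses (lr : forall x y, Omega x -> Omega y -> `|r x - r y| <= L * `|x - y|).
Let n2 : 2 <= n. Proof. by rewrite ler_nat. Qed.
Let mO : measurable (Omega : set cT). Proof. exact: measurable_domain. Qed.

Lemma measurable_lipschitz_domain f :
  (forall x y, Omega x -> Omega y -> `|f x - f y| <= L * `|x - y|) ->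
  measurable_fun (Omega : set cT) (f : cT -> mR).
Proof.
move=> lf; apply: continuous_open_measurable => // x Ox.
by apply: (lipschitz_open_continuous oOmega L0 _ lf); rewrite inE in Ox.
Qed.

Let mc : measurable_fun (Omega : set cT) (c : cT -> mR).
Proof. exact: measurable_lipschitz_domain. Qed.
Let mr : measurable_fun (Omega : set cT) (r : cT -> mR).
Proof. exact: measurable_lipschitz_domain. Qed.

Lemma measurable_trunc k M (v : cT -> R) : measurable_fun (Omega : set cT) v ->
  measurable_fun (Omega : set cT) (fun x => trunc k M (v x)).
Proof.
move=> mv; apply: (@measurableT_comp _ _ _ _ _ _ (trunc k M)) => //.
exact: (continuous_measurable_fun (@continuous_trunc _ k M)).
Qed.

Lemma C1_0_measurable phi : C1_0 Omega phi ->
  measurable_fun (Omega : set cT) (phi : cT -> mR) /\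
  forall i, measurable_fun (Omega : set cT) ((fun x => grad phi x ord0 i) : cT -> mR).
Proof.
move=> [cphi dphi cdphi phi0]; split; first exact: continuous_leb_measurable.
move=> i; rewrite (_ : (fun _ => _) = partial i phi).
  exact: continuous_leb_measurable.
by apply/funext => x; rewrite mxE.
Qed.

Lemma sobolev_phase_W11 : exists2 C1, 0 < C1 & forall eps, 0 < eps -> exists2 C, 0 < C &
  forall k M phi_ u g, 0 <= k -> 0 <= M -> (forall m, C1_0 Omega (phi_ m)) ->
  W11_limit phi_ u g ->
  (\int[leb]_(x in Omega)
     (phase_star n (c x) (r x) delta eta (trunc k M (u x)))%:E <=
   (\int[leb]_(x in Omega)
     (majorant n delta eta C1 eps C (c x) (r x) (trunc k M (u x)) (enorm (g x)))%:E) `^ (n / (n - 1)))%E.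
Proof.
have [C1 C10 H1] := sobolev_phase_C1 oOmega bOmega N1 r11 r12 r2n A00 L0 hdelta heta hde hc hr lc lr.
exists C1 => // eps e0; have [C C0 HC] := H1 _ e0; exists C => // k M phi_ u g k0 M0 Cphi.
move=> [mu_ mg gi phiu phig].
have [K K0 HK] := phase_bounded n2 r11 r2n A00 hdelta heta M.
pose e := n / (n - 1).
have n10 : 0 < n - 1 by have h := n2; lra.
have e1 : 0 < e by rewrite divr_gt0//; have h := n2; lra.
pose v m x := trunc k M (phi_ m x); pose w x := trunc k M (u x).
have hv t : 0 <= trunc k M t <= M by rewrite trunc_ge0// trunc_le.
have mphi m := (C1_0_measurable (Cphi m)).1.
have mdphi m := (C1_0_measurable (Cphi m)).2.
have mv m : measurable_fun (Omega : set cT) (v m : cT -> R)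
  by exact: (measurable_trunc k M (mphi m)).
have mw : measurable_fun (Omega : set cT) (w : cT -> R) by exact: measurable_trunc.
have mng : measurable_fun (Omega : set cT) ((fun x => enorm (g x)) : cT -> mR).
  exact: measurable_enorm.
have mngp m : measurable_fun (Omega : set cT) ((fun x => enorm (g x - grad (phi_ m) x)) : cT -> mR).
  exact: measurable_enormB mg (mdphi m).
have vw : {ae mu, forall x, Omega x -> v m x @[m --> \oo] --> w x}.
  apply: filterS phiu => x H /H {}H.
  exact: (cvg_comp _ _ H (@continuous_trunc _ k M _)).
have okn x : Omega x -> \forall m \near \oo, [/\ 0 <= c x <= A0, r1 <= r x <= r2 & 0 <= v m x].
  by move=> Ox; apply: nearW => m; split; [exact: hc|exact: hr|case/andP: (hv (phi_ m x))].
have w0 x : 0 <= w x by case/andP: (hv (u x)).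
have iK : mu.-integrable Omega (EFin \o cst K).
  apply: (integrable_bounded_domain oOmega bOmega (C := K)) => // x _.
  by rewrite ger0_norm// ltW.
have [iX cX] : mu.-integrable Omega
      (EFin \o fun x => phase_star n (c x) (r x) delta eta (w x)) /\
    (\int[leb]_(x in Omega) (phase_star n (c x) (r x) delta eta (v m x))%:E @[m --> \oo] -->
    \int[leb]_(x in Omega) (phase_star n (c x) (r x) delta eta (w x))%:E)%E.
  apply: (real_dominated_convergence mO _ _ _ iK).
  - by move=> m; exact: (measurable_phase_star delta eta r2n mO mc mr (mv m) hr).
  - exact: (measurable_phase_star delta eta r2n mO mc mr mw hr).
  - apply: filterS vw => x H Ox.
    by apply: (cvg_phase_star r11 r2n hdelta heta _ (okn _ Ox) (hr Ox) (w0 x) _ _ (H Ox)); exact: cvg_cst.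
  - move=> m x Ox; rewrite ger0_norm ?powR_ge0//.
    by have [] := HK _ _ _ (hc Ox) (hr Ox) (hv (phi_ m x)).
pose K' x := (C1 * (K * enorm (g x) + K) + eps * K + C * M).
have ig : mu.-integrable Omega (EFin \o fun x => enorm (g x)).
  apply/integrableP; split; first exact/measurable_EFinP.
  by under eq_integral do rewrite /= ger0_norm ?enorm_ge0//.
have iK' : mu.-integrable Omega (EFin \o K').
  pose A := C1 * K; pose B := C1 * K + eps * K + C * M.
  have -> : EFin \o K' = (fun x => A%:E * (EFin \o (fun x => enorm (g x))) x +
      (EFin \o cst B) x)%E.
    by apply/funext => x; rewrite /= -EFinM -EFinD /K' /A /B; congr EFin; ring.
  apply: integrableD => //; first exact: integrableZl.
  by apply: (integrable_bounded_domain oOmega bOmega (C := `|B|)).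
have majK x t : Omega x -> 0 <= majorant n delta eta C1 eps C (c x) (r x) (trunc k M t) (enorm (g x)) <= K' x.
  move=> Ox; have [_ h1 h2 h3] := HK _ _ _ (hc Ox) (hr Ox) (hv t).
  have [v0 vM] := andP (hv t); have gx := enorm_ge0 (g x).
  apply/andP; split; first by apply: majorant_ge0 => //; exact: ltW.
  rewrite /majorant /K'; apply: lerD; last by rewrite ler_pM2l.
  apply: lerD; last by rewrite ler_pM2l.
  by rewrite ler_pM2l// lerD// ler_wpM2r.
have [iY cY] : mu.-integrable Omega
      (EFin \o fun x => majorant n delta eta C1 eps C (c x) (r x) (w x) (enorm (g x))) /\
    (\int[leb]_(x in Omega) (majorant n delta eta C1 eps C (c x) (r x) (v m x) (enorm (g x)))%:E @[m --> \oo] -->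
    \int[leb]_(x in Omega) (majorant n delta eta C1 eps C (c x) (r x) (w x) (enorm (g x)))%:E)%E.
  apply: (real_dominated_convergence mO _ _ _ iK').
  - by move=> m; exact: (measurable_majorant delta eta r2n mO mc mr (mv m) hr).
  - exact: (measurable_majorant delta eta r2n mO mc mr mw hr).
  - apply: filterS vw => x H Ox.
    by apply: (cvg_majorant r11 r2n hdelta heta _ (okn _ Ox) (hr Ox) (w0 x) _ _ (H Ox)); exact: cvg_cst.
  - move=> m x Ox; have /andP[m0 mK] := majK x (phi_ m x) Ox.
    by rewrite ger0_norm.
pose X := fine (\int[leb]_(x in Omega) (phase_star n (c x) (r x) delta eta (w x))%:E)%E.
pose Y := fine (\int[leb]_(x in Omega) (majorant n delta eta C1 eps C (c x) (r x) (w x) (enorm (g x)))%:E)%E.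
have XE : (\int[leb]_(x in Omega) (phase_star n (c x) (r x) delta eta (w x))%:E = X%:E)%E.
  by rewrite fineK//; exact: (integrable_fin_num mO iX).
have YE : (\int[leb]_(x in Omega) (majorant n delta eta C1 eps C (c x) (r x) (w x) (enorm (g x)))%:E = Y%:E)%E.
  by rewrite fineK//; exact: (integrable_fin_num mO iY).
rewrite -/w XE YE poweR_EFin lee_fin.
have Y0 : 0 <= Y.
  rewrite -lee_fin -YE; apply: integral_ge0 => x Ox; rewrite lee_fin.
  by case/andP: (majK x (u x) Ox).
(* Replacing the gradient of [phi_ m] by [g] in the majorant costs at most [C1 * K] times the L^1
   distance of the two, [K] being a bound for the truncated slope. *)
have cYZ : (\int[leb]_(x in Omega) (majorant n delta eta C1 eps C (c x) (r x) (v m x) (enorm (g x)))%:E +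
    (C1 * K)%:E * \int[leb]_(x in Omega) (enorm (g x - grad (phi_ m) x))%:E @[m --> \oo] --> Y%:E)%E.
  rewrite -[X in _ --> X]adde0 -(mule0 (C1 * K)%:E) -YE.
  apply: cvgeD; [by rewrite YE mule0|exact: cY|].
  exact: cvgeZl.
(* The approximants satisfy the inequality only up to an error s, which continuity of the power
   removes at the end. *)
suff main s : 0 < s -> X <= (Y + s) `^ e.
  have cs : (Y + s) `^ e @[s --> (0 : R)^'+] --> Y `^ e.
    rewrite -[X in _ --> X `^ _](addr0 Y).
    apply: (@cvg_powR _ _ (0 : R)^'+ _ (fun s => Y + s) (cst e) (Y + 0) e e1).
    - by near=> s; rewrite addr_ge0.
    - by apply: cvgD; [exact: cvg_cst|exact: cvg_at_right_filter].
    - exact: cvg_cst.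
  by apply: (cvgr_to_ge cs); near=> s; exact: main.
move=> s0.
rewrite -lee_fin -XE; apply: (cvge_to_le cX).
have near_lt : \forall m \near \oo, (\int[leb]_(x in Omega) (majorant n delta eta C1 eps C (c x) (r x) (v m x) (enorm (g x)))%:E +
    (C1 * K)%:E * \int[leb]_(x in Omega) (enorm (g x - grad (phi_ m) x))%:E < (Y + s)%:E)%E.
  by apply: (cvge_near_lt cYZ); rewrite lte_fin ltrDl.
apply: filterS near_lt => m mlt.
apply: (le_trans (HC k M (phi_ m) k0 M0 (Cphi m))).
rewrite -poweR_EFin; apply: gt0_ler_poweR.
- exact: ltW.
- rewrite in_itv/= leey andbT; apply: integral_ge0 => x Ox; rewrite lee_fin majorant_ge0 ?(ltW C10) ?(ltW e0) ?(ltW C0) ?enorm_ge0//.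
  by case/andP: (hv (phi_ m x)).
- by rewrite in_itv/= leey andbT lee_fin addr_ge0// ltW.
apply: le_trans (ltW mlt).
have maj0 x y : Omega x -> 0 <= y -> 0 <= majorant n delta eta C1 eps C (c x) (r x) (v m x) y.
  by move=> Ox y0; apply: majorant_ge0 => //; [exact: ltW..|case/andP: (hv (phi_ m x))].
pose maj y x := majorant n delta eta C1 eps C (c x) (r x) (v m x) (y x).
apply: (@le_integralD _ cT R mu Omega (maj (fun x => enorm (grad (phi_ m) x)))
  (maj (fun x => enorm (g x))) (fun x => enorm (g x - grad (phi_ m) x)) (C1 * K) mO).
- apply: (measurable_majorant delta eta r2n mO mc mr (mv m) hr).
  by apply: measurable_enorm; exact: (mdphi m).
- exact: (measurable_majorant delta eta r2n mO mc mr (mv m) hr _ _ _ mng).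
- exact: (mngp m).
- exact: mulr_ge0 (ltW C10) (ltW K0).
- by move=> x Ox; rewrite maj0 ?enorm_ge0.
- by move=> x Ox; rewrite maj0 ?enorm_ge0.
- by move=> x Ox; exact: enorm_ge0.
move=> x Ox; rewrite /maj.
have [_ h1 h2 h3] := HK _ _ _ (hc Ox) (hr Ox) (hv (phi_ m x)).
have tri : enorm (grad (phi_ m) x) <= enorm (g x) + enorm (g x - grad (phi_ m) x).
  rewrite -[X in enorm X <= _](subrKC (g x)) (le_trans (ler_enormD _ _))// lerD2l.
  by rewrite -enormN opprB.
rewrite /majorant.
have s0' : 0 <= slope_t n (c x) (r x) delta eta (v m x) by rewrite mulr_ge0 ?powR_ge0.
have : slope_t n (c x) (r x) delta eta (v m x) * enorm (grad (phi_ m) x) <=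
   slope_t n (c x) (r x) delta eta (v m x) * enorm (g x) + K * enorm (g x - grad (phi_ m) x).
  apply: (le_trans (ler_wpM2l s0' tri)); rewrite mulrDr lerD2l ler_wpM2r ?enorm_ge0//.
rewrite -(ler_pM2l C10).
lra.
Unshelve. all: by end_near. Qed.

End sobolev_phase_limit.

(** * Embedding into the critical modular space *)

Section phase_facts.
Context {R : realType}.
Variables (n r1 r2 delta eta : R).
Hypotheses (n2 : 2 <= n) (r11 : 1 < r1) (r2n : r2 < n).
Hypotheses (hdelta : 1 <= delta) (heta : 0 <= eta) (hde : 1 < delta + eta).
Implicit Types (c r s t : R).

Lemma phase_homo c r s t : 0 <= c -> 0 <= r -> 0 <= s -> s <= t ->
  phase c r delta eta s <= phase c r delta eta t.
Proof.
move=> c0 rr0 s0 st; have t0 := le_trans s0 st.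
rewrite /phase ler_pM ?mulr_ge0 ?powR_ge0 ?ell_ge0 ?ell_homo//.
by rewrite ler_wpM2l// ge0_ler_powR ?nnegrE.
Qed.

Lemma phase_double c r t : 0 <= c -> 0 <= r -> r <= n -> 0 <= t ->
  phase c r delta eta (2 * t) <= 2 `^ (n + 1) * phase c r delta eta t.
Proof.
move=> c0 rr0 rn t0; have t20 : 0 <= 2 * t by rewrite mulr_ge0.
rewrite /phase powRM// powRD; last by rewrite (gt_eqF (ltr0n _ 2)) implybT.
rewrite powRr1//.
apply: (@le_trans _ _ (c * (2 `^ n * t `^ r) * (2 * ell delta eta t))); last first.
  by apply: ler_of_eq; ring.
rewrite ler_pM ?mulr_ge0 ?powR_ge0 ?ell_ge0 ?ell_double//.
by rewrite ler_wpM2l// ler_wpM2r ?powR_ge0// ler_powR// ler1n.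
Qed.

Lemma phase_star_homo c r s t : r1 <= r <= r2 -> 0 <= c -> 0 <= s -> s <= t ->
  phase_star n c r delta eta s <= phase_star n c r delta eta t.
Proof.
move=> hr c0 s0 st; have t1 := tau_exp_gt1 r11 r2n hr.
have rr0 : 0 <= r by case/andP: hr => /(lt_le_trans r11)/(lt_trans ltr01)/ltW.
apply: ge0_ler_powR; rewrite ?nnegrE ?phase_ge0 ?phase_homo//.
  by rewrite ltW// (lt_trans ltr01).
exact: le_trans st.
Qed.

Lemma phase_star_double c r t : r1 <= r <= r2 -> 0 <= c -> 0 <= t ->
  phase_star n c r delta eta (2 * t) <=
  2 `^ ((n + 1) * tau_exp n r2) * phase_star n c r delta eta t.
Proof.
move=> hr c0 t0; have t1 := tau_exp_gt1 r11 r2n hr.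
have rr0 : 0 <= r by case/andP: hr => /(lt_le_trans r11)/(lt_trans ltr01)/ltW.
have rn : r <= n by case/andP: hr => _ /le_trans; apply; exact: ltW.
have ta0 : 0 <= tau_exp n r by rewrite ltW// (lt_trans ltr01).
apply: (@le_trans _ _ ((2 `^ (n + 1) * phase c r delta eta t) `^ tau_exp n r)).
  have t20 : 0 <= 2 * t by rewrite mulr_ge0.
  apply: ge0_ler_powR => //; last exact: phase_double.
    by rewrite nnegrE phase_ge0.
  by rewrite nnegrE mulr_ge0 ?phase_ge0 ?powR_ge0.
rewrite powRM ?powR_ge0 ?phase_ge0// -powRrM ler_wpM2r ?powR_ge0// ler_powR ?ler1n//.
by rewrite ler_wpM2l ?(tau_exp_le n2 r2n hr)// addr_ge0// (le_trans _ n2).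
Qed.

Lemma phase_ge_lin c r t : 1 <= r -> 0 <= c -> 1 <= t ->
  c * ell delta eta 1 * t <= phase c r delta eta t.
Proof.
move=> r1' c0 t1; have t0 := le_trans ler01 t1.
rewrite /phase mulrAC ler_pM ?mulr_ge0 ?ell_ge0 ?ell_homo//.
by rewrite ler_wpM2l// le1r_powR.
Qed.

Lemma phase_le_star c r t : r1 <= r <= r2 -> 0 <= c -> 0 <= t ->
  phase c r delta eta t <= 1 + phase_star n c r delta eta t.
Proof.
move=> hr c0 t0; have t1 := tau_exp_gt1 r11 r2n hr.
have [H1|H1] := leP (phase c r delta eta t) 1.
  by rewrite (le_trans H1)// lerDl powR_ge0.
rewrite (@le_trans _ _ (phase_star n c r delta eta t))// ?lerDr//.
by apply: le1r_powR; exact: ltW.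
Qed.

End phase_facts.

Section small_power.
Context {R : realType}.

(* [X <= kappa * K] excludes the large solutions of [X <= (A * (X + K)) `^ e]. *)
Lemma small_power_bound (A kap e : R) : 0 < A -> 0 < kap -> 1 < e ->
  exists2 s, 0 < s & forall K X, 0 <= K <= s -> 0 <= X <= kap * K ->
    X <= (A * (X + K)) `^ e -> X <= K.
Proof.
move=> A0 k0 e1; pose B := A * (kap + 1); have e10 : 0 < e - 1 by rewrite subr_gt0.
have B0 : 0 < B by rewrite mulr_gt0// addr_gt0.
pose s := (2 * A)^-1 `^ (e - 1)^-1 / B.
have A20 : 0 < (2 * A)^-1 by rewrite invr_gt0 mulr_gt0.
exists s; first by rewrite divr_gt0// powR_gt0.
move=> K X /andP[K0 Ks] /andP[X0 XK] H.
have XK0 : 0 <= A * (X + K) by rewrite mulr_ge0 ?addr_ge0// ltW.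
have h1 : A * (X + K) <= B * K.
  by rewrite /B -mulrA ler_pM2l// mulrDl mul1r lerD2r.
have h2 : (A * (X + K)) `^ (e - 1) <= (2 * A)^-1.
  apply: (@le_trans _ _ (((2 * A)^-1 `^ (e - 1)^-1) `^ (e - 1))); last first.
    by rewrite -powRrM mulVf ?gt_eqF// powRr1 ?(ltW A20).
  apply: ge0_ler_powR; rewrite ?nnegrE ?powR_ge0 ?(ltW e10)//.
  apply: (le_trans h1); rewrite mulrC -ler_pdivlMr//.
have : X <= A * (X + K) * (2 * A)^-1.
  apply: (le_trans H); rewrite -(@mulr_powRB1 _ _ e)//; last exact: lt_trans e1.
  by rewrite ler_wpM2l.
have -> : A * (X + K) * (2 * A)^-1 = (X + K) / 2 by field; rewrite gt_eqF.
lra.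
Qed.

(** De Giorgi's lemma on fast geometric convergence. The ratio [g] solves (D g)^e = g and the
    threshold [s] solves (A s)^e = s g, so that the bound s g^i for the i-th term reproduces
    itself. *)
Lemma geometric_decay (A D e : R) : 0 < A -> 1 < D -> 1 < e ->
  exists2 s, 0 < s & forall Z : nat -> R, (forall i, 0 <= Z i) -> Z 0%N <= s ->
    (forall i, Z i.+1 <= (A * D ^+ i * Z i) `^ e) -> Z i @[i --> \oo] --> 0.
Proof.
move=> A0 D1 e1; have D0 := lt_trans ltr01 D1; have e10 : 0 < e - 1 by rewrite subr_gt0.
have e0 := lt_trans ltr01 e1.
pose g := D `^ (- (e / (e - 1))).
have g0 : 0 < g by exact: powR_gt0.
have g1 : g < 1.
  rewrite /g powRN invf_lt1 ?powR_gt0//.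
  by rewrite -[ltLHS](powRr0 D) /powR (gt_eqF D0) ltr_expR ltr_pM2r ?ln_gt0// divr_gt0.
have gD : (D * g) `^ e = g.
  rewrite powRM ?(ltW D0) ?(ltW g0)// /g -powRrM -powRD; last by rewrite (gt_eqF D0) implybT.
  by congr powR; field; rewrite gt_eqF.
pose s := (g / A `^ e) `^ (e - 1)^-1.
have gA : 0 < g / A `^ e by rewrite divr_gt0// powR_gt0.
have s0 : 0 < s by exact: powR_gt0.
have se : A `^ e * s `^ e = s * g.
  rewrite -(@mulr_powRB1 _ s e) ?(ltW s0)// /s -[in X in _ * (_ * X)]powRrM mulVf ?gt_eqF//.
  by rewrite powRr1 ?(ltW gA)//; field; rewrite gt_eqF// powR_gt0.
exists s => // Z Z0 Zs HZ.
have Zg i : Z i <= s * g ^+ i.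
  elim: i => [|i IH]; first by rewrite expr0 mulr1.
  apply: (le_trans (HZ i)).
  have Di : 0 <= D ^+ i by rewrite exprn_ge0// ltW.
  apply: (@le_trans _ _ ((A * s * (D * g) ^+ i) `^ e)).
    apply: ge0_ler_powR; rewrite ?nnegrE ?(ltW e0)//.
    - by rewrite !mulr_ge0// ltW.
    - by rewrite !mulr_ge0 ?exprn_ge0 ?mulr_ge0// ltW.
    rewrite exprMn (_ : A * s * _ = A * D ^+ i * (s * g ^+ i)); last by ring.
    by rewrite ler_wpM2l// mulr_ge0// ltW.
  have Dg0 : 0 <= D * g by rewrite mulr_ge0// ltW.
  have As0 : 0 <= A * s by rewrite mulr_ge0// ltW.
  rewrite powRM ?exprn_ge0// powRM ?(ltW A0) ?(ltW s0)// se.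
  rewrite -powR_mulrn// powRAC gD powR_mulrn ?(ltW g0)// exprS.
  by apply: ler_of_eq; ring.
apply: (@squeeze_cvgr _ _ _ _ (cst 0) (fun i => s * g ^+ i)).
- by apply: nearW => i; rewrite Z0 Zg.
- exact: cvg_cst.
rewrite -[X in _ --> X](mulr0 s); apply: cvgM; first exact: cvg_cst.
by apply: cvg_expr; rewrite ger0_norm// ltW.
Qed.

End small_power.

(* [dp_gapp] and [dp_gapq] are the uniform form of q / p < 1 + 1 / N, in both directions. *)
Record double_phase_data (R : realType) (N : nat) (Omega : set 'rV[R]_N)
    (a b p q : 'rV[R]_N -> R) (delta eta r1 r2 A0 L kap d : R) : Prop := DoublePhaseData {
  dp_open : open Omega;
  dp_bounded : bounded_set Omega;
  dp_N : (1 < N)%N;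
  dp_r11 : 1 < r1;
  dp_r12 : r1 <= r2;
  dp_r2 : r2 < N%:R;
  dp_A0 : 0 <= A0;
  dp_L : 0 <= L;
  dp_kap : 0 < kap;
  dp_d : 0 < d;
  dp_delta : 1 <= delta;
  dp_eta : 0 <= eta;
  dp_de : 1 < delta + eta;
  dp_a : forall x, Omega x -> 0 <= a x <= A0;
  dp_b : forall x, Omega x -> 0 <= b x <= A0;
  dp_p : forall x, Omega x -> r1 <= p x <= r2;
  dp_q : forall x, Omega x -> r1 <= q x <= r2;
  dp_ab : forall x, Omega x -> d <= a x + b x;
  dp_gapp : forall x, Omega x ->
    p x * N%:R / (N%:R + 1 - p x) + kap <= q x * tau_exp N%:R (q x);
  dp_gapq : forall x, Omega x ->
    q x * N%:R / (N%:R + 1 - q x) + kap <= p x * tau_exp N%:R (p x);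
  dp_la : forall x y, Omega x -> Omega y -> `|a x - a y| <= L * `|x - y|;
  dp_lb : forall x y, Omega x -> Omega y -> `|b x - b y| <= L * `|x - y|;
  dp_lp : forall x y, Omega x -> Omega y -> `|p x - p y| <= L * `|x - y|;
  dp_lq : forall x y, Omega x -> Omega y -> `|q x - q y| <= L * `|x - y|
}.

(** * Comparison of the double phase with the critical phase *)

Section double_phase.
Context {R : realType} {N : nat}.
Notation cT := (caratheodory_type (@lebesgue_outer R N)).
Notation mR := (measurableTypeR R).
Notation mu := (leb : {measure set cT -> \bar R}).
Variables (Omega : set 'rV[R]_N) (a b p q : 'rV[R]_N -> R).
Variables (delta eta r1 r2 A0 L kap d : R).
Hypothesis D : double_phase_data Omega a b p q delta eta r1 r2 A0 L kap d.
Let n : R := N%:R.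
Let e1 : R := expR 1.
Notation S := (log_double_phase a b p q delta eta).

Let n2 : 2 <= n. Proof. by rewrite ler_nat (dp_N D). Qed.
Let r11 := dp_r11 D. Let r12 := dp_r12 D. Let r2n : r2 < n := dp_r2 D.
Let A00 := dp_A0 D. Let hdelta := dp_delta D. Let heta := dp_eta D. Let hde := dp_de D.

Let he1 : 1 <= e1. Proof. by rewrite -expR0 ler_expR. Qed.
Let h0 : 0 <= 0 :> R. Proof. by []. Qed.
Let he10 : 1 < e1 + 0. Proof. by rewrite addr0 -expR0 ltr_expR. Qed.

Let ell_e t : ell e1 0 t = 1.
Proof. by rewrite /ell mul0r addr0 expRK. Qed.

(* The phase without logarithm is the phase with [delta = e] and [eta = 0]. *)
Lemma double_phaseE x t : S x t = phase (a x) (p x) e1 0 t + phase (b x) (q x) delta eta t.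
Proof. by rewrite /log_double_phase /phase ell_e mulr1. Qed.

(* The sum a^(p*/p) t^p* + (b log)^(q*/q) t^q* of the growth conditions. *)
Definition sobolev_phase x t : R :=
  phase_star n (a x) (p x) e1 0 t + phase_star n (b x) (q x) delta eta t.
Notation G := sobolev_phase.

Lemma sobolev_phase_ge0 x t : 0 <= G x t.
Proof. by rewrite addr_ge0 ?powR_ge0. Qed.

Let a0 x : Omega x -> 0 <= a x. Proof. by move=> /(dp_a D)/andP[]. Qed.
Let b0 x : Omega x -> 0 <= b x. Proof. by move=> /(dp_b D)/andP[]. Qed.
Let p1 x : Omega x -> 1 < p x.
Proof. by move=> /(dp_p D)/andP[/(lt_le_trans r11)]. Qed.
Let q1 x : Omega x -> 1 < q x.
Proof. by move=> /(dp_q D)/andP[/(lt_le_trans r11)]. Qed.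
Let pn x : Omega x -> p x <= n.
Proof. by move=> /(dp_p D)/andP[_ /le_trans]; apply; exact: ltW. Qed.
Let qn x : Omega x -> q x <= n.
Proof. by move=> /(dp_q D)/andP[_ /le_trans]; apply; exact: ltW. Qed.

Lemma double_phase_ge0 x t : Omega x -> 0 <= t -> 0 <= S x t.
Proof. by move=> Ox t0; rewrite double_phaseE addr_ge0// phase_ge0 ?a0 ?b0. Qed.

Lemma double_phase_homo x s t : Omega x -> 0 <= s -> s <= t -> S x s <= S x t.
Proof.
move=> Ox s0 st; rewrite !double_phaseE lerD// phase_homo ?a0 ?b0// ltW// (lt_trans ltr01)//.
  exact: p1.
exact: q1.
Qed.

Lemma double_phase_double x t : Omega x -> 0 <= t -> S x (2 * t) <= 2 `^ (n + 1) * S x t.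
Proof.
move=> Ox t0; rewrite !double_phaseE mulrDr lerD// phase_double ?a0 ?b0 ?pn ?qn//.
  by rewrite ltW// (lt_trans ltr01)// p1.
by rewrite ltW// (lt_trans ltr01)// q1.
Qed.

Lemma sobolev_phase_homo x s t : Omega x -> 0 <= s -> s <= t -> G x s <= G x t.
Proof.
move=> Ox s0 st; rewrite lerD//.
  exact: (phase_star_homo r11 r2n he1 h0 (dp_p D Ox) (a0 Ox)).
exact: (phase_star_homo r11 r2n hdelta heta (dp_q D Ox) (b0 Ox)).
Qed.

Definition kapG : R := 2 `^ ((n + 1) * tau_exp n r2).

Lemma kapG_ge1 : 1 <= kapG.
Proof.
have nr : 0 < n - r2 by rewrite subr_gt0.
rewrite -[leLHS](powRr0 2) ler_powR ?ler1n// mulr_ge0 ?divr_ge0 ?(ltW nr)//.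
by have := n2; lra.
Qed.

Lemma sobolev_phase_double x t : Omega x -> 0 <= t -> G x (2 * t) <= kapG * G x t.
Proof.
move=> Ox t0; rewrite mulrDr lerD//.
  exact: (phase_star_double n2 r11 r2n he1 h0 (dp_p D Ox) (a0 Ox)).
exact: (phase_star_double n2 r11 r2n hdelta heta (dp_q D Ox) (b0 Ox)).
Qed.

Let m : R := Num.min 1 (ell delta eta 1).
Let m0 : 0 < m. Proof. by rewrite lt_min ltr01 ell_gt0. Qed.

Let double_phase_ge x t : Omega x -> 1 <= t -> d * m * t <= S x t.
Proof.
move=> Ox t1; have t0 := le_trans ler01 t1; rewrite double_phaseE.
have := phase_ge_lin he1 h0 (ltW (p1 Ox)) (a0 Ox) t1.
have := phase_ge_lin hdelta heta (ltW (q1 Ox)) (b0 Ox) t1.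
rewrite ell_e mulr1 => h1 h2; apply: le_trans (lerD h2 h1); rewrite -mulrDl ler_wpM2r//.
apply: (@le_trans _ _ ((a x + b x) * m)); first by rewrite ler_wpM2r ?(ltW m0)// (dp_ab D).
rewrite mulrDl lerD//.
  by rewrite -[leRHS]mulr1 ler_wpM2l ?a0// ge_min lexx.
by rewrite ler_wpM2l ?b0// ge_min lexx orbT.
Qed.

Lemma le_double_phase : exists2 C, 0 < C & forall x t, Omega x -> 1 <= t -> t <= C * S x t.
Proof.
have dm : 0 < d * m by rewrite mulr_gt0 ?(dp_d D).
exists (d * m)^-1; first by rewrite invr_gt0.
by move=> x t Ox t1; rewrite ler_pdivlMl// double_phase_ge.
Qed.

(** For t >= 1 the double phase is at least d m, so one of its two phases is at least half of that
    and has a critical power bounded below. As [G] vanishes at t = 0, no such comparison holds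
    there; this is why the levels start at 1. *)
Lemma double_phase_le_sobolev : exists2 C, 0 < C & forall x t, Omega x -> 1 <= t ->
  1 <= C * G x t /\ S x t <= C * G x t.
Proof.
have dm : 0 < d * m by rewrite mulr_gt0 ?(dp_d D).
pose h := Num.min 1 (d * m / 2).
have h00 : 0 < h by rewrite lt_min ltr01 divr_gt0.
have h1 : h <= 1 by rewrite ge_min lexx.
pose t2 := tau_exp n r2; pose C0 := (h `^ t2)^-1.
have C00 : 0 < C0 by rewrite invr_gt0 powR_gt0.
have key x t : Omega x -> 1 <= t -> 1 <= C0 * G x t.
  move=> Ox t1; have t0 := le_trans ler01 t1.
  rewrite ler_pdivlMl ?powR_gt0// mulr1.
  have S1 : d * m <= S x t.
    by apply: le_trans (double_phase_ge Ox t1); rewrite ler_peMr// ltW.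
  have star c r de et : 1 <= de -> 0 <= et -> r1 <= r <= r2 -> h <= phase c r de et t ->
      h `^ t2 <= phase_star n c r de et t.
    move=> hd' he' hr hh; apply: (@le_trans _ _ (h `^ tau_exp n r)).
      by apply: ger_powR; [rewrite h00|exact: tau_exp_le hr].
    have := tau_exp_gt1 r11 r2n hr => t1'.
    apply: ge0_ler_powR; rewrite ?nnegrE ?(ltW h00)//; first by rewrite ltW// (lt_trans ltr01).
    exact: le_trans (ltW h00) hh.
  rewrite double_phaseE in S1.
  have [Ha|Ha] := leP (d * m / 2) (phase (a x) (p x) e1 0 t).
    apply: (@le_trans _ _ (phase_star n (a x) (p x) e1 0 t)); last by rewrite lerDl powR_ge0.
    by apply: star => //; [exact: (dp_p D)|rewrite (le_trans _ Ha)// ge_min lexx orbT].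
  apply: (@le_trans _ _ (phase_star n (b x) (q x) delta eta t)); last by rewrite lerDr powR_ge0.
  apply: star => //; first exact: (dp_q D).
  by rewrite (@le_trans _ _ (d * m / 2))// ?ge_min ?lexx ?orbT//; lra.
exists (2 * C0 + 1); first by rewrite addr_gt0// mulr_gt0.
move=> x t Ox t1; have k := key x t Ox t1; have t0 := le_trans ler01 t1.
have G0 := sobolev_phase_ge0 x t.
have CG : 0 <= C0 * G x t by rewrite mulr_ge0// ltW.
split; first by lra.
have := phase_le_star e1 0 r11 r2n (dp_p D Ox) (a0 Ox) t0.
have := phase_le_star delta eta r11 r2n (dp_q D Ox) (b0 Ox) t0.
rewrite double_phaseE; move: k CG G0; rewrite /sobolev_phase; lra.
Qed.

(** All Young parameters are 1: a large multiple of [G] on the right does no harm, since the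
    superlinear exponent deals with it later. The two gap fields serve the two applications of
    [slope_x_le], in which the phases exchange their roles. *)
Lemma majorant_le (C1 C2 Ca Cb : R) : 0 < C1 -> 0 < C2 -> 0 < Ca -> 0 < Cb ->
  exists2 C, 0 < C & forall x t y, Omega x -> 0 < t -> 0 <= y ->
  majorant n e1 0 C1 1 Ca (a x) (p x) t y <= C * (G x t + S x t + S x y + t) /\
  majorant n delta eta C2 1 Cb (b x) (q x) t y <= C * (G x t + S x t + S x y + t).
Proof.
move=> C10 C20 Ca0 Cb0.
have [K1 K10 HK1] := slope_x_le n2 r11 r2n A00 (dp_d D) he1 h0 he10 hdelta heta hde (dp_kap D) ltr01.
have [K2 K20 HK2] := slope_x_le n2 r11 r2n A00 (dp_d D) hdelta heta hde he1 h0 he10 (dp_kap D) ltr01.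
pose C := 2 * C1 + 2 * C2 + 1 + C1 * K1 + C2 * K2 + Ca + Cb.
have K1C : 0 < C1 * K1 by rewrite mulr_gt0.
have K2C : 0 < C2 * K2 by rewrite mulr_gt0.
exists C; first by rewrite /C; lra.
move=> x t y Ox t0 y0; have t0' := ltW t0.
have s1 : 0 < (1 : R) <= 1 by rewrite ltr01 lexx.
have := slope_t_young n2 r11 r2n he1 h0 s1 (dp_p D Ox) (a0 Ox) t0 y0.
have := slope_t_young n2 r11 r2n hdelta heta s1 (dp_q D Ox) (b0 Ox) t0 y0.
rewrite powR1 !mul1r => tq tp.
have xp := HK1 _ _ _ _ _ (dp_p D Ox) (dp_q D Ox) (dp_a D Ox) (b0 Ox) (dp_ab D Ox) (dp_gapp D Ox) t0'.
have ba : d <= b x + a x by rewrite addrC (dp_ab D).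
have xq := HK2 _ _ _ _ _ (dp_q D Ox) (dp_p D Ox) (dp_b D Ox) (a0 Ox) ba (dp_gapq D Ox) t0'.
rewrite -/n !mul1r in xp xq.
have := phase_ge0 (p x) he1 h0 (a0 Ox) t0'; have := phase_ge0 (p x) he1 h0 (a0 Ox) y0.
have := phase_ge0 (q x) hdelta heta (b0 Ox) t0'; have := phase_ge0 (q x) hdelta heta (b0 Ox) y0.
have : 0 <= phase_star n (a x) (p x) e1 0 t by exact: powR_ge0.
have : 0 <= phase_star n (b x) (q x) delta eta t by exact: powR_ge0.
rewrite /majorant !double_phaseE /sobolev_phase.
move: tq tp xp xq.
set ga := phase_star _ (a x) _ _ _ _; set gb := phase_star _ (b x) _ _ _ _.
set ta := slope_t _ (a x) _ _ _ _ * _; set tb := slope_t _ (b x) _ _ _ _ * _.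
set xa := slope_x _ (a x) _ _ _ _; set xb := slope_x _ (b x) _ _ _ _.
set Ha := phase (a x) _ _ _ t; set Hb := phase (b x) _ _ _ t.
set Ha' := phase (a x) _ _ _ y; set Hb' := phase (b x) _ _ _ y.
move=> tq tp xp xq gb0 ga0 hb'0 hb0 ha'0 ha0.
pose Z := ga + gb + (Ha + Hb) + (Ha' + Hb') + t.
have Z0 : 0 <= Z by rewrite /Z; lra.
have tZ : t <= Z by rewrite /Z; lra.
have pt : C1 * (ta + xa) <= 2 * C1 * Z + C1 * K1 * t.
  have h : ta + xa <= 2 * Z + K1 * t by rewrite /Z; lra.
  have := ler_wpM2l (ltW C10) h; lra.
have qt : C2 * (tb + xb) <= 2 * C2 * Z + C2 * K2 * t.
  have h : tb + xb <= 2 * Z + K2 * t by rewrite /Z; lra.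
  have := ler_wpM2l (ltW C20) h; lra.
have w1 : C1 * K1 * t <= C1 * K1 * Z by rewrite ler_wpM2l// mulr_ge0// ltW.
have w2 : C2 * K2 * t <= C2 * K2 * Z by rewrite ler_wpM2l// mulr_ge0// ltW.
have w3 : Ca * t <= Ca * Z by rewrite ler_wpM2l// ltW.
have w4 : Cb * t <= Cb * Z by rewrite ler_wpM2l// ltW.
have w5 : 0 <= C1 * K1 * Z by rewrite !mulr_ge0// ltW.
have w9 : 0 <= C1 * Z by rewrite mulr_ge0// ltW.
have w10 : 0 <= C2 * Z by rewrite mulr_ge0// ltW.
have w6 : 0 <= C2 * K2 * Z by rewrite !mulr_ge0// ltW.
have w7 : 0 <= Ca * Z by rewrite !mulr_ge0// ltW.
have w8 : 0 <= Cb * Z by rewrite !mulr_ge0// ltW.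
have gaZ : ga <= Z by rewrite /Z; lra.
have gbZ : gb <= Z by rewrite /Z; lra.
rewrite -/Z (_ : C * Z = 2 * (C1 * Z) + 2 * (C2 * Z) + Z + (C1 * K1 * Z + C2 * K2 * Z) + Ca * Z + Cb * Z); last first.
  by rewrite /C; ring.
clearbody Z; split; rewrite mul1r; lra.
Qed.

End double_phase.

Section excess.
Context {R : realType}.
Implicit Types k M t : R.

Definition excess (k t : R) : R := Num.max (`|t| - k) 0.

Lemma excess_ge0 k t : 0 <= excess k t.
Proof. by rewrite le_max lexx orbT. Qed.

Lemma trunc_le_excess k M t : trunc k M t <= excess k t.
Proof. by rewrite ge_min lexx. Qed.

Lemma trunc_double (k M t : R) : 0 <= M -> trunc k (2 * M) t <= 2 * trunc k M t.
Proof.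
move=> M0; have := excess_ge0 k t; rewrite /trunc -/(excess k t).
by move: (excess k t) => w w0; case: (leP w (2 * M)) => ?; case: (leP w M) => ?; lra.
Qed.

(** Above the level k' the excess over k is at least the fraction (k' - k) / k' of the modulus. *)
Lemma le_excess c k k' t : k' <= c * (k' - k) -> 1 <= c -> k' <= `|t| -> `|t| <= c * excess k t.
Proof.
move=> h c1 kt; apply: (@le_trans _ _ (c * (`|t| - k))); first by nra.
by rewrite ler_wpM2l ?(le_trans ler01)// le_max lexx.
Qed.

Lemma measurable_excess d (T : measurableType d) (D : set T) (u : T -> R) k :
  measurable_fun D u -> measurable_fun D (fun x => excess k (u x)).
Proof.
move=> mu_; apply: measurable_maxr => //; apply: measurable_funB => //.
exact: measurableT_comp.
Qed.

End excess.

Section integral_tail.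
Context d (T : measurableType d) (R : realType) (mu : {measure set T -> \bar R}).
Variables (D : set T) (mD : measurable D).
Implicit Types (f g F u : T -> R).

Lemma measurable_fun_ifD (b : T -> bool) f g : measurable_fun D b -> measurable_fun D f ->
  measurable_fun D g -> measurable_fun D (fun x => if b x then f x else g x).
Proof.
move=> mb mf mg; apply: measurable_fun_if => //.
- by apply: (measurable_funS mD) mf; exact: subIsetl.
- by apply: (measurable_funS mD) mg; exact: subIsetl.
Qed.

Lemma measurable_gtr_norm k u : measurable_fun D u -> measurable_fun D (fun x => k < `|u x|).
Proof.
by move=> mu_; apply: measurable_fun_ltr => //; apply: measurableT_comp => //.
Qed.

Lemma ge0_integralD_EFin f g : measurable_fun D f -> measurable_fun D g ->
  (forall x, D x -> 0 <= f x) -> (forall x, D x -> 0 <= g x) ->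
  (\int[mu]_(x in D) (f x + g x)%:E =
   \int[mu]_(x in D) (f x)%:E + \int[mu]_(x in D) (g x)%:E)%E.
Proof.
move=> mf mg f0 g0; rewrite -ge0_integralD//; [exact/measurable_EFinP|exact/measurable_EFinP].
Qed.

Lemma le_integral_EFin f g : measurable_fun D f -> measurable_fun D g ->
  (forall x, D x -> 0 <= f x) -> (forall x, D x -> f x <= g x) ->
  (\int[mu]_(x in D) (f x)%:E <= \int[mu]_(x in D) (g x)%:E)%E.
Proof.
move=> mf mg f0 fg; apply: ge0_le_integral => //.
- exact/measurable_EFinP.
- exact/measurable_EFinP.
Qed.

Lemma le_integralZ f g K : measurable_fun D f -> measurable_fun D g -> 0 <= K ->
  (forall x, D x -> 0 <= f x) -> (forall x, D x -> 0 <= g x) ->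
  (forall x, D x -> f x <= K * g x) ->
  (\int[mu]_(x in D) (f x)%:E <= K%:E * \int[mu]_(x in D) (g x)%:E)%E.
Proof.
move=> mf mg K0 f0 g0 fg.
have := @le_integralD _ T R mu D f (cst 0) g K mD mf (measurable_cst _) mg K0 f0.
rewrite integral0 add0e; apply => //.
by move=> x Dx; rewrite add0r fg.
Qed.

Lemma integral_tail F u e : measurable_fun D u -> mu.-integrable D (EFin \o F) ->
  (forall x, D x -> 0 <= F x) -> 0 < e ->
  exists k0 : nat, forall k, k0%:R <= k ->
    (\int[mu]_(x in D) (if k < `|u x| then F x else 0)%:E <= e%:E)%E.
Proof.
move=> mu_ iF F0 e0.
have mF : measurable_fun D F by apply/measurable_EFinP; exact: measurable_int iF.
have mif k : measurable_fun D (fun x => if k < `|u x| then F x else 0).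
  by apply: measurable_fun_ifD => //; exact: measurable_gtr_norm.
have [] := @real_dominated_convergence _ T R mu D
  (fun i x => if i%:R < `|u x| then F x else 0) (cst 0) F mD (fun i => mif i%:R) (measurable_cst _) _ iF.
- apply: nearW => x Dx; apply: cvg_near_cst.
  have [i ui] : exists i : nat, `|u x| <= i%:R.
    by exists (Num.truncn `|u x|).+1; apply/ltW; exact: truncnS_gt.
  exists i => //= j ij; rewrite ltNge (le_trans ui)// ler_nat//.
- move=> i x Dx; case: ifP => _; last by rewrite normr0 F0.
  by rewrite ger0_norm// F0.
move=> _; rewrite integral0 => cF.
have e0' : (0 < e%:E)%E by rewrite lte_fin.
have [k0 _ Hk0] := cvge_near_lt cF e0'.
exists k0 => k kk; apply: le_trans (ltW (Hk0 k0 (leqnn _))).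
apply: le_integral_EFin => //.
  by move=> x Dx; case: ifP => // _; exact: F0.
move=> x Dx; case: ifPn => [ku|_]; first by rewrite (le_lt_trans kk ku).
by case: ifP => // _; exact: F0.
Qed.

End integral_tail.

(** * Finiteness of the critical integral *)

Section embedding.
Context {R : realType} {N : nat}.
Notation cT := (caratheodory_type (@lebesgue_outer R N)).
Notation mR := (measurableTypeR R).
Notation mu := (leb : {measure set cT -> \bar R}).
Variables (Omega : set 'rV[R]_N) (a b p q : 'rV[R]_N -> R).
Variables (delta eta r1 r2 A0 L kap d : R).
Hypothesis D : double_phase_data Omega a b p q delta eta r1 r2 A0 L kap d.
Let n : R := N%:R.
Let e1 : R := expR 1.
Notation S := (log_double_phase a b p q delta eta).
Notation G := (sobolev_phase a b p q delta eta).
Let e : R := n / (n - 1).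

Let n2 : 2 <= n. Proof. by rewrite ler_nat (dp_N D). Qed.
Let r11 := dp_r11 D. Let r12 := dp_r12 D. Let r2n : r2 < n := dp_r2 D.
Let A00 := dp_A0 D. Let hdelta := dp_delta D. Let heta := dp_eta D. Let hde := dp_de D.
Let he1 : 1 <= e1. Proof. by rewrite -expR0 ler_expR. Qed.
Let h0 : 0 <= 0 :> R. Proof. by []. Qed.
Let he10 : 1 < e1 + 0. Proof. by rewrite addr0 -expR0 ltr_expR. Qed.
Let oO := dp_open D. Let bO := dp_bounded D.
Let mO : measurable (Omega : set cT). Proof. exact: measurable_domain. Qed.
Let ma : measurable_fun (Omega : set cT) (a : cT -> mR).
Proof. exact: (measurable_lipschitz_domain oO (dp_L D) (dp_la D)). Qed.
Let mb : measurable_fun (Omega : set cT) (b : cT -> mR).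
Proof. exact: (measurable_lipschitz_domain oO (dp_L D) (dp_lb D)). Qed.
Let mp : measurable_fun (Omega : set cT) (p : cT -> mR).
Proof. exact: (measurable_lipschitz_domain oO (dp_L D) (dp_lp D)). Qed.
Let mq : measurable_fun (Omega : set cT) (q : cT -> mR).
Proof. exact: (measurable_lipschitz_domain oO (dp_L D) (dp_lq D)). Qed.
Let e_gt1 : 1 < e.
Proof. by rewrite /e ltr_pdivlMr ?mul1r; have := n2; lra. Qed.
Let e_gt0 : 0 < e. Proof. exact: lt_trans e_gt1. Qed.

Lemma measurable_double_phase (v : cT -> R) : measurable_fun (Omega : set cT) v ->
  measurable_fun (Omega : set cT) (fun x => S x (v x)).
Proof.
move=> mv; under eq_fun do rewrite double_phaseE.
apply: measurable_funD; first exact: (measurable_phase e1 0 mO ma mp mv).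
exact: (measurable_phase delta eta mO mb mq mv).
Qed.

Let msa (v : cT -> R) : measurable_fun (Omega : set cT) v ->
  measurable_fun (Omega : set cT) (fun x => phase_star n (a x) (p x) e1 0 (v x)).
Proof. by move=> mv; exact: (measurable_phase_star e1 0 r2n mO ma mp mv (dp_p D)). Qed.
Let msb (v : cT -> R) : measurable_fun (Omega : set cT) v ->
  measurable_fun (Omega : set cT) (fun x => phase_star n (b x) (q x) delta eta (v x)).
Proof. by move=> mv; exact: (measurable_phase_star delta eta r2n mO mb mq mv (dp_q D)). Qed.

Lemma measurable_sobolev_phase (v : cT -> R) : measurable_fun (Omega : set cT) v ->
  measurable_fun (Omega : set cT) (fun x => G x (v x)).
Proof. by move=> mv; apply: measurable_funD; [exact: msa|exact: msb]. Qed.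

Lemma sobolev_phase0 x : Omega x -> G x 0 = 0.
Proof.
move=> Ox; rewrite /sobolev_phase /phase_star /phase.
have t1 := tau_exp_gt1 r11 r2n (dp_p D Ox); have t2 := tau_exp_gt1 r11 r2n (dp_q D Ox).
have [px _] := andP (dp_p D Ox); have [qx _] := andP (dp_q D Ox).
have z (y : R) : 1 < y -> y != 0 by move=> y1; rewrite gt_eqF// (lt_trans ltr01).
rewrite !(powR0, mulr0, mul0r) ?addr0// z//; [exact: lt_le_trans qx|exact: lt_le_trans px].
Qed.

Lemma sobolev_phase_bounded M : exists2 K, 0 < K & forall x t, Omega x -> 0 <= t <= M -> G x t <= K.
Proof.
have [K1 K10 H1] := phase_bounded n2 r11 r2n A00 he1 h0 M.
have [K2 K20 H2] := phase_bounded n2 r11 r2n A00 hdelta heta M.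
exists (K1 + K2); first exact: addr_gt0.
move=> x t Ox tM; have [_ + _ _] := H1 _ _ _ (dp_a D Ox) (dp_p D Ox) tM.
have [_ + _ _] := H2 _ _ _ (dp_b D Ox) (dp_q D Ox) tM.
by move=> h2 h1; exact: lerD.
Qed.

Definition tail_energy (u : 'rV[R]_N -> R) (g : 'rV[R]_N -> 'rV[R]_N) (k : R) : \bar R :=
  (\int[leb]_(x in Omega) (if k < `|u x| then S x `|u x| + S x (enorm (g x)) else 0)%:E)%E.

Lemma sobolev_trunc : exists2 A, 0 < A & forall k M phi_ u g, 1 <= k -> 0 <= M ->
  (forall m, C1_0 Omega (phi_ m)) -> W11_limit Omega phi_ u g ->
  (\int[leb]_(x in Omega) (G x (trunc k M (u x)))%:E <=
   (A%:E * (\int[leb]_(x in Omega) (G x (trunc k M (u x)))%:E + tail_energy u g k)) `^ e)%E.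
Proof.
have [C1 C10 H1] := sobolev_phase_W11 oO bO (dp_N D) r11 r12 r2n A00 (dp_L D) he1 h0 he10
  (dp_a D) (dp_p D) (dp_la D) (dp_lp D).
have [C2 C20 H2] := sobolev_phase_W11 oO bO (dp_N D) r11 r12 r2n A00 (dp_L D) hdelta heta hde
  (dp_b D) (dp_q D) (dp_lb D) (dp_lq D).
have [Ca Ca0 {}H1] := H1 1 ltr01; have [Cb Cb0 {}H2] := H2 1 ltr01.
have [C C0 HC] := majorant_le D C10 C20 Ca0 Cb0.
have [C' C'0 HC'] := le_double_phase D.
pose B := C * (1 + C'); have B0 : 0 < B by rewrite mulr_gt0// addr_gt0.
exists (2 * B); first by rewrite mulr_gt0.
move=> k M phi_ u g k1 M0 Cphi W; have [mu_ mg _ _ _] := W.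
have k0 := le_trans ler01 k1.
pose v x := trunc k M (u x).
pose y x := if k < `|u x| then S x `|u x| + S x (enorm (g x)) else 0.
have v0 x : 0 <= v x by exact: trunc_ge0.
have mv : measurable_fun (Omega : set cT) (v : cT -> R) by exact: (measurable_trunc k M mu_).
have mnu : measurable_fun (Omega : set cT) ((fun x => `|u x|) : cT -> R).
  by apply: (@measurableT_comp _ _ _ _ _ _ (@Num.norm R R)).
have mng : measurable_fun (Omega : set cT) ((fun x => enorm (g x)) : cT -> R).
  exact: measurable_enorm.
have my : measurable_fun (Omega : set cT) (y : cT -> R).
  have m1 := measurable_double_phase mnu; have m2 := measurable_double_phase mng.
  have mlt := measurable_gtr_norm k mu_.
  have m12 : measurable_fun (Omega : set cT)
    ((fun x => S x `|u x| + S x (enorm (g x))) : cT -> R) := measurable_funD m1 m2.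
  exact: (measurable_fun_ifD mO mlt m12 (measurable_cst _)).
have mG := measurable_sobolev_phase mv.
have y0 x : Omega x -> 0 <= y x.
  move=> Ox; rewrite /y; case: ifP => // _.
  by rewrite addr_ge0// (double_phase_ge0 D Ox)// enorm_ge0.
have maj x : Omega x ->
  majorant n e1 0 C1 1 Ca (a x) (p x) (v x) (enorm (g x)) <= B * (G x (v x) + y x) /\
  majorant n delta eta C2 1 Cb (b x) (q x) (v x) (enorm (g x)) <= B * (G x (v x) + y x).
  move=> Ox; have G0 := sobolev_phase_ge0 a b p q delta eta x (v x).
  have rhs : 0 <= B * (G x (v x) + y x).
    by apply: mulr_ge0 (ltW B0) _; exact: addr_ge0 G0 (y0 _ Ox).
  have := v0 x; rewrite le_eqVlt => /orP[/eqP vz|vx].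
    rewrite -vz in rhs *.
    by rewrite (majorant0 _ _ r11 r2n _ _ _ _ _ (dp_p D Ox)) (majorant0 _ _ r11 r2n _ _ _ _ _ (dp_q D Ox)).
  have ku : k < `|u x|.
    by rewrite ltNge; apply/negP => uk; move: vx; rewrite /v trunc_eq0// ltxx.
  have [h1 h2] := HC x (v x) (enorm (g x)) Ox vx (enorm_ge0 _).
  have vu : v x <= `|u x| by exact: trunc_le_norm.
  have Suv : S x (v x) <= S x `|u x| by exact: (double_phase_homo D Ox).
  have u1 : 1 <= `|u x| by rewrite (le_trans k1)// ltW.
  have uS := HC' x `|u x| Ox u1.
  have Su0 : 0 <= S x `|u x| by exact: (double_phase_ge0 D Ox).
  have Sg0 : 0 <= S x (enorm (g x)) by rewrite (double_phase_ge0 D Ox)// enorm_ge0.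
  have bound : C * (G x (v x) + S x (v x) + S x (enorm (g x)) + v x) <= B * (G x (v x) + y x).
    rewrite /B -mulrA ler_pM2l// /y ku.
    have : 0 <= C' * G x (v x) by rewrite mulr_ge0// ltW.
    have : 0 <= C' * S x (enorm (g x)) by rewrite mulr_ge0// ltW.
    lra.
  by split; [exact: le_trans h1 bound|exact: le_trans h2 bound].
have GE : (\int[leb]_(x in Omega) (G x (v x))%:E =
    \int[leb]_(x in Omega) (phase_star n (a x) (p x) e1 0 (v x))%:E +
    \int[leb]_(x in Omega) (phase_star n (b x) (q x) delta eta (v x))%:E)%E.
  apply: (@ge0_integralD_EFin _ cT R mu Omega mO (fun x => phase_star n (a x) (p x) e1 0 (v x))
    (fun x => phase_star n (b x) (q x) delta eta (v x)) (msa mv) (msb mv)) => x _; exact: powR_ge0.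
set X := (\int[leb]_(x in Omega) (G x (v x))%:E)%E in GE *.
have yE : tail_energy u g k = (\int[leb]_(x in Omega) (y x)%:E)%E by [].
rewrite -/X yE; set Y := (\int[leb]_(x in Omega) (y x)%:E)%E.
have X0 : (0 <= X)%E by apply: integral_ge0 => x _; rewrite lee_fin sobolev_phase_ge0.
have Y0 : (0 <= Y)%E by apply: integral_ge0 => x Ox; rewrite lee_fin y0.
have XYE : (X + Y = \int[leb]_(x in Omega) (G x (v x) + y x)%:E)%E.
  have G0 x : Omega x -> 0 <= G x (v x) by move=> _; exact: sobolev_phase_ge0.
  exact: (esym (@ge0_integralD_EFin _ cT R mu Omega mO _ _ mG my G0 y0)).
rewrite XYE; set W' := (\int[leb]_(x in Omega) (G x (v x) + y x)%:E)%E.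
have W'0 : (0 <= W')%E by rewrite /W' -XYE adde_ge0.
have BW0 : (0 <= B%:E * W')%E by rewrite mule_ge0// lee_fin ltW.
have Gy0 x : Omega x -> 0 <= G x (v x) + y x.
  by move=> Ox; rewrite addr_ge0 ?y0// sobolev_phase_ge0.
have mGy : measurable_fun (Omega : set cT) ((fun x => G x (v x) + y x) : cT -> R).
  exact: (measurable_funD mG my).
have mja := measurable_majorant e1 0 r2n mO ma mp mv (dp_p D) C1 1 Ca mng.
have mjb := measurable_majorant delta eta r2n mO mb mq mv (dp_q D) C2 1 Cb mng.
have Xa : (\int[leb]_(x in Omega) (phase_star n (a x) (p x) e1 0 (v x))%:E <= (B%:E * W') `^ e)%E.
  apply: (le_trans (H1 k M phi_ u g k0 M0 Cphi W)).
  have j0 x : Omega x -> 0 <= majorant n e1 0 C1 1 Ca (a x) (p x) (v x) (enorm (g x)).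
    by move=> _; apply: majorant_ge0; rewrite ?enorm_ge0// ltW.
  apply: gt0_ler_poweR; first exact: ltW.
  - by rewrite in_itv/= leey andbT; apply: integral_ge0 => x Ox; rewrite lee_fin j0.
  - by rewrite in_itv/= leey andbT.
  exact: (@le_integralZ _ cT R mu Omega mO _ _ B mja mGy (ltW B0) j0 Gy0 (fun x Ox => (maj x Ox).1)).
have Xb : (\int[leb]_(x in Omega) (phase_star n (b x) (q x) delta eta (v x))%:E <= (B%:E * W') `^ e)%E.
  apply: (le_trans (H2 k M phi_ u g k0 M0 Cphi W)).
  have j0 x : Omega x -> 0 <= majorant n delta eta C2 1 Cb (b x) (q x) (v x) (enorm (g x)).
    by move=> _; apply: majorant_ge0; rewrite ?enorm_ge0// ltW.
  apply: gt0_ler_poweR; first exact: ltW.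
  - by rewrite in_itv/= leey andbT; apply: integral_ge0 => x Ox; rewrite lee_fin j0.
  - by rewrite in_itv/= leey andbT.
  exact: (@le_integralZ _ cT R mu Omega mO _ _ B mjb mGy (ltW B0) j0 Gy0 (fun x Ox => (maj x Ox).2)).
rewrite {1}GE; apply: (le_trans (leeD Xa Xb)).
have -> : ((2 * B)%:E * W' = 2%:E * (B%:E * W'))%E by rewrite muleA -EFinM.
move: (B%:E * W')%E BW0 => V V0; rewrite poweRM//.
rewrite poweR_EFin -[X in (X <= _)%E]mule2n -mule_natl lee_wpmul2r ?poweR_ge0//.
by rewrite lee_fin -[leLHS]powRr1// ler_powR ?ler1n// ltW.
Qed.

(** Monotone convergence along the heights reached by successive doubling. *)
Lemma integral_excess_le M0 k c u : 0 < M0 -> measurable_fun (Omega : set cT) (u : cT -> R) ->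
  (forall i : nat, (\int[leb]_(x in Omega) (G x (trunc k (2 ^+ i * M0) (u x)))%:E <= c)%E) ->
  (\int[leb]_(x in Omega) (G x (excess k (u x)))%:E <= c)%E.
Proof.
move=> M00 mu_ H.
pose f (i : nat) (x : cT) := (G x (trunc k (2 ^+ i * M0) (u x)))%:E.
have Mi i : 0 <= 2 ^+ i * M0 by rewrite mulr_ge0 ?exprn_ge0// ltW.
have mf i : measurable_fun (Omega : set cT) (f i).
  by apply/measurable_EFinP; exact: measurable_sobolev_phase (measurable_trunc k _ mu_).
have fcvg (x : cT) : Omega x -> f i x @[i --> \oo] --> (G x (excess k (u x)))%:E.
  move=> Ox; apply: cvg_near_cst.
  have [j uj] : exists j : nat, excess k (u x) / M0 <= j%:R.
    by exists (Num.truncn (excess k (u x) / M0)).+1; apply/ltW; exact: truncnS_gt.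
  exists j => //= i ji; congr (G x _)%:E; rewrite /trunc -/(excess k (u x)) min_l//.
  rewrite -ler_pdivrMr// (le_trans uj)// -natrX ler_nat (leq_trans ji)//.
  by rewrite ltnW// ltn_expl.
rewrite (_ : (\int[leb]_(x in Omega) (G x (excess k (u x)))%:E =
    \int[mu]_(x in Omega) limn (f^~ x))%E); last first.
  by apply: eq_integral => x; rewrite inE => Ox; apply/esym/cvg_lim => //; exact: fcvg.
have f0 i x : Omega x -> (0 <= f i x)%E.
  by move=> Ox; rewrite lee_fin sobolev_phase_ge0.
have fnd x : Omega x -> nondecreasing_seq (f^~ x).
  move=> Ox i j ij; rewrite lee_fin (sobolev_phase_homo D Ox) ?trunc_ge0//.
  rewrite /trunc le_min ge_min lexx/= ge_min.
  by rewrite ler_wpM2r ?(ltW M00) ?orbT// ler_weXn2l// ler1n.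
have := @cvg_monotone_convergence _ cT R mu Omega mO f mf f0 fnd.
by move=> /cvge_to_le; apply; apply: nearW => i; exact: H.
Qed.

Let kG := @kapG R N r2.

Lemma sobolev_embedding phi_ u g : (forall m, C1_0 Omega (phi_ m)) -> W11_limit Omega phi_ u g ->
  (\int[leb]_(x in Omega) (S x `|u x|)%:E < +oo)%E ->
  (\int[leb]_(x in Omega) (S x (enorm (g x)))%:E < +oo)%E ->
  (\int[leb]_(x in Omega) (G x `|u x|)%:E < +oo)%E.
Proof.
move=> Cphi W Su Sg; have [mu_ mg _ _ _] := W.
have [A A0' HA] := sobolev_trunc.
have kG1 : 1 <= kG by exact: kapG_ge1 D.
have kG0 := lt_le_trans ltr01 kG1.
have [s s0 Hs] := small_power_bound A0' kG0 e_gt1.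
have mnu : measurable_fun (Omega : set cT) ((fun x => `|u x|) : cT -> R).
  by apply: (@measurableT_comp _ _ _ _ _ _ (@Num.norm R R)).
have mng : measurable_fun (Omega : set cT) ((fun x => enorm (g x)) : cT -> R).
  exact: measurable_enorm.
have m1 := measurable_double_phase mnu; have m2 := measurable_double_phase mng.
pose F (x : cT) := S x `|u x| + S x (enorm (g x)).
have S10 x : Omega x -> 0 <= S x `|u x| by move=> Ox; exact: (double_phase_ge0 D Ox).
have S20 x : Omega x -> 0 <= S x (enorm (g x)).
  by move=> Ox; rewrite (double_phase_ge0 D Ox)// enorm_ge0.
have F0 x : Omega x -> 0 <= F x by move=> Ox; exact: addr_ge0 (S10 _ Ox) (S20 _ Ox).
have mF : measurable_fun (Omega : set cT) F := measurable_funD m1 m2.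
have iF : mu.-integrable Omega (EFin \o F).
  apply/integrableP; split; first exact/measurable_EFinP.
  have -> : (\int[mu]_(x in Omega) `|(EFin \o F) x| = \int[mu]_(x in Omega) (F x)%:E)%E.
    by apply: eq_integral => x; rewrite inE => Ox; rewrite /= ger0_norm// F0.
  by rewrite (@ge0_integralD_EFin _ cT R mu Omega mO _ _ m1 m2 S10 S20) lte_add_pinfty.
have [k0 Hk0] := integral_tail mO mu_ iF F0 s0.
pose k : R := k0.+1%:R.
have k1 : 1 <= k by rewrite /k ler1n.
have kge0 := le_trans ler01 k1.
have Yk : (tail_energy u g k <= s%:E)%E by apply: Hk0; rewrite /k ler_nat.
pose X M := (\int[leb]_(x in Omega) (G x (trunc k M (u x)))%:E)%E.
(* [small_power_bound] excludes the values of [X] between s and kG s, so that a value known to be at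
   most kG s falls back below s. *)
have step (M : R) : 0 <= M -> (X M <= (kG * s)%:E)%E -> (X M <= s%:E)%E.
  move=> M0 XM; have X0 : (0 <= X M)%E by apply: integral_ge0 => x _; rewrite lee_fin sobolev_phase_ge0.
  have XE : X M = (fine (X M))%:E.
    by rewrite fineK// ge0_fin_numE// (le_lt_trans XM)// ltry.
  have := HA k M phi_ u g k1 M0 Cphi W; rewrite -/(X M) => H.
  rewrite XE lee_fin; apply: (Hs s); rewrite ?lexx ?(ltW s0)//.
    by rewrite -lee_fin -XE X0 -lee_fin -XE.
  rewrite -lee_fin -XE; apply: (le_trans H).
  rewrite -poweR_EFin; apply: gt0_ler_poweR; first exact: ltW.
  - rewrite in_itv/= leey andbT mule_ge0 ?lee_fin ?(ltW A0')// adde_ge0//.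
    apply: integral_ge0 => x Ox; rewrite lee_fin; case: ifP => // _; exact: F0.
  - by rewrite in_itv/= leey andbT lee_fin mulr_ge0 ?(ltW A0')// addr_ge0 ?(ltW s0)// -lee_fin -XE.
  by rewrite EFinM EFinD -XE lee_wpmul2l ?lee_fin ?(ltW A0')// leeD2l.
(* [X M] is small for small [M] by dominated convergence *)
have [M0 M00 XM0] : exists2 M0, 0 < M0 & (X M0 <= s%:E)%E.
  have [K K0 HK] := sobolev_phase_bounded 1.
  pose Mi (i : nat) : R := i.+1%:R^-1.
  have Mi0 i : 0 < Mi i by rewrite invr_gt0.
  have Mi1 i : Mi i <= 1 by rewrite invf_le1// ler1n.
  have iK : mu.-integrable Omega (EFin \o cst K).
    by apply: (integrable_bounded_domain oO bO (C := `|K|)).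
  have [] := @real_dominated_convergence _ cT R mu Omega
    (fun i x => G x (trunc k (Mi i) (u x))) (cst 0) (cst K) mO _ (measurable_cst _) _ iK.
  - by move=> i; exact: measurable_sobolev_phase (measurable_trunc k _ mu_).
  - apply: nearW => x Ox.
    have cv : trunc k (Mi i) (u x) @[i --> \oo] --> 0.
      apply: (@squeeze_cvgr _ _ _ _ (cst 0) Mi); last exact: cvg_harmonic.
        by apply: nearW => i; rewrite trunc_ge0 ?(ltW (Mi0 _))// trunc_le.
      exact: cvg_cst.
    rewrite /cst -(sobolev_phase0 Ox).
    have cc (y : R) : y @[_ --> \oo] --> y by exact: cvg_cst.
    have vi i : 0 <= trunc k (Mi i) (u x) by rewrite trunc_ge0// ltW.
    apply: cvgD.
      apply: (cvg_phase_star r11 r2n he1 h0 _ _ (dp_p D Ox) (lexx 0) (cc _) (cc _) cv).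
      by apply: nearW => i; split; [exact: (dp_a D)|exact: (dp_p D)|].
    apply: (cvg_phase_star r11 r2n hdelta heta _ _ (dp_q D Ox) (lexx 0) (cc _) (cc _) cv).
    by apply: nearW => i; split; [exact: (dp_b D)|exact: (dp_q D)|].
  - move=> i x Ox; rewrite ger0_norm ?sobolev_phase_ge0//; apply: HK => //.
    by rewrite trunc_ge0 ?(ltW (Mi0 i))// (le_trans (trunc_le _ _ _)).
  move=> _; rewrite integral0 => cX.
  have s0' : (0 < s%:E)%E by rewrite lte_fin.
  have [i0 _ Hi0] := cvge_near_lt cX s0'.
  by exists (Mi i0) => //; apply: ltW; exact: (Hi0 i0 (leqnn _)).
(* Doubling the height at most doubles the truncation, which multiplies [X] by at most [kG]; then
   [step] restores the bound s, the same for all heights. *)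
have Xi i : (X (2 ^+ i * M0)%R <= s%:E)%E.
  elim: i => [|i IH]; first by rewrite expr0 mul1r.
  have Mi : 0 <= 2 ^+ i * M0 by rewrite mulr_ge0 ?exprn_ge0// ltW.
  rewrite exprS -mulrA; apply: step; first by rewrite mulr_ge0.
  rewrite EFinM; apply: (@le_trans _ _ (kG%:E * X (2 ^+ i * M0)%R)%E); last first.
    by rewrite lee_wpmul2l// lee_fin ltW.
  have mt M := measurable_sobolev_phase (measurable_trunc k M mu_).
  apply: (@le_integralZ _ cT R mu Omega mO _ _ kG (mt _) (mt _) (ltW kG0)).
  - by move=> x _; exact: sobolev_phase_ge0.
  - by move=> x _; exact: sobolev_phase_ge0.
  move=> x Ox; apply: le_trans (sobolev_phase_double D Ox _); last by rewrite trunc_ge0.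
  apply: (sobolev_phase_homo D Ox); first by rewrite trunc_ge0// mulr_ge0.
  exact: trunc_double.
have XE := integral_excess_le M00 mu_ Xi.
(* Up to 2 k the critical phase is bounded, on a domain of finite measure; beyond 2 k the modulus of
   u is at most twice its excess over k. *)
have [K K0 HK] := sobolev_phase_bounded (2 * k).
have me : measurable_fun (Omega : set cT) ((fun x => excess k (u x)) : cT -> R).
  exact: measurable_excess mu_.
have mGu := measurable_sobolev_phase mnu; have mGe := measurable_sobolev_phase me.
apply: (@le_lt_trans _ _ (\int[mu]_(x in Omega) (cst K x)%:E +
    kG%:E * \int[mu]_(x in Omega) (G x (excess k (u x)))%:E)%E).
  apply: (@le_integralD _ cT R mu Omega _ _ _ kG mO mGu (measurable_cst K) mGe (ltW kG0)).
  - by move=> x _; exact: sobolev_phase_ge0.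
  - by move=> x _; exact: ltW.
  - by move=> x _; exact: sobolev_phase_ge0.
  move=> x Ox; have G0 t := sobolev_phase_ge0 a b p q delta eta x t.
  have [uk|uk] := leP `|u x| (2 * k).
    by rewrite (le_trans (HK x `|u x| Ox _))// ?uk ?normr_ge0// lerDl mulr_ge0// ltW.
  rewrite (@le_trans _ _ (kG * G x (excess k (u x))))//; last by rewrite lerDr ltW.
  apply: le_trans (sobolev_phase_double D Ox (excess_ge0 _ _)).
  apply: (sobolev_phase_homo D Ox) => //; apply: (@le_excess _ 2 k (2 * k)); rewrite ?ler1n ?(ltW uk)//.
  by rewrite ler_wpM2l// mulr_natl mulr2n addrK.
apply: lte_add_pinfty.
  have -> : (\int[mu]_(x in Omega) (cst K x)%:E = K%:E * mu Omega)%E.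
    by rewrite -(integral_cst mu mO).
  rewrite lte_mul_pinfty ?lee_fin ?(ltW K0)//.
  exact: leb_domain_lty.
rewrite lte_mul_pinfty ?lee_fin ?(ltW kG0)//.
by rewrite (le_lt_trans XE)// ltry.
Qed.

End embedding.

(** * Approximation by test functions and soft thresholds *)

(** The sum of the series has a finite integral, so the series converges almost everywhere and its
    terms tend to 0. The geometric rate spares the extraction of a subsequence. *)
Lemma geometric_integral_ae_cvg d (T : measurableType d) (R : realType)
    (mu : {measure set T -> \bar R}) (D : set T) (f_ : nat -> T -> R) (C : R) :
  measurable D -> (forall i, measurable_fun D (f_ i)) -> (forall i x, D x -> 0 <= f_ i x) ->
  (forall i, (\int[mu]_(x in D) (f_ i x)%:E <= (C * 2^-1 ^+ i)%:E)%E) ->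
  {ae mu, forall x, D x -> f_ i x @[i --> \oo] --> 0}.
Proof.
move=> mD mf f0 fC.
have mfE i : measurable_fun D (fun x => (f_ i x)%:E) by exact/measurable_EFinP.
have f0E i x : D x -> (0 <= (f_ i x)%:E)%E by move=> Dx; rewrite lee_fin f0.
pose F x := (\sum_(i <oo) (f_ i x)%:E)%E.
have C0 : 0 <= C.
  have := fC 0%N; rewrite expr0 mulr1 -lee_fin; apply: le_trans.
  by apply: integral_ge0 => x /f0E.
have FC : (\int[mu]_(x in D) F x <= (2 * C)%:E)%E.
  rewrite integral_nneseries//; apply: lime_le.
    by apply: is_cvg_nneseries => i _ _; apply: integral_ge0 => x /f0E.
  apply: nearW => m; apply: (@le_trans _ _ (\sum_(0 <= i < m) (C * 2^-1 ^+ i)%:E)%E).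
    by apply: lee_sum => i _; exact: fC.
  rewrite sumEFin lee_fin.
  have -> : \sum_(0 <= i < m) C * 2^-1 ^+ i = 2 * C - 2 * C * 2^-1 ^+ m.
    elim: m => [|m IH]; first by rewrite big_geq// expr0; ring.
    by rewrite big_nat_recr//= IH exprS; field.
  by rewrite gerBl !mulr_ge0// exprn_ge0.
have mF : measurable_fun D F by apply: ge0_emeasurable_sum => // i x Dx _; exact: f0E.
have iF : mu.-integrable D F.
  apply/integrableP; split => //; under eq_integral => x.
    rewrite inE => Dx; rewrite gee0_abs; last by apply: nneseries_ge0 => i _ _; exact: f0E.
    over.
  by rewrite (le_lt_trans FC)// ltry.
apply: filterS (integrable_ae mD iF) => x H Dx; have {}H := H Dx.
have tl := @nneseries_tail_cvg R (fun i => (f_ i x)%:E) xpredT _ (fun i _ => f0E i x Dx).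
have Fy : (\sum_(0 <= i <oo) (f_ i x)%:E < +oo)%E by move: H; rewrite fin_numElt => /andP[].
have {tl}tl := tl Fy.
have : (f_ i x)%:E @[i --> \oo] --> 0%:E.
  apply: (squeeze_cvge _ (cvg_cst _) tl); apply: nearW => i; rewrite f0E//=.
  have := @nneseries_lim_ge R (fun i => (f_ i x)%:E) xpredT i i.+1.
  by rewrite big_nat1; apply => j _ _; exact: f0E.
by move/fine_cvgP => [].
Qed.

Section approximation.
Context {R : realType} {N : nat}.
Notation cT := (caratheodory_type (@lebesgue_outer R N)).
Notation mR := (measurableTypeR R).
Notation mu := (leb : {measure set cT -> \bar R}).
Variables (Omega : set 'rV[R]_N) (a b p q : 'rV[R]_N -> R).
Variables (delta eta r1 r2 A0 L kap d : R).
Hypothesis D : double_phase_data Omega a b p q delta eta r1 r2 A0 L kap d.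
Let n : R := N%:R.
Notation S := (log_double_phase a b p q delta eta).
Let oO := dp_open D. Let bO := dp_bounded D.
Let mO : measurable (Omega : set cT). Proof. exact: measurable_domain. Qed.
Implicit Types (s t m l : R).

Lemma double_phase_add x s t : Omega x -> 0 <= s -> 0 <= t ->
  S x (s + t) <= S x (2 * s) + S x (2 * t).
Proof.
move=> Ox s0 t0; have [st|ts] := leP s t.
  rewrite (@le_trans _ _ (S x (2 * t)))//; last by rewrite lerDr (double_phase_ge0 D Ox)// mulr_ge0.
  by apply: (double_phase_homo D Ox); [exact: addr_ge0|rewrite mulr_natl mulr2n lerD2r].
rewrite (@le_trans _ _ (S x (2 * s)))//; last by rewrite lerDl (double_phase_ge0 D Ox)// mulr_ge0.
by apply: (double_phase_homo D Ox); [exact: addr_ge0|rewrite mulr_natl mulr2n lerD2l ltW].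
Qed.

Lemma double_phase_scale x m t : Omega x -> 0 <= m <= 1 -> 0 <= t -> S x (m * t) <= m * S x t.
Proof.
move=> Ox /andP[m0 m1] t0.
have pw r : 1 <= r -> (m * t) `^ r <= m * t `^ r.
  move=> r1'; rewrite powRM// ler_wpM2r ?powR_ge0//.
  have [->|mn] := eqVneq m 0; first by rewrite powR0// gt_eqF// (lt_le_trans ltr01).
  by rewrite ge1r_powR// lt0r mn m0.
have [a0 _] := andP (dp_a D Ox); have [b0 _] := andP (dp_b D Ox).
have p1 : 1 <= p x by case/andP: (dp_p D Ox) => /(lt_le_trans (dp_r11 D))/ltW.
have q1 : 1 <= q x by case/andP: (dp_q D Ox) => /(lt_le_trans (dp_r11 D))/ltW.
have mt : 0 <= m * t by rewrite mulr_ge0.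
rewrite /log_double_phase mulrDr lerD//.
  by rewrite mulrCA ler_wpM2l// pw.
have l1 : ln (delta + eta * (m * t)) <= ln (delta + eta * t).
  by apply: (ell_homo (dp_delta D) (dp_eta D)) => //; rewrite ler_piMl.
have l0 : 0 <= ln (delta + eta * (m * t)) by exact: (ell_ge0 (dp_delta D) (dp_eta D)).
rewrite [leRHS]mulrA; apply: ler_pM => //; first by rewrite mulr_ge0 ?powR_ge0.
by rewrite mulrCA ler_wpM2l// pw.
Qed.

(** Iterated doubling of [S] carries finiteness from the one scale of the definition to every
    scale. *)
Lemma in_LS_lty (v : 'rV[R]_N -> R) m : in_LS Omega S v -> 0 <= m ->
  (\int[leb]_(x in Omega) (S x (m * `|v x|))%:E < +oo)%E.
Proof.
move=> [mv [l l0 Sl]] m0.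
have [j mj] : exists j : nat, m / l <= 2 ^+ j.
  exists (Num.truncn (m / l)).+1; apply/ltW; apply: (lt_trans (truncnS_gt _)).
  by rewrite -natrX ltr_nat ltn_expl.
have K0 : 0 <= (2 `^ (n + 1)) ^+ j :> R by rewrite exprn_ge0 ?powR_ge0.
have mS c : measurable_fun (Omega : set cT) ((fun x => S x (c * `|v x|)) : cT -> R).
  have mnv : measurable_fun (Omega : set cT) ((fun x => `|v x|) : cT -> R).
    exact: (measurableT_comp (@normr_measurable R setT) mv).
  exact: (measurable_double_phase D (measurable_funM (measurable_cst c) mnv)).
have S0 c x : 0 <= c -> Omega x -> 0 <= S x (c * `|v x|).
  by move=> c0 Ox; rewrite (double_phase_ge0 D Ox)// mulr_ge0.
apply: (@le_lt_trans _ _ (((2 `^ (n + 1)) ^+ j)%:E * \int[leb]_(x in Omega) (S x (l * `|v x|))%:E)%E).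
  apply: (@le_integralZ _ cT R mu Omega mO _ _ _ (mS m) (mS l) K0).
  - by move=> x; exact: S0.
  - by move=> x; apply: S0; exact: ltW.
  move=> x Ox; have v0 := normr_ge0 (v x).
  apply: (@le_trans _ _ (S x (2 ^+ j * (l * `|v x|)))).
    apply: (double_phase_homo D Ox); first by rewrite mulr_ge0.
    by rewrite mulrA ler_wpM2r// -ler_pdivrMr.
  elim: j {mj K0} => [|j IH]; first by rewrite !expr0 !mul1r.
  rewrite !exprS -!mulrA; apply: (le_trans (double_phase_double D Ox _)).
    by rewrite !mulr_ge0 ?exprn_ge0// ltW.
  by rewrite ler_wpM2l ?powR_ge0.
by rewrite lte_mul_pinfty ?lee_fin.
Qed.

(** A Luxemburg norm below 2^-i, unfolded: a scale [l_ i] at which the modular of the error is at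
    most 1. The geometric rate later gives almost everywhere convergence of the whole sequence. *)
Definition modular_approx (phi_ : nat -> 'rV[R]_N -> R) u (g : 'rV[R]_N -> 'rV[R]_N) :=
  (forall i, test_function Omega (phi_ i)) /\
  exists l_ : nat -> R, (forall i, 0 < l_ i <= 2^-1 ^+ i) /\
  forall i, (\int[leb]_(x in Omega) (S x (`|u x - phi_ i x| / l_ i) +
    S x (enorm (g x - grad (phi_ i) x) / l_ i))%:E <= 1)%E.

Lemma in_W1S0_approx u g : in_W1S0 Omega S u g -> exists phi_, modular_approx phi_ u g.
Proof.
move=> [_ H].
have H' i : exists phil : ('rV[R]_N -> R) * R, [/\ test_function Omega phil.1,
    0 < phil.2 <= 2^-1 ^+ i & (\int[leb]_(x in Omega) (S x (`|u x - phil.1 x| / phil.2) +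
    S x (enorm (g x - grad phil.1 x) / phil.2))%:E <= 1)%E].
  have e0 : 0 < 2^-1 ^+ i :> R by rewrite exprn_gt0// invr_gt0.
  have [phi tphi /ereal_inf_lt[_ [l [l0 Il] <-]]] := H _ e0.
  by rewrite lte_fin => li; exists (phi, l); split => //=; rewrite l0 ltW.
pose f i := projT1 (cid (H' i)); have Hf i := projT2 (cid (H' i)).
exists (fun i => (f i).1); split; first by move=> i; have [] := Hf i.
by exists (fun i => (f i).2); split => i; have [] := Hf i.
Qed.

(* [t <= l + C * l * S x (t / l)], hence modular convergence implies convergence in L^1. *)
Lemma modular_L1 : exists2 C, 0 < C & forall (v : cT -> R) l, 0 < l ->
  measurable_fun (Omega : set cT) v -> (forall x, Omega x -> 0 <= v x) ->
  (\int[leb]_(x in Omega) (S x (v x / l))%:E <= 1)%E ->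
  (\int[leb]_(x in Omega) (v x)%:E <= (C * l)%:E)%E.
Proof.
have [C C0 HC] := le_double_phase D.
have Olty := leb_domain_lty bO.
pose V := fine (leb Omega); have V0 : 0 <= V by rewrite fine_ge0// measure_ge0.
have VE : leb Omega = V%:E by rewrite fineK// ge0_fin_numE// measure_ge0.
exists (V + C); first by rewrite ltr_wpDl.
move=> v l l0 mv v0 Sl.
have mS : measurable_fun (Omega : set cT) ((fun x => S x (v x / l)) : cT -> R).
  exact: (measurable_double_phase D (measurable_funM mv (measurable_cst _))).
have Cl0 : 0 <= C * l by rewrite mulr_ge0// ltW.
apply: (@le_trans _ _ (\int[mu]_(x in Omega) (cst l x)%:E +
    (C * l)%:E * \int[leb]_(x in Omega) (S x (v x / l))%:E)%E).
  apply: (@le_integralD _ cT R mu Omega _ _ _ (C * l) mO mv (measurable_cst l) mS Cl0 v0).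
  - by move=> x _; exact: ltW.
  - by move=> x Ox; rewrite (double_phase_ge0 D Ox)// divr_ge0 ?v0// ltW.
  move=> x Ox; have S0 : 0 <= S x (v x / l).
    by rewrite (double_phase_ge0 D Ox)// divr_ge0 ?v0// ltW.
  have [vl|vl] := leP (v x / l) 1.
    rewrite ler_pdivrMr// mul1r in vl; rewrite (le_trans vl)// lerDl mulr_ge0//.
  have := HC x _ Ox (ltW vl); rewrite ler_pdivrMr// => h.
  by rewrite (le_trans h)// mulrAC lerDr ltW.
have -> : (\int[mu]_(x in Omega) (cst l x)%:E = l%:E * mu Omega)%E.
  by rewrite -(integral_cst mu mO).
rewrite [mu Omega]VE -EFinM mulrDl EFinD [V * l]mulrC leeD2l//.
by rewrite -[leRHS]mule1 lee_wpmul2l.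
Qed.

Lemma integral_norm_lty (v : cT -> R) : measurable_fun (Omega : set cT) v ->
  (forall x, Omega x -> 0 <= v x) -> (\int[leb]_(x in Omega) (S x (v x))%:E < +oo)%E ->
  (\int[leb]_(x in Omega) (v x)%:E < +oo)%E.
Proof.
move=> mv v0 Sv; have [C C0 HC] := le_double_phase D.
have mS : measurable_fun (Omega : set cT) ((fun x => S x (v x)) : cT -> R).
  exact: (measurable_double_phase D mv).
have S0 x : Omega x -> 0 <= S x (v x) by move=> Ox; rewrite (double_phase_ge0 D Ox)// v0.
apply: (@le_lt_trans _ _ (\int[mu]_(x in Omega) (cst 1 x)%:E +
    C%:E * \int[leb]_(x in Omega) (S x (v x))%:E)%E).
  apply: (@le_integralD _ cT R mu Omega _ _ _ C mO mv (measurable_cst (1 : R)) mS (ltW C0) v0) => //.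
  move=> x Ox; have [v1|v1] := leP (v x) 1.
    by rewrite (le_trans v1)// lerDl mulr_ge0 ?S0// ltW.
  by rewrite (le_trans (HC _ _ Ox (ltW v1)))// lerDr.
apply: lte_add_pinfty; last by rewrite lte_mul_pinfty ?lee_fin// ltW.
have -> : (\int[mu]_(x in Omega) (cst 1 x)%:E = 1%:E * mu Omega)%E.
  by rewrite -(integral_cst mu mO).
by rewrite mul1e; exact: leb_domain_lty.
Qed.

Lemma in_LS_norm_lty v : in_LS Omega S v -> (\int[leb]_(x in Omega) (S x `|v x|)%:E < +oo)%E.
Proof.
move=> /(in_LS_lty (m := 1)) /(_ ler01); congr (_ < _)%E.
by apply: eq_integral => x _; rewrite mul1r.
Qed.

Lemma in_W1S_measurable u g : in_W1S Omega S u g ->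
  measurable_fun (Omega : set cT) (u : cT -> mR) /\
  forall i, measurable_fun (Omega : set cT) ((fun x => g x ord0 i) : cT -> mR).
Proof. by move=> [[mu_ _] [_ mg _] _]; split; [exact: mu_|move=> i; exact: (mg i).1]. Qed.

Lemma modular_approx_W11 phi_ u g : in_W1S Omega S u g -> modular_approx phi_ u g ->
  W11_limit Omega phi_ u g /\
  (\int[leb]_(x in Omega) `|u x - phi_ i x|%:E @[i --> \oo] --> 0)%E.
Proof.
move=> W [tphi [l_ [lb lS]]]; have [mu_ mg] := in_W1S_measurable W.
have [Lu _ Lg] := W.
have Cphi i := test_function_C1_0 (tphi i).
have mphi i := (C1_0_measurable oO (Cphi i)).1.
have mdphi i := (C1_0_measurable oO (Cphi i)).2.
have mng : measurable_fun (Omega : set cT) ((fun x => enorm (g x)) : cT -> R).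
  exact: measurable_enorm.
have mdiff i : measurable_fun (Omega : set cT) ((fun x => `|u x - phi_ i x|) : cT -> R).
  exact: (measurableT_comp (@normr_measurable R setT) (measurable_funB mu_ (mphi i))).
have mgdiff i : measurable_fun (Omega : set cT) ((fun x => enorm (g x - grad (phi_ i) x)) : cT -> R).
  exact: (measurable_enormB mg (mdphi i)).
have [C C0 HC] := modular_L1.
have l0 i : 0 < l_ i by case/andP: (lb i).
have mS i (v : cT -> R) : measurable_fun (Omega : set cT) v ->
    measurable_fun (Omega : set cT) ((fun x => S x (v x / l_ i)) : cT -> R).
  by move=> mv; exact: (measurable_double_phase D (measurable_funM mv (measurable_cst _))).
have S0 i (v : cT -> R) x : Omega x -> 0 <= v x -> 0 <= S x (v x / l_ i).
  by move=> Ox v0; rewrite (double_phase_ge0 D Ox)// divr_ge0// ltW.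
have half i (v w : cT -> R) : measurable_fun (Omega : set cT) v ->
    measurable_fun (Omega : set cT) w ->
    (forall x, Omega x -> 0 <= v x) -> (forall x, Omega x -> 0 <= w x) ->
    (\int[leb]_(x in Omega) (S x (v x / l_ i) + S x (w x / l_ i))%:E <= 1)%E ->
    (\int[leb]_(x in Omega) (v x)%:E <= (C * 2^-1 ^+ i)%:E)%E.
  move=> mv mw v0 w0 le1.
  apply: (@le_trans _ _ (C * l_ i)%:E); last first.
    by rewrite lee_fin ler_wpM2l ?(ltW C0)//; case/andP: (lb i).
  apply: HC => //; apply: le_trans le1.
  apply: (@le_integral_EFin _ cT R mu Omega mO _ _ (mS i v mv)
    (measurable_funD (mS i v mv) (mS i w mw))).
    by move=> x Ox; exact: S0 (v0 x Ox).
  by move=> x Ox; rewrite lerDl S0// w0.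
have n0 i x : Omega x -> 0 <= `|u x - phi_ i x| by [].
have e0 i x : Omega x -> 0 <= enorm (g x - grad (phi_ i) x) by move=> _; exact: enorm_ge0.
have cu i := half i _ _ (mdiff i) (mgdiff i) (n0 i) (e0 i) (lS i).
have lS' i : (\int[leb]_(x in Omega) (S x (enorm (g x - grad (phi_ i) x) / l_ i) +
    S x (`|u x - phi_ i x| / l_ i))%:E <= 1)%E.
  by under eq_integral do rewrite addrC.
have cg i := half i _ _ (mgdiff i) (mdiff i) (e0 i) (n0 i) (lS' i).
have geo : (C * 2^-1 ^+ i)%:E @[i --> \oo] --> 0%E.
  apply: cvg_EFin; first exact: nearW.
  rewrite -[X in _ --> X](mulr0 C); apply: cvgM; first exact: cvg_cst.
  by apply: cvg_expr; rewrite ger0_norm// invf_lt1// ltr1n.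
have to0 (f : nat -> 'rV[R]_N -> R) : (forall i x, Omega x -> 0 <= f i x) ->
    (forall i, (\int[leb]_(x in Omega) (f i x)%:E <= (C * 2^-1 ^+ i)%:E)%E) ->
    (\int[leb]_(x in Omega) (f i x)%:E @[i --> \oo] --> 0)%E.
  move=> f0 H; apply: (squeeze_cvge _ (cvg_cst _) geo); apply: nearW => i.
  by rewrite H andbT; apply: integral_ge0 => x Ox; rewrite lee_fin f0.
split; last exact: to0.
split => //.
- apply: (integral_norm_lty mng) => [x _|]; first exact: enorm_ge0.
  have := in_LS_norm_lty Lg; congr (_ < _)%E; apply: eq_integral => x _.
  by rewrite ger0_norm// enorm_ge0.
- have := @geometric_integral_ae_cvg _ cT R mu Omega _ C mO mdiff n0 cu.
  apply: filterS => x H Ox; have {}H := H Ox.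
  apply/cvgrPdist_lt => e e1; move/cvgr0Pnorm_lt : H => /(_ e e1).
  by apply: filterS => i; rewrite normr_id.
- exact: to0.
Qed.

End approximation.

(** * Smooth soft thresholds *)

Section soft_threshold.
Context {R : realType}.
Variables (k eps : R).
Hypotheses (k0 : 0 < k) (eps0 : 0 < eps).
Implicit Types s t c : R.

(** A smooth majorant of the absolute value, exceeding it by at most [eps]. *)
Definition bsqrt s : R := Num.sqrt (s ^+ 2 + eps ^+ 2).
Definition bslope s : R := s / bsqrt s.

Let w0 s : 0 < s ^+ 2 + eps ^+ 2. Proof. by rewrite ltr_wpDl ?sqr_ge0// exprn_gt0. Qed.

Lemma bsqrt_gt0 s : 0 < bsqrt s. Proof. by rewrite sqrtr_gt0. Qed.

Lemma bsqrt_sqr s : bsqrt s ^+ 2 = s ^+ 2 + eps ^+ 2.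
Proof. by rewrite sqr_sqrtr// ltW. Qed.

Lemma bsqrtN s : bsqrt (- s) = bsqrt s. Proof. by rewrite /bsqrt sqrrN. Qed.

Lemma bsqrt_bound s : `|s| <= bsqrt s <= `|s| + eps.
Proof.
have b0 := ltW (bsqrt_gt0 s); have s0 := normr_ge0 s.
rewrite -[X in X && _](@ler_pXn2r _ 2) ?nnegrE// -[X in _ && X](@ler_pXn2r _ 2) ?nnegrE ?addr_ge0 ?(ltW eps0)//.
rewrite bsqrt_sqr sqrrD real_normK ?num_real// lerDl sqr_ge0/= lerD2r lerDl.
by rewrite mulrn_wge0// mulr_ge0// ltW.
Qed.

Lemma is_derive_bsqrt s : is_derive s 1 bsqrt (bslope s).
Proof.
have h1 : is_derive s 1 (fun s => s ^+ 2 + eps ^+ 2) (2 * s).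
  by apply: is_derive_eq; rewrite /GRing.scale/=; ring.
have := @is_derive1_comp R (@Num.sqrt R) (fun s => s ^+ 2 + eps ^+ 2) s _ _ (is_derive1_sqrt (w0 s)) h1.
move=> h; apply: (@is_derive_eq _ _ _ _ _ _ _ _ h).
rewrite /bslope -/(bsqrt s); field; rewrite gt_eqF ?bsqrt_gt0//.
Qed.

Lemma bslope_bound s : `|bslope s| <= 1.
Proof.
have b0 := bsqrt_gt0 s; rewrite normrM normfV (gtr0_norm b0) ler_pdivrMr// mul1r.
by case/andP: (bsqrt_bound s).
Qed.

Lemma bslope_ge0 s : 0 <= s -> 0 <= bslope s.
Proof. by move=> s0; rewrite divr_ge0// ltW// bsqrt_gt0. Qed.

Lemma bslopeN s : bslope (- s) = - bslope s.
Proof. by rewrite /bslope bsqrtN mulNr. Qed.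

Lemma bslope_ge c s : 0 < c -> c <= s -> 1 - eps / c <= bslope s.
Proof.
move=> c0 cs; have s0 := lt_le_trans c0 cs; have b0 := bsqrt_gt0 s.
have /andP[_] := bsqrt_bound s; rewrite (gtr0_norm s0) => bs.
rewrite /bslope ler_pdivlMr// mulrBl mul1r lerBlDr (le_trans bs)// lerD2l.
rewrite mulrAC ler_pdivlMr// ler_wpM2l ?(ltW eps0)//.
have /andP[+ _] := bsqrt_bound s; rewrite (gtr0_norm s0); exact: le_trans.
Qed.

Lemma continuous_bsqrt : continuous bsqrt.
Proof. by move=> s; apply: differentiable_continuous; apply/derivable1_diffP; have [] := is_derive_bsqrt s. Qed.

Lemma continuous_bslope : continuous bslope.
Proof.
move=> s; apply: (@continuousM _ _ id (fun s => (bsqrt s)^-1)); first exact: cvg_id.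
apply: (@continuousV _ _ bsqrt); first by rewrite gt_eqF// bsqrt_gt0.
exact: continuous_bsqrt.
Qed.

(* A smooth approximation of the soft threshold [sgn t * max (|t| - k) 0]. *)
Definition soft t : R := t + (bsqrt (t - k) - bsqrt (t + k)) / 2.
Definition dsoft t : R := 1 + (bslope (t - k) - bslope (t + k)) / 2.

Lemma is_derive_soft t : is_derive t 1 soft (dsoft t).
Proof.
have sh c : is_derive t 1 (fun t => t + c) 1 by apply: is_derive_eq; rewrite addr0.
have h1 := @is_derive1_comp R bsqrt (fun t => t - k) t _ _ (is_derive_bsqrt (t - k)) (sh (- k)).
have h2 := @is_derive1_comp R bsqrt (fun t => t + k) t _ _ (is_derive_bsqrt (t + k)) (sh k).
have h3 := is_deriveZ (2^-1) (is_deriveB h1 h2).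
have := is_deriveD (is_derive_id t (1 : R)) h3.
rewrite (_ : _ + _ = soft); last first.
  by apply/funext => y; rewrite /soft/= /GRing.scale/= mulrC.
by move=> h; apply: (@is_derive_eq _ _ _ _ _ _ _ _ h); rewrite /dsoft /GRing.scale/=; ring.
Qed.

Lemma soft0 : soft 0 = 0.
Proof. by rewrite /soft !add0r bsqrtN subrr mul0r. Qed.

Lemma dsoft_bound t : 0 <= dsoft t <= 2.
Proof.
have := bslope_bound (t - k); have := bslope_bound (t + k).
rewrite !ler_norml /dsoft => /andP[? ?] /andP[? ?]; apply/andP; split; lra.
Qed.

Lemma dsoft_ge t : k <= `|t| -> 2^-1 <= dsoft t.
Proof.
have := bslope_bound (t - k); have := bslope_bound (t + k).
rewrite !ler_norml /dsoft => /andP[? ?] /andP[? ?].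
have [t0|t0] := lerP 0 t => kt.
  have : 0 <= t - k by rewrite subr_ge0 -(ger0_norm t0).
  by move=> /bslope_ge0; lra.
have : 0 <= - (t + k) by rewrite opprD subr_ge0 -(ltr0_norm t0).
by move=> /bslope_ge0; rewrite bslopeN; lra.
Qed.

(** Below k' the two square roots have slopes close to -1 and 1, up to eps / (k - k'), and the half
    of their difference nearly cancels the 1. The derivative is small there without being zero,
    which forces the second level in the energy estimate. *)
Lemma dsoft_le k' t : k' < k -> `|t| <= k' -> dsoft t <= eps / (k - k').
Proof.
move=> kk; rewrite ler_norml => /andP[t1 t2]; have c0 : 0 < k - k' by rewrite subr_gt0.
have h1 : 1 - eps / (k - k') <= bslope (t + k) by apply: bslope_ge => //; lra.
have h2 : 1 - eps / (k - k') <= bslope (- (t - k)) by apply: bslope_ge => //; lra.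
by rewrite bslopeN in h2; rewrite /dsoft; lra.
Qed.

Lemma soft_le t : `|soft t| <= excess k t + eps.
Proof.
have /andP[a1 a2] := bsqrt_bound (t - k); have /andP[b1 b2] := bsqrt_bound (t + k).
rewrite /soft /excess ler_norml.
have k0' := k0; have e0' := eps0.
move: a1 a2 b1 b2; set A := bsqrt _; set B := bsqrt _ => a1 a2 b1 b2.
case: (leP (`|t| - k) 0) => h; move: a1 a2 b1 b2 h;
case: (ger0P t) => ?; case: (ger0P (t - k)) => ?; case: (ger0P (t + k)) => ? a1 a2 b1 b2 h;
 apply/andP; split; lra.
Qed.

Lemma soft_lip s t : `|soft s - soft t| <= 2 * `|s - t|.
Proof.
wlog st : s t / s <= t.
  by move=> H; have [/H//|/ltW/H] := leP s t; rewrite distrC [`|t - s|]distrC.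
have cs : continuous soft.
  by move=> y; apply: differentiable_continuous; apply/derivable1_diffP; have [] := is_derive_soft y.
have [c _ E] := MVT_segment st (fun x _ => is_derive_soft x) (continuous_subspaceT cs).
rewrite distrC E normrM [`|s - t|]distrC ler_wpM2r//.
by have /andP[d0 d2] := dsoft_bound c; rewrite ger0_norm.
Qed.

Lemma continuous_soft : continuous soft.
Proof. by move=> y; apply: differentiable_continuous; apply/derivable1_diffP; have [] := is_derive_soft y. Qed.

Lemma continuous_dsoft : continuous dsoft.
Proof.
move=> t; have sh c : {for t, continuous (fun t : R => t + c)}.
  by apply: continuousD => //; exact: cst_continuous.
have c1 := @continuous_comp _ _ _ (fun t => t - k) bslope t (sh (- k)) (@continuous_bslope _).
have c2 := @continuous_comp _ _ _ (fun t => t + k) bslope t (sh k) (@continuous_bslope _).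
have c3 := continuousB c1 c2.
have c4 := continuousM c3 (@cst_continuous _ _ (2^-1 : R) t).
exact: (continuousD (@cst_continuous _ _ (1 : R) t) c4).
Qed.

(* The reciprocal [(bsqrt (t - c))^-1] and polynomials generate an algebra closed under
   differentiation which contains [soft]. *)
Definition rho c t : R := (bsqrt (t - c))^-1.

Lemma is_derive_rho c t : is_derive t 1 (rho c) (- (t - c) * rho c t ^+ 3).
Proof.
have b0 := bsqrt_gt0 (t - c).
have sh : is_derive t 1 (fun t => t - c) 1 by apply: is_derive_eq; rewrite ?oppr0 ?subr0 ?addr0.
have h1 := @is_derive1_comp R bsqrt (fun t => t - c) t _ _ (is_derive_bsqrt (t - c)) sh.
have h2 := @is_deriveV R (bsqrt \o (fun t => t - c)) t _ 1 (lt0r_neq0 b0) h1.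
apply: (@is_derive_eq _ _ _ _ _ _ _ _ h2).
by rewrite /rho /bslope /GRing.scale/=; field; rewrite gt_eqF.
Qed.

Lemma softE t : soft t = t + ((t - k) ^+ 2 + eps ^+ 2) * rho k t * 2^-1
  + ((t + k) ^+ 2 + eps ^+ 2) * rho (- k) t * (- 2^-1).
Proof.
by rewrite /soft -!bsqrt_sqr /rho opprK; field; rewrite !gt_eqF ?bsqrt_gt0.
Qed.

End soft_threshold.

(** * Soft thresholds of test functions *)

Section composition.
Context {R : realType} {N : nat}.
Implicit Types (f phi : 'rV[R]_N -> R) (x v : 'rV[R]_N).

Lemma is_derive_line f x v l :
  is_derive x v f l <-> is_derive (0 : R) 1 (fun s : R => f (x + s *: v)) l.
Proof.
pose F (s : R) := f (x + s *: v).
have E : (fun h : R => h^-1 *: ((F \o shift (0 : R)) (h *: 1) - F 0)) =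
    (fun h : R => h^-1 *: ((f \o shift x) (h *: v) - f x)).
  apply/funext => h; rewrite /F /comp /shift/= scale0r !addr0 [h *: 1]mulr1.
  by rewrite [x + _]addrC.
by split => -[d dl]; apply: DeriveDef; move: d dl; rewrite /derivable /derive E.
Qed.

Lemma is_derive_comp_dir (h : R -> R) phi x v l :
  derivable phi x v -> is_derive (phi x) 1 h l ->
  is_derive x v (fun y => h (phi y)) (l * 'D_v phi x).
Proof.
move=> /derivableP/is_derive_line dphi dh; apply/is_derive_line.
have := @is_derive1_comp R h (fun s : R => phi (x + s *: v)) 0 l _ _ dphi.
by rewrite scale0r addr0; apply.
Qed.

End composition.

Section smooth_algebra.
Context {R : realType} {N : nat}.
Variables (eps : R) (phi : 'rV[R]_N -> R).
Hypotheses (eps0 : 0 < eps) (sphi : smooth phi).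

(** All iterated partial derivatives of [phi] are generators, so that stability under [partial] is
    an induction on the construction and only the first-order chain rule occurs. *)
Inductive smooth_alg : ('rV[R]_N -> R) -> Prop :=
| smooth_alg_partial s : smooth_alg (iter_partial s phi)
| smooth_alg_cst c : smooth_alg (fun=> c)
| smooth_alg_rho c : smooth_alg (fun x => rho eps c (phi x))
| smooth_algD f g : smooth_alg f -> smooth_alg g -> smooth_alg (fun x => f x + g x)
| smooth_algM f g : smooth_alg f -> smooth_alg g -> smooth_alg (fun x => f x * g x).

Let smooth_alg_phi : smooth_alg phi. Proof. exact: (smooth_alg_partial [::]). Qed.

Lemma smooth_alg_derivable f : smooth_alg f ->
  [/\ continuous f, forall i x, derivable f x (delta_mx ord0 i) &
      forall i, smooth_alg (partial i f)].
Proof.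
elim => [s|c|c|f1 f2 _ [c1 d1 s1] _ [c2 d2 s2]|f1 f2 a1 [c1 d1 s1] a2 [c2 d2 s2]].
- have [cs ds] := sphi s; split => // i.
  exact: (smooth_alg_partial (i :: s)).
- split; [by move=> x; exact: cst_continuous|by move=> i x|].
  move=> i; rewrite (_ : partial i _ = fun=> 0); first exact: smooth_alg_cst.
  by apply/funext => x; rewrite /partial derive_cst.
- have [cp dp] := sphi [::].
  have dr i x := is_derive_comp_dir (dp i x) (is_derive_rho eps0 c (phi x)).
  split.
  + move=> x; apply: (@continuous_comp _ _ _ phi (rho eps c)); first exact: cp.
    by apply: differentiable_continuous; apply/derivable1_diffP; have [] := is_derive_rho eps0 c (phi x).
  + by move=> i x; have [] := dr i x.
  + move=> i; rewrite (_ : partial i _ = fun x => ((phi x * (-1) + c) *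
        (rho eps c (phi x) * (rho eps c (phi x) * rho eps c (phi x)))) * partial i phi x).
      have r := smooth_alg_rho c.
      apply: smooth_algM; last exact: (smooth_alg_partial [:: i]).
      apply: smooth_algM; last by do 2 apply: smooth_algM => //.
      apply: smooth_algD; last exact: smooth_alg_cst.
      by apply: smooth_algM => //; exact: smooth_alg_cst.
    apply/funext => x; rewrite /partial; have [_ ->] := dr i x.
    by rewrite -/(partial i phi x) /=; ring.
- split.
  + by move=> x; apply: continuousD; [exact: c1|exact: c2].
  + by move=> i x; apply: derivableD; [exact: d1|exact: d2].
  + move=> i; rewrite (_ : partial i _ = fun x => partial i f1 x + partial i f2 x).
      by apply: smooth_algD; [exact: s1|exact: s2].
    by apply/funext => x; rewrite /partial deriveD.
split.
+ by move=> x; apply: continuousM; [exact: c1|exact: c2].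
+ by move=> i x; apply: derivableM; [exact: d1|exact: d2].
+ move=> i; rewrite (_ : partial i _ = fun x => f1 x * partial i f2 x + f2 x * partial i f1 x).
    by apply: smooth_algD; apply: smooth_algM => //.
  by apply/funext => x; rewrite /partial deriveM.
Qed.

Lemma smooth_alg_smooth f : smooth_alg f -> smooth f.
Proof.
move=> af s; suff : smooth_alg (iter_partial s f) by move=> /smooth_alg_derivable[].
by elim: s => //= i s /smooth_alg_derivable[].
Qed.

Lemma smooth_soft k : smooth (fun x => soft k eps (phi x)).
Proof.
apply: smooth_alg_smooth; have ap := smooth_alg_phi.
have cs c := smooth_alg_cst c.
have sq c : smooth_alg (fun x => (phi x + c) * (phi x + c) + eps ^+ 2).
  by apply: smooth_algD => //; apply: smooth_algM; apply: smooth_algD.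
rewrite (_ : (fun x => _) = fun x => phi x +
   ((phi x + - k) * (phi x + - k) + eps ^+ 2) * rho eps k (phi x) * 2^-1 +
   ((phi x + k) * (phi x + k) + eps ^+ 2) * rho eps (- k) (phi x) * (- 2^-1)); last first.
  by apply/funext => x; rewrite softE.
have ar c := smooth_alg_rho c.
apply: smooth_algD; first apply: smooth_algD => //.
  by apply: smooth_algM => //; exact: smooth_algM.
by apply: smooth_algM => //; exact: smooth_algM.
Qed.

End smooth_algebra.

Section soft_test_function.
Context {R : realType} {N : nat}.
Variables (Omega : set 'rV[R]_N) (k eps : R).
Hypotheses (eps0 : 0 < eps).

Lemma test_function_soft phi : test_function Omega phi ->
  test_function Omega (fun x => soft k eps (phi x)) /\
  forall x, grad (fun x => soft k eps (phi x)) x = dsoft k eps (phi x) *: grad phi x.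
Proof.
move=> [sphi cphi sub]; split.
  have S : closure [set x | soft k eps (phi x) != 0] `<=` closure [set x | phi x != 0].
    apply: closure_subset => x /=; apply: contra_neq => ->; exact: soft0.
  split; first exact: smooth_soft.
    by apply: subclosed_compact S => //; exact: closed_closure.
  exact: subset_trans sub.
have [_ dp] := sphi [::].
move=> x; apply/rowP => i; rewrite !mxE /partial.
by have [_ ->] := is_derive_comp_dir (dp i x) (is_derive_soft k eps0 (phi x)).
Qed.

End soft_test_function.

Section L1_convergence.
Context d (T : measurableType d) (R : realType) (mu : {measure set T -> \bar R}).
Variables (D : set T) (mD : measurable D).

Lemma integrable_EFin (f : T -> R) : measurable_fun D f ->
  (\int[mu]_(x in D) `|f x|%:E < +oo)%E -> mu.-integrable D (EFin \o f).
Proof. by move=> mf If; apply/integrableP; split; [exact/measurable_EFinP|]. Qed.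

Lemma cvg_integral_L1 (f_ : nat -> T -> R) (f psi : T -> R) K :
  measurable_fun D psi -> 0 <= K -> (forall x, D x -> `|psi x| <= K) ->
  mu.-integrable D (EFin \o f) -> (forall i, mu.-integrable D (EFin \o f_ i)) ->
  (\int[mu]_(x in D) `|f x - f_ i x|%:E @[i --> \oo] --> 0)%E ->
  (\int[mu]_(x in D) (f_ i x * psi x)%:E @[i --> \oo] --> \int[mu]_(x in D) (f x * psi x)%:E)%E.
Proof.
move=> mpsi K0 psiK iF iFn cF.
have mf : measurable_fun D f by apply/measurable_EFinP; exact: measurable_int iF.
have mfn i : measurable_fun D (f_ i) by apply/measurable_EFinP; exact: measurable_int (iFn i).
have ipsi (h : T -> R) : mu.-integrable D (EFin \o h) -> mu.-integrable D (fun x => (h x * psi x)%:E).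
  move=> ih; have mh : measurable_fun D h by apply/measurable_EFinP; exact: measurable_int ih.
  apply: (@le_integrable _ _ _ mu D mD _ (fun x => (K%:E * (EFin \o h) x)%E)).
  - by apply/measurable_EFinP; exact: measurable_funM.
  - move=> x Dx; rewrite /= lee_fin !normrM (ger0_norm K0) mulrC ler_wpM2r//.
    exact: psiK.
  - exact: integrableZl.
pose r i := (\int[mu]_(x in D) ((f_ i x - f x) * psi x)%:E)%E.
have iB i : mu.-integrable D (EFin \o (fun x => f_ i x - f x)).
  have -> : EFin \o (fun x => f_ i x - f x) = ((EFin \o f_ i) \- (EFin \o f))%E.
    by apply/funext.
  exact: integrableB.
have E i : (\int[mu]_(x in D) (f_ i x * psi x)%:E = \int[mu]_(x in D) (f x * psi x)%:E + r i)%E.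
  rewrite -integralD//; [|exact: ipsi|exact: ipsi].
  by apply: eq_integral => x _; rewrite -EFinD; congr EFin; ring.
have r0 : r i @[i --> \oo] --> 0%E.
  apply/cvg_abse0P.
  have KF : (K%:E * \int[mu]_(x in D) `|f x - f_ i x|%:E @[i --> \oo] --> 0)%E.
    by rewrite -[X in _ --> X](mule0 K%:E); exact: cvgeZl.
  apply: (squeeze_cvge _ (cvg_cst _) KF); apply: nearW => i; rewrite abse_ge0/=.
  have mB : measurable_fun D (fun x => f_ i x - f x) by exact: measurable_funB.
  apply: (le_trans (le_abse_integral mu mD _)).
    by apply/measurable_EFinP; exact: measurable_funM.
  apply: (@le_integralZ _ T R mu D mD (fun x => `|(f_ i x - f x) * psi x|) (fun x => `|f x - f_ i x|) K) => //.
  - by apply: measurableT_comp => //; exact: measurable_funM.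
  - by apply: measurableT_comp => //; exact: measurable_funB.
  by move=> x Dx; rewrite normrM [`|f x - _|]distrC mulrC ler_wpM2r// psiK.
rewrite (_ : (fun i => _) = (fun i => \int[mu]_(x in D) (f x * psi x)%:E + r i)%E); last first.
  by apply/funext.
rewrite -[X in _ --> X]adde0; apply: cvgeD => //; last exact: cvg_cst.
by rewrite fin_num_adde_defl.
Qed.

End L1_convergence.

(** * Soft thresholds of u belong to W_0^{1,S} *)

Section soft_membership.
Context {R : realType} {N : nat}.
Notation cT := (caratheodory_type (@lebesgue_outer R N)).
Notation mR := (measurableTypeR R).
Notation mu := (leb : {measure set cT -> \bar R}).
Variables (Omega : set 'rV[R]_N) (a b p q : 'rV[R]_N -> R).
Variables (delta eta r1 r2 A0 L kap d : R).
Hypothesis D : double_phase_data Omega a b p q delta eta r1 r2 A0 L kap d.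
Let n : R := N%:R.
Notation S := (log_double_phase a b p q delta eta).
Let oO := dp_open D. Let bO := dp_bounded D.
Let mO : measurable (Omega : set cT). Proof. exact: measurable_domain. Qed.
Variables (k eps : R).
Hypotheses (eps0 : 0 < eps).
Variables (u : 'rV[R]_N -> R) (g : 'rV[R]_N -> 'rV[R]_N).
Hypothesis W0 : in_W1S0 Omega S u g.
Variable phi_ : nat -> 'rV[R]_N -> R.
Hypothesis app : modular_approx Omega a b p q delta eta phi_ u g.

Let W : in_W1S Omega S u g := W0.1.
Let tphi := app.1.
Let Cphi i := test_function_C1_0 (tphi i).
Let W11 : W11_limit Omega phi_ u g := (modular_approx_W11 D W app).1.
Let uL1 := (modular_approx_W11 D W app).2.
Let mu_ := (in_W1S_measurable W).1.
Let mg := (in_W1S_measurable W).2.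
Let mphi i := (C1_0_measurable oO (Cphi i)).1.
Let mdphi i := (C1_0_measurable oO (Cphi i)).2.
Let ng x := enorm (g x).
Let mng : measurable_fun (Omega : set cT) (ng : cT -> mR).
Proof. exact: measurable_enorm. Qed.
Let nd i x := enorm (g x - grad (phi_ i) x).
Let mnd i : measurable_fun (Omega : set cT) (nd i : cT -> mR).
Proof. exact: (measurable_enormB mg (mdphi i)). Qed.
Let T := soft k eps.
Let dT := dsoft k eps.
(** This factor multiplies the norm of [g] in the error of the gradients. It is controlled only by
    its almost everywhere convergence and the bound 2, so dominated convergence takes the place of
    the modular rate. *)
Let th i x := `|dT (u x) - dT (phi_ i x)|.

Let mcomp (f : R -> R) (v : cT -> R) : continuous f -> measurable_fun (Omega : set cT) v ->
  measurable_fun (Omega : set cT) (fun x => f (v x)).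
Proof. by move=> cf mv; exact: (measurableT_comp (continuous_measurable_fun cf) mv). Qed.

Let mdTu : measurable_fun (Omega : set cT) ((fun x => dT (u x)) : cT -> R).
Proof. exact: (mcomp (@continuous_dsoft R k eps eps0) mu_). Qed.
Let mth i : measurable_fun (Omega : set cT) (th i : cT -> R).
Proof.
exact: (measurableT_comp (@normr_measurable R setT)
  (measurable_funB mdTu (mcomp (@continuous_dsoft R k eps eps0) (mphi i)))).
Qed.
Let mnorm (v : cT -> R) : measurable_fun (Omega : set cT) v ->
  measurable_fun (Omega : set cT) (fun x => `|v x|).
Proof. by move=> mv; exact: (measurableT_comp (@normr_measurable R setT) mv). Qed.

Let th_bound i x : 0 <= th i x <= 2.
Proof.
rewrite normr_ge0/= /th ler_norml.
have := dsoft_bound k eps0 (u x); have := dsoft_bound k eps0 (phi_ i x).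
by rewrite -/dT => /andP[? ?] /andP[? ?]; apply/andP; split; lra.
Qed.

Let th_cvg : {ae mu, forall x, Omega x -> th i x @[i --> \oo] --> 0}.
Proof.
have [_ _ _ ae _] := W11; apply: filterS ae => x H Ox; have {}H := H Ox.
have c1 : dT (phi_ i x) @[i --> \oo] --> dT (u x).
  exact: (cvg_comp _ _ H (@continuous_dsoft _ k _ eps0 (u x))).
rewrite -(@normr0 _ R) -(subrr (dT (u x))).
by apply: cvg_norm; apply: cvgB => //; exact: cvg_cst.
Qed.

Let ng_lty : (\int[leb]_(x in Omega) (ng x)%:E < +oo)%E.
Proof. by have [_ _ + _ _] := W11. Qed.

Let Lg : in_LS Omega S ng. Proof. by have [] := W. Qed.

Let Sng_lty m : 0 <= m -> (\int[leb]_(x in Omega) (S x (m * ng x))%:E < +oo)%E.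
Proof.
move=> m0; have := in_LS_lty D Lg m0; congr (_ < _)%E; apply: eq_integral => x _.
by rewrite ger0_norm// enorm_ge0.
Qed.

Let mSv (v : cT -> R) (c : R) : measurable_fun (Omega : set cT) v ->
  measurable_fun (Omega : set cT) (fun x => S x (c * v x)).
Proof. by move=> mv; exact: (measurable_double_phase D (measurable_funM (measurable_cst c) mv)). Qed.

Let ng0 x : 0 <= ng x. Proof. exact: enorm_ge0. Qed.
Let nd0 i x : 0 <= nd i x. Proof. exact: enorm_ge0. Qed.

(** Pointwise convergence follows from [double_phase_scale], the factor being eventually at most 1;
    since it never exceeds 2, [S] of 2 m times the norm of [g] dominates. *)
Let Sth_cvg m : 0 <= m ->
  (\int[leb]_(x in Omega) (S x (m * (th i x * ng x)))%:E @[i --> \oo] --> 0)%E.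
Proof.
move=> m0; have m20 : 0 <= 2 * m by rewrite mulr_ge0.
have iB : mu.-integrable Omega (EFin \o (fun x => S x (2 * m * ng x))).
  apply: integrable_EFin; first exact: mSv.
  have := Sng_lty m20; congr (_ < _)%E; apply: eq_integral => x; rewrite inE => Ox.
  by rewrite ger0_norm// (double_phase_ge0 D Ox)// mulr_ge0.
have [] := @real_dominated_convergence _ cT R mu Omega (fun i x => S x (m * (th i x * ng x)))
  (cst 0) _ mO _ (measurable_cst _) _ iB.
- by move=> i; exact: (mSv m (measurable_funM (mth i) mng)).
- apply: filterS th_cvg => x H Ox; have {}H := H Ox.
  have cv : m * (th i x * ng x) @[i --> \oo] --> 0.
    rewrite -[X in _ --> X](mulr0 m) -(mul0r (ng x)).
    by apply: cvgM; [exact: cvg_cst|apply: cvgM => //; exact: cvg_cst].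
  have C := @double_phase_scale R N Omega a b p q delta eta r1 r2 A0 L kap d D x.
  apply: (@squeeze_cvgr _ _ _ _ (cst 0) (fun i => th i x * S x (m * ng x))).
  + have : \forall i \near \oo, th i x <= 1.
      move/cvgrPdist_le : H => /(_ 1 ltr01); apply: filterS => i.
      by rewrite sub0r normrN ger0_norm//; case/andP: (th_bound i x).
    apply: filterS => i th1; have /andP[t0 _] := th_bound i x.
    rewrite (double_phase_ge0 D Ox) ?mulr_ge0//= mulrCA.
    by apply: C => //; rewrite ?t0// mulr_ge0.
  + exact: cvg_cst.
  + by rewrite -[X in _ --> X](mul0r (S x (m * ng x))); apply: cvgM => //; exact: cvg_cst.
- move=> i x Ox; have /andP[t0 t2] := th_bound i x.
  rewrite ger0_norm; last by rewrite (double_phase_ge0 D Ox)// !mulr_ge0.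
  apply: (double_phase_homo D Ox); first by rewrite !mulr_ge0.
  by rewrite [2 * m]mulrC -mulrA ler_wpM2l// ler_wpM2r.
by rewrite integral0.
Qed.

Let Tlip i x : `|T (u x) - T (phi_ i x)| <= 2 * `|u x - phi_ i x|.
Proof. exact: soft_lip. Qed.

Let gradT i x : grad (fun x => T (phi_ i x)) x = dT (phi_ i x) *: grad (phi_ i) x.
Proof. exact: (test_function_soft k eps0 (tphi i)).2. Qed.

Let enormZ (c : R) v : enorm (c *: v : 'rV[R]_N) = `|c| * enorm v.
Proof.
rewrite /enorm -[`|c|]sqrtr_sqr -sqrtrM ?sqr_ge0//; congr Num.sqrt.
rewrite /dotp mulr_sumr; apply: eq_bigr => i _; rewrite !mxE; ring.
Qed.

Let gdiff i x : enorm (dT (u x) *: g x - grad (fun x => T (phi_ i x)) x) <=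
  2 * nd i x + th i x * ng x.
Proof.
rewrite gradT.
have -> : dT (u x) *: g x - dT (phi_ i x) *: grad (phi_ i) x =
    dT (phi_ i x) *: (g x - grad (phi_ i) x) + (dT (u x) - dT (phi_ i x)) *: g x.
  by rewrite scalerBr scalerBl [RHS]addrC addrA subrK.
apply: (le_trans (ler_enormD _ _)); rewrite !enormZ lerD// ler_wpM2r//.
  exact: enorm_ge0.
by have /andP[d0 d2] := dsoft_bound k eps0 (phi_ i x); rewrite ger0_norm.
Qed.

Let mgT j : measurable_fun (Omega : set cT)
  ((fun x => (dT (u x) *: g x) ord0 j) : cT -> mR).
Proof.
rewrite (_ : (fun x => _) = (fun x => dT (u x) * g x ord0 j)).
  exact: (measurable_funM mdTu (mg j)).
by apply/funext => x; rewrite mxE.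
Qed.

Let mTu : measurable_fun (Omega : set cT) ((fun x => T (u x)) : cT -> mR).
Proof. exact: (mcomp (@continuous_soft R k eps eps0) mu_). Qed.

Let T_le x : `|T (u x)| <= 2 * `|u x|.
Proof. by have := soft_lip k eps0 (u x) 0; rewrite soft0 !subr0. Qed.

Let dT_bound t : 0 <= dT t <= 2. Proof. exact: dsoft_bound. Qed.

Let Lu : in_LS Omega S u. Proof. by have [] := W. Qed.

Let u_lty : (\int[leb]_(x in Omega) `|u x|%:E < +oo)%E.
Proof.
apply: (integral_norm_lty D (mnorm mu_)) => //.
exact: (in_LS_norm_lty D Lu).
Qed.

Let fin_of_le (v w : cT -> R) (c : R) : measurable_fun (Omega : set cT) v ->
  measurable_fun (Omega : set cT) w -> 0 <= c -> (forall x, Omega x -> 0 <= v x) ->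
  (forall x, Omega x -> 0 <= w x) -> (forall x, Omega x -> v x <= c * w x) ->
  (\int[leb]_(x in Omega) (w x)%:E < +oo)%E -> (\int[leb]_(x in Omega) (v x)%:E < +oo)%E.
Proof.
move=> mv mw c0 v0 w0 vw wl.
apply: (le_lt_trans (@le_integralZ _ cT R mu Omega mO v w c mv mw c0 v0 w0 vw)).
by rewrite lte_mul_pinfty ?lee_fin.
Qed.

Let iTu : mu.-integrable Omega (EFin \o (fun x => T (u x))).
Proof.
apply: (@integrable_EFin _ cT R mu Omega _ mTu).
by apply: (fin_of_le (mnorm mTu) (mnorm mu_) (c := 2)) u_lty.
Qed.

Let idTg j : mu.-integrable Omega (EFin \o (fun x => (dT (u x) *: g x) ord0 j)).
Proof.
apply: (@integrable_EFin _ cT R mu Omega _ (mgT j)).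
apply: (fin_of_le (mnorm (mgT j)) mng (c := 2)) ng_lty => //.
move=> x Ox; rewrite mxE normrM; have /andP[d0 d2] := dT_bound (u x).
by rewrite ger0_norm// ler_pM// coord_le_enorm.
Qed.

Let loc_of_integrable (f : cT -> mR) : mu.-integrable Omega (EFin \o f) -> loc_integrable Omega f.
Proof.
move=> iF; have mf : measurable_fun (Omega : set cT) f.
  by apply/measurable_EFinP; exact: measurable_int iF.
split => // K cK KO.
have mK : measurable (K : set cT).
  apply: measurable_closed_rV; apply: compact_closed cK.
  exact: norm_hausdorff.
have /integrableP[_] := iF; apply: le_lt_trans.
have mabs : measurable_fun (Omega : set cT) (fun x => `|f x|%:E).
  by apply/measurable_EFinP; exact: (mnorm mf).
by apply: (@ge0_subset_integral _ cT R mu K Omega mK mO _ mabs).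
Qed.

Let C1_0_soft i : C1_0 Omega (fun x => T (phi_ i x)).
Proof. exact: test_function_C1_0 (test_function_soft k eps0 (tphi i)).1. Qed.

Let T_L1 : (\int[leb]_(x in Omega) `|T (u x) - T (phi_ i x)|%:E @[i --> \oo] --> 0)%E.
Proof.
have c2 : (2%:E * \int[leb]_(x in Omega) `|u x - phi_ i x|%:E @[i --> \oo] --> 0)%E.
  by rewrite -[X in _ --> X](mule0 2%:E); exact: cvgeZl.
apply: (squeeze_cvge _ (cvg_cst _) c2); apply: nearW => i; apply/andP; split.
  by apply: integral_ge0 => x _; rewrite lee_fin.
have m1 : measurable_fun (Omega : set cT) ((fun x => `|T (u x) - T (phi_ i x)|) : cT -> R).
  exact: (mnorm (measurable_funB mTu (mcomp (@continuous_soft R k eps eps0) (mphi i)))).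
have m2 := mnorm (measurable_funB mu_ (mphi i)).
by apply: (@le_integralZ _ cT R mu Omega mO _ _ 2 m1 m2).
Qed.

Let dT_L1 j : (\int[leb]_(x in Omega)
  `|(dT (u x) *: g x) ord0 j - partial j (fun x => T (phi_ i x)) x|%:E @[i --> \oo] --> 0)%E.
Proof.
have [_ _ _ _ c1] := W11.
have c2 : (\int[leb]_(x in Omega) (th i x * ng x)%:E @[i --> \oo] --> 0)%E.
  have i2 : mu.-integrable Omega (EFin \o (fun x => 2 * ng x)).
    apply: (@integrable_EFin _ cT R mu Omega _ (measurable_funM (measurable_cst (2 : R)) mng)).
    apply: (fin_of_le (mnorm (measurable_funM (measurable_cst (2 : R)) mng)) mng (c := 2)) ng_lty => //.
    by move=> x Ox; rewrite ger0_norm// mulr_ge0.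
  have [] := @real_dominated_convergence _ cT R mu Omega (fun i x => th i x * ng x)
    (cst 0) _ mO (fun i => measurable_funM (mth i) mng) (measurable_cst _) _ i2.
  - apply: filterS th_cvg => x H Ox; have {}H := H Ox.
    by rewrite -[X in _ --> X](mul0r (ng x)); apply: cvgM => //; exact: cvg_cst.
  - move=> i x Ox; have /andP[t0 t2] := th_bound i x.
    by rewrite ger0_norm ?mulr_ge0// ler_wpM2r.
  by rewrite integral0.
have c3 : (\int[leb]_(x in Omega) (th i x * ng x)%:E +
    2%:E * \int[leb]_(x in Omega) (nd i x)%:E @[i --> \oo] --> 0)%E.
  rewrite -[X in _ --> X]adde0; apply: cvgeD => //.
  by rewrite -[X in _ --> X](mule0 2%:E); exact: cvgeZl.
apply: (squeeze_cvge _ (cvg_cst _) c3); apply: nearW => i; apply/andP; split.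
  by apply: integral_ge0 => x _; rewrite lee_fin.
have mp : measurable_fun (Omega : set cT) ((partial j (fun x => T (phi_ i x))) : cT -> R).
  apply: continuous_leb_measurable => //.
  by have [_ _ + _] := C1_0_soft i; apply.
apply: (@le_integralD _ cT R mu Omega _ _ _ 2 mO (mnorm (measurable_funB (mgT j) mp))
  (measurable_funM (mth i) mng) (mnd i)) => //.
- by move=> x _; rewrite mulr_ge0//; case/andP: (th_bound i x).
move=> x Ox; rewrite addrC; apply: le_trans (gdiff i x).
have := coord_le_enorm (dT (u x) *: g x - grad (fun x => T (phi_ i x)) x) j.
have -> : (dT (u x) *: g x - grad (fun x => T (phi_ i x)) x) ord0 j =
    (dT (u x) *: g x) ord0 j - partial j (fun x => T (phi_ i x)) x by rewrite !mxE.
exact.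
Qed.

(** Integration by parts holds for the thresholds of the approximants, and both sides pass to the
    limit in L^1 against the bounded test function and its bounded derivative. *)
Let soft_weak_gradient : weak_gradient Omega (fun x => T (u x)) (fun x => dT (u x) *: g x).
Proof.
split; [exact: loc_of_integrable iTu|by move=> j; exact: loc_of_integrable (idTg j)|].
move=> j psi tpsi; have Cpsi := test_function_C1_0 tpsi.
have [cpsi _ cdpsi _] := Cpsi.
have [mpsi _] := C1_0_measurable oO Cpsi.
have mdpsi : measurable_fun (Omega : set cT) ((partial j psi) : cT -> R).
  by apply: continuous_leb_measurable => //; exact: cdpsi.
have bd (f : 'rV[R]_N -> R) : continuous f -> exists2 K : R, 0 < K & forall x, Omega x -> `|f x| <= K.
  move=> cf; have [K K0 fK] := continuous_bounded_domain bO (continuous_subspaceT cf).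
  by exists K => // x Ox; apply: fK; exact: subset_closure.
have [K1 K10 HK1] := bd _ (cdpsi j); have [K2 K20 HK2] := bd _ cpsi.
have iTphi i : mu.-integrable Omega (EFin \o (fun x => T (phi_ i x))).
  by apply: (integrable_continuous_domain oO bO); have [] := C1_0_soft i.
have ipT i : mu.-integrable Omega (EFin \o partial j (fun x => T (phi_ i x))).
  by apply: (integrable_continuous_domain oO bO); have [_ _ + _] := C1_0_soft i; apply.
have l1 := @cvg_integral_L1 _ cT R mu Omega mO _ _ _ K1 mdpsi (ltW K10) HK1 iTu iTphi T_L1.
have l2 := @cvg_integral_L1 _ cT R mu Omega mO _ _ _ K2 mpsi (ltW K20) HK2 (idTg j) ipT (dT_L1 j).
apply: (cvg_unique _ l1) => //.
rewrite (_ : (fun i => _) = (fun i => - \int[mu]_(x in Omega) (partial j (fun x => T (phi_ i x)) x * psi x)%:E)%E).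
  exact: cvgeN.
apply/funext => i; exact: (integration_by_parts_rV oO bO j (C1_0_soft i) Cpsi).
Qed.

(** The thresholds of the approximants of u approximate the threshold of u. The modular of the error
    splits into a part proportional to the modular error of u, scaled down by a small factor, and
    the part of [Sth_cvg]. *)
Lemma in_W1S0_soft : in_W1S0 Omega S (fun x => soft k eps (u x)) (fun x => dsoft k eps (u x) *: g x).
Proof.
have mdg : measurable_fun (Omega : set cT) ((fun x => enorm (dT (u x) *: g x)) : cT -> R).
  exact: measurable_enorm mgT.
split.
  split; [|exact: soft_weak_gradient|].
    split; first exact: mTu.
    exists 1 => //; under eq_integral do rewrite mul1r.
    apply: (fin_of_le (measurable_double_phase D (mnorm mTu)) (measurable_double_phase D (mnorm mu_))
      (c := 2 `^ (n + 1))) (in_LS_norm_lty D Lu).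
    - exact: powR_ge0.
    - by move=> x Ox; exact: (double_phase_ge0 D Ox).
    - by move=> x Ox; exact: (double_phase_ge0 D Ox).
    move=> x Ox; apply: le_trans (double_phase_double D Ox (normr_ge0 _)).
    exact: (double_phase_homo D Ox).
  split; first exact: mdg.
  exists 1 => //; under eq_integral do rewrite mul1r ger0_norm ?enorm_ge0//.
  have m2 := mSv 2 mng.
  apply: (fin_of_le (measurable_double_phase D mdg) m2 (c := 1)) (Sng_lty (ler0n _ 2)) => //.
  - by move=> x Ox; rewrite (double_phase_ge0 D Ox)// enorm_ge0.
  - by move=> x Ox; rewrite (double_phase_ge0 D Ox)// mulr_ge0.
  move=> x Ox; rewrite mul1r; apply: (double_phase_homo D Ox); first exact: enorm_ge0.
  have /andP[d0 d2] := dT_bound (u x).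
  by rewrite enormZ ger0_norm// ler_wpM2r// enorm_ge0.
move=> e e0; have [_ [l_ [lb lS]]] := app.
(* Half of the required bound, because the norm has to be strictly below it. *)
pose l := e / 2; have l0 : 0 < l by rewrite divr_gt0.
have li0 i : 0 < l_ i by case/andP: (lb i).
have l20 : 0 <= 2 / l by rewrite divr_ge0// ltW.
have n1 : \forall i \near \oo, (\int[leb]_(x in Omega) (S x (2 / l * (th i x * ng x)))%:E < (2^-1)%:E)%E.
  by apply: (cvge_near_lt (Sth_cvg l20)); rewrite lte_fin invr_gt0.
have n2 : \forall i \near \oo, 2^-1 ^+ i <= l / 8 :> R.
  have : (2^-1 : R) ^+ i @[i --> \oo] --> 0.
    by apply: cvg_expr; rewrite ger0_norm// invf_lt1// ltr1n.
  move=> /cvgrPdist_le /(_ (l / 8)); rewrite divr_gt0// => /(_ isT).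
  by apply: filterS => i; rewrite sub0r normrN ger0_norm// exprn_ge0.
have [i [n1i n2i]] := filter_ex (filterI n1 n2).
exists (fun x => T (phi_ i x)); first exact: (test_function_soft k eps0 (tphi i)).1.
apply: (@le_lt_trans _ _ l%:E); last by rewrite lte_fin /l ltr_pdivrMr// ltr_pMr// ltr1n.
apply: ereal_inf_lbound; exists l => //; split => //.
(* One factor 2 is the Lipschitz constant of the threshold, the other is lost in splitting [S] of a
   sum. With [l_ i] at most l / 8 the factor [c] is at most 1/2, and [n1] has made the rest of the
   modular less than 1/2. *)
pose c := 4 * l_ i / l.
have c0 : 0 <= c by rewrite divr_ge0 ?mulr_ge0// ltW.
have c1 : c <= 2^-1.
  rewrite /c ler_pdivrMr//; have /andP[_ h] := lb i; have := le_trans h n2i; lra.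
have c01 : 0 <= c <= 1 by rewrite c0 (le_trans c1)// invf_le1// ler1n.
pose m1 x := `|T (u x) - T (phi_ i x)|.
pose m2 x := enorm (dT (u x) *: g x - grad (fun x => T (phi_ i x)) x).
pose y x := S x (`|u x - phi_ i x| / l_ i) + S x (nd i x / l_ i).
pose z x := S x (2 / l * (th i x * ng x)).
have mz : measurable_fun (Omega : set cT) (z : cT -> R) := mSv (2 / l) (measurable_funM (mth i) mng).
have mdu := mnorm (measurable_funB mu_ (mphi i)).
have my : measurable_fun (Omega : set cT) (y : cT -> R).
  exact: (measurable_funD (measurable_double_phase D (measurable_funM mdu (measurable_cst (l_ i)^-1)))
    (measurable_double_phase D (measurable_funM (mnd i) (measurable_cst (l_ i)^-1)))).
have mm1 : measurable_fun (Omega : set cT) (m1 : cT -> R).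
  exact: (mnorm (measurable_funB mTu (mcomp (@continuous_soft R k eps eps0) (mphi i)))).
have mm2 : measurable_fun (Omega : set cT) (m2 : cT -> R).
  exact: (measurable_enormB mgT (C1_0_measurable oO (C1_0_soft i)).2).
have mlhs : measurable_fun (Omega : set cT) ((fun x => S x (m1 x / l) + S x (m2 x / l)) : cT -> R).
  exact: (measurable_funD (measurable_double_phase D (measurable_funM mm1 (measurable_cst l^-1)))
    (measurable_double_phase D (measurable_funM mm2 (measurable_cst l^-1)))).
have z0 x : Omega x -> 0 <= z x.
  move=> Ox; have /andP[t0 _] := th_bound i x.
  by apply: (double_phase_ge0 D Ox); rewrite mulr_ge0// mulr_ge0.
have y0 x : Omega x -> 0 <= y x.
  by move=> Ox; rewrite addr_ge0// (double_phase_ge0 D Ox)// divr_ge0// ltW.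
have m10 x : 0 <= m1 x by exact: normr_ge0.
have m20 x : 0 <= m2 x by exact: enorm_ge0.
have lhs0 x : Omega x -> 0 <= S x (m1 x / l) + S x (m2 x / l).
  by move=> Ox; rewrite addr_ge0// (double_phase_ge0 D Ox)// divr_ge0// ltW.
have main x : Omega x -> S x (m1 x / l) + S x (m2 x / l) <= z x + c * y x.
  move=> Ox.
  have ndl : 0 <= nd i x / l_ i by rewrite divr_ge0// ltW.
  have udl : 0 <= `|u x - phi_ i x| / l_ i by rewrite divr_ge0// ltW.
  have h1 : S x (m1 x / l) <= c * S x (`|u x - phi_ i x| / l_ i).
    apply: le_trans (double_phase_scale D Ox c01 udl).
    apply: (double_phase_homo D Ox); first by rewrite divr_ge0// ltW.
    have -> : c * (`|u x - phi_ i x| / l_ i) = 4 * `|u x - phi_ i x| / l.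
      by rewrite /c; field; rewrite !gt_eqF.
    rewrite ler_wpM2r ?invr_ge0 ?(ltW l0)// (le_trans (Tlip i x))// ler_wpM2r// ler_nat//.
  have h2 : S x (m2 x / l) <= z x + c * S x (nd i x / l_ i).
    apply: (@le_trans _ _ (S x ((2 * nd i x) / l + (th i x * ng x) / l))).
      apply: (double_phase_homo D Ox); first by rewrite divr_ge0 ?enorm_ge0// ltW.
      by rewrite -mulrDl ler_wpM2r ?invr_ge0 ?(ltW l0)// gdiff.
    have /andP[t0 _] := th_bound i x.
    apply: (le_trans (double_phase_add D Ox _ _)).
    - by rewrite divr_ge0 ?mulr_ge0// ltW.
    - by rewrite divr_ge0 ?mulr_ge0// ltW.
    rewrite addrC lerD//.
      apply: ler_of_eq; rewrite /z; congr (S x _); ring.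
    apply: le_trans (double_phase_scale D Ox c01 ndl).
    rewrite (_ : c * _ = 2 * (2 * nd i x / l))//.
    by rewrite /c; field; rewrite !gt_eqF.
  by rewrite /y mulrDr; lra.
apply: (le_trans (@le_integralD _ cT R mu Omega _ _ _ c mO mlhs mz my c0 lhs0 z0 y0 main)).
apply: (@le_trans _ _ ((2^-1)%:E + c%:E * 1%:E)%E).
  by rewrite leeD// ?(ltW n1i)// lee_wpmul2l ?lee_fin// lS.
by rewrite -EFinM -EFinD lee_fin; lra.
Qed.

End soft_membership.

(** * Energy estimate and De Giorgi iteration *)

(* The integral of an arbitrary function is still monotone, as a lower integral, which
   spares the measurability of the composed coefficients. *)
Section monotone_integral.
Local Open Scope ereal_scope.
Context d (T : measurableType d) (R : realType) (mu : {measure set T -> \bar R}).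
Variables (D : set T) (mD : measurable D).
Implicit Types f g : T -> \bar R.

Lemma ge0_le_integral_any f g : (forall x, D x -> 0 <= f x) ->
  (forall x, D x -> f x <= g x) -> \int[mu]_(x in D) f x <= \int[mu]_(x in D) g x.
Proof.
move=> f0 fg; have g0 x : D x -> 0 <= g x by move=> Dx; exact: le_trans (f0 _ Dx) (fg _ Dx).
rewrite !ge0_integralE//; apply: ge_ereal_sup => _ [h hf <-]; apply: ereal_sup_ubound.
exists h => // x; apply: (le_trans (hf x)).
by rewrite /patch; case: ifPn => //; rewrite inE => /fg.
Qed.

Lemma le_integral_any f g : (forall x, D x -> f x <= g x) ->
  \int[mu]_(x in D) f x <= \int[mu]_(x in D) g x.
Proof.
move=> fg; rewrite integralE [leRHS]integralE; apply: leeB.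
  apply: ge0_le_integral_any => x Dx; first exact: funepos_ge0.
  by rewrite !funeposE ge_max !le_max fg//= lexx orbT.
apply: ge0_le_integral_any => x Dx; first exact: funeneg_ge0.
by rewrite !funenegE ge_max !le_max leeN2 fg//= lexx orbT.
Qed.

Let measurable_modify (N : set T) (c : \bar R) f : measurable N -> measurable_fun D f ->
  measurable_fun D (fun x => if x \in N then c else f x).
Proof.
move=> mN mf; apply: measurable_fun_if => //.
- apply: (measurable_fun_bool true); rewrite (_ : _ @^-1` [set true] = N); first exact: measurableI.
  by apply/seteqP; split => x /= => [/set_mem|/mem_set].
- by apply: (measurable_funS mD) mf; exact: subIsetl.
Qed.

(** On the exceptional null set [f] is replaced by [-oo], so that the inequality holds everywhere;
    the change keeps the integral since [f] is measurable, and [g] may be arbitrary. *)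
Lemma ae_le_integral_any f g : measurable_fun D f -> {ae mu, forall x, D x -> f x <= g x} ->
  \int[mu]_(x in D) f x <= \int[mu]_(x in D) g x.
Proof.
move=> mf [N [mN N0 fgN]].
rewrite (@ae_eq_integral _ _ _ mu D (fun x => if x \in N then -oo else f x) f)//.
- apply: le_integral_any => x Dx; case: ifPn; first by rewrite leNye.
  rewrite notin_setE => Nx; apply: contra_notP Nx => fg; apply: fgN => /= /(_ Dx).
  exact: fg.
- exact: measurable_modify.
exists N; split => // x /= H; apply: contra_notP H => Nx Dx.
by rewrite memNset.
Qed.

Lemma ae_ge_integral_any f g : measurable_fun D g -> {ae mu, forall x, D x -> f x <= g x} ->
  \int[mu]_(x in D) f x <= \int[mu]_(x in D) g x.
Proof.
move=> mg [N [mN N0 fgN]].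
rewrite (@ae_eq_integral _ _ _ mu D (fun x => if x \in N then +oo else g x) g)//.
- apply: le_integral_any => x Dx; case: ifPn; first by rewrite leey.
  rewrite notin_setE => Nx; apply: contra_notP Nx => fg; apply: fgN => /= /(_ Dx).
  exact: fg.
- exact: measurable_modify.
exists N; split => // x /= H; apply: contra_notP H => Nx Dx.
by rewrite memNset.
Qed.

End monotone_integral.

(** * The growth conditions in terms of the phases *)

Section growth.
Context {R : realType} {N : nat}.
Variables (Omega : set 'rV[R]_N) (a b p q : 'rV[R]_N -> R).
Variables (delta eta r1 r2 A0 L kap d : R).
Hypothesis D : double_phase_data Omega a b p q delta eta r1 r2 A0 L kap d.
Let n : R := N%:R.
Let e1 : R := expR 1.
Notation S := (log_double_phase a b p q delta eta).
Notation G := (sobolev_phase a b p q delta eta).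
Notation l := (ell delta eta).
Implicit Types (x : 'rV[R]_N) (t y w : R).

Let n2 : 2 <= n. Proof. by rewrite ler_nat (dp_N D). Qed.
Let ell_e t : ell e1 0 t = 1.
Proof. by rewrite /ell mul0r addr0 expRK. Qed.

Lemma growth_sobolev_phase x t : Omega x -> 0 <= t ->
  a x `^ (sobolev_exp N (p x) / p x) * t `^ sobolev_exp N (p x)
  + (b x * ln (delta + eta * t)) `^ (sobolev_exp N (q x) / q x) * t `^ sobolev_exp N (q x) = G x t.
Proof.
move=> Ox t0; have [a0 _] := andP (dp_a D Ox); have [b0 _] := andP (dp_b D Ox).
have l0 : 0 <= l t by exact: (ell_ge0 (dp_delta D) (dp_eta D)).
have ex r : r1 <= r <= r2 -> sobolev_exp N r / r = tau_exp n r /\ sobolev_exp N r = r * tau_exp n r.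
  move=> /andP[rr1 rr2]; have r0 : 0 < r by rewrite (lt_le_trans _ rr1)// (lt_trans ltr01 (dp_r11 D)).
  have nr : 0 < n - r by rewrite subr_gt0 (le_lt_trans rr2 (dp_r2 D)).
  by rewrite /sobolev_exp /tau_exp -/n; split; field; rewrite !gt_eqF.
have [pe1 pe2] := ex _ (dp_p D Ox); have [qe1 qe2] := ex _ (dp_q D Ox).
rewrite pe1 qe1 pe2 qe2 /sobolev_phase /phase_star /phase ell_e mulr1; congr (_ + _).
  by rewrite powRM ?powR_ge0// -powRrM.
by rewrite [in RHS]mulrAC [in RHS]powRM ?mulr_ge0 ?powR_ge0// -powRrM.
Qed.

Definition B_growth x t y : R :=
  a x `^ (sobolev_exp N (p x) / p x) * t `^ (sobolev_exp N (p x) - 1)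
  + (b x * ln (delta + eta * t)) `^ (sobolev_exp N (q x) / q x) * t `^ (sobolev_exp N (q x) - 1)
  + a x `^ ((N%:R + 1) / N%:R) * y `^ (p x / conj_exp (sobolev_exp N (p x)))
  + (b x * ln (delta + eta * t)) `^ (1 / q x)
    * (b x * ln (delta + eta * y)) `^ (1 / conj_exp (sobolev_exp N (q x)))
    * y `^ (q x / conj_exp (sobolev_exp N (q x)))
  + 1.

(** Allows |u| to be replaced by the maximum of |u| and 1, since a bound for the growth times t
    bounds the growth itself only where t >= 1. *)
Lemma B_growth_homo x s t y : Omega x -> 0 <= s -> s <= t -> 0 <= y -> B_growth x s y <= B_growth x t y.
Proof.
move=> Ox s0 st y0; have t0 := le_trans s0 st.
have [a0 _] := andP (dp_a D Ox); have [b0 _] := andP (dp_b D Ox).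
have ls0 : 0 <= l s by exact: (ell_ge0 (dp_delta D) (dp_eta D)).
have lt0 : 0 <= l t by exact: (ell_ge0 (dp_delta D) (dp_eta D)).
have lst : l s <= l t by exact: (ell_homo (dp_delta D) (dp_eta D)).
have ex r : r1 <= r <= r2 -> 0 <= sobolev_exp N r - 1 /\ 0 <= sobolev_exp N r / r /\ 0 <= 1 / r.
  move=> hr; have [rr1 rr2] := andP hr.
  have r0 : 0 < r by rewrite (lt_le_trans _ rr1)// (lt_trans ltr01 (dp_r11 D)).
  have nr : 0 < n - r by rewrite subr_gt0 (le_lt_trans rr2 (dp_r2 D)).
  have t1 := tau_exp_gt1 (dp_r11 D) (dp_r2 D) hr.
  have E : sobolev_exp N r = r * tau_exp N%:R r by rewrite /sobolev_exp /tau_exp; ring.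
  have r1' : 1 < r := lt_le_trans (dp_r11 D) rr1.
  rewrite E; split; first by rewrite subr_ge0; nra.
  have tt : 0 <= tau_exp N%:R r by rewrite (le_trans ler01)// ltW.
  have r0' := ltW r0; by split; rewrite divr_ge0// mulr_ge0.
have [p1 [p2 _]] := ex _ (dp_p D Ox); have [q1 [q2 q3]] := ex _ (dp_q D Ox).
have bl : 0 <= b x * l s by rewrite mulr_ge0.
have bl' : b x * l s <= b x * l t by rewrite ler_wpM2l.
have bt0 := le_trans bl bl'.
rewrite /B_growth lerD2r; apply: lerD; first apply: lerD; first apply: lerD.
- by rewrite ler_wpM2l ?powR_ge0// ge0_ler_powR ?nnegrE.
- by apply: ler_pM; rewrite ?powR_ge0// ge0_ler_powR ?nnegrE.
- exact: lexx.
by rewrite ler_wpM2r ?powR_ge0// ler_wpM2r ?powR_ge0// ge0_ler_powR ?nnegrE.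
Qed.

(** With th = 1 / r* the exponents of the growth condition are exactly those of the phase of y to
    the power 1 - th times the critical phase of t to the power th, because the conjugate exponent
    of r* has inverse 1 - th. The power of s is uniform since r* <= n tau(r2). *)
Let young_phase (c r de et s t y : R) : 0 < s <= 1 -> r1 <= r <= r2 -> 0 <= c ->
  1 <= de -> 0 <= et -> 0 < t -> 0 <= y ->
  (c * ell de et t) `^ (1 / r) * (c * ell de et y) `^ (1 / conj_exp (sobolev_exp N r))
    * y `^ (r / conj_exp (sobolev_exp N r)) * t <=
  s * phase c r de et y + s `^ (- (n * tau_exp n r2)) * phase_star n c r de et t.
Proof.
move=> s01 hr c0 hd he t0 y0; have [rr1 rr2] := andP hr; have t0' := ltW t0.
have r1' : 1 < r := lt_le_trans (dp_r11 D) rr1; have r0 := lt_trans ltr01 r1'.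
have r2n : r2 < n := dp_r2 D.
have nr : 0 < n - r by rewrite subr_gt0 (le_lt_trans rr2).
have t1 : 1 < tau_exp n r := tau_exp_gt1 (dp_r11 D) r2n hr.
have n0 : 0 < n by rewrite (lt_le_trans _ n2).
pose th := (r * tau_exp n r)^-1.
have rt1 : 1 < r * tau_exp n r by nra.
have th0 : 0 < th by rewrite invr_gt0 (lt_trans ltr01).
have E : sobolev_exp N r = r * tau_exp n r by rewrite /sobolev_exp /tau_exp -/n; ring.
have cE : (conj_exp (sobolev_exp N r))^-1 = 1 - th.
  by rewrite E /conj_exp /th invf_div mulrBl mul1r mulfV// gt_eqF// (lt_trans ltr01).
have ly0 : 0 <= ell de et y by exact: ell_ge0.
have lt0 : 0 <= ell de et t by exact: ell_ge0.
have star : phase_star n c r de et t `^ th = (c * ell de et t) `^ (1 / r) * t.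
  rewrite /phase_star -powRrM.
  have -> : tau_exp n r * th = r^-1.
    by rewrite /th /tau_exp; field; rewrite !gt_eqF.
  rewrite /phase mulrAC [LHS]powRM ?powR_ge0 ?mulr_ge0// -powRrM mulfV ?gt_eqF// powRr1//.
  by rewrite mul1r.
have ph : phase c r de et y `^ (1 - th) = (c * ell de et y) `^ (1 - th) * y `^ (r * (1 - th)).
  by rewrite /phase mulrAC [LHS]powRM ?powR_ge0 ?mulr_ge0// -powRrM.
rewrite !cE [1 * (1 - th)]mul1r.
rewrite (_ : _ * _ * _ * t = phase c r de et y `^ (1 - th) * phase_star n c r de et t `^ th); last first.
  by rewrite star ph; ring.
apply: powR_young => //; rewrite ?powR_ge0 ?phase_ge0//.
  by rewrite th0 invf_le1 ?(lt_trans ltr01 rt1)// ltW.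
rewrite invrK; have := tau_exp_le n2 r2n hr => t2.
have : r * tau_exp n r <= n * tau_exp n r2.
  by apply: ler_pM => //; rewrite ?(ltW r0)// ?(le_trans ler01 (ltW t1))//; lra.
by lra.
Qed.

(** The first two terms times t make up [G], and each gradient term times t is a product as in
    [young_phase]. For the first phase two powers of [a] combine into the one of the growth
    condition: 1/p plus the inverse of the conjugate exponent of p* equals (N + 1) / N. *)
Lemma B_growth_young s : 0 < s <= 1 -> exists2 C, 0 < C & forall x t y, Omega x -> 0 < t -> 0 <= y ->
  B_growth x t y * t <= s * S x y + C * G x t + t.
Proof.
move=> s01; have [s0 _] := andP s01.
pose K := s `^ (- (n * tau_exp n r2)); have K0 : 0 < K by exact: powR_gt0.
exists (1 + K); first by rewrite addr_gt0.
move=> x t y Ox t0 y0; have t0' := ltW t0.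
have [a0 _] := andP (dp_a D Ox); have [b0 _] := andP (dp_b D Ox).
have he1 : 1 <= e1 by rewrite -expR0 ler_expR.
have ya := young_phase s01 (dp_p D Ox) a0 he1 (lexx 0) t0 y0.
have yb := young_phase s01 (dp_q D Ox) b0 (dp_delta D) (dp_eta D) t0 y0.
rewrite !ell_e !mulr1 in ya.
have ex r : r1 <= r <= r2 -> 0 < sobolev_exp N r /\
    1 / r + 1 / conj_exp (sobolev_exp N r) = (N%:R + 1) / N%:R.
  move=> hr; have [rr1 rr2] := andP hr.
  have r0 : 0 < r by rewrite (lt_le_trans _ rr1)// (lt_trans ltr01 (dp_r11 D)).
  have nr : 0 < n - r by rewrite subr_gt0 (le_lt_trans rr2 (dp_r2 D)).
  have n0 : 0 < n by rewrite (lt_le_trans _ n2).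
  split; first by rewrite /sobolev_exp divr_gt0// mulr_gt0.
  rewrite /conj_exp /sobolev_exp -/n.
  by rewrite invf_div; field; rewrite !gt_eqF.
have [ps pe] := ex _ (dp_p D Ox); have [qs _] := ex _ (dp_q D Ox).
have aE : a x `^ (1 / p x) * a x `^ (1 / conj_exp (sobolev_exp N (p x))) = a x `^ ((N%:R + 1) / N%:R).
  rewrite -powRD ?pe//; apply/implyP => /eqP h; exfalso.
  have : 0 < (N%:R + 1) / N%:R :> R by rewrite divr_gt0 ?addr_gt0 ?(lt_le_trans _ n2).
  by rewrite h ltxx.
rewrite aE in ya.
have G_E := growth_sobolev_phase Ox t0'.
have pt : t `^ (sobolev_exp N (p x) - 1) * t = t `^ sobolev_exp N (p x) by rewrite mulrC mulr_powRB1.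
have qt : t `^ (sobolev_exp N (q x) - 1) * t = t `^ sobolev_exp N (q x) by rewrite mulrC mulr_powRB1.
have SE : S x y = phase (a x) (p x) e1 0 y + phase (b x) (q x) delta eta y by exact: double_phaseE.
rewrite SE; move: ya yb; rewrite -/(l t) -/(l y).
set ta := a x `^ _ * _ * t; set tb := _ * _ * _ * t => ya yb.
have -> : B_growth x t y * t = G x t + ta + tb + t.
  by rewrite -G_E -pt -qt /B_growth /ta /tb /ell; ring.
move: ya yb; rewrite /sobolev_phase -/n -/e1 -/K mulrDl mul1r.
by lra.
Qed.

End growth.

Section integrable_real.
Context d (T : measurableType d) (R : realType) (mu : {measure set T -> \bar R}).
Variables (D : set T) (mD : measurable D).
Implicit Types f g : T -> R.
Notation intg f := (mu.-integrable D (EFin \o f)).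

Lemma integrable_measurable_fun f : intg f -> measurable_fun D f.
Proof. by move=> iF; apply/measurable_EFinP; exact: measurable_int iF. Qed.

Lemma integrable_real_le f g : measurable_fun D f -> intg g ->
  (forall x, D x -> `|f x| <= g x) -> intg f.
Proof.
move=> mf ig fg; apply: (@le_integrable _ _ _ mu D mD _ (EFin \o g)) => //.
  exact/measurable_EFinP.
by move=> x Dx; rewrite /= lee_fin (le_trans (fg _ Dx))// ler_norm.
Qed.

Lemma integrable_realD f g : intg f -> intg g -> intg (fun x => f x + g x).
Proof.
move=> iF iG; rewrite (_ : EFin \o _ = ((EFin \o f) \+ (EFin \o g))%E); first exact: integrableD.
by apply/funext.
Qed.

Lemma integrable_realZ c f : intg f -> intg (fun x => c * f x).
Proof.
move=> iF; rewrite (_ : EFin \o _ = (fun x => c%:E * (EFin \o f) x)%E); first exact: integrableZl.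
by apply/funext.
Qed.

Lemma integrable_realM (h : T -> R) c f : measurable_fun D h ->
  (forall x, D x -> `|h x| <= c) -> intg f -> intg (fun x => h x * f x).
Proof.
move=> mh hc iF; have mf := integrable_measurable_fun iF.
have iN : intg (fun x => `|f x|).
  apply: (@le_integrable _ _ _ mu D mD _ (EFin \o f)) => //.
    by apply/measurable_EFinP; exact: measurableT_comp.
  by move=> x Dx; rewrite /= lee_fin normr_id.
apply: (integrable_real_le _ (integrable_realZ c iN)); first exact: measurable_funM.
by move=> x Dx; rewrite normrM ler_wpM2r// hc.
Qed.

Lemma integrable_real_if (b : T -> bool) f : measurable_fun D b -> intg f ->
  intg (fun x => if b x then f x else 0).
Proof.
move=> mb iF; have mf := integrable_measurable_fun iF.
have iN : intg (fun x => `|f x|).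
  apply: (@le_integrable _ _ _ mu D mD _ (EFin \o f)) => //.
    by apply/measurable_EFinP; exact: measurableT_comp.
  by move=> x Dx; rewrite /= lee_fin normr_id.
apply: (integrable_real_le _ iN); first exact: measurable_fun_ifD.
by move=> x Dx; case: ifP => // _; rewrite normr0.
Qed.

(** Here [m] is to bound one side of the weak equation from below and [M] the other side from above;
    integrability allows the subtraction. *)
Lemma integral_balance P M Q m : intg P -> intg M -> intg Q -> intg m ->
  (forall x, D x -> P x + M x <= Q x + m x) ->
  (\int[mu]_(x in D) (m x)%:E <= \int[mu]_(x in D) (M x)%:E)%E ->
  (\int[mu]_(x in D) (P x)%:E <= \int[mu]_(x in D) (Q x)%:E)%E.
Proof.
move=> iP iM iQ im H mM.
have : (\int[mu]_(x in D) (P x + M x)%:E <= \int[mu]_(x in D) (Q x + m x)%:E)%E.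
  apply: le_integral => //; [exact: integrable_realD|exact: integrable_realD|].
  by move=> x Dx; rewrite lee_fin H//; move: Dx; rewrite ?inE.
have E f g : intg f -> intg g -> (\int[mu]_(x in D) (f x + g x)%:E =
    \int[mu]_(x in D) (f x)%:E + \int[mu]_(x in D) (g x)%:E)%E.
  by move=> iF iG; rewrite -integralD.
rewrite (E _ _ iP iM) (E _ _ iQ im).
have fin f : intg f -> exists r, (\int[mu]_(x in D) (f x)%:E = r%:E)%E.
  move=> iF; exists (fine (\int[mu]_(x in D) (f x)%:E)).
  by rewrite fineK//; exact: (integrable_fin_num mD iF).
have [rP ->] := fin _ iP; have [rQ ->] := fin _ iQ.
move: mM; have [rM ->] := fin _ iM; have [rm ->] := fin _ im.
by rewrite -!EFinD !lee_fin; lra.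
Qed.

End integrable_real.

(** * Energy estimate on superlevel sets *)

Section energy.
Context {R : realType} {N : nat}.
Notation cT := (caratheodory_type (@lebesgue_outer R N)).
Notation mR := (measurableTypeR R).
Notation mu := (leb : {measure set cT -> \bar R}).
Variables (Omega : set 'rV[R]_N) (a b p q : 'rV[R]_N -> R).
Variables (delta eta r1 r2 A0 L kap d : R).
Hypothesis D : double_phase_data Omega a b p q delta eta r1 r2 A0 L kap d.
Notation S := (log_double_phase a b p q delta eta).
Notation G := (sobolev_phase a b p q delta eta).
Notation Bg := (B_growth a b p q delta eta).
Variables (A : 'rV[R]_N -> R -> 'rV[R]_N -> 'rV[R]_N) (B : 'rV[R]_N -> R -> 'rV[R]_N -> R).
Variables (alpha2 alpha3 beta : R).
Hypotheses (halpha2 : 0 < alpha2) (halpha3 : 0 < alpha3) (hbeta : 0 < beta).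
Hypothesis A_coercive : {ae leb, forall x, Omega x -> forall (t : R) (xi : 'rV[R]_N),
  alpha2 * S x (enorm xi) - alpha3 * (G x `|t| + 1) <= dotp (A x t xi) xi}.
Hypothesis B_bound : {ae leb, forall x, Omega x -> forall (t : R) (xi : 'rV[R]_N),
  `|B x t xi| <= beta * Bg x `|t| (enorm xi)}.
Variables (u : 'rV[R]_N -> R) (g : 'rV[R]_N -> 'rV[R]_N).
Hypothesis W0 : in_W1S0 Omega S u g.
Hypothesis weak : forall phi h, in_W1S0 Omega S phi h ->
  (\int[leb]_(x in Omega) (dotp (A x (u x) (g x)) (h x))%:E =
   \int[leb]_(x in Omega) (B x (u x) (g x) * phi x)%:E)%E.
Hypothesis Gu : (\int[leb]_(x in Omega) (G x `|u x|)%:E < +oo)%E.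

Let oO := dp_open D. Let bO := dp_bounded D.
Let mO : measurable (Omega : set cT). Proof. exact: measurable_domain. Qed.
Let W : in_W1S Omega S u g := W0.1.
Let mu_ := (in_W1S_measurable W).1.
Let mg := (in_W1S_measurable W).2.
Let t_ x := `|u x|.
Let y_ x := enorm (g x).
Let mt : measurable_fun (Omega : set cT) (t_ : cT -> R).
Proof. exact: (measurableT_comp (@normr_measurable R setT) mu_). Qed.
Let my : measurable_fun (Omega : set cT) (y_ : cT -> R).
Proof. exact: measurable_enorm. Qed.
Let y0 x : 0 <= y_ x. Proof. exact: enorm_ge0. Qed.
Let t0 x : 0 <= t_ x. Proof. exact: normr_ge0. Qed.
Notation intg f := (mu.-integrable Omega (EFin \o f)).

Let intg_ge0 (f : cT -> R) : measurable_fun (Omega : set cT) f -> (forall x, Omega x -> 0 <= f x) ->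
  (\int[leb]_(x in Omega) (f x)%:E < +oo)%E -> intg f.
Proof.
move=> mf f0 fl; apply: (@integrable_EFin _ cT R mu Omega _ mf).
move: fl; congr (_ < _)%E; apply: eq_integral => x; rewrite inE => Ox.
by rewrite ger0_norm// f0.
Qed.

Let iS : intg (fun x => S x (y_ x)).
Proof.
apply: intg_ge0; first exact: (measurable_double_phase D my).
  by move=> x Ox; exact: (double_phase_ge0 D Ox).
have [_ _ Lg] := W; have := in_LS_norm_lty D Lg; congr (_ < _)%E.
by apply: eq_integral => x _; rewrite ger0_norm ?enorm_ge0.
Qed.

Let iG : intg (fun x => G x (t_ x)).
Proof.
exact: (intg_ge0 (measurable_sobolev_phase D mt) (fun x _ => sobolev_phase_ge0 _ _ _ _ _ _ x _) Gu).
Qed.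

Let it : intg t_.
Proof.
apply: (intg_ge0 mt (fun x _ => t0 x)); have [Lu _ _] := W.
exact: (integral_norm_lty D mt (fun x _ => t0 x) (in_LS_norm_lty D Lu)).
Qed.

Let ic (c : R) : intg (fun=> c).
Proof. exact: (@integrable_bounded_domain _ _ Omega oO bO (cst c) `|c| (measurable_cst _) (fun _ _ => lexx _)). Qed.

Let dotpZr (v w : 'rV[R]_N) c : dotp v (c *: w) = c * dotp v w.
Proof. by rewrite /dotp mulr_sumr; apply: eq_bigr => i _; rewrite mxE; ring. Qed.

(** The test function is the soft threshold of u at level k. Coercivity bounds one side from below
    by the integral of [m], the growth of B bounds the other from above by that of [M]; what is left
    compares S of the gradient above k with [G] above k', up to eps times a fixed integrable
    function. *)
Lemma energy_estimate : exists2 C, 0 < C & forall k' k, 1 <= k' -> k' < k ->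
  (\int[leb]_(x in Omega) (if k <= `|u x| then S x (enorm (g x)) else 0)%:E <=
   C%:E * \int[leb]_(x in Omega) (if (k' < `|u x|)%R then G x `|u x| else 0)%:E)%E.
Proof.
(* Above k the derivative of the threshold is at least 1/2, which leaves alpha2 / 2; Young's share
   beta s <= alpha2 / 4 is subtracted from it, whence the factor alpha2 / 4 in [P]. *)
pose s := Num.min 1 (alpha2 / (4 * beta)).
have s0 : 0 < s by rewrite lt_min ltr01 divr_gt0// mulr_gt0.
have s1 : 0 < s <= 1 by rewrite s0 ge_min lexx.
have sb : beta * s <= alpha2 / 4.
  apply: (@le_trans _ _ (beta * (alpha2 / (4 * beta)))).
    by rewrite ler_pM2l// ge_min lexx orbT.
  by apply: ler_of_eq; field; rewrite gt_eqF.
have s11 : 0 < (1 : R) <= 1 by rewrite ltr01 lexx.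
have [Cs Cs0 HCs] := B_growth_young D s1.
have [C1 C10 HC1] := B_growth_young D s11.
have [C3 C30 HC3] := double_phase_le_sobolev D.
have [C4 C40 HC4] := le_double_phase D.
have [K1 K10 HK1] := sobolev_phase_bounded D 1.
(* An integrable bound for the growth of B at u, from Young at the maximum of |u| and 1. It is
   multiplied by the eps by which the threshold may exceed [excess k] anywhere in Omega. *)
pose E x := S x (y_ x) + C1 * (G x (t_ x) + K1) + (t_ x + 1).
have G0 x t : 0 <= G x t by exact: sobolev_phase_ge0.
have S0 x : Omega x -> 0 <= S x (y_ x) by move=> Ox; exact: (double_phase_ge0 D Ox).
have BE x : Omega x -> Bg x (t_ x) (y_ x) <= E x.
  move=> Ox; pose t1 := Num.max (t_ x) 1.
  have t11 : 1 <= t1 by rewrite le_max lexx orbT.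
  have t10 := lt_le_trans ltr01 t11.
  have tt1 : t_ x <= t1 by rewrite le_max lexx.
  have h := HC1 x t1 (y_ x) Ox t10 (y0 x).
  have hm := B_growth_homo D Ox (t0 x) tt1 (y0 x).
  have b0 : 0 <= Bg x t1 (y_ x) by rewrite /B_growth !addr_ge0 ?mulr_ge0 ?powR_ge0.
  have h2 : Bg x t1 (y_ x) <= Bg x t1 (y_ x) * t1 by rewrite ler_peMr.
  have h3 : G x t1 <= G x (t_ x) + K1.
    rewrite /t1; case: (leP (t_ x) 1) => ?; last by rewrite lerDl ltW.
    by rewrite (le_trans (HK1 x 1 Ox _)) ?ler01 ?lexx// lerDr.
  have h4 : t1 <= t_ x + 1.
    by rewrite /t1; have := t0 x; case: (leP (t_ x) 1) => ? ?; lra.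
  have h5 := ler_wpM2l (ltW C10) h3.
  by rewrite /E; rewrite mul1r in h; lra.
have E0 x : Omega x -> 0 <= E x.
  move=> Ox; have h1 := S0 x Ox; have h2 := t0 x.
  have h3 : 0 <= C1 * (G x (t_ x) + K1) by rewrite mulr_ge0 ?(ltW C10)// addr_ge0// ltW.
  by rewrite /E; lra.
have iE : intg E.
  have iGK := integrable_realD mO iG (ic K1).
  exact: (integrable_realD mO (integrable_realD mO iS (integrable_realZ mO C1 iGK))
    (integrable_realD mO it (ic 1))).
(* The summands come from Young's constant, from the linear term by t <= C4 S <= C4 C3 G, and from
   the deficit in the coercivity condition, with a derivative of at most 2 and 1 <= C3 G. *)
pose CC := beta * Cs + beta * (C4 * C3) + 2 * alpha3 * (1 + C3).
have CC0 : 0 < CC.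
  have h1 : 0 < beta * Cs by rewrite mulr_gt0.
  have h2 : 0 < beta * (C4 * C3) by rewrite !mulr_gt0.
  have h3 : 0 < 2 * alpha3 * (1 + C3) by rewrite !mulr_gt0// addr_gt0.
  by rewrite /CC; lra.
pose C := 4 * CC / alpha2.
exists C; first by rewrite divr_gt0// mulr_gt0.
move=> k' k k'1 k'k.
have k0 : 0 < k by rewrite (lt_trans _ k'k)// (lt_le_trans ltr01).
pose E2 x := alpha3 / (k - k') * (G x (t_ x) + 1) + beta * E x.
have kk0 : 0 < k - k' by rewrite subr_gt0.
have ak0 : 0 < alpha3 / (k - k') by rewrite divr_gt0.
have E20 x : Omega x -> 0 <= E2 x.
  move=> Ox; have GG : 0 <= G x (t_ x) + 1 by rewrite addr_ge0.
  by rewrite /E2 addr_ge0// mulr_ge0 ?E0// ltW.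
have iE2 : intg E2.
  exact: (integrable_realD mO (integrable_realZ mO _ (integrable_realD mO iG (ic 1)))
    (integrable_realZ mO beta iE)).
pose P x := alpha2 / 4 * (if k <= t_ x then S x (y_ x) else 0).
pose F x := if k' < t_ x then G x (t_ x) else 0.
have mk' : measurable_fun (Omega : set cT) ((fun x => k' < t_ x) : cT -> bool).
  exact: (measurable_gtr_norm k' mu_).
have mk : measurable_fun (Omega : set cT) ((fun x => k < t_ x) : cT -> bool).
  exact: (measurable_gtr_norm k mu_).
have mkl : measurable_fun (Omega : set cT) ((fun x => k <= t_ x) : cT -> bool).
  exact: (measurable_fun_ler (measurable_cst k) mt).
have iP : intg P by exact: (integrable_realZ mO _ (integrable_real_if mO mkl iS)).
have iF : intg F by exact: (integrable_real_if mO mk' iG).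
have main eps : 0 < eps -> (\int[mu]_(x in Omega) (P x)%:E <=
    \int[mu]_(x in Omega) (CC * F x + eps * E2 x)%:E)%E.
  move=> eps0.
  pose m x := dsoft k eps (u x) * (alpha2 * S x (y_ x) + - alpha3 * (G x (t_ x) + 1)).
  pose M x := beta * (if k < t_ x then s * S x (y_ x) + (Cs * G x (t_ x) + t_ x) else 0) +
    beta * eps * E x.
  have iM : intg M.
    have i1 := integrable_realD mO (integrable_realZ mO s iS)
      (integrable_realD mO (integrable_realZ mO Cs iG) it).
    exact: (integrable_realD mO (integrable_realZ mO beta (integrable_real_if mO mk i1))
      (integrable_realZ mO (beta * eps) iE)).
  have md : measurable_fun (Omega : set cT) ((fun x => dsoft k eps (u x)) : cT -> R).
    exact: (measurableT_comp (continuous_measurable_fun (@continuous_dsoft R k eps eps0)) mu_).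
  have im : intg m.
    have i1 := integrable_realD mO (integrable_realZ mO alpha2 iS)
      (integrable_realZ mO (- alpha3) (integrable_realD mO iG (ic 1))).
    apply: (integrable_realM mO md (c := 2) _ i1) => x Ox.
    by have /andP[? ?] := dsoft_bound k eps0 (u x); rewrite ger0_norm.
  have iQ : intg (fun x => CC * F x + eps * E2 x).
    exact: (integrable_realD mO (integrable_realZ mO CC iF) (integrable_realZ mO eps iE2)).
  apply: (@integral_balance _ cT R mu Omega mO P M _ m iP iM iQ im).
    move=> x Ox; have /andP[d0 d2] := dsoft_bound k eps0 (u x).
    have Sx := S0 x Ox; have Ex := E0 x Ox; have Gx := G0 x (t_ x).
    set dd := dsoft _ _ _ in d0 d2 *.
    have GG0 : 0 <= alpha3 * (G x (t_ x) + 1) by rewrite mulr_ge0 ?(ltW halpha3)// addr_ge0.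
    have f4 : dd * (alpha3 * (G x (t_ x) + 1)) <= 2 * (alpha3 * (G x (t_ x) + 1)).
      by rewrite ler_wpM2r.
    have f6 : 0 <= eps * (alpha3 / (k - k') * (G x (t_ x) + 1)).
      by rewrite mulr_ge0 ?(ltW eps0)// mulr_ge0 ?(ltW ak0)// addr_ge0.
    have f9 : 0 <= beta * Cs * G x (t_ x) by rewrite !mulr_ge0// ltW.
    have f10 : 0 <= beta * (C4 * C3) * G x (t_ x) by rewrite !mulr_ge0// ltW.
    have f11 : 0 <= dd * (alpha2 * S x (y_ x)) by rewrite !mulr_ge0// ltW.
    have f5 : 1 <= C3 * G x (t_ x) -> 2 * (alpha3 * (G x (t_ x) + 1)) <= 2 * alpha3 * (1 + C3) * G x (t_ x).
      move=> h; have := ler_wpM2l (ltW halpha3) h; lra.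
    rewrite /P /M /m /F /E2 /CC -/dd.
    have [kt|tk] := leP k (t_ x).
      have k't : k' < t_ x := lt_le_trans k'k kt.
      have t1 : 1 <= t_ x by rewrite (le_trans k'1)// ltW.
      have [h1 h2] := HC3 x _ Ox t1.
      have h3 := HC4 x _ Ox t1.
      rewrite k't.
      have f1 : beta * (s * S x (y_ x)) <= alpha2 / 4 * S x (y_ x) by rewrite mulrA ler_wpM2r.
      have f2 : beta * t_ x <= beta * (C4 * C3) * G x (t_ x).
        rewrite -mulrA ler_pM2l// (le_trans h3)// -mulrA ler_pM2l//.
      have f3 : 2^-1 * (alpha2 * S x (y_ x)) <= dd * (alpha2 * S x (y_ x)).
        by rewrite ler_wpM2r ?mulr_ge0 ?(ltW halpha2)//; exact: dsoft_ge.
      have f7 : beta * (if k < t_ x then s * S x (y_ x) + (Cs * G x (t_ x) + t_ x) else 0) <=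
          beta * (s * S x (y_ x) + (Cs * G x (t_ x) + t_ x)).
        rewrite ler_pM2l//; case: ifP => // _.
        by rewrite !addr_ge0 ?mulr_ge0// ?(ltW s0) ?(ltW Cs0).
      have := f5 h1; lra.
    rewrite (ltNge k) (ltW tk)/= !mulr0 !add0r.
    (* Between the levels the derivative is only bounded by 2, and the deficit of coercivity goes
       into [CC * F]; below k' the derivative is at most eps / (k - k'), and the deficit goes into
       [E2]. *)
    have [k't|tk'] := ltP k' (t_ x).
      have t1 : 1 <= t_ x by rewrite (le_trans k'1)// ltW.
      by have [/f5 h1 _] := HC3 x _ Ox t1; lra.
    have dle : dd <= eps / (k - k') by exact: dsoft_le.
    have f8 : dd * (alpha3 * (G x (t_ x) + 1)) <= eps * (alpha3 / (k - k') * (G x (t_ x) + 1)).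
      apply: (le_trans (ler_wpM2r GG0 dle)); apply: ler_of_eq; ring.
    lra.
  have [phi_ app] := in_W1S0_approx W0.
  have Ws := in_W1S0_soft D k eps0 W0 app.
  have mm := integrable_measurable_fun im; have mM := integrable_measurable_fun iM.
  apply: (@le_trans _ _ (\int[leb]_(x in Omega)
      (dotp (A x (u x) (g x)) (dsoft k eps (u x) *: g x))%:E)%E).
    apply: (@ae_le_integral_any _ cT R mu Omega mO (EFin \o m)); first exact/measurable_EFinP.
    apply: filterS A_coercive => x H Ox; have {}H := H Ox (u x) (g x).
    rewrite lee_fin dotpZr /m; have /andP[d0 _] := dsoft_bound k eps0 (u x).
    by rewrite ler_wpM2l// mulNr.
  rewrite (weak Ws).
  apply: (@ae_ge_integral_any _ cT R mu Omega mO _ (EFin \o M)); first exact/measurable_EFinP.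
  apply: filterS B_bound => x H Ox; have {}H := H Ox (u x) (g x).
  rewrite lee_fin; apply: (le_trans (ler_norm _)); rewrite normrM.
  have Bx : `|B x (u x) (g x)| <= beta * Bg x (t_ x) (y_ x) by exact: H.
  have b0 : 0 <= Bg x (t_ x) (y_ x) by rewrite /B_growth !addr_ge0 ?mulr_ge0 ?powR_ge0.
  have sl := soft_le k0 eps0 (u x).
  have h1 : Bg x (t_ x) (y_ x) * excess k (u x) <=
      (if k < t_ x then s * S x (y_ x) + (Cs * G x (t_ x) + t_ x) else 0).
    case: ifPn => [kt|]; last first.
      by rewrite -leNgt => tk; rewrite /excess max_r ?mulr0// subr_le0.
    have tp : 0 < t_ x := lt_trans k0 kt.
    apply: (@le_trans _ _ (Bg x (t_ x) (y_ x) * t_ x)).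
      by rewrite ler_wpM2l// /excess ge_max gerBl (ltW k0) normr_ge0.
    by rewrite addrA; exact: HCs.
  have h2 : Bg x (t_ x) (y_ x) * eps <= eps * E x by rewrite mulrC ler_pM2l// BE.
  apply: (@le_trans _ _ (beta * Bg x (t_ x) (y_ x) * (excess k (u x) + eps))).
    by apply: ler_pM.
  rewrite /M -!mulrA -mulrDr ler_pM2l// mulrDr lerD//.
have fin (f : cT -> R) : intg f -> exists r, (\int[mu]_(x in Omega) (f x)%:E = r%:E)%E.
  move=> jF; exists (fine (\int[mu]_(x in Omega) (f x)%:E)%E).
  by rewrite fineK//; exact: (integrable_fin_num mO jF).
have F0 x : Omega x -> 0 <= F x by move=> Ox; rewrite /F; case: ifP.
have P0 x : Omega x -> 0 <= P x.
  by move=> Ox; rewrite /P mulr_ge0 ?divr_ge0 ?(ltW halpha2)//; case: ifP => // _; exact: S0.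
have [rP EP] := fin _ iP; have [rF EF] := fin _ iF; have [rE EE] := fin _ iE2.
have rE0 : 0 <= rE by rewrite -lee_fin -EE; apply: integral_ge0 => x /E20.
have mF := integrable_measurable_fun iF; have mP := integrable_measurable_fun iP.
(* The smoothing parameter tends to 0: it occurs only in front of the integral of [E2], which does
   not depend on it. *)
have PF : rP <= CC * rF.
  apply/ler_addgt0Pr => e e0.
  have ez0 : 0 < e / (rE + 1) by rewrite divr_gt0// ltr_wpDl.
  have := main _ ez0; rewrite EP => h.
  have mCF := measurable_funM (measurable_cst CC) mF.
  have mE2 := integrable_measurable_fun iE2.
  have mQ : measurable_fun (Omega : set cT) ((fun x => CC * F x + e / (rE + 1) * E2 x) : cT -> R).
    exact: (measurable_funD mCF (measurable_funM (measurable_cst (e / (rE + 1))) mE2)).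
  have CF0 x : Omega x -> 0 <= CC * F x by move=> Ox; rewrite mulr_ge0 ?F0// ltW.
  have Q0 x : Omega x -> 0 <= CC * F x + e / (rE + 1) * E2 x.
    by move=> Ox; rewrite addr_ge0 ?CF0// mulr_ge0 ?E20// ltW.
  have h2 := @le_integralD _ cT R mu Omega _ _ _ _ mO mQ mCF mE2 (ltW ez0) Q0 CF0 E20 (fun x _ => lexx _).
  have h3 := @le_integralZ _ cT R mu Omega mO _ _ CC mCF mF (ltW CC0) CF0 F0 (fun x _ => lexx _).
  rewrite EF -EFinM in h3.
  have := le_trans h (le_trans h2 (leeD2r _ h3)).
  rewrite EE -EFinM -EFinD lee_fin => h4; apply: (le_trans h4); rewrite lerD2l.
  by rewrite mulrAC ler_pdivrMr ?ltr_wpDl// ler_pM2l// lerDl.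
have mkS := integrable_measurable_fun (integrable_real_if mO mkl iS).
have C40' : 0 <= 4 / alpha2 by rewrite divr_ge0// ltW.
have kS0 x : Omega x -> 0 <= (if k <= t_ x then S x (y_ x) else 0).
  by move=> Ox; case: ifP => // _; exact: S0.
have PE x : Omega x -> (if k <= t_ x then S x (y_ x) else 0) <= 4 / alpha2 * P x.
  by move=> Ox; apply: ler_of_eq; rewrite /P; field; rewrite gt_eqF.
apply: (le_trans (@le_integralZ _ cT R mu Omega mO _ _ (4 / alpha2) mkS mP C40' kS0 P0 PE)).
rewrite EP [X in (_ <= _ * X)%E]EF -!EFinM lee_fin.
apply: (le_trans (ler_wpM2l C40' PF)); apply: ler_of_eq; rewrite /C; field; by rewrite gt_eqF.
Qed.

End energy.

(** * De Giorgi iteration *)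

Section de_giorgi.
Context {R : realType} {N : nat}.
Notation cT := (caratheodory_type (@lebesgue_outer R N)).
Notation mR := (measurableTypeR R).
Notation mu := (leb : {measure set cT -> \bar R}).
Variables (Omega : set 'rV[R]_N) (a b p q : 'rV[R]_N -> R).
Variables (delta eta r1 r2 A0 L kap d : R).
Hypothesis D : double_phase_data Omega a b p q delta eta r1 r2 A0 L kap d.
Let n : R := N%:R.
Notation S := (log_double_phase a b p q delta eta).
Notation G := (sobolev_phase a b p q delta eta).
Let e : R := n / (n - 1).
Let kG : R := @kapG R N r2.
Variables (phi_ : nat -> 'rV[R]_N -> R) (u : 'rV[R]_N -> R) (g : 'rV[R]_N -> 'rV[R]_N).
Hypothesis Cphi : forall m, C1_0 Omega (phi_ m).
Hypothesis W : W11_limit Omega phi_ u g.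
Hypothesis mu_ : measurable_fun (Omega : set cT) (u : cT -> R).
Hypothesis mg : measurable_fun (Omega : set cT) ((fun x => enorm (g x)) : cT -> R).
Hypothesis Gu : (\int[leb]_(x in Omega) (G x `|u x|)%:E < +oo)%E.
Variable C : R.
Hypothesis C0 : 0 < C.
Hypothesis energy : forall k' k, 1 <= k' -> k' < k ->
  (\int[leb]_(x in Omega) (if k <= `|u x| then S x (enorm (g x)) else 0)%:E <=
   C%:E * \int[leb]_(x in Omega) (if (k' < `|u x|)%R then G x `|u x| else 0)%:E)%E.

Let oO := dp_open D. Let bO := dp_bounded D.
Let mO : measurable (Omega : set cT). Proof. exact: measurable_domain. Qed.
Let Z k : \bar R := (\int[leb]_(x in Omega) (G x (excess k (u x)))%:E)%E.
Let mt : measurable_fun (Omega : set cT) ((fun x => `|u x|) : cT -> R).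
Proof. exact: (measurableT_comp (@normr_measurable R setT) mu_). Qed.
Let mGe k : measurable_fun (Omega : set cT) ((fun x => G x (excess k (u x))) : cT -> R).
Proof. exact: (measurable_sobolev_phase D (measurable_excess k mu_)). Qed.
Let mGu : measurable_fun (Omega : set cT) ((fun x => G x `|u x|) : cT -> R).
Proof. exact: (measurable_sobolev_phase D mt). Qed.
Let m_if (c : cT -> bool) (f : cT -> R) : measurable_fun (Omega : set cT) c ->
  measurable_fun (Omega : set cT) f ->
  measurable_fun (Omega : set cT) ((fun x => if c x then f x else 0) : cT -> R).
Proof. by move=> mb mf; apply: (@measurable_fun_ifD _ cT R Omega mO _ _ (cst 0) mb mf). Qed.
Let G0 x t : 0 <= G x t. Proof. exact: sobolev_phase_ge0. Qed.
Let kG1 : 1 <= kG. Proof. exact: kapG_ge1 D. Qed.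
Let kG0 : 0 < kG. Proof. exact: lt_le_trans ltr01 kG1. Qed.

Let Z_ge0 k : (0 <= Z k)%E.
Proof. by apply: integral_ge0 => x _; rewrite lee_fin. Qed.

Let Z_antimono k l : k <= l -> (Z l <= Z k)%E.
Proof.
move=> kl; apply: (@le_integral_EFin _ cT R mu Omega mO _ _ (mGe l) (mGe k)) => // x Ox.
apply: (sobolev_phase_homo D Ox); first exact: excess_ge0.
by rewrite /excess ge_max !le_max lexx orbT andbT lerB.
Qed.

Let Z_lty k : 0 <= k -> (Z k < +oo)%E.
Proof.
move=> k0; apply: le_lt_trans Gu.
apply: (@le_integral_EFin _ cT R mu Omega mO _ _ (mGe k) mGu) => // x Ox.
apply: (sobolev_phase_homo D Ox); first exact: excess_ge0.
by rewrite /excess ge_max normr_ge0 andbT gerBl.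
Qed.

Let ZE k : 0 <= k -> Z k = (fine (Z k))%:E.
Proof. by move=> k0; apply/esym/fineK; rewrite (ge0_fin_numE (Z_ge0 k)); exact: Z_lty. Qed.

Let G_pow2 x t m : Omega x -> 0 <= t -> G x (2 ^+ m * t) <= kG ^+ m * G x t.
Proof.
move=> Ox t0; elim: m => [|m IH]; first by rewrite !expr0 !mul1r.
rewrite !exprS -!mulrA; apply: le_trans (sobolev_phase_double D Ox _) _.
  by rewrite mulr_ge0// exprn_ge0.
by rewrite ler_pM2l.
Qed.

(** Three levels enter: the Sobolev inequality at l, the energy estimate from l down to k', and |u|
    <= 2^m (|u| - k) above k', which bounds G(|u|) by kG^m times [G] of the excess over k. The bound
    is uniform in the truncation height, which is then sent to infinity. *)
Let step : exists2 A, 0 < A & forall k k' l m, 1 <= k -> k < k' -> k' < l ->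
  k' <= 2 ^+ m * (k' - k) -> (Z l <= ((A * kG ^+ m)%:E * Z k) `^ e)%E.
Proof.
have [A A0' HA] := sobolev_trunc D.
have [C3 C30 HC3] := double_phase_le_sobolev D.
exists (A * (1 + C3 + C)); first by rewrite mulr_gt0// !addr_gt0.
move=> k k' l m k1 kk' k'l hm.
have k'1 : 1 <= k' by rewrite (le_trans k1)// ltW.
have l1 : 1 <= l by rewrite (le_trans k'1)// ltW.
have k0 : 0 <= k := le_trans ler01 k1.
have ZkE := ZE k0.
set z := fine (Z k) in ZkE.
have z0 : 0 <= z by rewrite -lee_fin -ZkE.
pose F x := if k' < `|u x| then G x `|u x| else 0.
have mF : measurable_fun (Omega : set cT) (F : cT -> R).
  have mk : measurable_fun (Omega : set cT) ((fun x => k' < `|u x|) : cT -> bool).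
    exact: (measurable_gtr_norm k' mu_).
  exact: (m_if mk mGu).
have F0 x : 0 <= F x by rewrite /F; case: ifP.
have c1 : 1 <= 2 ^+ m :> R by rewrite exprn_ege1// ler1n.
have T : (\int[leb]_(x in Omega) (F x)%:E <= (kG ^+ m)%:E * Z k)%E.
  apply: (@le_integralZ _ cT R mu Omega mO _ _ (kG ^+ m) mF (mGe k)) => //.
    by rewrite exprn_ge0// ltW.
  move=> x Ox; rewrite /F; case: ifPn => [k'u|_]; last by rewrite mulr_ge0// exprn_ge0// ltW.
  apply: le_trans (G_pow2 m Ox (excess_ge0 k (u x))).
  by apply: (sobolev_phase_homo D Ox) => //; apply: le_excess hm c1 (ltW k'u).
rewrite ZkE -EFinM in T.
have tail : (tail_energy Omega a b p q delta eta u g l <= ((C3 + C) * (kG ^+ m * z))%:E)%E.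
  pose f1 x := if l <= `|u x| then S x (enorm (g x)) else 0.
  have mf1 : measurable_fun (Omega : set cT) (f1 : cT -> R).
    apply: (m_if _ (measurable_double_phase D mg)).
    exact: (measurable_fun_ler (measurable_cst l) mt).
  have mtl : measurable_fun (Omega : set cT)
     ((fun x => if l < `|u x| then S x `|u x| + S x (enorm (g x)) else 0) : cT -> R).
    apply: (m_if (measurable_gtr_norm l mu_)).
    exact: (measurable_funD (measurable_double_phase D mt) (measurable_double_phase D mg)).
  have Sg0 x : Omega x -> 0 <= S x (enorm (g x)).
    by move=> Ox; rewrite (double_phase_ge0 D Ox)// enorm_ge0.
  have f10 x : Omega x -> 0 <= f1 x by move=> Ox; rewrite /f1; case: ifP => // _; exact: Sg0.
  have le1 : (tail_energy Omega a b p q delta eta u g l <=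
      \int[mu]_(x in Omega) (f1 x)%:E + C3%:E * \int[mu]_(x in Omega) (F x)%:E)%E.
    apply: (@le_integralD _ cT R mu Omega _ _ _ C3 mO mtl mf1 mF (ltW C30)) => //.
      move=> x Ox; case: ifP => // _; rewrite addr_ge0 ?Sg0//.
      by rewrite (double_phase_ge0 D Ox).
    move=> x Ox; case: ifPn => [lu|_]; last by rewrite addr_ge0 ?f10// mulr_ge0// ltW.
    rewrite /f1 (ltW lu) /F (lt_trans k'l lu) addrC lerD2l.
    by have [] := HC3 x `|u x| Ox (le_trans l1 (ltW lu)).
  apply: (le_trans le1); rewrite mulrDl addrC EFinD leeD//.
    by rewrite EFinM lee_wpmul2l// lee_fin ltW.
  apply: (le_trans (energy k'1 k'l)).
  by rewrite EFinM lee_wpmul2l// lee_fin ltW.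
have Xle M : 0 <= M -> (\int[leb]_(x in Omega) (G x (trunc l M (u x)))%:E <= Z k)%E.
  move=> M0; apply: le_trans (Z_antimono (ltW (lt_trans kk' k'l))).
  apply: (@le_integral_EFin _ cT R mu Omega mO _ _
    (measurable_sobolev_phase D (measurable_trunc l M mu_)) (mGe l)) => // x Ox.
  apply: (sobolev_phase_homo D Ox); first by rewrite trunc_ge0.
  exact: trunc_le_excess.
apply: (integral_excess_le D ltr01 mu_) => i.
have M0 : 0 <= 2 ^+ i * 1 :> R by rewrite mulr1 exprn_ge0.
apply: (le_trans (HA l (2 ^+ i * 1) phi_ u g l1 M0 Cphi W)).
have e0 : 0 <= e.
  have n2 : 2 <= n by rewrite ler_nat (dp_N D).
  by rewrite divr_ge0//; lra.
have B0 : 0 <= A * (1 + C3 + C) * kG ^+ m * z.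
  by rewrite !mulr_ge0 ?exprn_ge0// ?(ltW A0') ?(ltW kG0)// !addr_ge0 ?(ltW C0) ?(ltW C30).
have X0 : (0 <= \int[leb]_(x in Omega) (G x (trunc l (2 ^+ i * 1) (u x)))%:E)%E.
  by apply: integral_ge0 => x _; rewrite lee_fin.
apply: gt0_ler_poweR => //.
- rewrite in_itv/= leey andbT mule_ge0 ?lee_fin ?(ltW A0')// adde_ge0//.
  apply: integral_ge0 => x Ox; rewrite lee_fin; case: ifP => // _.
  by rewrite addr_ge0// (double_phase_ge0 D Ox)// enorm_ge0.
- by rewrite in_itv/= leey andbT ZkE lee_fin.
rewrite ZkE -EFinM.
have -> : A * (1 + C3 + C) * kG ^+ m * z = A * (kG ^+ m * z + (C3 + C) * (kG ^+ m * z)) by ring.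
rewrite EFinM EFinD lee_wpmul2l ?lee_fin ?(ltW A0')// leeD//.
apply: (le_trans (Xle _ M0)); rewrite ZkE lee_fin.
by rewrite ler_peMl// exprn_ege1.
Qed.

Lemma energy_bounded : exists K, {ae leb, forall x, Omega x -> `|u x| <= K}.
Proof.
have [A A0' HA] := step.
have e1 : 1 < e.
  have n2 : 2 <= n by rewrite ler_nat (dp_N D).
  by rewrite /e ltr_pdivlMr ?mul1r; lra.
have AA : 0 < A * kG ^+ 3 by rewrite mulr_gt0// exprn_gt0.
(* [kG] is only known to be at least 1, and [geometric_decay] asks for a base above 1. *)
have D1 : 1 < 2 * kG by have h := kG1; lra.
have [s s0 Hs] := geometric_decay AA D1 e1.
have iG : mu.-integrable Omega (EFin \o (fun x => G x `|u x|)).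
  apply: (@integrable_EFin _ cT R mu Omega _ mGu).
  by under eq_integral do rewrite ger0_norm//.
(* The starting level is so high that the integral of G(|u|) beyond it lies below the threshold [s]
   of [geometric_decay]. *)
have [k0 Hk0] := integral_tail mO mu_ iG (fun x _ => G0 x _) s0.
pose h : R := k0.+1%:R.
have h1 : 1 <= h by rewrite ler1n.
pose k i : R := h * (2 - 2^-1 ^+ i).
have w i : 0 < (2^-1 : R) ^+ i by rewrite exprn_gt0.
have w1 i : (2^-1 : R) ^+ i <= 1 by rewrite exprn_ile1// invf_le1// ler1n.
have k1 i : 1 <= k i.
  by rewrite /k; have := w1 i; nra.
have k2 i : k i <= 2 * h.
  by rewrite /k; have := w i; nra.
have kp i : 0 <= k i := le_trans ler01 (k1 i).
have ZkE i := ZE (kp i).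
have z_ge0 i : 0 <= fine (Z (k i)) by rewrite fine_ge0.
have cvZ : fine (Z (k i)) @[i --> \oo] --> 0.
  apply: Hs => //.
    rewrite -lee_fin -ZkE; apply: le_trans (Hk0 h _); last by rewrite ler_nat.
    have -> : k 0%N = h by rewrite /k expr0; ring.
    have mF : measurable_fun (Omega : set cT) ((fun x => if h < `|u x| then G x `|u x| else 0) : cT -> R).
      have mk : measurable_fun (Omega : set cT) ((fun x => h < `|u x|) : cT -> bool).
        exact: (measurable_gtr_norm h mu_).
      exact: (m_if mk mGu).
    apply: (@le_integral_EFin _ cT R mu Omega mO _ _ (mGe h) mF) => // x Ox.
    case: ifPn => [hu|]; last first.
      by rewrite -leNgt => uh; rewrite /excess max_r ?subr_le0// (sobolev_phase0 D Ox).
    apply: (sobolev_phase_homo D Ox); first exact: excess_ge0.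
    by rewrite /excess ge_max normr_ge0 andbT gerBl (le_trans ler01).
  (* The midpoint of two successive levels. Its distance h 2^-i / 4 from the lower one, times 2^(i +
     3), is 2 h, an upper bound for k'. So [step] is used with m = i + 3, the origin of the factor
     [kG ^+ 3]. *)
  move=> i; pose k' := h * (2 - 3 / 4 * 2^-1 ^+ i).
  have kk' : k i < k' by rewrite /k /k'; have := w i; nra.
  have k'k : k' < k i.+1 by rewrite /k /k' exprS; have := w i; nra.
  have hk' : k' <= 2 ^+ (i + 3) * (k' - k i).
    have -> : 2 ^+ (i + 3) * (k' - k i) = 2 * h * (2 ^+ i * 2^-1 ^+ i).
      by rewrite /k' /k exprD; field.
    rewrite -exprMn mulfV// expr1n mulr1 /k'; have := w i; nra.
  have := HA _ _ _ _ (k1 i) kk' k'k hk'.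
  rewrite (ZkE i.+1) (ZkE i) -EFinM poweR_EFin lee_fin => H; apply: (le_trans H).
  apply: ge0_ler_powR; first by rewrite (le_trans ler01)// ltW.
  - by rewrite nnegrE !mulr_ge0// ?exprn_ge0// ltW.
  - have h2 : 0 <= (2 * kG) ^+ i by rewrite exprn_ge0// ltW// (lt_trans ltr01).
    exact: (mulr_ge0 (mulr_ge0 (ltW AA) h2) (z_ge0 i)).
  rewrite ler_wpM2r// exprD -mulrA (mulrC (kG ^+ i)) ler_wpM2l ?(ltW A0')//.
  by rewrite ler_wpM2l ?exprn_ge0 ?(ltW kG0)// exprMn ler_peMl ?exprn_ege1 ?ler1n// exprn_ge0// ltW.
have Z0 : Z (2 * h) = 0%E.
  apply/eqP; rewrite eq_le Z_ge0 andbT.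
  have h20 : 0 <= 2 * h by rewrite mulr_ge0// (le_trans ler01).
  rewrite (ZE h20) lee_fin -(cvg_lim _ cvZ)//; apply: limr_ge; first by apply: cvgP cvZ.
  by apply: nearW => i; rewrite -lee_fin; have := Z_antimono (k2 i); rewrite {1}(ZE h20) {1}(ZkE i).
have [C3 C30 HC3] := double_phase_le_sobolev D.
(* The integral of [G] vanishes at level 2 h. One unit higher the excess is at least 1, where [G] is
   bounded away from 0, so the set above 2 h + 1 is null. *)
exists (2 * h + 1).
pose f x : R := if 2 * h + 1 < `|u x| then 1 else 0.
have mf : measurable_fun (Omega : set cT) (f : cT -> R).
  exact: (m_if (f := cst 1) (measurable_gtr_norm (2 * h + 1) mu_) (@measurable_cst _ _ cT R _ 1)).
have f0 x : 0 <= f x by rewrite /f; case: ifP.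
have If : (\int[mu]_(x in Omega) (f x)%:E <= C3%:E * Z (2 * h)%R)%E.
  apply: (@le_integralZ _ cT R mu Omega mO _ _ C3 mf (mGe _)) => //; first exact: ltW.
  move=> x Ox; rewrite /f; case: ifPn => [hu|_]; last by rewrite mulr_ge0// ltW.
  have e1' : 1 <= excess (2 * h) (u x) by rewrite /excess le_max; apply/orP; left; lra.
  by have [] := HC3 x _ Ox e1'.
rewrite Z0 mule0 in If.
have /(ae_eq_integral_abs mu mO) : measurable_fun (Omega : set cT) (EFin \o f : cT -> \bar R).
  exact/measurable_EFinP.
move=> [H _].
have /H : (\int[mu]_(x in Omega) `|(EFin \o f) x| = 0)%E.
  under eq_integral do rewrite gee0_abs ?lee_fin//.
  by apply/eqP; rewrite eq_le If integral_ge0// => x _; rewrite lee_fin.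
apply: filterS => x H' Ox; rewrite leNgt; apply/negP => hu.
by have := H' Ox; rewrite /= /f hu => -[] /eqP; rewrite oner_eq0.
Qed.

End de_giorgi.

Lemma Linfty_bounded (R : realType) (N : nat) (Omega : set 'rV[R]_N) (u : 'rV[R]_N -> R) (K : R) :
  measurable (Omega : set (caratheodory_type (@lebesgue_outer R N))) ->
  measurable_fun (Omega : set (caratheodory_type (@lebesgue_outer R N)))
    (u : caratheodory_type (@lebesgue_outer R N) -> R) ->
  {ae leb, forall x, Omega x -> `|u x| <= K} -> Linfty Omega u.
Proof.
move=> mO mu_ H; rewrite /Linfty inE; apply/andP; split.
  by rewrite inE; apply/(measurable_restrictT _ mO).
rewrite inE /= /finite_norm unlock /Lnorm; case: ifP => // _.
apply: (@le_lt_trans _ _ (Num.max K 0)%:E); last exact: ltry.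
apply: ereal_inf_lbound; apply: filterS H => x Hx; rewrite /= lee_fin patchE.
by case: ifPn => [|_]; rewrite ?normr0 ?le_max ?lexx ?orbT// inE => /Hx ->.
Qed.

(** * Uniform constants from compactness of the closure *)

Section uniform_constants.
Context {R : realType} {N : nat}.
Variable Omega : set 'rV[R]_N.
Hypothesis bO : bounded_set Omega.

Lemma lipschitz_within_continuous (f : 'rV[R]_N -> R) (L : R) : 0 <= L ->
  (forall x y, closure Omega x -> closure Omega y -> `|f x - f y| <= L * `|x - y|) ->
  {within closure Omega, continuous f}.
Proof.
move=> L0 lf; apply/subspace_continuousP => x Ox; apply/cvgrPdist_lt => eps eps0.
have L1 : 0 < L + 1 by rewrite ltr_wpDl.
near=> y.
have Oy : closure Omega y by near: y; exact: withinT.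
apply: (le_lt_trans (lf _ _ Ox Oy)).
have xy : `|x - y| < eps / (L + 1).
  near: y; apply: cvg_within.
  have /cvgrPdist_lt : id y @[y --> x] --> x by exact: cvg_id.
  by apply; exact: divr_gt0.
rewrite (@le_lt_trans _ _ ((L + 1) * `|x - y|))//; first by rewrite ler_wpM2r// lerDl.
by rewrite mulrC -ltr_pdivlMr.
Unshelve. all: by end_near. Qed.

Lemma continuous_lower_bound (f : 'rV[R]_N -> R) : {within closure Omega, continuous f} ->
  (forall x, closure Omega x -> 0 < f x) ->
  exists2 c, 0 < c & forall x, closure Omega x -> c <= f x.
Proof.
move=> /subspace_continuousP cf f0.
have cV : {within closure Omega, continuous (fun x => (f x)^-1)}.
  by apply/subspace_continuousP => x Ox; apply: cvgV; [rewrite gt_eqF// f0|exact: cf].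
have [C C0 HC] := continuous_bounded_domain bO cV.
exists C^-1; first by rewrite invr_gt0.
move=> x Ox; rewrite invf_ple ?posrE ?f0//.
by apply: le_trans (HC x Ox); exact: ler_norm.
Qed.

(** The points of Omega where f < d form an open set by Lipschitz continuity, and a nonempty open
    set has positive measure. *)
Lemma ae_le_open (f : 'rV[R]_N -> R) (L d : R) : open Omega -> 0 <= L ->
  (forall x y, Omega x -> Omega y -> `|f x - f y| <= L * `|x - y|) ->
  {ae leb, forall x, Omega x -> d <= f x} -> forall x, Omega x -> d <= f x.
Proof.
move=> oO L0 lf [E [mE E0 HE]] x Ox; rewrite leNgt; apply/negP => fx.
pose U := [set y | Omega y /\ f y < d].
have oU : open U.
  rewrite openE => y [Oy fy]; rewrite /interior /=.
  have cy : f z @[z --> y] --> f y by exact: (lipschitz_open_continuous oO L0 Oy lf).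
  have h : \forall z \near y, Omega z by apply: open_nbhs_nbhs.
  apply: filterS2 h (cvgr_lt _ cy _ fy).
  by move=> z Oz fz; split.
have := leb_open_gt0 oU (conj Ox fx : U x).
rewrite ltNge => /negP; apply; rewrite -E0.
apply: (le_outer_measure (@lebesgue_outer R N)) => y [Oy fy]; apply: HE => /= H.
by have := H Oy; rewrite leNgt fy.
Qed.

End uniform_constants.

(** Compactness of the closure turns each strict inequality between exponents into a positive
    constant: [c1] and [c2] separate the exponents from 1 and N, and [c3] is the room in q / p < 1 +
    1 / N after clearing denominators. *)
Lemma double_phase_data_of_domain (R : realType) (N : nat) (Omega : set 'rV[R]_N)
  (a b p q : 'rV[R]_N -> R) (d delta eta : R) :
  (2 <= N)%N -> open Omega -> bounded_set Omega -> Omega !=set0 ->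
  [lipschitz p x | x in closure Omega] -> [lipschitz q x | x in closure Omega] ->
  (forall x, closure Omega x -> [/\ 1 < p x, p x <= q x, q x < N%:R & q x / p x < 1 + N%:R^-1]) ->
  [lipschitz a x | x in closure Omega] -> [lipschitz b x | x in closure Omega] ->
  (forall x, closure Omega x -> 0 <= a x /\ 0 <= b x) -> 0 < d ->
  {ae leb, forall x, Omega x -> d <= a x + b x} ->
  1 <= delta -> 0 <= eta -> 1 < delta + eta ->
  exists r1 r2 A0 L kap, double_phase_data Omega a b p q delta eta r1 r2 A0 L kap d.
Proof.
move=> N2 oO bO [x0 Ox0] lp lq hpq la lb ab0 d0 hab hd he hde.
have n2 : 2 <= N%:R :> R by rewrite ler_nat.
have n0 : 0 < N%:R :> R by lra.
have [L L0 [HLp HLq HLa HLb]] : exists2 L : R, 0 <= L & [/\ L.-lipschitz_(closure Omega) p,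
    L.-lipschitz_(closure Omega) q, L.-lipschitz_(closure Omega) a & L.-lipschitz_(closure Omega) b].
  have [L [? ?]] : exists L : R, 0 <= L /\ [/\ L.-lipschitz_(closure Omega) p,
    L.-lipschitz_(closure Omega) q, L.-lipschitz_(closure Omega) a & L.-lipschitz_(closure Omega) b].
    near (pinfty_nbhs R) => L; exists L; split; first by near: L; exact: nbhs_pinfty_ge.
    by split; near: L.
  by exists L.
have lip (f : 'rV[R]_N -> R) : L.-lipschitz_(closure Omega) f -> forall x y, closure Omega x -> closure Omega y ->
    `|f x - f y| <= L * `|x - y|.
  by move=> H x y Ox Oy; exact: (H (x, y)).
have sub x : Omega x -> closure Omega x by exact: subset_closure.
have cont (f : 'rV[R]_N -> R) (H : L.-lipschitz_(closure Omega) f) := lipschitz_within_continuous L0 (lip f H).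
have [c1 c10 Hc1] : exists2 c, 0 < c & forall x, closure Omega x -> c <= p x - 1.
  apply: (continuous_lower_bound bO); last by move=> x /hpq[]; rewrite subr_gt0.
  apply: (@lipschitz_within_continuous _ _ _ _ L) => // x y Ox Oy.
  by have := lip _ HLp _ _ Ox Oy; rewrite opprB addrA subrK.
have [c2 c20 Hc2] : exists2 c, 0 < c & forall x, closure Omega x -> c <= N%:R - q x.
  apply: (continuous_lower_bound bO); last by move=> x /hpq[]; rewrite subr_gt0.
  apply: (@lipschitz_within_continuous _ _ _ _ L) => // x y Ox Oy.
  have := lip _ HLq _ _ Ox Oy; rewrite distrC.
  by rewrite (_ : N%:R - q x - (N%:R - q y) = q y - q x)//; ring.
have [c3 c30 Hc3] : exists2 c, 0 < c & forall x, closure Omega x -> c <= (N%:R + 1) * p x - N%:R * q x.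
  apply: (continuous_lower_bound bO).
    apply: (@lipschitz_within_continuous _ _ _ _ ((N%:R + 1) * L + N%:R * L)).
      by rewrite addr_ge0// mulr_ge0// addr_ge0// ltW.
    move=> x y Ox Oy; have h1 := lip _ HLp _ _ Ox Oy; have h2 := lip _ HLq _ _ Ox Oy.
    rewrite (_ : _ - _ = (N%:R + 1) * (p x - p y) - N%:R * (q x - q y)); last by ring.
    rewrite (le_trans (ler_normB _ _))// !normrM ger0_norm ?addr_ge0//.
    have n10 : 0 <= N%:R + 1 :> R by lra.
    have := ler_wpM2l n10 h1; have := ler_wpM2l (ltW n0) h2.
    by rewrite (@ger0_norm _ N%:R)//; lra.
  move=> x /hpq[p1 pq qn]; have p0 : 0 < p x by rewrite (lt_trans ltr01).
  rewrite ltr_pdivrMr// -(ltr_pM2l n0) subr_gt0.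
  by rewrite mulrA mulrDr mulr1 mulfV// gt_eqF.
have [A1 A10 HA1] := continuous_bounded_domain bO (cont a HLa).
have [B1 B10 HB1] := continuous_bounded_domain bO (cont b HLb).
pose r1 := 1 + c1; pose r2 := N%:R - c2; pose kap := Num.min c3 1 / (N%:R + 1).
have pr x : Omega x -> [/\ r1 <= p x, p x <= q x & q x <= r2].
  move=> /sub Ox; have [_ ? _ _] := hpq x Ox; have := Hc1 x Ox; have := Hc2 x Ox.
  by rewrite /r1 /r2; split => //; lra.
have m0 : 0 < Num.min c3 1 by rewrite lt_min c30 ltr01.
have k0 : 0 < kap by rewrite divr_gt0// ltr_wpDl.
(* The difference of the two exponents is N ((N + 1) y - N x) over a denominator of at most N (N +
   1), whence the division by N + 1 in [kap]. For x = p and y = q the factor (N + 1) q - N p is at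
   least q > 1, which explains the minimum with 1. *)
have gap x y : 1 < x -> x < N%:R -> 1 < y -> y < N%:R -> Num.min c3 1 <= (N%:R + 1) * y - N%:R * x ->
    x * N%:R / (N%:R + 1 - x) + kap <= y * tau_exp N%:R y.
  move=> x1 xn y1 yn h.
  have d1 : 0 < N%:R - y by rewrite subr_gt0.
  have d2 : 0 < N%:R + 1 - x by lra.
  have E : y * tau_exp N%:R y - x * N%:R / (N%:R + 1 - x) =
      N%:R * ((N%:R + 1) * y - N%:R * x) / ((N%:R - y) * (N%:R + 1 - x)).
    by rewrite /tau_exp; field; rewrite !gt_eqF.
  rewrite addrC -lerBrDr E /kap ler_pdivlMr ?mulr_gt0// mulrAC ler_pdivrMr; last by lra.
  have h3 : (N%:R - y) * (N%:R + 1 - x) <= N%:R * (N%:R + 1) by apply: ler_pM; lra.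
  apply: (@le_trans _ _ (Num.min c3 1 * (N%:R * (N%:R + 1)))); first by rewrite ler_wpM2l// ltW.
  have n10 : 0 <= N%:R * (N%:R + 1) :> R by rewrite mulr_ge0//; lra.
  by have := ler_wpM2r n10 h; lra.
have lipO (f : 'rV[R]_N -> R) : L.-lipschitz_(closure Omega) f -> forall x y, Omega x -> Omega y ->
  `|f x - f y| <= L * `|x - y| by move=> H x y /sub Ox /sub Oy; exact: lip.
exists r1, r2, (Num.max A1 B1), L, kap; split => //.
- by rewrite ltrDl.
- by have [] := pr _ Ox0; lra.
- by rewrite /r2 gtrBl.
- by rewrite le_max (ltW A10).
- move=> x /sub Ox; have [-> _] := ab0 x Ox.
  by rewrite le_max (le_trans (ler_norm _) (HA1 x Ox)).
- move=> x /sub Ox; have [_ ->] := ab0 x Ox.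
  by rewrite le_max (le_trans (ler_norm _) (HB1 x Ox)) orbT.
- by move=> x /pr[h1 h2 h3]; rewrite h1 (le_trans h2).
- by move=> x /pr[h1 h2 h3]; rewrite h3 (le_trans h1).
- apply: (@ae_le_open _ _ _ (fun x => a x + b x) (L + L) d oO _ _ hab); first exact: addr_ge0.
  move=> x y Ox Oy; rewrite opprD addrACA (le_trans (ler_normD _ _))// mulrDl.
  by rewrite lerD// lipO.
- move=> x /sub Ox; have [p1 pq qn _] := hpq x Ox.
  apply: gap => //; [exact: le_lt_trans qn|exact: lt_le_trans pq|].
  rewrite ge_min; apply/orP; right.
  by have := ler_wpM2l (ltW n0) pq; lra.
- move=> x /sub Ox; have [p1 pq qn _] := hpq x Ox.
  apply: gap => //; [exact: lt_le_trans pq|exact: le_lt_trans qn|].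
  by rewrite ge_min Hc3.
- exact: lipO.
- exact: lipO.
- exact: lipO.
- exact: lipO.
Unshelve. all: by end_near. Qed.

Theorem theorem1p2 (R : realType) (N : nat) (hN : (2 <= N)%N)
  (Omega : set 'rV[R]_N) (hOmega : bounded_lipschitz_domain Omega)
  (p q : 'rV[R]_N -> R)
  (hp_lip : [lipschitz p x | x in closure Omega])
  (hq_lip : [lipschitz q x | x in closure Omega])
  (hpq : forall x, closure Omega x ->
    [/\ 1 < p x, p x <= q x, q x < N%:R & q x / p x < 1 + N%:R^-1])
  (a b : 'rV[R]_N -> R)
  (ha_lip : [lipschitz a x | x in closure Omega])
  (hb_lip : [lipschitz b x | x in closure Omega])
  (hab_ge0 : forall x, closure Omega x -> 0 <= a x /\ 0 <= b x)
  (d : R) (hd : 0 < d)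
  (hab : {ae leb, forall x, Omega x -> d <= a x + b x})
  (delta eta : R) (hdelta : 1 <= delta <= expR 1) (heta : 0 <= eta)
  (hdeltaeta : 1 < delta + eta)
  (hdelta1 : delta = 1 -> exists2 C : R, 0 < C &
    {ae leb, forall x, Omega x -> b x <= C * a x})
  (A : 'rV[R]_N -> R -> 'rV[R]_N -> 'rV[R]_N)
  (B : 'rV[R]_N -> R -> 'rV[R]_N -> R)
  (hA : forall i, caratheodory_fun Omega (fun x t xi => A x t xi ord0 i))
  (hB : caratheodory_fun Omega B)
  (alpha1 alpha2 alpha3 beta : R)
  (halpha1 : 0 < alpha1) (halpha2 : 0 < alpha2) (halpha3 : 0 < alpha3)
  (hbeta : 0 < beta)
  (hA_growth : {ae leb, forall x, Omega x -> forall (t : R) (xi : 'rV[R]_N),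
    enorm (A x t xi) <= alpha1 *
      (a x `^ ((N%:R - 1) / (N%:R - p x))
         * `|t| `^ (sobolev_exp N (p x) / conj_exp (p x))
       + (b x * ln (delta + eta * `|t|)) `^ ((N%:R - 1) / (N%:R - q x))
         * `|t| `^ (sobolev_exp N (q x) / conj_exp (q x))
       + a x * enorm xi `^ (p x - 1)
       + b x * enorm xi `^ (q x - 1) * ln (delta + eta * enorm xi)
       + 1)})
  (hA_coercive : {ae leb, forall x, Omega x -> forall (t : R) (xi : 'rV[R]_N),
    alpha2 * (a x * enorm xi `^ p x
              + b x * enorm xi `^ q x * ln (delta + eta * enorm xi))
    - alpha3 *
      (a x `^ (sobolev_exp N (p x) / p x) * `|t| `^ sobolev_exp N (p x)
       + (b x * ln (delta + eta * `|t|)) `^ (sobolev_exp N (q x) / q x)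
         * `|t| `^ sobolev_exp N (q x)
       + 1)
    <= dotp (A x t xi) xi})
  (hB_growth : {ae leb, forall x, Omega x -> forall (t : R) (xi : 'rV[R]_N),
    `|B x t xi| <= beta *
      (a x `^ (sobolev_exp N (p x) / p x) * `|t| `^ (sobolev_exp N (p x) - 1)
       + (b x * ln (delta + eta * `|t|)) `^ (sobolev_exp N (q x) / q x)
         * `|t| `^ (sobolev_exp N (q x) - 1)
       + a x `^ ((N%:R + 1) / N%:R)
         * enorm xi `^ (p x / conj_exp (sobolev_exp N (p x)))
       + (b x * ln (delta + eta * `|t|)) `^ (1 / q x)
         * (b x * ln (delta + eta * enorm xi))
             `^ (1 / conj_exp (sobolev_exp N (q x)))
         * enorm xi `^ (q x / conj_exp (sobolev_exp N (q x)))
       + 1)}) :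
  forall u : 'rV[R]_N -> R,
    weak_solution Omega (log_double_phase a b p q delta eta) A B u ->
    Linfty Omega u.

Proof.
move=> u [g W0 weak].
have [oO _ O0 bO _] := hOmega; have /andP[hd1 _] := hdelta.
have [r1 [r2 [A0 [L [kap D]]]]] :=
  double_phase_data_of_domain hN oO bO O0 hp_lip hq_lip hpq ha_lip hb_lip hab_ge0 hd hab hd1 heta hdeltaeta.
have W := W0.1; have [Lu _ Lg] := W.
have [phi_ app] := in_W1S0_approx W0.
have Cphi i := test_function_C1_0 (app.1 i).
have [W11 _] := modular_approx_W11 D W app.
have [mu_ mg] := in_W1S_measurable W.
have Gu := sobolev_embedding D Cphi W11 (in_LS_norm_lty D Lu).
have Sg : (\int[leb]_(x in Omega) (log_double_phase a b p q delta eta x (enorm (g x)))%:E < +oo)%E.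
  have := in_LS_norm_lty D Lg; congr (_ < _)%E.
  by apply: eq_integral => x _; rewrite ger0_norm ?enorm_ge0.
have {}Gu := Gu Sg.
have [C C0 energy] : exists2 C : R, 0 < C & forall k' k, 1 <= k' -> k' < k ->
  (\int[leb]_(x in Omega) (if k <= `|u x| then log_double_phase a b p q delta eta x (enorm (g x)) else 0)%:E <=
   C%:E * \int[leb]_(x in Omega) (if (k' < `|u x|)%R then sobolev_phase a b p q delta eta x `|u x| else 0)%:E)%E.
  apply: (energy_estimate D halpha2 halpha3 hbeta _ _ W0 weak Gu).
    apply: filterS hA_coercive => x H Ox t xi; apply: le_trans (H Ox t xi).
    by rewrite -(growth_sobolev_phase D Ox (normr_ge0 t)).
  by apply: filterS hB_growth => x H Ox t xi; exact: H.
have mg' : measurable_fun (Omega : set (caratheodory_type (@lebesgue_outer R N)))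
    ((fun x => enorm (g x)) : caratheodory_type (@lebesgue_outer R N) -> R) by exact: measurable_enorm.
have [K HK] := energy_bounded D Cphi W11 mu_ mg' Gu C0 energy.
exact: (Linfty_bounded (measurable_domain oO) mu_ HK).
Qed.
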